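(* Let $\psi$ be a unit vector in $A^2$, let $\psi^\alpha=V^\alpha\psi$ for $\alpha>-1$, and let $f$ be a non-negative function in $L^1(\mathbb D,d\lambda)\cap L^\infty(\mathbb D)$. If $h$ is continuous on the closed interval $[0,\|f\|_\infty]$, then $$\lim_{\alpha\to\infty}\frac{\mathrm{tr}\big(\mathbf L_f^{\psi^\alpha,\alpha}\,h(\mathbf L_f^{\psi^\alpha,\alpha})\big)}{\alpha+1}=\int_{\mathbb D}f(z)h(f(z))\,d\lambda(z).$$
   Context: $\mathbb D$ is the open unit disc, $dA$ is area measure, $d\lambda(z)=\frac{dA(z)}{\pi(1-|z|^2)^2}$ on $\mathbb D$. For $\alpha>-1$, $A_\alpha^2$ is the Hilbert space of analytic functions $u$ on $\mathbb D$ with $\|u\|_{A^2_\alpha}^2=\int_{\mathbb D}|u|^2\,dA_\alpha<\infty$, where $dA_\alpha(z)=\frac{\alpha+1}{\pi}(1-|z|^2)^\alpha dA(z)$; $A^2=A_0^2$. The unitary operator $V^\alpha:A^2\to A_\alpha^2$ is $$V^\alpha\Big(\sum_{n\ge0}a_nz^n\Big)=\sum_{n\ge0}\frac{a_n}{\sqrt{n+1}}\sqrt{\frac{\Gamma(n+\alpha+2)}{n!\,\Gamma(\alpha+2)}}\,z^n.$$ For $z\in\mathbb D$, the unitary operator $U_z^\alpha$ on $A_\alpha^2$ is $$U_z^\alpha u(\zeta)=u(\varphi_z(\zeta))\frac{(1-|z|^2)^{(2+\alpha)/2}}{(1-\bar z\zeta)^{2+\alpha}},\qquad\varphi_z(\zeta)=\frac{\zeta-z}{1-\bar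 z\zeta}$$ (principal branch). Write $u_\theta(\zeta)=u(e^{i\theta}\zeta)$. For $\psi\in A_\alpha^2$ and $f\in L^\infty(\mathbb D)$ (regarded as a function on $\mathbb T\times\mathbb D$ independent of the first variable) the localization operator $\mathbf L_f^{\psi,\alpha}$ on $A^2_\alpha$ is defined by $$\langle\mathbf L_f^{\psi,\alpha}g,h\rangle_{A_\alpha^2}=(\alpha+1)\int_0^{2\pi}\frac{d\theta}{2\pi}\int_{\mathbb D}f(z)\langle g,U_z^\alpha\psi_\theta\rangle_{A_\alpha^2}\langle U_z^\alpha\psi_\theta,h\rangle_{A_\alpha^2}\,d\lambda(z),\quad g,h\in A_\alpha^2.$$ $h(\mathbf L_f^{\psi^\alpha,\alpha})$ is defined by the continuous functional calculus of self-adjoint operators, and $\mathrm{tr}$ is the operator trace on $A^2_\alpha$. *)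

(* Defs.v *)
From HB Require Import structures.
From mathcomp Require Import all_boot all_order all_algebra.
From mathcomp Require Import complex ring lra.
From mathcomp Require Import all_classical all_reals all_analysis.
From mathcomp Require Import measurable_realfun.

Set Implicit Arguments.
Unset Strict Implicit.
Unset Printing Implicit Defensive.

Import Order.TTheory GRing.Theory Num.Theory.
Import numFieldNormedType.Exports.

Local Open Scope classical_set_scope.
Local Open Scope ring_scope.
Local Open Scope complex_scope.

(* R[i] has no canonical topology in the libraries.                           *)
HB.instance Definition _ (R : realType) := NormedModule.copy R[i] R[i]^o.

Section complex_functions.
Context (R : realType).
Implicit Types (z w : R[i]) (s : R).

Definition modulus z : R := ComplexField.Normc.normc z.

Definition cis (t : R) : R[i] := cos t +i* sin t.

(* The principal argument, in ]-pi, pi].                                      *)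
Definition principal_arg z : R :=
  if 0 <= complex.Im z then acos (complex.Re z / modulus z)
  else - acos (complex.Re z / modulus z).

(* z^s = exp(s Log z), for the principal branch of the logarithm and z != 0.  *)
Definition principal_power z s : R[i] :=
  (modulus z `^ s)%:C * cis (s * principal_arg z).

Definition EulerGamma s : R :=
  (\int[lebesgue_measure]_(t in `]0, +oo[) (t `^ (s - 1) * expR (- t)))%R.

(* As for Rintegral, the value is meaningful for integrable F only.           *)
Definition Cintegral d (T : measurableType d) (mu : {measure set T -> \bar R})
    (D : set T) (F : T -> R[i]) : R[i] :=
  (\int[mu]_(x in D) complex.Re (F x))%R +i* (\int[mu]_(x in D) complex.Im (F x))%R.

End complex_functions.

Section disc.
Context (R : realType).
Implicit Types (f : R[i] -> R).

Definition disc : set R[i] := [set z | modulus z < 1].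

(* Measure theory on the plane is done in the real coordinates (x, y), as R[i]
   carries no measurable structure.                                           *)
Definition plane_point (p : measurableTypeR R * measurableTypeR R) : R[i] :=
  p.1 +i* p.2.

Definition plane_disc : set (measurableTypeR R * measurableTypeR R) :=
  plane_point @^-1` disc.

Definition area := (@lebesgue_measure R \x @lebesgue_measure R)%E.

(* dA_alpha and d lambda are given by their densities with respect to dA.     *)
Definition bergman_weight (alpha : R) (z : R[i]) : R :=
  (alpha + 1) / pi * (1 - modulus z ^+ 2) `^ alpha.

Definition lambda_weight (z : R[i]) : R :=
  (pi * (1 - modulus z ^+ 2) ^+ 2)^-1.

Definition disc_integral (weight : R[i] -> R) (F : R[i] -> R[i]) : R[i] :=
  Cintegral area plane_disc
    (fun p => (weight (plane_point p))%:C * F (plane_point p)).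

Definition disc_measurable f := measurable_fun plane_disc (f \o plane_point).

Definition lambda_integrable f :=
  area.-integrable plane_disc
    (fun p => (f (plane_point p) * lambda_weight (plane_point p))%:E).

(* ess sup of |f| over the disc: the function is extended by 0 to the plane.  *)
Definition disc_esssup f : \bar R :=
  'N[area]_(+oo%E) [(fun p => (f (plane_point p))%:E) \_ plane_disc].

Definition disc_ae_nonneg f :=
  {ae area, forall p, plane_disc p -> 0 <= f (plane_point p)}.

End disc.
Arguments disc {R}.
Arguments plane_disc {R}.
Arguments area {R}.
Arguments lambda_weight {R} z.

Section bergman_set.
Context (R : realType).
Implicit Types (alpha : R) (u v : R[i] -> R[i]).

(* Derivability of u : R[i] -> R[i] in the direction 1 of the R[i]-module R[i]
   is complex differentiability.                                              *)
Definition analytic_on_disc u := forall z, disc z -> derivable u z 1.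

(* A function on the disc is encoded by its extension by 0 to R[i].           *)
Definition bergman alpha : set (R[i] -> R[i]) := [set u |
  [/\ analytic_on_disc u,
      forall z, ~ disc z -> u z = 0
    & (\int[area]_(p in plane_disc)
         (bergman_weight alpha (plane_point p)
          * modulus (u (plane_point p)) ^+ 2)%:E < +oo)%E]].

(* The pairing of L^2(dA_alpha), for arbitrary functions on the disc.         *)
Definition disc_ip alpha u v : R[i] :=
  disc_integral (bergman_weight alpha) (fun z => u z * (v z)^*).

End bergman_set.

Section bergman_submodule.
Context (R : realType).
Local Notation T := (measurableTypeR R * measurableTypeR R)%type.

Lemma modulusE (x y : R) : modulus (x +i* y) = Num.sqrt (x ^+ 2 + y ^+ 2).
Proof. by []. Qed.

Lemma normE (z : R[i]) : `|z| = (modulus z)%:C.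
Proof. by []. Qed.

Lemma modulus_ge0 (z : R[i]) : 0 <= modulus z.
Proof. by case: z => x y; rewrite modulusE sqrtr_ge0. Qed.

Lemma modulusM (z w : R[i]) : modulus (z * w) = modulus z * modulus w.
Proof. exact: ComplexField.Normc.normcM. Qed.

Lemma modulusD (z w : R[i]) : modulus (z + w) <= modulus z + modulus w.
Proof. by have := ler_normD z w; rewrite !normE -rmorphD lecR. Qed.

Lemma modulusD2 (z w : R[i]) :
  modulus (z + w) ^+ 2 <= 2 * modulus z ^+ 2 + 2 * modulus w ^+ 2.
Proof.
have := modulusD z w; have := modulus_ge0 z; have := modulus_ge0 w.
have := modulus_ge0 (z + w).
set a := modulus _; set b := modulus _; set c := modulus _ => a0 b0 c0 abc.
have : a ^+ 2 <= (c + b) ^+ 2 by rewrite lerXn2r ?nnegrE// addr_ge0.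
have := sqr_ge0 (c - b); rewrite sqrrB sqrrD; nra.
Qed.

Lemma modulus_dist (z w : R[i]) : `|modulus z - modulus w| <= modulus (z - w).
Proof.
have h (a b : R[i]) : modulus a - modulus b <= modulus (a - b).
  by have := modulusD (a - b) b; rewrite subrK -lerBlDr.
have e : modulus (z - w) = modulus (w - z).
  by have := distrC z w; rewrite !normE => /complexI.
by rewrite ler_norml lerNl opprB h andbT {1}e h.
Qed.

Lemma modulus_le_abs (x y : R) : modulus (x +i* y) <= `|x| + `|y|.
Proof.
rewrite modulusE -[leRHS]ger0_norm ?addr_ge0// -sqrtr_sqr ler_sqrt ?sqr_ge0//.
rewrite -(real_normK (num_real x)) -(real_normK (num_real y)).
by rewrite sqrrD lerD2r lerDl mulrn_wge0// mulr_ge0.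
Qed.

Lemma measurable_open_plane (O : set T) :
  (forall p, O p -> exists2 d : R, 0 < d &
     forall q : T, `|q.1 - p.1| < d -> `|q.2 - p.2| < d -> O q) ->
  measurable O.
Proof.
move=> Oo.
pose box (i : (rat * rat) * (rat * rat)) : set T :=
  `](ratr i.1.1 : R), ratr i.1.2[%classic `*`
  `](ratr i.2.1 : R), ratr i.2.2[%classic.
have -> : O = \bigcup_(i in [set i | box i `<=` O]) box i.
  apply/seteqP; split => [[x y] Oxy|p [i bi] bp]; last exact: bi.
  have [d d0 hd] := Oo _ Oxy.
  have rat2 (a : R) : exists i : rat * rat, [/\ ratr i.1 < a, a < ratr i.2,
      a - d / 2 < ratr i.1 & ratr i.2 < a + d / 2].
    have [|q1] := @rat_in_itvoo R (a - d / 2) a.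
      by rewrite ltrBlDr ltrDl divr_gt0.
    rewrite in_itv/= => /andP[? ?].
    have [|q2] := @rat_in_itvoo R a (a + d / 2).
      by rewrite ltrDl divr_gt0.
    rewrite in_itv/= => /andP[? ?].
    by exists (q1, q2).
  have [i [ix1 ix2 ix3 ix4]] := rat2 x.
  have [j [jx1 jx2 jx3 jx4]] := rat2 y.
  exists (i, j); last by split; rewrite /= in_itv/=; apply/andP.
  move=> [x' y'] [/=]; rewrite !in_itv/= => /andP[? ?] /andP[? ?].
  by apply: hd => /=; rewrite ltr_norml; apply/andP; split; lra.
rewrite bigcup_mkcond; apply: countable_bigcupT_measurable => [|i].
  exact: countableP.
by case: ifP => // _; apply: measurableX; exact: measurable_itv.
Qed.

Definition disc_continuous (g : R[i] -> R) := forall z, disc z ->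
  forall e : R, 0 < e -> exists2 d : R, 0 < d &
    forall w, modulus (w - z) < d -> `|g w - g z| < e.

Lemma modulus_plane (p q : T) :
  modulus (plane_point q - plane_point p) <= `|q.1 - p.1| + `|q.2 - p.2|.
Proof. exact: modulus_le_abs. Qed.

Lemma measurable_disc_continuous_gt (g : R[i] -> R) (a : R) :
  disc_continuous g ->
  measurable (plane_disc `&` [set p | a < g (plane_point p)]).
Proof.
move=> gc; apply: measurable_open_plane => p [/= Dp ap].
have [|d d0 hd] := gc _ Dp (g (plane_point p) - a); first by rewrite subr_gt0.
have Dp1 : 0 < 1 - modulus (plane_point p) by rewrite subr_gt0.
have m0 : 0 < Num.min d (1 - modulus (plane_point p)) by rewrite lt_min d0.
exists (Num.min d (1 - modulus (plane_point p)) / 2); first by rewrite divr_gt0.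
move=> q q1 q2; have := modulus_plane p q.
move: q1 q2 m0; set m := Num.min _ _; set c := modulus _ => q1 q2 m0 qm.
have cm : c < m by lra.
move: (cm); rewrite lt_min => /andP[cd c1]; split.
  have := modulusD (plane_point q - plane_point p) (plane_point p).
  rewrite subrK => h; apply: (le_lt_trans h); move: c1; rewrite -/c ltrBrDr.
  exact.
have := hd _ cd; rewrite ltr_norml /= => /andP[? _]; lra.
Qed.

Lemma measurable_disc_continuous (g : R[i] -> R) : disc_continuous g ->
  measurable_fun plane_disc (g \o (@plane_point R)).
Proof.
move=> gc.
apply: (measurability _ (measurable_realfun.RGenOInfty.measurableE R)).
move=> _ [_ [a ->] <-].
rewrite [X in measurable X](_ : _ =
  plane_disc `&` [set p | a < g (plane_point p)]); last first.
  by apply/seteqP; split => p [? /=]; rewrite in_itv/= andbT.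
exact: measurable_disc_continuous_gt.
Qed.

Lemma measurable_plane_disc : measurable (@plane_disc R).
Proof.
rewrite -[plane_disc]setIT.
have : disc_continuous (cst 0 : R[i] -> R).
  by move=> z _ e e0; exists 1 => // w _; rewrite subrr normr0.
move=> /(@measurable_disc_continuous_gt _ (-1)).
by rewrite [X in _ `&` X](_ : _ = setT)//; apply/seteqP; split => p //= _; rewrite ltrN10.
Qed.

Lemma disc_continuous_modulus : disc_continuous (@modulus R).
Proof.
move=> z _ e e0; exists e => // w; exact/le_lt_trans/modulus_dist.
Qed.

Lemma analytic_disc_continuous (u : R[i] -> R[i]) :
  analytic_on_disc u -> disc_continuous (fun z => modulus (u z)).
Proof.
move=> au z Dz e e0.
have : {for z, continuous u}.
  exact/differentiable_continuous/derivable1_diffP/au.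
move=> /cvgrPdist_lt /(_ e%:C).
rewrite ltcR e0 => /(_ isT) /nbhs_normP[d /= d0 hd].
have dR : d = (complex.Re d)%:C.
  by move: d0; rewrite ltcE /= => /andP[/eqP + _]; case: (d) => a b /= ->.
exists (complex.Re d); first by move: d0; rewrite dR ltcR.
move=> w wz; apply: (le_lt_trans (modulus_dist _ _)).
have := hd w; rewrite /= dR !normE !ltcR.
have e2 (a b : R[i]) : modulus (a - b) = modulus (b - a).
  by have := distrC a b; rewrite !normE => /complexI.
by rewrite (e2 z w) => /(_ wz); rewrite (e2 (u z)).
Qed.

Lemma bergman_integrand_measurable (alpha : R) u : analytic_on_disc u ->
  measurable_fun plane_disc (fun p : T => bergman_weight alpha (plane_point p)
          * modulus (u (plane_point p)) ^+ 2 : R).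
Proof.
move=> au.
have mm := measurable_disc_continuous disc_continuous_modulus.
have mu := measurable_disc_continuous (analytic_disc_continuous au).
apply: measurable_funM; last exact: measurable_funX.
apply: measurable_funM => //.
apply: (measurableT_comp (f := fun x : R => x `^ alpha)
  (g := fun p : T => 1 - modulus (plane_point p) ^+ 2)).
  exact: measurable_powR.
by apply: measurable_funB => //; exact: measurable_funX.
Qed.

Lemma bergman_weight_ge0 (alpha : R) z : 0 <= alpha + 1 ->
  0 <= bergman_weight alpha z.
Proof. by move=> a0; rewrite !mulr_ge0 ?powR_ge0// invr_ge0 pi_ge0. Qed.


Lemma bergman_norm_lty (alpha : R) (u v : R[i] -> R[i]) (c : R[i]) :
  bergman alpha u -> bergman alpha v ->
  (\int[area]_(p in plane_disc)
         (bergman_weight alpha (plane_point p)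
          * modulus (c * u (plane_point p) + v (plane_point p)) ^+ 2)%:E < +oo)%E.
Proof.
move=> [au _ iu] [av _ iv].
have [a0|a0] := leP 0 (alpha + 1); last first.
  have le0 p : plane_disc p -> ((bergman_weight alpha (plane_point p)
    * modulus (c * u (plane_point p) + v (plane_point p)) ^+ 2)%:E <= 0)%E.
    move=> _; rewrite lee_fin mulr_le0_ge0// ?sqr_ge0//.
    rewrite mulr_le0_ge0 ?powR_ge0// mulr_le0_ge0 ?invr_ge0 ?pi_ge0//.
    exact: ltW.
  rewrite integralE integral0_eq ?sub0e; last first.
    by move=> p Dp; rewrite funeposE; apply/max_idPr/le0.
  apply: (@le_lt_trans _ _ 0%E) => //; rewrite leeNl oppe0.
  by apply: integral_ge0.
pose k : R := 2 * modulus c ^+ 2.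
have k0 : 0 <= k by rewrite mulr_ge0// sqr_ge0.
have /measurable_EFinP mu := bergman_integrand_measurable alpha au.
have /measurable_EFinP mv := bergman_integrand_measurable alpha av.
have mD := measurable_plane_disc.
have ge0 (w : R[i] -> R[i]) (p : T) : plane_disc p ->
    (0 <= (bergman_weight alpha (plane_point p)
          * modulus (w (plane_point p)) ^+ 2)%:E)%E.
  by move=> _; rewrite lee_fin mulr_ge0 ?bergman_weight_ge0 ?sqr_ge0.
apply: (@le_lt_trans _ _ (\int[area]_(p in plane_disc)
   (k%:E * (bergman_weight alpha (plane_point p)
          * modulus (u (plane_point p)) ^+ 2)%:E +
    2%:E * (bergman_weight alpha (plane_point p)
          * modulus (v (plane_point p)) ^+ 2)%:E))%E).
  apply: ge0_le_integral => //.
  - by move=> p Dp; exact: (ge0 (c \*: u + v)).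
  - apply/measurable_EFinP; have := @bergman_integrand_measurable alpha (c \*: u + v).
    apply => z Dz; apply: derivableD; [apply: derivableZ; exact: au|exact: av].
  - by apply: emeasurable_funD; apply: measurable_funeM.
  - move=> p Dp; rewrite -!EFinM -EFinD lee_fin.
    have := modulusD2 (c * u (plane_point p)) (v (plane_point p)).
    rewrite modulusM /k.
    have := bergman_weight_ge0 (plane_point p) a0.
    by move=> w0 /(ler_wpM2l w0) /le_trans; apply; rewrite le_eqVlt; apply/orP; left; apply/eqP; ring.
rewrite ge0_integralD//; last 4 first.
- by move=> p Dp; rewrite mule_ge0 ?lee_fin//; exact: (ge0 u).
- exact: measurable_funeM.
- by move=> p Dp; rewrite mule_ge0 ?lee_fin//; exact: (ge0 v).
- exact: measurable_funeM.
rewrite ge0_integralZl_EFin//; last by move=> p; exact: (ge0 u).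
rewrite ge0_integralZl_EFin//; last by move=> p; exact: (ge0 v).
by apply: lte_add_pinfty; apply: lte_mul_pinfty; rewrite ?lee_fin.
Qed.

Lemma bergman_submod_closed (alpha : R) :
  submod_closed (mem (bergman alpha) : {pred R[i] -> R[i]}).
Proof.
have b0 : bergman alpha (0 : R[i] -> R[i]).
  split=> [z _|//|]; first exact: derivable_cst.
  rewrite integral0_eq// => p _.
  by rewrite /modulus ComplexField.Normc.normc0 expr0n mulr0.
split=> [|c u v]; rewrite !inE // => bu bv.
have [[au u0 _] [av v0 _]] := (bu, bv); split.
- by move=> z Dz; apply: derivableD; [apply: derivableZ; exact: au|exact: av].
- by move=> z Dz; rewrite !fctE u0// v0// scaler0 addr0.
- exact: bergman_norm_lty.
Qed.

End bergman_submodule.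

Section bergman_space.
Context (R : realType).
Implicit Types (alpha : R).

Definition bergman_pred (alpha : R) : {pred R[i] -> R[i]} := mem (bergman alpha).
HB.instance Definition _ alpha :=
  GRing.isSubmodClosed.Build R[i] (R[i] -> R[i]) (bergman_pred alpha)
    (bergman_submod_closed alpha).

Record bergman_space (alpha : R) := BergmanSpace {
  bergman_fun :> R[i] -> R[i];
  _ : bergman_fun \in bergman_pred alpha }.

HB.instance Definition _ alpha := [isSub for @bergman_fun alpha].
HB.instance Definition _ alpha := [Choice of bergman_space alpha by <:].
HB.instance Definition _ alpha :=
  [SubChoice_isSubLmodule of bergman_space alpha by <:].

Definition bergman_ip alpha (u v : bergman_space alpha) : R[i] :=
  disc_ip alpha u v.

End bergman_space.
Arguments bergman_ip {R} alpha u v.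

(* Operators on a space H that is a Hilbert space for the inner product ip,
   which is linear in its first argument.                                     *)
Section operators.
Context (R : realType) (H : lmodType R[i]) (ip : H -> H -> R[i]).
Implicit Types (u v : H) (T S : H -> H) (p : {poly R[i]}) (h : R -> R[i]).

Definition hnorm u : R := Num.sqrt (complex.Re (ip u u)).

Definition bounded_operator T :=
  linear T /\ exists M : R, forall u, hnorm (T u) <= M * hnorm u.

Definition spectrum T : set R[i] := [set l | ~ exists S,
  [/\ bounded_operator S, cancel (fun u => T u - l *: u) S
    & cancel S (fun u => T u - l *: u)]].

Definition operator_poly p T : H -> H :=
  fun u => \sum_(k < size p) p`_k *: iter k T u.

(* S = h(T) for self-adjoint T: the limit in operator norm of p_n(T), for
   polynomials p_n that tend to h uniformly on the spectrum of T, which is a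
   set of real numbers.                                                       *)
Definition is_cfc T h S := exists p_ : nat -> {poly R[i]},
  (forall e : R, 0 < e -> \forall n \near \oo, forall x : R,
     spectrum T x%:C -> modulus ((p_ n).[x%:C] - h x) < e) /\
  (forall e : R, 0 < e -> \forall n \near \oo, forall u,
     hnorm (operator_poly (p_ n) T u - S u) <= e * hnorm u).

Definition cfc T h : H -> H := xget (fun=> 0) [set S | is_cfc T h S].

Definition orthonormal_basis (e : nat -> H) :=
  (forall i j, ip (e i) (e j) = (i == j)%:R) /\
  (forall u, hnorm (u - \sum_(i < n) ip u (e i) *: e i) @[n --> \oo] --> (0 : R)).

(* For a bounded operator T on an infinite-dimensional separable H, such a t
   exists if and only if T is of trace class: the series has to converge, to
   the same sum, in every orthonormal basis.                                  *)
Definition is_trace T (t : R[i]) := forall e, orthonormal_basis e ->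
  series (fun n => ip (T (e n)) (e n)) @ \oo --> t.

Definition trace T : R[i] := xget 0 [set t | is_trace T t].

End operators.

Section localization.
Context (R : realType).
Implicit Types (alpha : R) (z : R[i]) (f : R[i] -> R) (u psi : R[i] -> R[i]).

(* The coefficients of the expansion u(z) = sum a_n z^n on the disc.          *)
Definition power_series_coef u : nat -> R[i] := xget (fun=> 0) [set a |
  forall z, disc z -> series (fun n => a n * z ^+ n) @ \oo --> u z].

Definition V_coef alpha (n : nat) : R :=
  (Num.sqrt n.+1%:R)^-1 *
  Num.sqrt (EulerGamma (n%:R + alpha + 2) / (n`!%:R * EulerGamma (alpha + 2))).

Definition V alpha u : R[i] -> R[i] := fun z =>
  if z \in disc then
    limn (series (fun n => power_series_coef u n * (V_coef alpha n)%:C * z ^+ n))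
  else 0.

Definition mobius z (zeta : R[i]) : R[i] := (zeta - z) / (1 - z^* * zeta).

Definition U alpha z u : R[i] -> R[i] := fun zeta =>
  u (mobius z zeta) * ((1 - modulus z ^+ 2) `^ ((2 + alpha) / 2))%:C
  / principal_power (1 - z^* * zeta) (2 + alpha).

Definition rotation (theta : R) u : R[i] -> R[i] := fun zeta =>
  u (cis theta * zeta).

Definition localization_form alpha psi f (g h : R[i] -> R[i]) : R[i] :=
  (alpha + 1)%:C *
  Cintegral (@lebesgue_measure R) `[0, 2 * pi] (fun theta : R =>
    (2 * pi)^-1%:C *
    disc_integral lambda_weight (fun z =>
      (f z)%:C * disc_ip alpha g (U alpha z (rotation theta psi))
               * disc_ip alpha (U alpha z (rotation theta psi)) h)).

(* bergman_ip is definite, so at most one map L satisfies the equation.       *)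
Definition localization alpha psi f : bergman_space alpha -> bergman_space alpha :=
  xget (fun=> 0) [set L : bergman_space alpha -> bergman_space alpha |
    forall g h, bergman_ip alpha (L g) h = localization_form alpha psi f g h].

End localization.
Arguments localization {R} alpha psi f.

(* Main.v *)
(* The states v(theta, z) = U_z psi_theta are a resolution of the identity, so
   that tr(L h(L)) is the integral of f <h(L) v, v>. Comparing with the integral
   of f h(f) reduces the theorem, through a polynomial approximating h, to
   bounding the mean square of (L - f) v, that is, int f^2 - tr(L^2) / (alpha + 1).
   Expanding tr(L^2) with the reproducing kernels bounds it from below by the
   integral of the square of a Berezin transform of f. The latter is an average
   of f against a radial probability density on the disc, translated by Moebius
   maps; its second moment is computed from the Taylor coefficients of psi and
   tends to 0, so that the transforms converge weakly to f. *)
From HB Require Import structures.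
Require Import Defs.
From mathcomp Require Import all_boot all_order all_algebra.
From mathcomp Require Import complex ring lra.
From mathcomp Require Import all_classical all_reals all_analysis.
From mathcomp Require Import measurable_realfun ess_sup_inf.
Set Implicit Arguments.
Unset Strict Implicit.
Unset Printing Implicit Defensive.
Import Order.TTheory GRing.Theory Num.Theory.
Import numFieldNormedType.Exports.
Local Open Scope classical_set_scope.
Local Open Scope ring_scope.
Local Open Scope complex_scope.
Local Notation "z ^*" := (conjc z) : ring_scope.
Local Notation Re := (@complex.Re _).
Local Notation Im := (@complex.Im _).
Local Notation leb := (@lebesgue_measure _).
Local Notation pp := (@plane_point _).
Local Notation pc := (@power_series_coef _).

#[global] Arguments modulus {R} z : simpl never.

(** [f] is merely bounded and measurable, so pointwise convergence of its Berezin transforms is not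
    at hand, and weak convergence has to do. It suffices because the defect to be bounded is a mean
    square, hence nonnegative: only a lower bound for the trace of [L^2] is wanted, and an integral
    of squares is lower semicontinuous under weak convergence. Weak convergence itself comes from
    symmetry: the averaging kernel depends on the pseudohyperbolic distance alone, so an average of
    [f] paired with a test function is [f] paired with the average of that function, which is
    continuous.

    The resolution of the identity is obtained without Schur's lemma. The rotations of [psi] make
    the frame operator diagonal in the monomials, and its values on the reproducing kernels
    determine a power series that identifies the diagonal.

    Everything is done for [alpha >= 0], which is all that the limit sees. The operator, its
    functional calculus and the trace are picked by choice in their definitions, so each has to be
    shown to exist before anything can be said of it. *)

Lemma measurable_EFinM d (T : measurableType d) (R : realType) (D : set T) (f g : T -> R) :
  measurable_fun setT f -> measurable_fun setT g -> measurable_fun D (fun x => (f x * g x)%:E).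
Proof. by move=> mf mg; apply/measurable_EFinP; apply: measurable_funTS; exact: measurable_funM. Qed.

Lemma measurable_segment (R : realType) (a b : R) : measurable (`[a, b]%classic : set (measurableTypeR R)).
Proof. exact: measurable_itv. Qed.

(** * Arithmetic and limits in the complex plane *)

Section complex_basics.
Context (R : realType).
Implicit Types (z w : R[i]) (x y t : R).

Lemma complexE z : z = Re z +i* Im z. Proof. by case: z. Qed.
Lemma ReD z w : Re (z + w) = Re z + Re w. Proof. by case: z; case: w. Qed.
Lemma ImD z w : Im (z + w) = Im z + Im w. Proof. by case: z; case: w. Qed.
Lemma ReN z : Re (- z) = - Re z. Proof. by case: z. Qed.
Lemma ImN z : Im (- z) = - Im z. Proof. by case: z. Qed.
Lemma ReB z w : Re (z - w) = Re z - Re w. Proof. by rewrite ReD ReN. Qed.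
Lemma ImB z w : Im (z - w) = Im z - Im w. Proof. by rewrite ImD ImN. Qed.
Lemma ReM z w : Re (z * w) = Re z * Re w - Im z * Im w.
Proof. by case: z; case: w. Qed.
Lemma ImM z w : Im (z * w) = Re z * Im w + Im z * Re w.
Proof. by case: z; case: w. Qed.
Lemma Re_conj z : Re z^* = Re z. Proof. by case: z. Qed.
Lemma Im_conj z : Im z^* = - Im z. Proof. by case: z. Qed.
Lemma ReZ x z : Re (x%:C * z) = x * Re z. Proof. by rewrite ReM /= mul0r subr0. Qed.
Lemma ImZ x z : Im (x%:C * z) = x * Im z. Proof. by rewrite ImM /= mul0r addr0. Qed.

Lemma Re_sum (I : Type) (r : seq I) (P : pred I) (F : I -> R[i]) :
  Re (\sum_(i <- r | P i) F i) = \sum_(i <- r | P i) Re (F i).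
Proof. by apply: (big_morph Re ReD). Qed.

Lemma complexP z w : Re z = Re w -> Im z = Im w -> z = w.
Proof. by case: z; case: w => ? ? ? ? /= -> ->. Qed.

Lemma realCB x y : (x - y)%:C = x%:C - y%:C. Proof. exact: rmorphB. Qed.
Lemma realCN x : (- x)%:C = - x%:C. Proof. exact: rmorphN. Qed.
Lemma realCM x y : (x * y)%:C = x%:C * y%:C. Proof. exact: rmorphM. Qed.
Lemma realCX x n : (x ^+ n)%:C = x%:C ^+ n. Proof. exact: rmorphXn. Qed.
Lemma realCn (n : nat) : (n%:R : R)%:C = n%:R. Proof. exact: rmorph_nat. Qed.
Lemma realCV x : (x^-1)%:C = (x%:C)^-1. Proof. exact: fmorphV. Qed.
Lemma realC_sum (I : Type) (r : seq I) (P : pred I) (F : I -> R) :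
  (\sum_(i <- r | P i) F i)%:C = \sum_(i <- r | P i) (F i)%:C :> R[i].
Proof. exact: rmorph_sum. Qed.

Lemma conjCM z w : (z * w)^* = z^* * w^*. Proof. exact: rmorphM. Qed.
Lemma conjCD z w : (z + w)^* = z^* + w^*. Proof. exact: rmorphD. Qed.
Lemma conjCB z w : (z - w)^* = z^* - w^*. Proof. exact: rmorphB. Qed.
Lemma conjCN z : (- z)^* = - z^*. Proof. exact: rmorphN. Qed.
Lemma conjCX z n : (z ^+ n)^* = z^* ^+ n. Proof. exact: rmorphXn. Qed.
Lemma conjC_sum (I : Type) (r : seq I) (P : pred I) (F : I -> R[i]) :
  (\sum_(i <- r | P i) F i)^* = \sum_(i <- r | P i) (F i)^*.
Proof. exact: rmorph_sum. Qed.

Lemma modulus_sqr z : modulus z ^+ 2 = Re z ^+ 2 + Im z ^+ 2.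
Proof. by case: z => a b; rewrite modulusE sqr_sqrtr// addr_ge0 ?sqr_ge0. Qed.

Lemma modulus0 : modulus (0 : R[i]) = 0.
Proof. exact: ComplexField.Normc.normc0. Qed.

Lemma modulus1 : modulus (1 : R[i]) = 1.
Proof. exact: ComplexField.Normc.normc1. Qed.

Lemma modulusN z : modulus (- z) = modulus z.
Proof. by case: z => a b; rewrite !modulusE !sqrrN. Qed.

Lemma modulusBC z w : modulus (z - w) = modulus (w - z).
Proof. by rewrite -modulusN opprB. Qed.

Lemma modulus_conj z : modulus z^* = modulus z.
Proof. by case: z => a b; rewrite !modulusE sqrrN. Qed.

Lemma modulusV z : modulus z^-1 = (modulus z)^-1.
Proof. exact: ComplexField.Normc.normcV. Qed.

Lemma modulusX z n : modulus (z ^+ n) = modulus z ^+ n.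
Proof. by elim: n => [|n ih]; rewrite ?expr0 ?modulus1// !exprS modulusM ih. Qed.

Lemma modulusR x : modulus x%:C = `|x|.
Proof. by rewrite modulusE expr0n/= addr0 sqrtr_sqr. Qed.

Lemma modulus_nat (n : nat) : modulus (n%:R : R[i]) = n%:R.
Proof. by rewrite -realCn modulusR normr_nat. Qed.

Lemma modulus_eq0 z : (modulus z == 0) = (z == 0).
Proof.
apply/eqP/eqP => [|->]; last exact: modulus0.
exact: ComplexField.Normc.eq0_normc.
Qed.

Lemma modulus_gt0 z : (0 < modulus z) = (z != 0).
Proof. by rewrite lt0r modulus_ge0 andbT modulus_eq0. Qed.

Lemma modulus_sum (I : Type) (r : seq I) (P : pred I) (F : I -> R[i]) :
  modulus (\sum_(i <- r | P i) F i) <= \sum_(i <- r | P i) modulus (F i).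
Proof.
elim/big_rec2: _ => [|i y z _ h]; first by rewrite modulus0.
by rewrite (le_trans (modulusD _ _))// lerD2l.
Qed.

Lemma modulus_subD w z v : modulus (z - w) <= modulus (z - v) + modulus (v - w).
Proof. by rewrite (le_trans _ (modulusD _ _))// addrA subrK. Qed.

Lemma mulC_conj z : z * z^* = (modulus z ^+ 2)%:C.
Proof.
rewrite modulus_sqr; case: z => a b; apply: complexP.
  by rewrite ReM /= mulrN opprK !expr2.
by rewrite ImM /= mulrN mulrC addrC subrr.
Qed.

Lemma Re_le_modulus z : `|Re z| <= modulus z.
Proof.
rewrite -(@ler_pXn2r _ 2) ?nnegrE ?modulus_ge0// modulus_sqr real_normK ?num_real//.
by rewrite lerDl sqr_ge0.
Qed.

Lemma Im_le_modulus z : `|Im z| <= modulus z.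
Proof.
rewrite -(@ler_pXn2r _ 2) ?nnegrE ?modulus_ge0// modulus_sqr real_normK ?num_real//.
by rewrite lerDr sqr_ge0.
Qed.

Lemma modulus_ReIm z : modulus z <= `|Re z| + `|Im z|.
Proof. by case: z => a b; exact: modulus_le_abs. Qed.

Lemma cisD x y : cis (x + y) = cis x * cis y.
Proof.
by apply: complexP; rewrite ?ReM ?ImM /= ?cosD ?sinD// [RHS]addrC.
Qed.

Lemma cis0 : cis 0 = 1 :> R[i]. Proof. by rewrite /cis cos0 sin0. Qed.

Lemma modulus_cis x : modulus (cis x) = 1.
Proof. by rewrite /cis modulusE cos2Dsin2 sqrtr1. Qed.

Lemma conjC_cis x : (cis x)^* = cis (- x).
Proof. by rewrite /cis cosN sinN. Qed.

Lemma cisX x n : cis x ^+ n = cis (n%:R * x).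
Proof.
elim: n => [|n ih]; first by rewrite expr0 mul0r cis0.
by rewrite exprSr ih -cisD -natr1 mulrDl mul1r.
Qed.

Lemma cis_neq0 x : cis x != 0.
Proof. by rewrite -modulus_gt0 modulus_cis. Qed.

Lemma cisNK x : cis (- x) * cis x = 1.
Proof. by rewrite -cisD addNr cis0. Qed.

Lemma nearC {T : Type} (F : set_system T) {FF : Filter F} (f : T -> R[i]) (l : R[i]) :
  f x @[x --> F] --> l <->
  forall e : R, 0 < e -> \forall x \near F, modulus (f x - l) < e.
Proof.
split=> [/cvgrPdist_lt h e e0|h].
  have := h e%:C; rewrite ltcR => /(_ e0); apply: filterS => x.
  by rewrite normE ltcR modulusBC.
apply/cvgrPdist_lt => e e0.
have eR : e = (Re e)%:C.
  by move: e0; rewrite ltcE /= => /andP[/eqP + _]; case: e => a b /= ->.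
move: e0; rewrite eR ltcR => /h; apply: filterS => x.
by rewrite normE ltcR modulusBC.
Qed.

Lemma cvgC_ReIm {T : Type} (F : set_system T) {FF : Filter F} (f : T -> R[i]) (l : R[i]) :
  f x @[x --> F] --> l <->
  (Re (f x) @[x --> F] --> Re l) /\ (Im (f x) @[x --> F] --> Im l).
Proof.
split=> [/nearC h|[/cvgrPdist_lt h1 /cvgrPdist_lt h2]].
  split; apply/cvgrPdist_lt => e /h; apply: filterS => x; rewrite distrC;
    apply: le_lt_trans.
    by rewrite -ReB Re_le_modulus.
  by rewrite -ImB Im_le_modulus.
apply/nearC => e e0; have e20 : 0 < e / 2 by rewrite divr_gt0.
have := h2 _ e20; have := h1 _ e20; apply: filterS2 => x a b.
rewrite (le_lt_trans (modulus_ReIm _))// ReB ImB.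
by rewrite [e]splitr ltrD// distrC.
Qed.

Lemma cvgC_unique {T : Type} (F : set_system T) {FF : ProperFilter F}
    (f : T -> R[i]) (a b : R[i]) :
  f x @[x --> F] --> a -> f x @[x --> F] --> b -> a = b.
Proof.
move=> /cvgC_ReIm[a1 a2] /cvgC_ReIm[b1 b2]; apply: complexP.
  exact: (cvg_unique _ a1 b1).
exact: (cvg_unique _ a2 b2).
Qed.

Lemma cvgC_lim {T : Type} (F : set_system T) {FF : ProperFilter F}
    (f : T -> R[i]) (a : R[i]) : f x @[x --> F] --> a -> lim (f x @[x --> F]) = a.
Proof. by move=> h; apply: (cvgC_unique (cvgP _ h) h). Qed.

Lemma cvgCM {T : Type} (F : set_system T) {FF : Filter F} (f g : T -> R[i]) (a b : R[i]) :
  f x @[x --> F] --> a -> g x @[x --> F] --> b -> f x * g x @[x --> F] --> a * b.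
Proof.
move=> /cvgC_ReIm[a1 a2] /cvgC_ReIm[b1 b2]; apply/cvgC_ReIm; split.
  under eq_fun do rewrite ReM; rewrite ReM.
  by apply: cvgB; apply: cvgM.
under eq_fun do rewrite ImM; rewrite ImM.
by apply: cvgD; apply: cvgM.
Qed.

Lemma cvgCD {T : Type} (F : set_system T) {FF : Filter F} (f g : T -> R[i]) (a b : R[i]) :
  f x @[x --> F] --> a -> g x @[x --> F] --> b -> f x + g x @[x --> F] --> a + b.
Proof.
move=> /cvgC_ReIm[a1 a2] /cvgC_ReIm[b1 b2]; apply/cvgC_ReIm; split.
  by under eq_fun do rewrite ReD; rewrite ReD; apply: cvgD.
by under eq_fun do rewrite ImD; rewrite ImD; apply: cvgD.
Qed.

Lemma cvgC_cst {T : Type} (F : set_system T) {FF : Filter F} (a : R[i]) :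
  (fun=> a : R[i]) x @[x --> F] --> a.
Proof. by apply/nearC => e e0; near=> x; rewrite subrr modulus0. Unshelve. all: by end_near. Qed.

Lemma cvgCB {T : Type} (F : set_system T) {FF : Filter F} (f g : T -> R[i]) (a b : R[i]) :
  f x @[x --> F] --> a -> g x @[x --> F] --> b -> f x - g x @[x --> F] --> a - b.
Proof.
move=> /cvgC_ReIm[a1 a2] /cvgC_ReIm[b1 b2]; apply/cvgC_ReIm; split.
  by under eq_fun do rewrite ReB; rewrite ReB; apply: cvgB.
by under eq_fun do rewrite ImB; rewrite ImB; apply: cvgB.
Qed.

Lemma cvgC_modulus {T : Type} (F : set_system T) {FF : Filter F} (f : T -> R[i]) (a : R[i]) :
  f x @[x --> F] --> a -> modulus (f x) @[x --> F] --> modulus a.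
Proof.
move=> /nearC h; apply/cvgrPdist_lt => e /h; apply: filterS => x.
by rewrite distrC; apply: le_lt_trans; exact: modulus_dist.
Qed.

Lemma cvgC_conj {T : Type} (F : set_system T) {FF : Filter F} (f : T -> R[i]) (a : R[i]) :
  f x @[x --> F] --> a -> (f x)^* @[x --> F] --> a^*.
Proof.
move=> /nearC h; apply/nearC => e /h; apply: filterS => x.
by rewrite -conjCB modulus_conj.
Qed.

Lemma cvgC_real {T : Type} (F : set_system T) {FF : Filter F} (f : T -> R) (a : R) :
  f x @[x --> F] --> a -> (f x)%:C @[x --> F] --> a%:C.
Proof. by move=> h; apply/cvgC_ReIm; split=> //=; exact: cvg_cst. Qed.

End complex_basics.

(** * Hilbert spaces through the Riesz property *)

Section hilbert_spaces.
Context (R : realType) (H : lmodType R[i]) (ip : H -> H -> R[i]).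
Implicit Types (u v w : H) (T S : H -> H).
Local Notation hn := (hnorm ip).

Record inner_product : Prop := InnerProduct {
  ip_linear : forall (a : R[i]) u v w, ip (a *: u + v) w = a * ip u w + ip v w;
  ip_sym : forall u v, ip v u = (ip u v)^*;
  ip_pos : forall u, 0 <= Re (ip u u);
  ip_definite : forall u, Re (ip u u) = 0 -> u = 0 }.

Definition riesz_property := forall phi : H -> R[i],
  (forall (a : R[i]) u v, phi (a *: u + v) = a * phi u + phi v) ->
  (exists M, forall u, modulus (phi u) <= M * hn u) ->
  exists w, forall u, phi u = ip u w.

(* The Riesz representation property replaces completeness, which follows from it. *)
Record hilbert : Prop := Hilbert {
  hilbert_inner_product :> inner_product;
  riesz : riesz_property }.

Hypothesis Hip : inner_product.

Lemma ipDl u v w : ip (u + v) w = ip u w + ip v w.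
Proof. by have := ip_linear Hip 1 u v w; rewrite scale1r mul1r. Qed.

Lemma ip0l w : ip 0 w = 0.
Proof. by have := ipDl 0 0 w; rewrite addr0 => /eqP; rewrite -subr_eq0 opprD addNKr oppr_eq0 => /eqP. Qed.

Lemma ipZl a u w : ip (a *: u) w = a * ip u w.
Proof. by have := ip_linear Hip a u 0 w; rewrite addr0 ip0l addr0. Qed.

Lemma ipNl u w : ip (- u) w = - ip u w.
Proof. by rewrite -scaleN1r ipZl mulN1r. Qed.

Lemma ipBl u v w : ip (u - v) w = ip u w - ip v w.
Proof. by rewrite ipDl ipNl. Qed.

Lemma ipDr u v w : ip w (u + v) = ip w u + ip w v.
Proof. by rewrite (ip_sym Hip (u + v)) ipDl conjCD -!(ip_sym Hip). Qed.

Lemma ipZr a u w : ip w (a *: u) = a^* * ip w u.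
Proof. by rewrite (ip_sym Hip (a *: u)) ipZl conjCM -(ip_sym Hip). Qed.

Lemma ip0r w : ip w 0 = 0.
Proof. by rewrite (ip_sym Hip) ip0l conjc0. Qed.

Lemma ipNr u w : ip w (- u) = - ip w u.
Proof. by rewrite (ip_sym Hip) ipNl conjCN -(ip_sym Hip). Qed.

Lemma ipBr u v w : ip w (u - v) = ip w u - ip w v.
Proof. by rewrite ipDr ipNr. Qed.

Lemma ip_suml (I : Type) (r : seq I) (P : pred I) (F : I -> H) w :
  ip (\sum_(i <- r | P i) F i) w = \sum_(i <- r | P i) ip (F i) w.
Proof. by apply: (big_morph (ip^~ w)) => [u v|]; rewrite ?ipDl ?ip0l. Qed.

Lemma ip_sumr (I : Type) (r : seq I) (P : pred I) (F : I -> H) w :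
  ip w (\sum_(i <- r | P i) F i) = \sum_(i <- r | P i) ip w (F i).
Proof. by apply: (big_morph (ip w)) => [u v|]; rewrite ?ipDr ?ip0r. Qed.

Lemma hn_ge0 u : 0 <= hn u. Proof. exact: sqrtr_ge0. Qed.

Lemma hnorm_sqr u : hn u ^+ 2 = Re (ip u u).
Proof. by rewrite sqr_sqrtr// ip_pos. Qed.

Lemma ip_self u : ip u u = (hn u ^+ 2)%:C.
Proof.
rewrite hnorm_sqr; apply: complexP => //=.
have := ip_sym Hip u u; case: (ip u u) => a b [] /= /eqP.
by rewrite -subr_eq0 opprK -mulr2n mulrn_eq0 => /eqP.
Qed.

Lemma hnorm0 : hn 0 = 0. Proof. by rewrite /hnorm ip0l sqrtr0. Qed.

Lemma hnorm_eq0 u : (hn u == 0) = (u == 0).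
Proof.
apply/eqP/eqP => [h|->]; last exact: hnorm0.
by apply: (ip_definite Hip); rewrite -hnorm_sqr h expr0n.
Qed.

Lemma hnormZ a u : hn (a *: u) = modulus a * hn u.
Proof.
apply/eqP; rewrite -(@eqrXn2 _ 2) ?mulr_ge0 ?hn_ge0 ?modulus_ge0//.
rewrite exprMn !hnorm_sqr ipZl ipZr mulrA mulC_conj ReZ.
exact/eqP.
Qed.

Lemma hnormN u : hn (- u) = hn u.
Proof. by rewrite -scaleN1r hnormZ modulusN modulus1 mul1r. Qed.

Lemma hnormBC u v : hn (u - v) = hn (v - u).
Proof. by rewrite -hnormN opprB. Qed.

Lemma hnorm_sqrD u v :
  hn (u + v) ^+ 2 = hn u ^+ 2 + 2 * Re (ip u v) + hn v ^+ 2.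
Proof.
rewrite !hnorm_sqr ipDl !ipDr !ReD (ip_sym Hip u v) Re_conj; ring.
Qed.

Lemma discr_le (a b c : R) : 0 <= a ->
  (forall t, 0 <= a * t ^+ 2 + 2 * b * t + c) -> b ^+ 2 <= a * c.
Proof.
move=> a0 h; have [a_eq0|an0] := eqVneq a 0.
  have [->|b0] := eqVneq b 0; first by rewrite a_eq0 expr0n mul0r.
  (* For [a = 0] the quadratic is affine, and at this point it takes the value [-1]. *)
  have := h (- (c + 1) / (2 * b)); rewrite a_eq0 mul0r add0r.
  have -> : 2 * b * (- (c + 1) / (2 * b)) = - (c + 1).
    by rewrite mulrCA divff ?mulr1// mulf_neq0// pnatr_eq0.
  by lra.
have ap : 0 < a by rewrite lt0r an0.
have := h (- b / a).
have -> : a * (- b / a) ^+ 2 + 2 * b * (- b / a) + c = (a * c - b ^+ 2) / a.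
  by field.
by rewrite pmulr_lge0 ?invr_gt0// subr_ge0.
Qed.

Lemma linear0 T : linear T -> T 0 = 0.
Proof. by move=> lT; have := lT (-1) 0 0; rewrite scaler0 addr0 scaleN1r addNr. Qed.

Lemma linearZ' T (a : R[i]) u : linear T -> T (a *: u) = a *: T u.
Proof. by move=> lT; have := lT a u 0; rewrite !addr0 (linear0 lT) addr0. Qed.

Lemma linearD' T u v : linear T -> T (u + v) = T u + T v.
Proof. by move=> lT; have := lT 1 u v; rewrite !scale1r. Qed.

Lemma linearB' T u v : linear T -> T (u - v) = T u - T v.
Proof. by move=> lT; rewrite linearD'// -scaleN1r linearZ'// scaleN1r. Qed.

Lemma linear_sum' T (I : Type) (r : seq I) (P : pred I) (F : I -> H) : linear T ->
  T (\sum_(i <- r | P i) F i) = \sum_(i <- r | P i) T (F i).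
Proof. by move=> lT; apply: (big_morph T) => [u v|]; [exact: linearD'|exact: linear0]. Qed.

(* Cauchy-Schwarz for a positive sesquilinear form, here [ip (T u) v]. *)
Lemma form_cauchy_schwarz T u v :
  linear T -> (forall u v, ip (T u) v = ip u (T v)) ->
  (forall u, 0 <= Re (ip (T u) u)) ->
  modulus (ip (T u) v) ^+ 2 <= Re (ip (T u) u) * Re (ip (T v) v).
Proof.
move=> lT sT pT; set z := ip (T u) v; set m := modulus z.
have [m0|m0] := eqVneq m 0; first by rewrite m0 expr0n mulr_ge0.
have mp : 0 < m by rewrite lt0r m0 modulus_ge0.
(* [c] is the phase of [z], so that the cross term of the form at [t u + c v] is the real number
   [2 m t]. *)
pose c : R[i] := z / m%:C.
have cz : c^* * z = m%:C.
  rewrite /c conjCM mulrAC [z^* * z]mulrC mulC_conj -/m expr2 realCM.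
  by rewrite -realCV conjc_real realCV mulfK// -normE -/m; apply/eqP => -[] /eqP; rewrite (negPf m0).
have cc : c * c^* = 1.
  by rewrite mulC_conj /c modulusM modulusV modulusR ger0_norm ?modulus_ge0// -/m divff// expr1n.
apply: (@discr_le _ m) => // t.
have -> : Re (ip (T u) u) * t ^+ 2 + 2 * m * t + Re (ip (T v) v) =
   Re (ip (T (t%:C *: u + c *: v)) (t%:C *: u + c *: v)); last exact: pT.
rewrite lT ipDl !ipDr !ipZr.
rewrite (linearZ' c v lT).
rewrite !ipZl conjc_real.
have -> : ip (T v) u = z^* by rewrite sT (ip_sym Hip).
have -> : c^* * (t%:C * ip (T u) v) = (t * m)%:C.
  by rewrite mulrCA cz realCM.
have -> : t%:C * (c * z^*) = (t * m)%:C.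
  rewrite -[c * _](@conjcK R) conjCM conjcK cz conjc_real realCM//.
rewrite [c^* * _]mulrA [c^* * c]mulrC cc mul1r !ReD !ReZ /=; ring.
Qed.

Lemma cauchy_schwarz u v : modulus (ip u v) <= hn u * hn v.
Proof.
rewrite -(@ler_pXn2r _ 2) ?nnegrE ?modulus_ge0 ?mulr_ge0 ?hn_ge0//.
rewrite exprMn !hnorm_sqr.
by apply: (@form_cauchy_schwarz id) => //; exact: (ip_pos Hip).
Qed.

Lemma hnormD u v : hn (u + v) <= hn u + hn v.
Proof.
rewrite -(@ler_pXn2r _ 2) ?nnegrE ?addr_ge0 ?hn_ge0// hnorm_sqrD sqrrD.
rewrite lerD2r lerD2l -[leRHS]mulr_natl ler_pM2l// (le_trans _ (cauchy_schwarz _ _))//.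
exact: le_trans (ler_norm _) (Re_le_modulus _).
Qed.

Lemma hnormB u v : hn (u - v) <= hn u + hn v.
Proof. by rewrite (le_trans (hnormD _ _))// hnormN. Qed.

Lemma hnorm_subD u v w : hn (u - v) <= hn (u - w) + hn (w - v).
Proof. by rewrite (le_trans _ (hnormD _ _))// addrA subrK. Qed.

Lemma hnorm_sum (I : Type) (r : seq I) (P : pred I) (F : I -> H) :
  hn (\sum_(i <- r | P i) F i) <= \sum_(i <- r | P i) hn (F i).
Proof.
elim/big_rec2: _ => [|i y z _ h]; first by rewrite hnorm0.
by rewrite (le_trans (hnormD _ _))// lerD2l.
Qed.

Lemma hnorm_le_dual u (c : R) : 0 <= c ->
  (forall v, modulus (ip u v) <= c * hn v) -> hn u <= c.
Proof.
move=> c0 /(_ u); rewrite ip_self modulusR ger0_norm ?sqr_ge0// expr2.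
have := hn_ge0 u; rewrite le_eqVlt => /orP[/eqP <-//|u0].
by rewrite ler_pM2r.
Qed.

Lemma ip_ext u w : (forall v, ip u v = ip w v) -> u = w.
Proof.
move=> h; apply/eqP; rewrite -subr_eq0 -hnorm_eq0; apply/eqP/le_anti.
rewrite hn_ge0 andbT; apply: hnorm_le_dual => // v.
by rewrite ipBl h subrr modulus0 mul0r.
Qed.

Definition hcvg (u_ : nat -> H) u := hn (u_ n - u) @[n --> \oo] --> (0 : R).

Lemma hcvg_ip (u_ : nat -> H) u v : hcvg u_ u -> ip (u_ n) v @[n --> \oo] --> ip u v.
Proof.
move=> /cvgrPdist_lt h; apply/nearC => e e0.
have d0 : 0 < e / (hn v + 1) by rewrite divr_gt0// ltr_wpDl// hn_ge0.
have := h _ d0; apply: filterS => n; rewrite sub0r normrN ger0_norm ?hn_ge0//.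
rewrite ltr_pdivlMr ?ltr_wpDl ?hn_ge0// -ipBl => lt.
rewrite (le_lt_trans (cauchy_schwarz _ _))// (le_lt_trans _ lt)// ler_wpM2l ?hn_ge0//.
by rewrite lerDl.
Qed.

Lemma hcvg_norm (u_ : nat -> H) u : hcvg u_ u -> hn (u_ n) @[n --> \oo] --> hn u.
Proof.
move=> /cvgrPdist_lt h; apply/cvgrPdist_lt => e /h; apply: filterS => n.
rewrite sub0r normrN ger0_norm ?hn_ge0//; apply: le_lt_trans.
rewrite ler_norml; apply/andP; split.
  by have := hnormD (u_ n - u) u; rewrite subrK; lra.
by have := hnormD (u - u_ n) (u_ n); rewrite subrK hnormBC; lra.
Qed.

Lemma cauchy_complex (z : nat -> R[i]) :
  (forall e : R, 0 < e -> exists N, forall m n, (N <= m)%N -> (N <= n)%N ->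
     modulus (z m - z n) <= e) -> exists l : R[i], z n @[n --> \oo] --> l.
Proof.
move=> h.
have hr (f : R[i] -> R) : (forall a b, `|f a - f b| <= modulus (a - b)) ->
    cvgn (f \o z).
  move=> fl; apply/cauchy_cvgP/cauchy_exP => e e0.
  have e20 : 0 < e / 2 by rewrite divr_gt0.
  have [N hN] := h (e / 2) e20.
  exists (f (z N)); exists N => // n /= Nn; rewrite /ball /= (le_lt_trans (fl _ _))//.
  by rewrite (le_lt_trans (hN _ _ _ _))// ltr_pdivrMr// mulr_natr mulr2n ltrDl.
have c1 := hr Re (fun a b => (eq_ind _ (fun x => `|x| <= _) (Re_le_modulus _) _ (ReB a b))).
have c2 := hr Im (fun a b => (eq_ind _ (fun x => `|x| <= _) (Im_le_modulus _) _ (ImB a b))).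
exists (lim (Re (z n) @[n --> \oo]) +i* lim (Im (z n) @[n --> \oo])).
by apply/cvgC_ReIm; split.
Qed.

Lemma le_limC (z : nat -> R[i]) (l : R[i]) (c : R) : z n @[n --> \oo] --> l ->
  (\forall n \near \oo, modulus (z n) <= c) -> modulus l <= c.
Proof. by move=> /cvgC_modulus h hc; exact: (ler_cvg_to h (cvg_cst c) hc). Qed.

Hypothesis ip_riesz : riesz_property.

(** The weak limits of a Cauchy sequence define a bounded functional, whose Riesz vector is [w];
    testing against all [v] upgrades weak convergence to norm convergence. The conclusion keeps the
    modulus of the Cauchy condition, which makes the operator version uniform in the vector. *)
Lemma hilbert_complete (u_ : nat -> H) :
  (forall e : R, 0 < e -> exists N, forall m n, (N <= m)%N -> (N <= n)%N ->
     hn (u_ m - u_ n) <= e) ->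
  exists w, forall (e : R) N, (forall m n, (N <= m)%N -> (N <= n)%N ->
     hn (u_ m - u_ n) <= e) -> forall n, (N <= n)%N -> hn (u_ n - w) <= e.
Proof.
move=> h.
have cv v : exists l : R[i], ip v (u_ n) @[n --> \oo] --> l.
  apply: cauchy_complex => e e0.
  have v1 : 0 < hn v + 1 by rewrite ltr_wpDl ?hn_ge0.
  have [N hN] := h _ (divr_gt0 e0 v1).
  exists N => m n Nm Nn; rewrite -ipBr (le_trans (cauchy_schwarz _ _))//.
  rewrite (@le_trans _ _ ((hn v + 1) * (e / (hn v + 1))))//.
    by rewrite ler_pM ?hn_ge0 ?hN// lerDl.
  by rewrite mulrC divfK// gt_eqF.
have [phi hphi] := choice cv.
have [w hw] : exists w, forall u, phi u = ip u w.
  apply: (ip_riesz) => [a u v|].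
    apply: (cvgC_unique (hphi _)).
    under eq_fun do rewrite (ip_linear Hip).
    apply: cvgCD => //; apply: cvgCM => //; exact: cvgC_cst.
  have [N hN] := h 1 ltr01; exists (hn (u_ N) + 1) => u.
  apply: (le_limC (hphi u)); exists N => // n /= Nn.
  rewrite (le_trans (cauchy_schwarz _ _))// mulrC ler_wpM2r ?hn_ge0//.
  have := hnormD (u_ n - u_ N) (u_ N); rewrite subrK => /le_trans; apply.
  by rewrite addrC lerD2l hN.
exists w => e N hN n Nn; apply: hnorm_le_dual.
  exact: le_trans (hn_ge0 _) (hN _ _ Nn Nn).
move=> v; rewrite (ip_sym Hip v) modulus_conj.
have cvg : ip v (u_ n - u_ m) @[m --> \oo] --> ip v (u_ n - w).
  under eq_fun do rewrite ipBr; rewrite ipBr.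
  by apply: cvgCB; [exact: cvgC_cst|rewrite -hw].
apply: (le_limC cvg); exists N => // m /= Nm.
by rewrite (le_trans (cauchy_schwarz _ _))// mulrC ler_wpM2r ?hn_ge0// hN.
Qed.

Lemma operator_complete (T_ : nat -> H -> H) : (forall n, linear (T_ n)) ->
  (forall e : R, 0 < e -> exists N, forall m n, (N <= m)%N -> (N <= n)%N ->
     forall u, hn (T_ m u - T_ n u) <= e * hn u) ->
  exists S, linear S /\ forall (e : R), 0 < e -> exists N, forall n, (N <= n)%N ->
     forall u, hn (T_ n u - S u) <= e * hn u.
Proof.
move=> lT h.
have cv u : exists w, forall (e : R) N, (forall m n, (N <= m)%N -> (N <= n)%N ->
     hn (T_ m u - T_ n u) <= e) -> forall n, (N <= n)%N -> hn (T_ n u - w) <= e.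
  apply: hilbert_complete => e e0.
  have v1 : 0 < hn u + 1 by rewrite ltr_wpDl ?hn_ge0.
  have [N hN] := h _ (divr_gt0 e0 v1).
  exists N => m n Nm Nn; rewrite (le_trans (hN _ _ Nm Nn _))//.
  rewrite -mulrA ler_piMr ?(ltW e0)// mulrC ler_pdivrMr// mul1r lerDl//.
have [S hS] := choice cv.
have cS u : hcvg (T_ ^~ u) (S u).
  apply/cvgrPdist_le => e e0; have v1 : 0 < hn u + 1 by rewrite ltr_wpDl ?hn_ge0.
  have [N hN] := h _ (divr_gt0 e0 v1).
  exists N => // n Nn; rewrite /= sub0r normrN ger0_norm ?hn_ge0//.
  apply: hS Nn => m k Nm Nk; rewrite (le_trans (hN _ _ Nm Nk _))//.
  rewrite -mulrA ler_piMr ?(ltW e0)// mulrC ler_pdivrMr// mul1r lerDl//.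
exists S; split=> [a u v|e e0].
  apply: ip_ext => x; have := hcvg_ip (v := x) (cS (a *: u + v)).
  under eq_fun do rewrite lT (ip_linear Hip).
  move=> /cvgC_unique; apply; rewrite (ip_linear Hip).
  apply: cvgCD; last exact: hcvg_ip.
  by apply: cvgCM; [exact: cvgC_cst|exact: hcvg_ip].
have [N hN] := h _ e0; exists N => n Nn u; apply: hS Nn => m k Nm Nk.
exact: hN.
Qed.

Lemma hcvg_unique (u_ : nat -> H) u v : hcvg u_ u -> hcvg u_ v -> u = v.
Proof.
move=> hu hv; apply: ip_ext => x.
exact: (cvgC_unique (hcvg_ip (v := x) hu) (hcvg_ip (v := x) hv)).
Qed.

Lemma hcvg_le (u_ : nat -> H) u (b : nat -> R) :
  (forall n, hn (u_ n - u) <= b n) -> b n @[n --> \oo] --> (0 : R) -> hcvg u_ u.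
Proof.
move=> h b0; apply: (squeeze_cvgr _ (cvg_cst 0) b0).
by apply: nearW => n; rewrite hn_ge0 h.
Qed.

Lemma hcvg_bounded T (K : R) (u_ : nat -> H) u : linear T ->
  (forall u, hn (T u) <= K * hn u) -> hcvg u_ u -> hcvg (fun n => T (u_ n)) (T u).
Proof.
move=> lT bT hu; apply: (@hcvg_le _ _ (fun n => K * hn (u_ n - u))) => [n|].
  by rewrite -linearB'.
by rewrite -[0 : R](mulr0 K); apply: cvgM => //; exact: cvg_cst.
Qed.

Lemma hcvg_linear (a : R[i]) (u_ v_ : nat -> H) u v : hcvg u_ u -> hcvg v_ v ->
  hcvg (fun n => a *: u_ n + v_ n) (a *: u + v).
Proof.
move=> hu hv; apply: (@hcvg_le _ _ (fun n => modulus a * hn (u_ n - u) + hn (v_ n - v))) => [n|].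
  by rewrite opprD addrACA -scalerBr (le_trans (hnormD _ _))// hnormZ.
rewrite -[0 : R]addr0 -[X in X + _](mulr0 (modulus a)).
by apply: cvgD => //; apply: cvgM => //; exact: cvg_cst.
Qed.

Lemma operator_cvg (T_ : nat -> H -> H) S : (forall (e : R), 0 < e -> exists N,
    forall n, (N <= n)%N -> forall u, hn (T_ n u - S u) <= e * hn u) ->
  forall u, hcvg (T_ ^~ u) (S u).
Proof.
move=> hS u; apply/cvgrPdist_le => e e0; have v1 : 0 < hn u + 1 by rewrite ltr_wpDl ?hn_ge0.
have [N hN] := hS _ (divr_gt0 e0 v1).
exists N => // n Nn; rewrite /= sub0r normrN ger0_norm ?hn_ge0//.
rewrite (le_trans (hN _ Nn _))// -mulrA ler_piMr ?(ltW e0)// mulrC ler_pdivrMr// mul1r lerDl//.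
Qed.

End hilbert_spaces.

(** * Spectra and functional calculus of self-adjoint operators *)

Section operator_polynomials.
Context (R : realType) (H : lmodType R[i]) (ip : H -> H -> R[i]).
Hypothesis Hip : hilbert ip.
Let Hpre : inner_product ip. Proof. exact: Hip. Qed.
Implicit Types (u v w : H) (T S B K : H -> H) (p q r : {poly R[i]}).
Local Notation hn := (hnorm ip).
Local Notation selfadj T := (forall u v, ip (T u) v = ip u (T v)).

Lemma operator_polyE p T u n : (size p <= n)%N ->
  operator_poly p T u = \sum_(k < n) p`_k *: iter k T u.
Proof.
move=> pn; rewrite /operator_poly !(big_ord_widen_cond _ (fun=> true) (fun k => p`_k *: iter k T u) pn).
rewrite [RHS](bigID (fun i : 'I_n => (i < size p)%N))/= [X in _ + X]big1 ?addr0//.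
by move=> i; rewrite -leqNgt => /(nth_default 0) ->; rewrite scale0r.
Qed.

Lemma operator_polyD p q T u :
  operator_poly (p + q) T u = operator_poly p T u + operator_poly q T u.
Proof.
pose n := maxn (size p) (size q).
rewrite (@operator_polyE (p + q) _ _ n) ?size_polyD//.
rewrite (@operator_polyE p _ _ n) ?leq_maxl// (@operator_polyE q _ _ n) ?leq_maxr//.
by rewrite -big_split; apply: eq_bigr => i _; rewrite coefD scalerDl.
Qed.

Lemma operator_polyC (c : R[i]) T u : operator_poly c%:P T u = c *: u.
Proof.
by rewrite (@operator_polyE _ _ _ 1) ?size_polyC_leq1// big_ord1 coefC.
Qed.

Lemma operator_polyMX p T u :
  operator_poly (p * 'X) T u = operator_poly p T (T u).
Proof.
rewrite (@operator_polyE _ _ _ (size p).+1) ?size_polyMleq_add//; last first.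
  by rewrite (leq_trans (size_polyMleq _ _))// size_polyX addn2.
rewrite big_ord_recl coefMX eqxx scale0r add0r /operator_poly.
by apply: eq_bigr => i _; rewrite coefMX /= -iterSr iterS.
Qed.

Section fixed_operator.
Variables (T : H -> H) (lT : linear T).
Local Notation op p := (operator_poly p T).

Lemma linear_operator_poly p : linear (op p).
Proof.
elim/poly_ind: p => [|p c ih] a u v.
  by rewrite -polyC0 !operator_polyC !scale0r scaler0 addr0.
rewrite !operator_polyD !operator_polyMX !operator_polyC lT ih !scalerDr !scalerA.
by rewrite [c * a]mulrC addrACA.
Qed.

Lemma operator_poly_comm p u : op p (T u) = T (op p u).
Proof.
elim/poly_ind: p u => [|p c ih] u.
  by rewrite -polyC0 !operator_polyC !scale0r linear0.
by rewrite !operator_polyD !operator_polyMX !operator_polyC !ih (linearD' _ _ lT) (linearZ' _ _ lT).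
Qed.

Lemma operator_polyM p q u : op (p * q) u = op p (op q u).
Proof.
elim/poly_ind: p u => [|p c ih] u.
  by rewrite mul0r -polyC0 !operator_polyC !scale0r.
rewrite mulrDl !operator_polyD [p * 'X * q]mulrAC !operator_polyMX ih !operator_polyC.
rewrite !operator_poly_comm; congr (_ + _); move: u {ih}.
elim/poly_ind: q => [|q d ih2] u; first by rewrite mulr0 -polyC0 !operator_polyC !scale0r scaler0.
rewrite mulrDr mulrA !operator_polyD !operator_polyMX -polyCM !operator_polyC scalerDr scalerA.
by rewrite ih2.
Qed.

Lemma operator_poly_subX (l : R[i]) u : op ('X - l%:P) u = T u - l *: u.
Proof.
rewrite operator_polyD -polyCN operator_polyC scaleNr.
by rewrite -['X]mul1r operator_polyMX -polyC1 operator_polyC scale1r.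
Qed.

Lemma operator_poly_bounded p (K : R) : (forall u, hn (T u) <= K * hn u) ->
  exists2 C : R, 0 <= C & forall u, hn (op p u) <= C * hn u.
Proof.
move=> bT; elim/poly_ind: p => [|p c [C C0 ih]].
  by exists 0 => // u; rewrite -polyC0 operator_polyC scale0r hnorm0// mul0r.
exists (C * `|K| + modulus c); first by rewrite addr_ge0 ?mulr_ge0 ?modulus_ge0.
move=> u; rewrite operator_polyD operator_polyMX operator_polyC mulrDl.
rewrite (le_trans (hnormD Hip _ _))// lerD ?hnormZ// (le_trans (ih _))// -mulrA.
rewrite ler_wpM2l// (le_trans (bT _))// ler_wpM2r ?hn_ge0//.
exact: ler_norm.
Qed.

Lemma operator_poly_adjoint p u v : selfadj T ->
  ip (op p u) v = ip u (op (map_poly (@conjc R) p) v).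
Proof.
move=> sT; elim/poly_ind: p u v => [|p c ih] u v.
  by rewrite rmorph0 -polyC0 !operator_polyC !scale0r (ip0l Hip) ip0r.
rewrite rmorphD rmorphM /= map_polyX map_polyC /= !operator_polyD !operator_polyMX !operator_polyC.
rewrite (ipDl Hip) (ipDr Hip) ih sT (ipZl Hip) (ipZr Hip) operator_poly_comm.
by rewrite (_ : (c^*)^* = c)//; exact: conjcK.
Qed.

End fixed_operator.

(** [m] is the square of the norm of [B], and vectors that nearly attain it are approximate
    eigenvectors of [B' B]: since [B'] has the same norm, [|B' B u - m u|^2] is at most [m |B u|^2 -
    2 m |B u|^2 + m^2 = m (m - |B u|^2)] for a unit vector [u]. *)
Lemma approximate_eigenvector B B' (K : R) (u0 : H) : linear B ->
  (forall u v, ip (B u) v = ip u (B' v)) ->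
  (forall u, hn (B u) <= K * hn u) -> hn u0 = 1 ->
  exists m : R, [/\ 0 <= m, forall u, hn (B u) ^+ 2 <= m * hn u ^+ 2 &
   forall d : R, 0 < d -> exists u, hn u = 1 /\ hn (B' (B u) - m%:C *: u) < d].
Proof.
move=> lB adj bB u01; pose E := [set hn (B u) ^+ 2 | u in [set u | hn u = 1]].
have ubE : ubound E (K ^+ 2).
  move=> _ [u /= u1 <-]; have := bB u; rewrite u1 mulr1 => h.
  by rewrite lerXn2r ?nnegrE ?hn_ge0// (le_trans (hn_ge0 ip (B u)) h).
have sE : has_sup E by split; [exists (hn (B u0) ^+ 2), u0|exists (K ^+ 2)].
pose m := sup E.
have m0 : 0 <= m.
  apply: (@le_trans _ _ (hn (B u0) ^+ 2)); first exact: sqr_ge0.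
  by apply: sup_ubound; [case: sE|exists u0].
have bm u : hn (B u) ^+ 2 <= m * hn u ^+ 2.
  have [->|un0] := eqVneq u 0.
    by rewrite linear0// hnorm0// expr0n mulr0.
  have hu : 0 < hn u by rewrite lt0r hn_ge0 hnorm_eq0// un0.
  have : hn (B ((hn u)^-1%:C *: u)) ^+ 2 <= m.
    apply: sup_ubound; first by case: sE.
    exists ((hn u)^-1%:C *: u) => //=.
    by rewrite hnormZ// modulusR ger0_norm ?invr_ge0 ?hn_ge0// mulVf ?gt_eqF.
  rewrite linearZ'// hnormZ// modulusR ger0_norm ?invr_ge0 ?hn_ge0//.
  by rewrite exprMn exprVn mulrC ler_pdivrMr ?exprn_gt0.
(* The adjoint inherits the bound from [|B' w|^2 = <B B' w, w>], Cauchy-Schwarz and division by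
   [|B' w|^2]. *)
have bm' w : hn (B' w) ^+ 2 <= m * hn w ^+ 2.
  have h : (hn (B' w) ^+ 2) ^+ 2 <= m * hn (B' w) ^+ 2 * hn w ^+ 2.
    rewrite [X in X ^+ 2](_ : _ = modulus (ip (B (B' w)) w)); last first.
      by rewrite adj ip_self// modulusR ger0_norm// sqr_ge0.
    apply: (@le_trans _ _ ((hn (B (B' w)) * hn w) ^+ 2)).
      by rewrite lerXn2r ?nnegrE ?modulus_ge0 ?mulr_ge0 ?hn_ge0// cauchy_schwarz.
    by rewrite exprMn ler_wpM2r ?sqr_ge0.
  have := hn_ge0 ip (B' w); rewrite le_eqVlt => /orP[/eqP <-|b0].
    by rewrite expr0n mulr_ge0 ?sqr_ge0.
  by move: h; rewrite [_ ^+ 2 ^+ 2]expr2 [m * _ * _]mulrAC ler_pM2r ?exprn_gt0.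
exists m; split=> // d d0.
(* With this tolerance in the supremum the defect [m (m - |B u|^2)] stays below [d^2]; the [+ 1]
   covers [m = 0]. *)
have d10 : 0 < d ^+ 2 / (m + 1) by rewrite divr_gt0 ?exprn_gt0// ltr_wpDl.
have [_ [u /= u1 <-] hu] := sup_adherent d10 sE; exists u; split=> //.
rewrite -(@ltr_pXn2r _ 2) ?nnegrE ?hn_ge0 ?(ltW d0)//.
rewrite hnorm_sqrD// hnormN// hnormZ// modulusR ger0_norm// u1 mulr1.
have -> : Re (ip (B' (B u)) (- (m%:C *: u))) = - m * hn (B u) ^+ 2.
  rewrite (ipNr Hip) (ipZr Hip) conjc_real ReN ReZ mulNr; congr (- (_ * _)).
  by rewrite (ip_sym Hip) Re_conj -adj hnorm_sqr.
have h1 := bm' (B u); have mE : m * (m - hn (B u) ^+ 2) < d ^+ 2.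
  move: hu; rewrite ltrBlDr -ltrBlDl -/m ltr_pdivlMr ?ltr_wpDl// => hu.
  have := bm u; rewrite u1 expr1n mulr1 => h3.
  apply: le_lt_trans hu; rewrite mulrC ler_wpM2l ?subr_ge0//; lra.
apply: le_lt_trans mE; lra.
Qed.

Definition bounded_below B := exists2 d : R, 0 < d & forall u, d * hn u <= hn (B u).

(** If [l] is not real then [|Im <T u - l u, u>| = |Im l| |u|^2] bounds the operator from below; if
    [l] is real, a bounded inverse would do so. *)
Lemma not_bounded_below_spectrum T (l : R[i]) : linear T -> selfadj T ->
  ~ bounded_below (fun u => T u - l *: u) ->
  exists2 x : R, l = x%:C & spectrum ip T x%:C.
Proof.
move=> lT sT nb.
have Iml : Im l = 0.
  apply/eqP; apply: contrapT => /negP i0; apply: nb; exists `|Im l|; rewrite ?normr_gt0// => u.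
  have [->|un0] := eqVneq u 0; first by rewrite hnorm0// mulr0 hn_ge0.
  have hu : 0 < hn u by rewrite lt0r hn_ge0 hnorm_eq0// un0.
  rewrite -(ler_pM2r hu) (le_trans _ (cauchy_schwarz Hip _ _))//.
  apply: le_trans (Im_le_modulus _); rewrite (ipBl Hip) ImB.
  have -> : Im (ip (T u) u) = 0.
    have : ip (T u) u = (ip (T u) u)^* by rewrite -(ip_sym Hip) sT.
    by case: (ip (T u) u) => a b [] /= /eqP; rewrite -subr_eq0 opprK -mulr2n mulrn_eq0 => /eqP.
  rewrite sub0r normrN (ipZl Hip) ip_self// ImM /= mulr0 add0r normrM -mulrA -expr2.
  by rewrite (ger0_norm (sqr_ge0 _)).
exists (Re l); first by apply: complexP.
have <- : l = (Re l)%:C by apply: complexP.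
move=> [S [[lS [M bS]] SK _]]; apply: nb; exists (`|M| + 1)^-1.
  by rewrite invr_gt0 ltr_wpDl.
move=> u; rewrite mulrC ler_pdivrMr ?ltr_wpDl// -{1}[u]SK.
rewrite (le_trans (bS _))// mulrC ler_wpM2l ?hn_ge0//.
by rewrite (le_trans (ler_norm _))// lerDl.
Qed.

(** Factor [r] over the complex numbers: if [T - l] were bounded below for every root [l], so would
    be the product [r(T)], against the small values assumed. *)
Lemma spectrum_root T r : linear T -> selfadj T -> r != 0 ->
  (forall d : R, 0 < d -> exists u, hn u = 1 /\ hn (operator_poly r T u) < d) ->
  exists2 x : R, spectrum ip T x%:C & r.[x%:C] = 0.
Proof.
move=> lT sT r0 small; apply: contrapT => none.
have [s rE] := closed_field_poly_normal r.
have lc0 : lead_coef r != 0 by rewrite lead_coef_eq0.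
have below l : l \in s -> bounded_below (fun u => T u - l *: u).
  move=> ls; apply: contrapT => /(not_bounded_below_spectrum lT sT)[x lx sx].
  apply: none; exists x => //; rewrite -lx rE hornerZ horner_prod.
  by rewrite (big_rem l)//= hornerXsubC subrr mul0r mulr0.
have [d d0 hd] : bounded_below (operator_poly (\prod_(z <- s) ('X - z%:P)) T).
  elim: s {rE} below => [|l s ih] below.
    by exists 1 => // u; rewrite big_nil -polyC1 operator_polyC scale1r mul1r.
  have [d1 d10 h1] := below l (mem_head _ _).
  have [d2 d20 h2] := ih (fun z zs => below z (mem_behead (s := l :: s) zs)).
  exists (d1 * d2); first exact: mulr_gt0.
  move=> u; rewrite big_cons operator_polyM// operator_poly_subX.
  by rewrite (le_trans _ (h1 _))// -mulrA ler_pM2l.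
have c0 : 0 < modulus (lead_coef r) by rewrite modulus_gt0.
have [u [u1]] := small _ (mulr_gt0 c0 d0).
rewrite {1}rE -mul_polyC operator_polyM// operator_polyC hnormZ//.
rewrite ltr_pM2l// => /(le_lt_trans (hd u)); rewrite u1 mulr1 ltxx//.
Qed.

Lemma horner_conj_poly p (x : R) :
  (map_poly (@conjc R) p).[x%:C] = (p.[x%:C])^*.
Proof. by rewrite -[in LHS](conjc_real x) horner_map. Qed.

(** Let [m] be the square of the norm of [p(T)]. Approximate eigenvectors make the polynomial
    [conj p p - m] small at [T], so [spectrum_root] gives a spectral value at which [|p|^2 = m]. The
    norm of [p(T)] is thus attained on the spectrum, by factorization alone. *)
Lemma spectral_bound T p (K e : R) : linear T -> selfadj T ->
  (forall u, hn (T u) <= K * hn u) -> 0 <= e ->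
  (forall x : R, spectrum ip T x%:C -> modulus p.[x%:C] <= e) ->
  forall u, hn (operator_poly p T u) <= e * hn u.
Proof.
move=> lT sT bT e0 pe u.
have [->|un0] := eqVneq u 0.
  by rewrite (linear0 (linear_operator_poly lT p)) hnorm0// mulr0.
have hu : 0 < hn u by rewrite lt0r hn_ge0 hnorm_eq0// un0.
pose u0 := (hn u)^-1%:C *: u.
have u01 : hn u0 = 1.
  by rewrite hnormZ// modulusR ger0_norm ?invr_ge0 ?hn_ge0// mulVf ?gt_eqF.
have approx r : exists m : R, [/\ 0 <= m,
    forall u, hn (operator_poly r T u) ^+ 2 <= m * hn u ^+ 2 &
    forall d : R, 0 < d -> exists u, hn u = 1 /\
     hn (operator_poly (map_poly (@conjc R) r * r - (m%:C)%:P) T u) < d].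
  have [C C0 bC] := operator_poly_bounded r bT.
  have [m [m0 bm am]] := approximate_eigenvector (linear_operator_poly lT r)
    (fun u v => operator_poly_adjoint lT r u v sT) bC u01.
  exists m; split=> // d /am [v [v1 hv]]; exists v; split=> //.
  by rewrite operator_polyD -polyCN operator_polyM// operator_polyC scaleNr.
have [m [m0 bm am]] := approx p.
have root_val (x : R) : (map_poly (@conjc R) p * p - (m%:C)%:P).[x%:C] = 0 -> modulus p.[x%:C] ^+ 2 = m.
  rewrite hornerD hornerN hornerC hornerM horner_conj_poly mulrC mulC_conj.
  by move/eqP; rewrite subr_eq0 => /eqP /complexI.
have [x sx px] : exists2 x : R, spectrum ip T x%:C & modulus p.[x%:C] ^+ 2 = m.
  (* If [conj p p - m] is the zero polynomial then [|p|^2 = m] everywhere and any spectral value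
     will do; the polynomial ['X] provides one. *)
  have [q0|q0] := eqVneq (map_poly (@conjc R) p * p - (m%:C)%:P) 0.
    have [m' [_ _ am']] := approx 'X.
    have X0 : map_poly (@conjc R) 'X * 'X - (m'%:C)%:P != 0.
      rewrite map_polyX -expr2 -size_poly_gt0 size_polyDl ?size_polyXn//.
      by rewrite size_polyN (leq_ltn_trans (size_polyC_leq1 _)).
    have [x sx _] := spectrum_root lT sT X0 am'.
    by exists x => //; apply: root_val; rewrite q0 horner0.
  by have [x sx hx] := spectrum_root lT sT q0 am; exists x => //; exact: root_val.
rewrite -(@ler_pXn2r _ 2) ?nnegrE ?mulr_ge0 ?hn_ge0//.
rewrite (le_trans (bm u))// exprMn ler_wpM2r ?sqr_ge0// -px.
by rewrite lerXn2r ?nnegrE ?modulus_ge0// pe.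
Qed.

Lemma neumann K (rho : R) : linear K -> 0 <= rho -> rho < 1 ->
  (forall u, hn (K u) <= rho * hn u) ->
  exists S, [/\ bounded_operator ip S, cancel (fun u => u - K u) S &
    cancel S (fun u => u - K u)].
Proof.
move=> lK r0 r1 bK.
have itK n u : hn (iter n K u) <= rho ^+ n * hn u.
  elim: n => [|n ih]; first by rewrite expr0 mul1r.
  by rewrite iterS (le_trans (bK _))// exprS -mulrA ler_wpM2l.
pose T_ n u := \sum_(k < n) iter k K u.
have lit n : linear (iter n K).
  elim: n => [|n ih] a u v //; by rewrite !iterS ih lK.
have lT n : linear (T_ n).
  move=> a u v; rewrite /T_ scaler_sumr -big_split; apply: eq_bigr => k _.
  exact: lit.
have tel n u : T_ n (u - K u) = u - iter n K u.
  elim: n => [|n ih]; first by rewrite /T_ big_ord0 subrr.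
  rewrite /T_ big_ord_recr /= -/(T_ n _) ih linearB'// -iterSr iterS.
  by rewrite addrA subrK.
have comm n u : T_ n (K u) = K (T_ n u).
  rewrite /T_ linear_sum'//; apply: eq_bigr => k _.
  by rewrite -iterSr iterS.
have rho1 : 0 < 1 - rho by rewrite subr_gt0.
(* The exact geometric remainder, rather than its bound, makes the induction on [k] close. *)
have tail m k u : hn (T_ (m + k)%N u - T_ m u) <=
    (rho ^+ m - rho ^+ (m + k)) / (1 - rho) * hn u.
  elim: k => [|k ih]; first by rewrite addn0 !subrr hnorm0// !mul0r.
  rewrite addnS {1}/T_ big_ord_recr /= -/(T_ _ u) addrAC.
  rewrite (le_trans (hnormD Hip _ _))//.
  apply: le_trans (lerD ih (itK _ _)) _; rewrite -mulrDl ler_wpM2r ?hn_ge0//.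
  rewrite le_eqVlt; apply/orP; left; apply/eqP; rewrite exprS; field.
  by rewrite gt_eqF.
have rn : rho ^+ n @[n --> \oo] --> (0 : R) by apply: cvg_expr; rewrite ger0_norm.
have tail' m n u : (m <= n)%N -> hn (T_ n u - T_ m u) <= rho ^+ m / (1 - rho) * hn u.
  move=> mn; rewrite -(subnKC mn) (le_trans (tail _ _ _))// ler_wpM2r ?hn_ge0//.
  by rewrite ler_wpM2r ?invr_ge0 ?(ltW rho1)// gerBl exprn_ge0.
have [S [lS hS]] : exists S, linear S /\ forall (e : R), 0 < e -> exists N,
    forall n, (N <= n)%N -> forall u, hn (T_ n u - S u) <= e * hn u.
  apply: (operator_complete Hip (riesz Hip)) => // e e0; move/cvgrPdist_le : rn => /(_ _ (mulr_gt0 e0 rho1)) [N _ hN].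
  have small m : (N <= m)%N -> rho ^+ m / (1 - rho) <= e.
    move=> Nm; have := hN m Nm; rewrite sub0r normrN ger0_norm ?exprn_ge0//.
    by rewrite ler_pdivrMr.
  exists N => m n Nm Nn u; wlog mn : m n Nm Nn / (n <= m)%N.
    by move=> w; case: (leqP n m) => [|/ltnW] mn; [|rewrite hnormBC//]; apply: w.
  by rewrite (le_trans (tail' _ _ _ mn))// ler_wpM2r ?hn_ge0// small.
have cS u : hcvg ip (T_ ^~ u) (S u) := operator_cvg hS u.
have SK u : S (u - K u) = u.
  apply: (hcvg_unique Hip (cS _)); apply/cvgrPdist_le => e e0.
  have v1 : 0 < hn u + 1 by rewrite ltr_wpDl ?hn_ge0.
  move/cvgrPdist_le : rn => /(_ _ (divr_gt0 e0 v1)); apply: filterS => n.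
  rewrite !sub0r !normrN ger0_norm ?exprn_ge0// ler_pdivlMr// => h.
  rewrite ger0_norm ?hn_ge0// tel addrAC subrr add0r hnormN//.
  by rewrite (le_trans (itK _ _))// (le_trans _ h)// ler_wpM2l ?exprn_ge0// lerDl.
have KS u : K (S u) = S (K u).
  have h := hcvg_bounded lK bK (cS u); apply: (hcvg_unique Hip h).
  by have := cS (K u); under eq_fun do rewrite comm.
exists S; split; last by move=> u; rewrite KS -linearB'// SK.
  split=> //; have [N hN] := hS 1 ltr01; have [C C0 hC] : exists2 C : R, 0 <= C & forall u, hn (T_ N u) <= C * hn u.
    exists ((1 - rho)^-1) => [|u]; first by rewrite invr_ge0 ltW.
    have := tail' 0 N u (leq0n _); rewrite {2}/T_ big_ord0 subr0 expr0 mul1r//.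
  exists (C + 1) => u; have := hN N (leqnn _) u; rewrite mul1r hnormBC// mulrDl mul1r => h.
  by rewrite -[S u](subrK (T_ N u)) (le_trans (hnormD Hip _ _))// addrC lerD.
exact: SK.
Qed.

(** Cauchy-Schwarz for the positive form [<T u, v>] at [v = T u] gives
    [|T u|^4 <= M |u|^2 M |T u|^2]. *)
Lemma positive_operator_norm T (M : R) u : linear T -> selfadj T ->
  (forall u, 0 <= Re (ip (T u) u) <= M * hn u ^+ 2) -> hn (T u) <= M * hn u.
Proof.
move=> lT sT pT; have M0 : hn u != 0 -> 0 <= M.
  move=> u0; have /andP[a b] := pT u; have := le_trans a b.
  by rewrite pmulr_lge0// exprn_gt0// lt0r u0 hn_ge0.
have [u0|u0] := eqVneq (hn u) 0.
  have /eqP : hn u == 0 by rewrite u0.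
  by move/eqP; rewrite hnorm_eq0// => /eqP ->; rewrite linear0// !hnorm0// mulr0.
have := form_cauchy_schwarz Hip u (T u) lT sT (fun u => proj1 (andP (pT u))).
rewrite ip_self// modulusR ger0_norm ?sqr_ge0// => h.
have h2 : (hn (T u) ^+ 2) ^+ 2 <= M * hn u ^+ 2 * (M * hn (T u) ^+ 2).
  by rewrite (le_trans h)// ler_pM//; have /andP[] := pT u; have /andP[] := pT (T u).
have := hn_ge0 ip (T u); rewrite le_eqVlt => /orP[/eqP <-|b0].
  by rewrite mulr_ge0 ?hn_ge0// M0.
rewrite -(@ler_pXn2r _ 2) ?nnegrE ?mulr_ge0 ?hn_ge0 ?M0//.
rewrite -(@ler_pM2r _ (hn (T u) ^+ 2)) ?exprn_gt0//.
by move: h2; rewrite expr2 => /le_trans; apply; rewrite le_eqVlt; apply/orP; left; apply/eqP; ring.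
Qed.

Section positive_operator.
Variables (T : H -> H) (M : R).
Hypotheses (lT : linear T) (sT : selfadj T) (M0 : 0 <= M)
  (pT : forall u, 0 <= Re (ip (T u) u) <= M * hn u ^+ 2).

Lemma positive_operator_spectrum (x : R) : spectrum ip T x%:C -> 0 <= x <= M.
Proof.
(* Outside [0, M] a multiple of T - x is the identity minus a contraction. *)
have inv (a rho : R) K : a != 0 -> linear K -> 0 <= rho -> rho < 1 ->
    (forall u, hn (K u) <= rho * hn u) ->
    (forall u, T u - x%:C *: u = a%:C *: (u - K u)) -> ~ spectrum ip T x%:C.
  move=> a0 lK r0 r1 bK eK; apply.
  have [S [[lS [C bS]] c1 c2]] := neumann lK r0 r1 bK.
  have aC : a%:C * (a^-1)%:C = 1 :> R[i] by rewrite -realCM divff.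
  exists (fun u => (a^-1)%:C *: S u); split.
  - split=> [b u v|]; first by rewrite lS scalerDr !scalerA [_ * b]mulrC.
    exists (`|a^-1| * C) => u; rewrite hnormZ// modulusR -mulrA.
    by rewrite ler_wpM2l.
  - by move=> u; rewrite eK linearZ'// c1 scalerA mulrC aC scale1r.
  - move=> u; rewrite eK linearZ'// -scalerBr scalerA aC scale1r; exact: c2.
move=> sx; apply/andP; split; rewrite leNgt; apply/negP => hx; move: sx.
  have a0 : 0 < M - x by rewrite subr_gt0 (lt_le_trans hx).
  have aC : (M - x)%:C * ((M - x)^-1)%:C = 1 :> R[i] by rewrite -realCM divff// gt_eqF.
  pose K u := ((M - x)^-1)%:C *: (M%:C *: u - T u).
  have lK : linear K.
    move=> b u v; rewrite /K lT opprD [M%:C *: _]scalerDr scalerA [M%:C * b]mulrC -scalerA.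
    by rewrite addrACA -scalerBr scalerDr !scalerA [_ * b]mulrC.
  apply: (inv (M - x) (M / (M - x)) K) => //.
  - by rewrite (gt_eqF a0).
  - by rewrite divr_ge0// ltW.
  - by rewrite ltr_pdivrMr// mul1r ltrDl oppr_gt0.
  - move=> u; apply: positive_operator_norm => // [v w|v].
      by rewrite /K (ipZl Hip) (ipZr Hip) conjc_real (ipBl Hip) (ipBr Hip) sT (ipZl Hip) (ipZr Hip) conjc_real.
    rewrite /K (ipZl Hip) ReZ (ipBl Hip) (ipZl Hip) ReB ReZ ip_self// /=.
    have /andP[p1 p2] := pT v; rewrite mulr_ge0 ?invr_ge0 ?(ltW a0) ?subr_ge0//=.
    by rewrite mulrC mulrAC ler_wpM2r ?invr_ge0 ?(ltW a0)// lerBlDr lerDl.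
  move=> u; rewrite /K scalerBr scalerA aC scale1r realCB scalerBl.
  by rewrite opprB [RHS]addrC addrA subrK.
have x0 : 0 < x by apply: le_lt_trans hx.
pose K u := (x^-1)%:C *: T u.
have lK : linear K by move=> b u v; rewrite /K lT scalerDr !scalerA mulrC.
apply: (inv (- x) (M / x) K) => //.
- by rewrite oppr_eq0 gt_eqF.
- by rewrite divr_ge0// ltW.
- by rewrite ltr_pdivrMr// mul1r.
- move=> u; apply: positive_operator_norm => // [v w|v].
    by rewrite /K (ipZl Hip) (ipZr Hip) conjc_real sT.
  rewrite /K (ipZl Hip) ReZ; have /andP[p1 p2] := pT v.
  by rewrite mulr_ge0 ?invr_ge0 ?(ltW x0)//= mulrC mulrAC ler_wpM2r ?invr_ge0 ?(ltW x0).
move=> u; rewrite /K realCN !scaleNr scalerBr scalerA -realCM divff ?gt_eqF//.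
by rewrite scale1r opprB.
Qed.

(** The spectrum lies in [[0, M]] by positivity, so uniform polynomial approximants of [h] on that
    interval form a Cauchy sequence of operators, and [cfc] denotes a genuine limit. The estimate is
    for an arbitrary [p], since the trace estimates compare [cfc] with an approximant of their
    own. *)
Lemma cfcP (h : R -> R[i]) :
  (forall e : R, 0 < e -> exists p : {poly R[i]}, forall x : R, 0 <= x <= M ->
     modulus (p.[x%:C] - h x) <= e) ->
  linear (cfc ip T h) /\ forall (p : {poly R[i]}) (e : R), 0 <= e ->
    (forall x : R, 0 <= x <= M -> modulus (p.[x%:C] - h x) <= e) ->
    forall u, hn (operator_poly p T u - cfc ip T h u) <= e * hn u.
Proof.
move=> ap.
have bT u : hn (T u) <= M * hn u by exact: positive_operator_norm.
have opB p q u : operator_poly p T u - operator_poly q T u = operator_poly (p - q) T u.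
  rewrite operator_polyD; congr (_ + _); rewrite -[- q]mulN1r -polyC1 -polyCN.
  by rewrite operator_polyM// operator_polyC scaleN1r.
have hb p (e : R) : 0 <= e -> (forall x : R, spectrum ip T x%:C -> modulus p.[x%:C] <= e) ->
    forall u, hn (operator_poly p T u) <= e * hn u by exact: spectral_bound.
have ap1 n : exists p : {poly R[i]}, forall x : R, 0 <= x <= M ->
     modulus (p.[x%:C] - h x) <= n.+1%:R^-1 by apply: ap; rewrite invr_gt0.
have [p_ hp] := choice ap1.
have [S [lS cS]] : exists S, linear S /\ forall (e : R), 0 < e -> exists N,
    forall n, (N <= n)%N -> forall u, hn (operator_poly (p_ n) T u - S u) <= e * hn u.
  apply: (operator_complete Hip (riesz Hip)) => // [n|e e0]; first exact: linear_operator_poly.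
  have /cvgrPdist_lt/(_ (e / 2)) := @cvg_harmonic R.
  rewrite divr_gt0// => /(_ isT)[N _ hN]; exists N => m n Nm Nn u; rewrite opB.
  apply: hb => [|x /positive_operator_spectrum xM]; first exact: ltW.
  rewrite hornerD hornerN (le_trans (modulus_subD _ _ (h x)))// [e]splitr lerD//.
    rewrite (le_trans (hp _ _ xM))//; have := hN m Nm.
    by rewrite sub0r normrN ger0_norm ?invr_ge0// => /ltW.
  rewrite modulusBC (le_trans (hp _ _ xM))//; have := hN n Nn.
  by rewrite sub0r normrN ger0_norm ?invr_ge0// => /ltW.
have exS : is_cfc ip T h S.
  exists p_; split=> e e0; last by have [N hN] := cS _ e0; exists N.
  have /cvgrPdist_lt/(_ _ e0)[N _ hN] := @cvg_harmonic R; exists N => // n Nn.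
  move=> x /positive_operator_spectrum xM; rewrite (le_lt_trans (hp _ _ xM))//.
  by have := hN n Nn; rewrite sub0r normrN ger0_norm ?invr_ge0.
have : is_cfc ip T h (cfc ip T h) by apply: xgetPex; exists S.
(* From here on only [is_cfc] is used: the chosen operator may come from another sequence of
   polynomials than the one above. *)
move: (cfc ip T h) => {S lS cS exS p_ hp ap1} S [p_ [hp hS]].
have cS u : hcvg ip (fun n => operator_poly (p_ n) T u) (S u).
  apply: (operator_cvg (T_ := fun n => operator_poly (p_ n) T)) => e e0; have [N _ hN] := hS _ e0.
  by exists N => n Nn; exact: hN.
split=> [a u v|p e e0 pe u].
  apply: (hcvg_unique Hip (cS _)).
  under [X in hcvg ip X _]eq_fun do rewrite linear_operator_poly//.
  exact: hcvg_linear.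
apply/ler_addgt0Pr => d d0.
have v1 : 0 < 2 * (hn u + 1) by rewrite mulr_gt0// ltr_wpDl ?hn_ge0.
pose d' := d / (2 * (hn u + 1)); have d'0 : 0 < d' by rewrite divr_gt0.
have [N1 _ h1] := hp _ d'0; have [N2 _ h2] := hS _ d'0.
pose n := maxn N1 N2.
have a1 := h2 n (leq_maxr _ _) u.
have a2 : hn (operator_poly p T u - operator_poly (p_ n) T u) <= (e + d') * hn u.
  rewrite opB; apply: hb => [|x sx]; first by rewrite addr_ge0// ltW.
  rewrite hornerD hornerN (le_trans (modulus_subD _ _ (h x)))// lerD//.
    by rewrite pe// positive_operator_spectrum.
  by rewrite modulusBC ltW// h1//= leq_maxl.
apply: (le_trans (hnorm_subD Hip _ _ (operator_poly (p_ n) T u))).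
apply: (le_trans (lerD a2 a1)); rewrite mulrDl -addrA lerD2l -mulrDl.
have -> : d' + d' = d / (hn u + 1).
  by rewrite /d'; field; rewrite gt_eqF// ltr_wpDl ?hn_ge0.
by rewrite -mulrA ler_piMr ?(ltW d0)// mulrC ler_pdivrMr ?ltr_wpDl ?hn_ge0// mul1r lerDl.
Qed.

End positive_operator.

End operator_polynomials.

(** * Weierstrass approximation by Bernstein polynomials *)

Section weierstrass.
Context (R : realType).
Implicit Types (x c e : R) (h : R -> R[i]).

(* Bernstein polynomials, by the de Casteljau recursion. *)
Fixpoint bernstein (n : nat) (g : nat -> R[i]) : {poly R[i]} :=
  if n is n'.+1 then 'X * bernstein n' (g \o S) + (1 - 'X) * bernstein n' g
  else (g 0%N)%:P.

(** The expectation of [w] under the binomial law of parameters [n] and [x]; it dominates the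
    Bernstein polynomial of any [g] with [|g| <= w]. *)
Fixpoint bernstein_mean (n : nat) (w : nat -> R) x : R :=
  if n is n'.+1 then
    x * bernstein_mean n' (w \o S) x + (1 - x) * bernstein_mean n' w x
  else w 0%N.

Lemma bernsteinS n g x : (bernstein n.+1 g).[x%:C] =
  x%:C * (bernstein n (g \o S)).[x%:C] + (1 - x%:C) * (bernstein n g).[x%:C].
Proof. by rewrite /= hornerD !hornerM hornerD hornerN hornerX hornerC. Qed.

Lemma bernstein_sub_cst n g (a : R[i]) x :
  (bernstein n (fun k => g k - a)).[x%:C] = (bernstein n g).[x%:C] - a.
Proof.
elim: n g => [|n ih] g; first by rewrite !hornerC.
rewrite !bernsteinS ih -[(fun k => g k - a) \o S]/(fun k => (g \o S) k - a) ih.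
ring.
Qed.

Lemma bernstein_le n g w x : 0 <= x <= 1 ->
  (forall k, (k <= n)%N -> modulus (g k) <= w k) ->
  modulus (bernstein n g).[x%:C] <= bernstein_mean n w x.
Proof.
move=> /andP[x0 x1]; elim: n g w => [|n ih] g w gw; first by rewrite hornerC gw.
rewrite bernsteinS (le_trans (modulusD _ _))// !modulusM -[1 - _](realCB 1 x) !modulusR.
rewrite !ger0_norm ?subr_ge0//= lerD// ler_wpM2l ?subr_ge0// ih// => k kn.
  exact: gw.
by apply: gw; rewrite (leq_trans kn).
Qed.

(** Variance plus squared bias of the binomial law. The family of quadratics is stable under the
    recursion, whose shift moves [c] to [c - 1]. *)
Lemma bernstein_mean_sqr n a b c x :
  bernstein_mean n (fun k => a + b * (k%:R - c) ^+ 2) x =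
  a + b * (n%:R * x * (1 - x) + (n%:R * x - c) ^+ 2).
Proof.
elim: n c => [|n ih] c /=; first by ring.
have -> : bernstein_mean n ((fun k => a + b * (k%:R - c) ^+ 2) \o S) x =
    bernstein_mean n (fun k => a + b * (k%:R - (c - 1)) ^+ 2) x.
  by congr (bernstein_mean n _ x); apply/funext => k /=; rewrite -natr1; ring.
rewrite !ih -natr1; ring.
Qed.

(** Uniform continuity in the form that the variance of the binomial law can absorb: small
    oscillation for close arguments, a multiple of the squared distance otherwise. The bound on [h]
    and the radius both come from compactness of the segment. *)
Lemma uniform_continuity_modulus h (M e : R) : 0 < e ->
  (forall x, 0 <= x <= M -> forall d, 0 < d -> exists2 r : R, 0 < r &
     forall y, 0 <= y <= M -> `|y - x| < r -> modulus (h y - h x) < d) ->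
  exists C : R, 0 <= C /\ forall x y, 0 <= x <= M -> 0 <= y <= M ->
    modulus (h y - h x) <= e + C * (y - x) ^+ 2.
Proof.
move=> e0 hc; have nc := (compact_near_coveringP _).1 (segment_compact (a := 0) (b := M)).
have [C [_ hC]] : \forall C \near (+oo : set_system R),
    `[0, M] `<=` [set x | 0 <= x <= M -> forall y, 0 <= y <= M ->
    modulus (h y - h x) <= e + C * (y - x) ^+ 2].
  apply: (@nc) => x0 /=; rewrite in_itv/= => x0M.
  have [r r0 hr] := hc x0 x0M (e / 2) (divr_gt0 e0 (ltr0Sn _ 1)).
  have [B [_ hB]] : \forall B \near (+oo : set_system R),
      `[0, M] `<=` [set x | 0 <= x <= M -> modulus (h x) <= B].
    apply: (@nc) => x1 /=; rewrite in_itv/= => x1M.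
    have [r1 r10 hr1] := hc x1 x1M 1 ltr01.
    exists ([set x | `|x1 - x| < r1], [set b | modulus (h x1) + 1 <= b]) => /=.
      split; first by apply/nbhs_normP; exists r1.
      exact: nbhs_pinfty_ge (num_real _).
    move=> [x b] /= [xr bb] xM; rewrite (le_trans _ bb)//.
    rewrite -lerBlDl (le_trans (ler_norm _))// (le_trans (modulus_dist _ _))// ltW//.
    by apply: hr1 => //; rewrite distrC.
  have {}hB x : 0 <= x <= M -> modulus (h x) <= `|B| + 1.
    by move=> xM; apply: (hB (`|B| + 1)) => //; rewrite ?in_itv// (le_lt_trans (ler_norm _))// ltrDl.
  (* Beyond distance [r / 2] the quadratic term alone reaches [2 (|B| + 1)], twice a bound for
     [h]. *)
  exists ([set x | `|x0 - x| < r / 2], [set c | 2 * (`|B| + 1) / (r / 2) ^+ 2 <= c]) => /=.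
    split; first by apply/nbhs_normP; exists (r / 2) => //=; rewrite divr_gt0.
    exact: nbhs_pinfty_ge (num_real _).
  move=> [x c] /= [xr cc] xM y yM.
  have r20 : 0 < r / 2 by rewrite divr_gt0.
  have c0 : 0 <= c by apply: le_trans cc; apply: divr_ge0; rewrite ?sqr_ge0 ?mulr_ge0 ?addr_ge0//.
  have [yx|yx] := ltP `|y - x| (r / 2).
    rewrite (@le_trans _ _ e)//; last by rewrite lerDl mulr_ge0 ?sqr_ge0.
    rewrite (le_trans (modulus_subD _ _ (h x0)))// [e]splitr lerD//.
      apply/ltW/hr => //; rewrite [r]splitr -(subrKA x) (le_lt_trans (ler_normD _ _))// ltrD//.
      by rewrite distrC.
    rewrite modulusBC; apply/ltW/hr => //; rewrite distrC (lt_trans xr)//.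
    by rewrite ltr_pdivrMr// mulr_natr mulr2n ltrDl.
  rewrite (@le_trans _ _ (2 * (`|B| + 1)))//.
    by rewrite (le_trans (modulusD _ _))// modulusN mulr_natl mulr2n lerD// hB.
  rewrite (@le_trans _ _ (c * (r / 2) ^+ 2))//.
    by rewrite -ler_pdivrMr// exprn_gt0.
  rewrite (@le_trans _ _ (c * (y - x) ^+ 2))//; last by rewrite lerDr ltW.
  rewrite ler_wpM2l// -[leRHS]real_normK ?num_real//.
  by rewrite lerXn2r ?nnegrE// ltW.
exists (`|C| + 1); split; first by rewrite addr_ge0.
move=> x y xM yM; apply: (hC (`|C| + 1)) => //; rewrite /= ?in_itv//.
by rewrite (le_lt_trans (ler_norm _))// ltrDl.
Qed.

Theorem weierstrass_approximation h (M e : R) : 0 <= M -> 0 < e ->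
  {within `[0, M], continuous h} ->
  exists p : {poly R[i]}, forall x, 0 <= x <= M -> modulus (p.[x%:C] - h x) <= e.
Proof.
rewrite le_eqVlt => /orP[/eqP <-|M0] e0 hc.
  exists (h 0)%:P => x /le_anti <-; by rewrite hornerC subrr modulus0 ltW.
have {}hc x : 0 <= x <= M -> forall d, 0 < d -> exists2 r : R, 0 < r &
     forall y, 0 <= y <= M -> `|y - x| < r -> modulus (h y - h x) < d.
  move=> xM d d0; have := (subspace_continuousP _ _).1 hc x.
  rewrite /= in_itv => /(_ xM) /nearC /(_ d d0).
  rewrite /within/= => /nbhs_normP[r r0 hr]; exists r => // y yM yx.
  have bx : ball_ Num.Def.normr x r y by rewrite /ball_ /= distrC.
  have yI : y \in `[0, M] by rewrite in_itv.
  exact: (hr y bx yI).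
have e20 : 0 < e / 2 by rewrite divr_gt0.
have [C [C0 hC]] := uniform_continuity_modulus e20 hc.
(* Chosen so that the variance term, at most [C M^2 / n] since [t (1 - t) <= 1], costs no more than
   [e / 2]. *)
pose n := (Num.truncn (C * M ^+ 2 / (e / 2))).+1.
have n0 : 0 < n%:R :> R by rewrite ltr0n.
have nM : C * M ^+ 2 / n%:R <= e / 2.
  by rewrite ler_pdivrMr// [e / 2 * _]mulrC -ler_pdivrMr//; apply/ltW/truncnS_gt.
exists (bernstein n (fun k => h (M * (k%:R / n%:R))) \Po ((M^-1)%:C *: 'X)).
move=> x /andP[x0 xM]; rewrite horner_comp hornerZ hornerX -realCM.
set t := M^-1 * x.
have xE : x = M * t by rewrite /t mulrA divff ?mul1r// gt_eqF.
have t01 : 0 <= t <= 1.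
  by rewrite /t mulr_ge0 ?invr_ge0 ?(ltW M0)//= mulrC ler_pdivrMr// mul1r.
rewrite -bernstein_sub_cst.
have le k : (k <= n)%N -> modulus (h (M * (k%:R / n%:R)) - h x) <=
   e / 2 + C * M ^+ 2 / n%:R ^+ 2 * (k%:R - n%:R * t) ^+ 2.
  move=> kn; apply: le_trans (hC x _ _ _) _; first by rewrite x0.
    rewrite mulr_ge0 ?divr_ge0 ?(ltW M0)//= ler_piMr ?(ltW M0)//.
    by rewrite ler_pdivrMr// mul1r ler_nat.
  rewrite lerD2l le_eqVlt; apply/orP; left; apply/eqP.
  by rewrite xE; field; rewrite gt_eqF.
apply: (le_trans (bernstein_le t01 le)); rewrite bernstein_mean_sqr subrr expr0n addr0.
rewrite [leRHS]splitr lerD2l (le_trans _ nM)//.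
have -> : C * M ^+ 2 / n%:R ^+ 2 * (n%:R * t * (1 - t)) = C * M ^+ 2 / n%:R * (t * (1 - t)).
  by field; rewrite gt_eqF.
move: t01 => /andP[t0 t1].
apply: ler_piMr; last by rewrite mulr_ile1// ?subr_ge0// gerBl.
by apply: divr_ge0; rewrite ?(ltW n0)// mulr_ge0// sqr_ge0.
Qed.

End weierstrass.

(** * Complex-valued measurable functions and their integrals *)

Section complex_integral.
Context d (T : measurableType d) (R : realType) (mu : {measure set T -> \bar R}).
Implicit Types (D : set T) (F G : T -> R[i]) (a : R[i]) (g : T -> R).

Definition cmeas D F :=
  measurable_fun D (fun x => Re (F x)) /\ measurable_fun D (fun x => Im (F x)).

Definition cinteg D F :=
  mu.-integrable D (EFin \o (fun x => Re (F x))) /\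
  mu.-integrable D (EFin \o (fun x => Im (F x))).

Lemma cmeas_cst D a : cmeas D (fun=> a).
Proof. by split; exact: measurable_cst. Qed.

Lemma cmeas_real D g : measurable_fun D g -> cmeas D (fun x => (g x)%:C).
Proof. by move=> mg; split=> //=; exact: measurable_cst. Qed.

Lemma cmeasD D F G : cmeas D F -> cmeas D G ->
  cmeas D (fun x => F x + G x).
Proof.
move=> [f1 f2] [g1 g2]; split.
  by under eq_fun do rewrite ReD; exact: measurable_funD.
by under eq_fun do rewrite ImD; exact: measurable_funD.
Qed.

Lemma cmeasB D F G : cmeas D F -> cmeas D G ->
  cmeas D (fun x => F x - G x).
Proof.
move=> [f1 f2] [g1 g2]; split.
  by under eq_fun do rewrite ReB; exact: measurable_funB.
by under eq_fun do rewrite ImB; exact: measurable_funB.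
Qed.

Lemma cmeasM D F G : cmeas D F -> cmeas D G ->
  cmeas D (fun x => F x * G x).
Proof.
move=> [f1 f2] [g1 g2]; split.
  by under eq_fun do rewrite ReM; apply: measurable_funB; exact: measurable_funM.
by under eq_fun do rewrite ImM; apply: measurable_funD; exact: measurable_funM.
Qed.

Lemma cmeas_conj D F : cmeas D F -> cmeas D (fun x => (F x)^*).
Proof.
move=> [f1 f2]; split; first by under eq_fun do rewrite Re_conj.
by under eq_fun do rewrite Im_conj; exact: measurableT_comp.
Qed.

Lemma cmeas_sum D (I : Type) (s : seq I) (h : I -> T -> R[i]) :
  (forall i, cmeas D (h i)) -> cmeas D (fun x => \sum_(i <- s) h i x).
Proof.
move=> mh; elim: s => [|i s ih].
  by under eq_fun do rewrite big_nil; exact: cmeas_cst.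
by under eq_fun do rewrite big_cons; exact: cmeasD.
Qed.

Lemma cmeas_cvg D (h : nat -> T -> R[i]) F : measurable D ->
  (forall n, cmeas D (h n)) ->
  (forall x, D x -> h n x @[n --> \oo] --> F x) -> cmeas D F.
Proof.
move=> mD mh hF; split.
  apply: (measurable_fun_cvg (h := fun n x => Re (h n x))) => [n|x Dx].
    by have [] := mh n.
  by have /cvgC_ReIm[] := hF x Dx.
apply: (measurable_fun_cvg (h := fun n x => Im (h n x))) => [n|x Dx].
  by have [] := mh n.
by have /cvgC_ReIm[] := hF x Dx.
Qed.

Lemma meas_modulus2 D F : cmeas D F ->
  measurable_fun D (fun x => modulus (F x) ^+ 2).
Proof.
move=> [f1 f2]; under eq_fun do rewrite modulus_sqr.
by apply: measurable_funD; exact: measurable_funX.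
Qed.

Lemma measurable_modulus D F : cmeas D F ->
  measurable_fun D (fun x => modulus (F x)).
Proof.
move=> /meas_modulus2 mF.
have -> : (fun x => modulus (F x)) = Num.sqrt \o (fun x => modulus (F x) ^+ 2).
  by apply/funext => x /=; rewrite sqrtr_sqr ger0_norm ?modulus_ge0.
apply: (measurableT_comp _ mF); exact: (continuous_measurable_fun (@sqrt_continuous R)).
Qed.

Lemma cinteg_cmeas D F : cinteg D F -> cmeas D F.
Proof. by move=> [/measurable_int/measurable_EFinP ? /measurable_int/measurable_EFinP]. Qed.

Section fixed_domain.
Variables (D : set T) (mD : measurable D).

Lemma cinteg_bound F g : cmeas D F -> mu.-integrable D (EFin \o g) ->
  (forall x, D x -> modulus (F x) <= g x) -> cinteg D F.
Proof.
move=> [f1 f2] ig Fg; split.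
  apply: (le_integrable mD _ _ ig); first exact/measurable_EFinP.
  move=> x Dx /=; rewrite lee_fin (le_trans (Re_le_modulus _))// (le_trans (Fg _ Dx))//.
  exact: ler_norm.
apply: (le_integrable mD _ _ ig); first exact/measurable_EFinP.
move=> x Dx /=; rewrite lee_fin (le_trans (Im_le_modulus _))// (le_trans (Fg _ Dx))//.
exact: ler_norm.
Qed.

Lemma cinteg_modulus F : cinteg D F ->
  mu.-integrable D (EFin \o (fun x => modulus (F x))).
Proof.
move=> iF; have [m1 m2] := cinteg_cmeas iF; case: iF => i1 i2.
have := integrableD mD (integrable_abse i1) (integrable_abse i2).
apply: (le_integrable mD); first exact/measurable_EFinP/measurable_modulus.
move=> x Dx /=; rewrite lee_fin (ger0_norm (modulus_ge0 _)).
by rewrite (le_trans (modulus_ReIm _))// ler_norm.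
Qed.

Lemma cintegD F G : cinteg D F -> cinteg D G ->
  cinteg D (fun x => F x + G x).
Proof.
move=> iF iG; have := integrableD mD (cinteg_modulus iF) (cinteg_modulus iG).
move=> ig; apply: (cinteg_bound (g := fun x => modulus (F x) + modulus (G x))) => //.
  by apply: cmeasD; exact: cinteg_cmeas.
by move=> x _; exact: modulusD.
Qed.

Lemma cintegZ a F : cinteg D F -> cinteg D (fun x => a * F x).
Proof.
move=> iF; have := integrableZl mD (modulus a) (cinteg_modulus iF).
move=> ig; apply: (cinteg_bound (g := fun x => modulus a * modulus (F x))) => //.
  by apply: cmeasM; [exact: cmeas_cst|exact: cinteg_cmeas].
by move=> x _; rewrite modulusM.
Qed.

Lemma CintegralD F G : cinteg D F -> cinteg D G ->
  Cintegral mu D (fun x => F x + G x) = Cintegral mu D F + Cintegral mu D G.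
Proof.
move=> [f1 f2] [g1 g2]; apply: complexP; rewrite ?ReD ?ImD /=.
  by under eq_Rintegral do rewrite ReD; rewrite RintegralD.
by under eq_Rintegral do rewrite ImD; rewrite RintegralD.
Qed.

Lemma CintegralZ a F : cinteg D F ->
  Cintegral mu D (fun x => a * F x) = a * Cintegral mu D F.
Proof.
move=> [f1 f2]; apply: complexP; rewrite ?ReM ?ImM /=.
  under eq_Rintegral do rewrite ReM.
  have := RintegralB mD (integrableZl mD (Re a) f1) (integrableZl mD (Im a) f2).
  by rewrite !RintegralZl.
under eq_Rintegral do rewrite ImM.
have := RintegralD mD (integrableZl mD (Re a) f2) (integrableZl mD (Im a) f1).
by rewrite !RintegralZl.
Qed.

Lemma CintegralB F G : cinteg D F -> cinteg D G ->
  Cintegral mu D (fun x => F x - G x) = Cintegral mu D F - Cintegral mu D G.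
Proof.
move=> [f1 f2] [g1 g2]; apply: complexP; rewrite ?ReB ?ImB /=.
  by under eq_Rintegral do rewrite ReB; rewrite RintegralB.
by under eq_Rintegral do rewrite ImB; rewrite RintegralB.
Qed.

Lemma cinteg0 : cinteg D (fun=> 0).
Proof. by split; exact: integrable0. Qed.

Lemma cinteg_sum (I : Type) (s : seq I) (h : I -> T -> R[i]) :
  (forall i, cinteg D (h i)) -> cinteg D (fun x => \sum_(i <- s) h i x).
Proof.
move=> ih; elim: s => [|i s hs].
  by under [X in cinteg _ X]eq_fun do rewrite big_nil; exact: cinteg0.
by under [X in cinteg _ X]eq_fun do rewrite big_cons; exact: cintegD.
Qed.

Lemma Cintegral0 : Cintegral mu D (fun=> 0) = 0.
Proof. by rewrite /Cintegral /= /Rintegral integral0. Qed.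

Lemma Cintegral_sum (I : Type) (s : seq I) (h : I -> T -> R[i]) :
  (forall i, cinteg D (h i)) ->
  Cintegral mu D (fun x => \sum_(i <- s) h i x) = \sum_(i <- s) Cintegral mu D (h i).
Proof.
move=> ih; elim: s => [|i s hs].
  rewrite big_nil; under [X in Cintegral _ _ X]eq_fun do rewrite big_nil; exact: Cintegral0.
rewrite big_cons -hs -CintegralD//; last exact: cinteg_sum.
by congr (Cintegral _ _ _); apply/funext => x; rewrite big_cons.
Qed.

Lemma le_modulus_Cintegral F : cinteg D F ->
  modulus (Cintegral mu D F) <= (\int[mu]_(x in D) modulus (F x))%R.
Proof.
move=> iF; set z := Cintegral mu D F; set m := modulus z.
have m0 : 0 <= m := modulus_ge0 _.
have [->|mn0] := eqVneq m 0; first by apply: Rintegral_ge0 => x _; exact: modulus_ge0.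
have mp : 0 < m by rewrite lt0r mn0.
have iZ := cintegZ z^* iF.
(* Rotate the integral to the positive real axis. *)
have : m ^+ 2 = (\int[mu]_(x in D) Re (z^* * F x))%R.
  by have /(congr1 Re) := CintegralZ z^* iF; rewrite mulrC mulC_conj /= => ->.
have : (\int[mu]_(x in D) Re (z^* * F x) <= \int[mu]_(x in D) (m * modulus (F x)))%R.
  apply: le_Rintegral => //.
  - by case: iZ.
  - exact: (integrableZl mD m (cinteg_modulus iF)).
  - move=> x _; rewrite (le_trans (ler_norm _))// (le_trans (Re_le_modulus _))//.
    by rewrite modulusM modulus_conj.
rewrite RintegralZl//; last exact: cinteg_modulus.
by move=> h e; move: h; rewrite -e expr2 ler_pM2l.
Qed.

Lemma Cintegral_conj F : cinteg D F ->
  Cintegral mu D (fun x => (F x)^*) = (Cintegral mu D F)^*.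
Proof.
move=> [f1 f2]; apply: complexP; rewrite ?Re_conj ?Im_conj /=.
  by under eq_Rintegral do rewrite Re_conj.
under eq_Rintegral do rewrite Im_conj -mulN1r.
by rewrite RintegralZl// mulN1r.
Qed.

Lemma eq_Cintegral F G : (forall x, D x -> F x = G x) ->
  Cintegral mu D F = Cintegral mu D G.
Proof.
by move=> FG; congr (_ +i* _); apply: eq_Rintegral => x /set_mem /FG ->.
Qed.

Lemma Cintegral_cvg (h : nat -> T -> R[i]) F g : (forall n, cmeas D (h n)) ->
  mu.-integrable D (EFin \o g) ->
  (forall n x, D x -> modulus (h n x) <= g x) ->
  (forall x, D x -> h n x @[n --> \oo] --> F x) ->
  Cintegral mu D (h n) @[n --> \oo] --> Cintegral mu D F.
Proof.
move=> mh ig hg hF.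
have iF : cinteg D F.
  apply: (cinteg_bound _ ig); first exact: cmeas_cvg hF.
  move=> x Dx; apply: (ler_cvg_to (cvgC_modulus (hF x Dx)) (cvg_cst (g x))).
  by apply: nearW => n; exact: hg.
have ih n : cinteg D (h n) by apply: (cinteg_bound _ ig); last exact: hg.
case: iF => iF1 iF2; apply/cvgC_ReIm; split=> /=.
  apply: fine_cvg; rewrite fineK; last exact: (integrable_fin_num mD iF1).
  apply: (dominated_cvg (g := EFin \o g) mD) => //.
  - by move=> n; have [] := mh n; move=> /measurable_EFinP.
  - move=> x Dx; have /cvgC_ReIm[h1 _] := hF x Dx.
    by apply/fine_cvgP; split; [exact: nearW|exact: h1].
  - by move=> n x Dx /=; rewrite lee_fin (le_trans (Re_le_modulus _))// hg.
apply: fine_cvg; rewrite fineK; last exact: (integrable_fin_num mD iF2).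
apply: (dominated_cvg (g := EFin \o g) mD) => //.
- by move=> n; have [_] := mh n; move=> /measurable_EFinP.
- move=> x Dx; have /cvgC_ReIm[_ h1] := hF x Dx.
  by apply/fine_cvgP; split; [exact: nearW|exact: h1].
- by move=> n x Dx /=; rewrite lee_fin (le_trans (Im_le_modulus _))// hg.
Qed.

End fixed_domain.
End complex_integral.

(** * Complex differentiation *)

Section complex_derivative.
Context (R : realType).
Implicit Types (z w d : R[i]) (u v q : R[i] -> R[i]) (e r : R).

Lemma nbhsC z (P : set R[i]) :
  nbhs z P <-> exists2 r : R, 0 < r & forall w, modulus (w - z) < r -> P w.
Proof.
split=> [/nbhs_normP[r /= r0 hr]|[r r0 hr]].
  have rR : r = (Re r)%:C.
    by move: r0; rewrite ltcE /= => /andP[/eqP + _]; case: r {hr} => a b /= ->.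
  exists (Re r); first by move: r0; rewrite rR ltcR.
  by move=> w wz; apply: hr; rewrite /ball_ /= normE modulusBC rR ltcR.
apply/nbhs_normP; exists r%:C; first by rewrite /= ltcR.
by move=> w; rewrite /ball_ /= normE ltcR modulusBC; exact: hr.
Qed.

Definition cnbhs z : set_system R[i] :=
  [set P | exists2 r : R, 0 < r & forall w, modulus (w - z) < r -> P w].

Global Instance cnbhs_filter z : Filter (cnbhs z).
Proof.
split=> [|P Q [r r0 hr] [t t0 ht]|P Q PQ [r r0 hr]]; first by exists 1.
  exists (Num.min r t); first by rewrite lt_min r0.
  by move=> w; rewrite lt_min => /andP[wr wt]; split; [exact: hr|exact: ht].
by exists r => // w /hr /PQ.
Qed.

(* A sealed definition, since unfolding it makes unification diverge. *)
Variant ccont u z : Prop := CCont of u w @[w --> cnbhs z] --> u z.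

Lemma ccontP u z : ccont u z <-> forall e, 0 < e -> exists2 r, 0 < r &
  forall w, modulus (w - z) < r -> modulus (u w - u z) < e.
Proof. by split=> [[/nearC]//|h]; split; apply/nearC. Qed.

Lemma ccont_cst z w : ccont (fun=> w) z.
Proof. by split; exact: (@cvgC_cst R _ (cnbhs z)). Qed.

Lemma ccont_id z : ccont id z. Proof. by apply/ccontP => e e0; exists e. Qed.

Lemma ccont_comp u v z : ccont v z -> ccont u (v z) -> ccont (u \o v) z.
Proof.
move=> /ccontP cv /ccontP cu; apply/ccontP => e /cu[r /cv[t t0 ht] hr].
by exists t => // w /ht /hr.
Qed.

Lemma ccontD u v z : ccont u z -> ccont v z -> ccont (fun w => u w + v w) z.
Proof. by move=> [cu] [cv]; split; exact: cvgCD. Qed.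

Lemma ccontM u v z : ccont u z -> ccont v z -> ccont (fun w => u w * v w) z.
Proof. by move=> [cu] [cv]; split; exact: cvgCM. Qed.

Lemma ccontX u z n : ccont u z -> ccont (fun w => u w ^+ n) z.
Proof.
move=> cu; elim: n => [|n ih]; first exact: ccont_cst.
have -> : (fun w => u w ^+ n.+1) = (fun w => u w * u w ^+ n).
  by apply/funext => w; rewrite exprS.
exact: ccontM.
Qed.

(* Caratheodory's form of complex differentiability. *)
Definition cder u z d :=
  exists q, [/\ forall w, u w - u z = q w * (w - z), q z = d & ccont q z].

(** The factorization only has to be known near [z]: elsewhere the difference quotient takes over,
    as [cder] asks for a global factor. *)
Lemma cder_near u z d q : (exists2 r : R, 0 < r & forall w, modulus (w - z) < r -> u w - u z = q w * (w - z)) ->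
  q z = d -> ccont q z -> cder u z d.
Proof.
move=> [r r0 hr] qz qc.
pose q' w := if w == z then d else (u w - u z) / (w - z).
have q'z : q' z = d by rewrite /q' eqxx.
exists q'; split=> // [w|].
  rewrite /q'; case: eqVneq => [->|wz]; first by rewrite !subrr mulr0.
  by rewrite divfK// subr_eq0.
apply/ccontP => e e0; move/ccontP : qc => /(_ e e0)[r1 r10 h1].
exists (Num.min r r1); first by rewrite lt_min r0.
move=> w; rewrite lt_min => /andP[wr wr1]; rewrite q'z /q'.
case: eqVneq => [_|wz]; first by rewrite subrr modulus0.
by rewrite hr// mulfK ?subr_eq0// -qz h1.
Qed.

Lemma cder_derivable u z d : cder u z d -> derivable u z 1.
Proof.
move=> [q [hq qz qc]]; apply/cvg_ex; exists d; apply/nearC => e e0.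
move/ccontP : qc => /(_ e e0)[r r0 hr].
rewrite near_withinE; apply/nbhsC; exists r => // h; rewrite subr0 => hr' h0.
rewrite hq /= addrK [h *: 1]mulr1 [_ *: _]mulrC mulfK//.
by rewrite -qz hr// addrK.
Qed.

Lemma derivable_cder u z : derivable u z 1 -> exists d, cder u z d.
Proof.
move=> /cvg_ex[d /nearC h]; exists d.
pose q w := if w == z then d else (u w - u z) / (w - z).
have qz : q z = d by rewrite /q eqxx.
exists q; split=> // [w|].
  rewrite /q; case: eqVneq => [->|wz]; first by rewrite !subrr mulr0.
  by rewrite divfK// subr_eq0.
apply/ccontP => e e0; have /h := e0; rewrite near_withinE => /nbhsC[r r0 hr].
exists r => // w wr; rewrite qz /q; case: eqVneq => [_|wz].
  by rewrite subrr modulus0.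
have := hr (w - z); rewrite subr0 => /(_ wr); rewrite subr_eq0 => /(_ wz).
rewrite /= [_ *: 1]mulr1 [_ *: _]mulrC subrK; exact.
Qed.

Lemma cder_ccont u z d : cder u z d -> ccont u z.
Proof.
move=> [q [hq qz qc]].
have -> : u = (fun w => u z + q w * (w - z)).
  by apply/funext => w; rewrite -hq addrC subrK.
apply: ccontD; first exact: ccont_cst.
apply: ccontM => //; apply: ccontD; [exact: ccont_id|exact: ccont_cst].
Qed.

Lemma cder_cst z w : cder (fun=> w) z 0.
Proof.
exists (fun=> 0); split=> //; last exact: ccont_cst.
by move=> ?; rewrite subrr mul0r.
Qed.

Lemma cder_id z : cder id z 1.
Proof. by exists (fun=> 1); split=> //; [move=> ?; rewrite mul1r|exact: ccont_cst]. Qed.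

Lemma cderD u v z d1 d2 : cder u z d1 -> cder v z d2 ->
  cder (fun w => u w + v w) z (d1 + d2).
Proof.
move=> [q1 [h1 <- c1]] [q2 [h2 <- c2]]; exists (fun w => q1 w + q2 w); split=> //.
  by move=> w; rewrite mulrDl -h1 -h2; ring.
exact: ccontD.
Qed.

Lemma cderM u v z d1 d2 : cder u z d1 -> cder v z d2 ->
  cder (fun w => u w * v w) z (d1 * v z + u z * d2).
Proof.
move=> D1 D2; have cv := cder_ccont D2; move: D1 D2.
move=> [q1 [h1 <- c1]] [q2 [h2 <- c2]]; exists (fun w => q1 w * v w + u z * q2 w); split=> //.
  by move=> w; rewrite mulrDl mulrAC -h1 -mulrA -h2; ring.
by apply: ccontD; apply: ccontM => //; exact: ccont_cst.
Qed.

Lemma cderZ a v z d : cder v z d -> cder (fun w => a * v w) z (a * d).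
Proof. by move=> h; have := cderM (cder_cst z a) h; rewrite mul0r add0r. Qed.

Lemma cderB u v z d1 d2 : cder u z d1 -> cder v z d2 ->
  cder (fun w => u w - v w) z (d1 - d2).
Proof.
move=> D1 /(cderZ (-1)); rewrite mulN1r => D2; have := cderD D1 D2.
by under eq_fun do rewrite mulN1r.
Qed.

Lemma cder_comp u v z d1 d2 : cder v z d2 -> cder u (v z) d1 ->
  cder (u \o v) z (d1 * d2).
Proof.
move=> D2; have cv := cder_ccont D2; case: D2 => q2 [h2 <- c2] [q1 [h1 <- c1]].
exists (fun w => q1 (v w) * q2 w); split=> //.
  by move=> w /=; rewrite h1 h2 mulrA.
by apply: ccontM => //; exact: (ccont_comp cv c1).
Qed.

Lemma cderV z : z != 0 -> cder (fun w => w^-1) z (- (z^-1 ^+ 2)).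
Proof.
move=> z0; apply: (@cder_near _ _ _ (fun w => - (w^-1 * z^-1))) => //.
- exists (modulus z); first by rewrite modulus_gt0.
  move=> w; have [->|w0 _] := eqVneq w 0; first by rewrite sub0r modulusN ltxx.
  by field; rewrite z0 w0.
- apply/ccontP => e e0; set m := modulus z.
  have m0 : 0 < m by rewrite modulus_gt0.
  (* Within [m / 2] of [z] one has [|w| > m / 2], so the error [|w - z| / (|w| m^2)] is below
     [2 |w - z| / m^3]. *)
  exists (Num.min (m / 2) (e * (m ^+ 3 / 2))).
    by rewrite lt_min divr_gt0//= mulr_gt0// divr_gt0// exprn_gt0.
  move=> w; rewrite lt_min => /andP[w1 w2].
  have wm : m / 2 < modulus w.
    have := modulusD (z - w) w; rewrite subrK modulusBC -/m; lra.
  have w0 : w != 0 by rewrite -modulus_gt0 (lt_trans _ wm)// divr_gt0.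
  have -> : - (w^-1 / z) - - (z^-1 / z) = (w - z) * (w^-1 * z^-1 ^+ 2).
    by field; rewrite z0 w0.
  rewrite !modulusM !modulusV -/m -expr2.
  have -> : e = e * (m ^+ 3 / 2) * ((m / 2)^-1 * m^-1 ^+ 2) by field; rewrite gt_eqF.
  apply: (@le_lt_trans _ _ (modulus (w - z) * ((m / 2)^-1 * m^-1 ^+ 2))).
    rewrite ler_wpM2l ?modulus_ge0// ler_wpM2r ?sqr_ge0// lef_pV2 ?posrE ?divr_gt0//.
      exact: ltW.
    by rewrite (lt_trans _ wm)// divr_gt0.
  by rewrite ltr_pM2r// mulr_gt0// ?exprn_gt0// invr_gt0// divr_gt0.
Qed.

Lemma cder_div u v z d1 d2 : v z != 0 -> cder u z d1 -> cder v z d2 ->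
  exists d, cder (fun w => u w / v w) z d.
Proof.
move=> v0 D1 D2; have D3 := cder_comp D2 (cderV v0).
by eexists; exact: (cderM D1 D3).
Qed.

Lemma cderX u z d n : cder u z d -> exists d', cder (fun w => u w ^+ n) z d'.
Proof.
move=> D; elim: n => [|n [d' ih]]; first by exists 0; exact: cder_cst.
by eexists; have := cderM D ih; under eq_fun do rewrite -exprS; exact.
Qed.

Lemma cder_local u v z d : (exists2 r : R, 0 < r & forall w, modulus (w - z) < r -> u w = v w) -> cder u z d -> cder v z d.
Proof.
move=> [r r0 uv] [q [hq qz qc]]; apply: (cder_near _ qz qc).
exists r => // w wr; rewrite -!uv//.
by rewrite subrr modulus0.
Qed.

End complex_derivative.

(** * Power series on the disc *)

Section complex_series.
Context (R : realType).
Implicit Types (z w : R[i]) (u : R[i] -> R[i]) (a f : nat -> R[i]) (M : nat -> R) (x y : R).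

(** The M-test. The bound on the tail depends on [M] alone, hence is uniform in any parameter of
    [f]. *)
Lemma series_normal_cvg f M : (forall n, modulus (f n) <= M n) -> cvgn (series M) ->
  exists2 l : R[i], series f n @[n --> \oo] --> l &
    forall N, modulus (l - series f N) <= limn (series M) - series M N.
Proof.
move=> fM cM; have M0 n : 0 <= M n by exact: le_trans (modulus_ge0 _) (fM n).
have nd : nondecreasing_seq (series M).
  by apply/nondecreasing_seqP => n; rewrite seriesSr lerDl.
have dist m n : (m <= n)%N -> modulus (series f n - series f m) <= series M n - series M m.
  move=> mn; rewrite -(subnKC mn); elim: (n - m)%N => [|k ih].
    by rewrite addn0 !subrr modulus0.
  rewrite addnS !seriesSr addrAC [leRHS]addrAC (le_trans (modulusD _ _))// lerD//.
have le n : series M n <= limn (series M) by exact: nondecreasing_cvgn_le.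
have [l hl] : exists l : R[i], series f n @[n --> \oo] --> l.
  apply: cauchy_complex => e e0; have /cvgrPdist_le/(_ e e0)[N _ hN] := cM.
  exists N => m n Nm Nn; wlog mn : m n Nm Nn / (n <= m)%N.
    by move=> W; case: (leqP n m) => [|/ltnW] mn; [|rewrite modulusBC]; apply: W.
  rewrite (le_trans (dist _ _ mn))//; apply: le_trans (hN n Nn).
  by rewrite (le_trans _ (ler_norm _))// lerD2r.
exists l => // N; have h : modulus (series f n - series f N) @[n --> \oo] --> modulus (l - series f N).
  exact: (cvgC_modulus (cvgCB hl (@cvgC_cst _ _ \oo _ _))).
apply: (ler_cvg_to h (cvg_cst _)); exists N => // n /= Nn.
by rewrite (le_trans (dist _ _ Nn))// lerD2r.
Qed.

Lemma ccont_series (f : nat -> R[i] -> R[i]) M (u : R[i] -> R[i]) z (r : R) : 0 < r ->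
  (forall n, ccont (f n) z) -> cvgn (series M) ->
  (forall n w, modulus (w - z) < r -> modulus (f n w) <= M n) ->
  (forall w, modulus (w - z) < r -> series (f ^~ w) n @[n --> \oo] --> u w) ->
  ccont u z.
Proof.
move=> r0 cf cM fM fu; apply/ccontP => e e0.
have e30 : 0 < e / 3 by rewrite divr_gt0.
have /cvgrPdist_lt/(_ _ e30)[N _ hN] := cM.
have tail w : modulus (w - z) < r -> modulus (u w - series (f ^~ w) N) < e / 3.
  move=> wr; have [l hl hb] := series_normal_cvg (fun n => fM n w wr) cM.
  rewrite -(cvgC_unique hl (fu w wr)) (le_lt_trans (hb N))//.
  by rewrite (le_lt_trans (ler_norm _))// hN /=.
have /ccontP/(_ _ e30)[t t0 ht] : ccont (fun w => series (f ^~ w) N) z.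
  elim: N {hN tail} => [|N ih]; first by rewrite /series /=; under eq_fun do rewrite big_geq//; exact: ccont_cst.
  by under [X in ccont X]eq_fun do rewrite seriesSr; exact: ccontD.
exists (Num.min r t); first by rewrite lt_min r0.
move=> w; rewrite lt_min => /andP[wr wt].
have zr : modulus (z - z) < r by rewrite subrr modulus0.
apply: (le_lt_trans (modulus_subD _ _ (series (f ^~ w) N))).
have := modulus_subD (u z) (series (f ^~ w) N) (series (f ^~ z) N).
have := tail _ zr; rewrite [X in X < _]modulusBC.
have := tail _ wr; have := ht _ wt; lra.
Qed.

Definition has_pseries a u := forall z, disc z ->
  series (fun n => a n * z ^+ n) n @[n --> \oo] --> u z.

Definition summable_coefs a := forall x, 0 <= x < 1 ->
  cvgn (series (fun n => modulus (a n) * x ^+ n)).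

(** Abel's lemma: boundedness at [y] gives summability at a smaller [x]. With [t^2 = x / y], one
    factor [t^n] absorbs [n.+1] and the other leaves a geometric series. *)
Lemma bounded_geometric_cvg M x y K : (forall n, 0 <= M n) ->
  (forall n, M n * y ^+ n <= K) -> 0 <= x < y ->
  cvgn (series (fun n => n.+1%:R * M n * x ^+ n)).
Proof.
move=> M0 hK /andP[x0 xy]; have y0 : 0 < y by exact: le_lt_trans xy.
pose t := Num.sqrt (x / y).
have xy1 : x / y < 1 by rewrite ltr_pdivrMr// mul1r.
have t0 : 0 <= t by exact: sqrtr_ge0.
have t1 : t < 1 by rewrite -sqrtr1 ltr_sqrt.
have tt : t ^+ 2 = x / y by rewrite sqr_sqrtr// divr_ge0// ltW.
have s1 : 0 < 1 - t by rewrite subr_gt0.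
(* Bernoulli: n.+1 * t ^ n is bounded by 1 / (1 - t). *)
have bern n : n.+1%:R * t ^+ n <= (1 - t)^-1.
  rewrite -[leRHS]mul1r ler_pdivlMr//.
  suff : n.+1%:R * t ^+ n * (1 - t) <= 1 - t ^+ n.+1.
    by move/le_trans; apply; rewrite gerBl exprn_ge0.
  elim: n => [|n ih]; first by rewrite expr0 expr1 !mul1r.
  have tn : 0 <= t ^+ n by rewrite exprn_ge0.
  have tn1 : t ^+ n.+1 <= t ^+ n by rewrite exprS ler_piMl// ltW.
  have : (n.+1%:R * t ^+ n * (1 - t)) * t <= (1 - t ^+ n.+1) * t by rewrite ler_wpM2r.
  have p : 0 <= (1 - t) * (1 - t ^+ n.+1).
    by rewrite mulr_ge0 ?subr_ge0 ?(ltW t1)// exprn_ile1// ltW.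
  move: p; rewrite -[n.+2%:R]natr1 ![t ^+ n.+2]exprS ![t ^+ n.+1]exprS; nra.
have K0 : 0 <= K by apply: le_trans (hK 0%N); rewrite mulr_ge0.
apply: (series_le_cvg (v_ := fun n => (K / (1 - t)) * t ^+ n)).
- by move=> n; rewrite !mulr_ge0 ?exprn_ge0.
- by move=> n; rewrite mulr_ge0 ?exprn_ge0// divr_ge0// ltW.
- move=> n; have -> : x ^+ n = y ^+ n * t ^+ n * t ^+ n.
    by rewrite -mulrA -exprD addnn -mul2n exprM tt -exprMn mulrCA divff ?mulr1// gt_eqF.
  have -> : n.+1%:R * M n * (y ^+ n * t ^+ n * t ^+ n) = (M n * y ^+ n) * (n.+1%:R * t ^+ n) * t ^+ n by ring.
  by rewrite ler_wpM2r ?exprn_ge0// ler_pM// ?mulr_ge0 ?exprn_ge0// ltW.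
- by apply: is_cvg_geometric_series; rewrite ger0_norm.
Qed.

Lemma cvg_series_bounded M : cvgn (series M) -> exists K, forall n, `|M n| <= K.
Proof.
move=> /cvg_series_cvg_0 /cvgP /cvg_seq_bounded [K [_ hK]].
by exists (K + 1) => n; apply: (hK (K + 1)) => //; rewrite ltrDl.
Qed.

Lemma power_series_term_bounded a u x : has_pseries a u -> 0 <= x < 1 ->
  exists K, forall n, modulus (a n) * x ^+ n <= K.
Proof.
move=> au /andP[x0 x1]; have xd : disc (x%:C : R[i]) by rewrite /disc /mkset modulusR ger0_norm.
have h := au _ xd.
have h1 : series (fun n => a n * x%:C ^+ n) n.+1 @[n --> \oo] --> u x%:C.
  by move/nearC : h => h; apply/nearC => e /h [N _ hN]; exists N => // n Nn; apply: hN; exact: leqW.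
have h0 : modulus (a n * x%:C ^+ n) @[n --> \oo] --> (0 : R).
  rewrite -(@modulus0 R) -[0](subrr (u x%:C)).
  have -> : (fun n => modulus (a n * x%:C ^+ n)) = (fun n => modulus
      (series (fun n => a n * x%:C ^+ n) n.+1 - series (fun n => a n * x%:C ^+ n) n)).
    by apply/funext => n; rewrite seriesSr addrAC subrr add0r.
  exact: (cvgC_modulus (cvgCB h1 h)).
have /cvgP /cvg_seq_bounded [K [_ hK]] := h0.
exists (K + 1) => n; rewrite -[x]ger0_norm// -modulusR -modulusX -modulusM.
by rewrite -[leLHS]ger0_norm ?modulus_ge0//; apply: (hK (K + 1)) => //; rewrite ltrDl.
Qed.

Lemma power_series_summable a u x : has_pseries a u -> 0 <= x < 1 ->
  cvgn (series (fun n => n.+1%:R * modulus (a n) * x ^+ n)).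
Proof.
move=> au /andP[x0 x1]; pose y := (x + 1) / 2.
have y01 : 0 <= y < 1 by rewrite /y; lra.
have [K hK] := power_series_term_bounded au y01.
apply: (bounded_geometric_cvg _ hK) => [n|]; first exact: modulus_ge0.
by rewrite x0/= /y; lra.
Qed.

Lemma power_series_abs_summable a u : has_pseries a u -> summable_coefs a.
Proof.
move=> au x x01; have := power_series_summable au x01.
have [x0 _] := andP x01.
apply: series_le_cvg => n; rewrite ?mulr_ge0 ?exprn_ge0 ?modulus_ge0//.
by rewrite -mulrA ler_peMl ?mulr_ge0 ?exprn_ge0 ?modulus_ge0// ler1n.
Qed.

Lemma summable_has_pseries a : summable_coefs a -> exists u, has_pseries a u.
Proof.
move=> sa; have h z : exists l : R[i], disc z -> series (fun n => a n * z ^+ n) n @[n --> \oo] --> l.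
  have [zd|] := pselect (disc z); last by exists 0.
  have zx : 0 <= modulus z < 1 by rewrite modulus_ge0.
  have fm n : modulus (a n * z ^+ n) <= modulus (a n) * modulus z ^+ n.
    by rewrite modulusM modulusX.
  have [l hl _] := series_normal_cvg fm (sa _ zx).
  by exists l.
by have [u hu] := choice h; exists u.
Qed.

(** The difference quotient [(u w - u z) / (w - z)] is itself the sum of a series, with terms [a n]
    times [w^(n-1) + ... + z^(n-1)]; normal convergence near [z] makes it continuous there, which is
    Caratheodory's criterion. *)
Lemma power_series_cder a u z : has_pseries a u -> disc z -> exists d, cder u z d.
Proof.
move=> au zd; pose rho := (modulus z + 1) / 2.
have zd' : modulus z < 1 by []; have z0 := modulus_ge0 z.
have rho0 : 0 < rho by rewrite /rho; lra.
have rho1 : rho < 1 by rewrite /rho; lra.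
have r0 : 0 < rho - modulus z by rewrite /rho; lra.
have wrho w : modulus (w - z) < rho - modulus z -> modulus w < rho.
  by move=> h; have := modulusD (w - z) z; rewrite subrK; lra.
pose f n w : R[i] := a n * \sum_(k < n) w ^+ (n.-1 - k) * z ^+ k.
(* Bounds the [n] products [w^(n-1-k) z^k], each at most [rho^(n-1)]; the factor [n.+1] in place of
   [n] is that of [power_series_summable]. *)
pose M n := n.+1%:R * modulus (a n) * rho ^+ n / rho.
have cM : cvgn (series M).
  have -> : M = (fun n => rho^-1 * (n.+1%:R * modulus (a n) * rho ^+ n)).
    by apply/funext => n; rewrite /M mulrC.
  have rr : 0 <= rho < 1 by rewrite (ltW rho0).
  exact: (is_cvg_seriesZ (power_series_summable au rr)).
have fM n w : modulus (w - z) < rho - modulus z -> modulus (f n w) <= M n.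
  move=> /wrho wr; have -> : M n = modulus (a n) * (n.+1%:R * rho ^+ n / rho) by rewrite /M; ring.
  rewrite /f modulusM ler_wpM2l ?modulus_ge0//; case: n => [|n]; first by rewrite big_ord0 modulus0 expr0 mulr1 mul1r invr_ge0 ltW.
  rewrite (le_trans (modulus_sum _ _ _))//.
  apply: (@le_trans _ _ (\sum_(k < n.+1) rho ^+ n)).
    apply: ler_sum => k _; rewrite modulusM !modulusX /=.
    have -> : rho ^+ n = rho ^+ (n - k) * rho ^+ k by rewrite -exprD subnK// -ltnS.
    have zr : modulus z <= rho by rewrite /rho; lra.
    by rewrite ler_pM ?exprn_ge0 ?modulus_ge0// lerXn2r ?nnegrE ?modulus_ge0// ltW.
  rewrite sumr_const card_ord exprSr mulrA mulfK ?gt_eqF// -[leLHS]mulr_natl.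
  by rewrite ler_wpM2r ?exprn_ge0 ?(ltW rho0)// ler_nat.
have ex w : exists l : R[i], modulus (w - z) < rho - modulus z -> series (f ^~ w) n @[n --> \oo] --> l.
  have [wr|] := pselect (modulus (w - z) < rho - modulus z); last by exists 0.
  have [l hl _] := series_normal_cvg (fun n => fM n w wr) cM.
  by exists l.
have [q hq] := choice ex; exists (q z); apply: (@cder_near _ _ _ _ q) => //.
  exists (rho - modulus z) => // w wr.
  have wd : disc w by rewrite /disc /mkset (lt_trans (wrho _ wr)).
  apply: (cvgC_unique (cvgCB (au _ wd) (au _ zd))).
  have h : series (f ^~ w) n * (w - z) @[n --> \oo] --> q w * (w - z).
    exact: (cvgCM (hq w wr) (@cvgC_cst R _ \oo _ (w - z))).
  have -> : (fun n => series (fun n => a n * w ^+ n) n - series (fun n => a n * z ^+ n) n) =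
      (fun n => series (f ^~ w) n * (w - z)); last exact: h.
  apply/funext => n; rewrite /series /= mulr_suml -sumrB; apply: eq_bigr => k _.
  by rewrite -mulrBr subrXX /f -mulrA; congr (_ * _); rewrite mulrC.
apply: (ccont_series r0 _ cM fM) => // n; rewrite /f.
apply: ccontM; first exact: ccont_cst.
suff : forall m, ccont (fun w => \sum_(k < n) w ^+ (m - k) * z ^+ k) z by exact.
move=> m; elim: n => [|n ih].
  by under [X in ccont X]eq_fun do rewrite big_ord0; exact: ccont_cst.
under [X in ccont X]eq_fun do rewrite big_ord_recr /=.
apply: ccontD => //; apply: ccontM; last exact: ccont_cst.
exact/ccontX/ccont_id.
Qed.

Lemma disc0 : disc (0 : R[i]). Proof. by rewrite /disc /mkset modulus0. Qed.

Lemma power_series_at0 a u : has_pseries a u -> u 0 = a 0%N.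
Proof.
move=> /(_ _ disc0) /cvgC_unique; apply; apply/nearC => e e0.
exists 1%N => // -[//|n] _; rewrite /series /= big_nat_recl//= expr0 mulr1 big1 ?addr0 ?subrr ?modulus0// => i _.
by rewrite expr0n mulr0.
Qed.

Lemma power_series_shift a u m : has_pseries a u ->
  exists2 g, has_pseries (fun j => a (m + j)%N) g &
    forall z, disc z -> u z - \sum_(j < m) a j * z ^+ j = z ^+ m * g z.
Proof.
move=> au; elim: m => [|m [g hg E]].
  by exists u => // z _; rewrite big_ord0 subr0 mul1r.
have [g' hg'] : exists g', has_pseries (fun j => a (m.+1 + j)%N) g'.
  apply: summable_has_pseries => x /andP[x0 x1].
  pose y := (x + 1) / 2; have y01 : 0 <= y < 1 by rewrite /y; lra.
  have [K hK] := power_series_term_bounded au y01.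
  have y0 : 0 < y by rewrite /y; lra.
  have hK' n : modulus (a (m.+1 + n)%N) * y ^+ n <= K / y ^+ m.+1.
    by rewrite ler_pdivlMr ?exprn_gt0// -mulrA -exprD addnC hK.
  have xy : 0 <= x < y by rewrite x0/= /y; lra.
  have := bounded_geometric_cvg (fun n => modulus_ge0 _) hK' xy.
  apply: series_le_cvg => n; rewrite ?mulr_ge0 ?exprn_ge0 ?modulus_ge0//.
  by rewrite -mulrA ler_peMl ?mulr_ge0 ?exprn_ge0 ?modulus_ge0// ler1n.
exists g' => // z zd; rewrite big_ord_recr /= opprD addrA E// exprSr -mulrA.
rewrite [a m * _]mulrC -mulrBr; congr (_ * _).
apply: (cvgC_unique (cvgCB (hg z zd) (@cvgC_cst _ _ \oo _ (a m)))).
have h : z * series (fun n => a (m.+1 + n)%N * z ^+ n) n @[n --> \oo] --> z * g' z.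
  exact: (cvgCM (@cvgC_cst _ _ \oo _ z) (hg' z zd)).
apply/nearC => e e0; move/nearC : h => /(_ e e0) [N _ hN].
exists N.+1 => // -[//|n] /= Nn; have := hN n Nn; congr (modulus (_ - _) < _).
rewrite /series /= big_nat_recl//= addn0 expr0 mulr1 addrAC subrr add0r mulr_sumr.
by apply: eq_bigr => i _; rewrite addnS addSn mulrCA exprS.
Qed.

(** Taylor remainders divided by [z^m], along the points [1 / (k + 2)]. An explicit sequential limit
    gives uniqueness of the coefficients and, for functions that depend on a parameter, their
    measurability. *)
Lemma power_series_coef_limit a u m : has_pseries a u ->
  (k.+2%:R ^+ m * (u k.+2%:R^-1 - \sum_(j < m) a j * k.+2%:R^-1 ^+ j) : R[i])
    @[k --> \oo] --> a m.
Proof.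
move=> /(power_series_shift m)[g hg E].
have dk k : disc (k.+2%:R^-1 : R[i]).
  by rewrite /disc /mkset modulusV modulus_nat invf_lt1// ltr1n.
have -> : (fun k => k.+2%:R ^+ m * (u k.+2%:R^-1 - \sum_(j < m) a j * k.+2%:R^-1 ^+ j) : R[i])
    = (fun k => g k.+2%:R^-1).
  by apply/funext => k; rewrite E// exprVn mulVKf// expf_neq0// pnatr_eq0.
have [d /cder_ccont /ccontP gc] := power_series_cder hg disc0.
have <- : g 0 = a m by rewrite (power_series_at0 hg) addn0.
apply/nearC => e /gc[r r0 hr].
have /cvgrPdist_lt/(_ _ r0)[N _ hN] := @cvg_harmonic R; exists N => // n /= Nn.
apply: hr; rewrite subr0 modulusV modulus_nat; have := hN n.+1 (leqW Nn).
by rewrite sub0r normrN ger0_norm// invr_ge0.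
Qed.

Lemma power_series_unique a b u : has_pseries a u -> has_pseries b u -> a = b.
Proof.
move=> ha hb; apply/funext => m; elim/ltn_ind: m => m ih.
have h1 := power_series_coef_limit (m := m) ha; have h2 := power_series_coef_limit (m := m) hb.
have E : (fun k => k.+2%:R ^+ m * (u k.+2%:R^-1 - \sum_(j < m) a j * k.+2%:R^-1 ^+ j) : R[i]) =
   (fun k => k.+2%:R ^+ m * (u k.+2%:R^-1 - \sum_(j < m) b j * k.+2%:R^-1 ^+ j)).
  by apply/funext => k; congr (_ * (_ - _)); apply: eq_bigr => j _; rewrite ih.
by rewrite E in h1; exact: (cvgC_unique h1 h2).
Qed.

Lemma power_series_coefE a u : has_pseries a u -> power_series_coef u = a.
Proof.
move=> au; have : has_pseries (power_series_coef u) u.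
  by rewrite /power_series_coef; apply: (@xgetPex _ _ [set a | has_pseries a u]); exists a.
by move=> /power_series_unique; apply.
Qed.

End complex_series.

(** * Exponential, principal logarithm and principal powers *)

Section complex_exponential.
Context (R : realType).
Implicit Types (z w d : R[i]) (u : R[i] -> R[i]) (e r x t : R).

Lemma cder_epsP u z d : cder u z d <-> forall e, 0 < e -> exists2 r, 0 < r &
  forall w, modulus (w - z) < r -> modulus (u w - u z - d * (w - z)) <= e * modulus (w - z).
Proof.
split=> [[q [hq <- /ccontP qc]] e e0|h].
  have [r r0 hr] := qc e e0; exists r => // w wr.
  by rewrite hq -mulrBl modulusM ler_wpM2r ?modulus_ge0// ltW// hr.
pose q w := if w == z then d else (u w - u z) / (w - z).
have qz : q z = d by rewrite /q eqxx.
exists q; split=> // [w|].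
  rewrite /q; case: eqVneq => [->|wz]; first by rewrite !subrr mulr0.
  by rewrite divfK// subr_eq0.
apply/ccontP => e e0; have e20 : 0 < e / 2 by rewrite divr_gt0.
have [r r0 hr] := h _ e20; exists r => // w wr; rewrite qz /q.
case: eqVneq => [_|wz]; first by rewrite subrr modulus0.
have m0 : 0 < modulus (w - z) by rewrite modulus_gt0 subr_eq0.
rewrite -(ltr_pM2r m0) -modulusM mulrBl divfK ?subr_eq0//.
by rewrite (le_lt_trans (hr _ wr))// ltr_pM2r// ltr_pdivrMr// mulr_natr mulr2n ltrDl.
Qed.

Lemma is_derive_eps (f : R -> R) x (d e : R) : is_derive x 1 f d -> 0 < e ->
  exists2 r, 0 < r & forall t, `|t| < r -> `|f (x + t) - f x - d * t| <= e * `|t|.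
Proof.
move=> [df <-] e0; have : h^-1 *: ((f \o shift x) h%:A - f x) @[h --> (0 : R)^'] --> 'D_1 f x.
  exact: df.
move=> /cvgrPdist_lt /(_ e e0); rewrite near_withinE => /nbhs_normP[r r0 hr].
exists r => // t tr; have [->|t0] := eqVneq t 0.
  by rewrite addr0 subrr mulr0 subr0 normr0 mulr0.
have b : ball_ Num.Def.normr 0 r t by rewrite /ball_ /= sub0r normrN.
have := hr t b t0; set D := 'D_1 f x => /= /ltW h.
have tp : 0 < `|t| by rewrite normr_gt0.
rewrite -(ler_pM2r tp) -normrM mulrBl in h.
have E1 : t^-1 *: (f (t *: 1 + x) - f x) * t = f (x + t) - f x.
  by rewrite -[t *: 1]/(t * 1) mulr1 [t + x]addrC -[_ *: _]/(_ * _) mulrAC mulVf// mul1r.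
by rewrite E1 distrC in h.
Qed.

Definition cexp z : R[i] := (expR (Re z))%:C * cis (Im z).

Lemma cexpD z w : cexp (z + w) = cexp z * cexp w.
Proof. by rewrite /cexp ReD ImD expRD cisD realCM; ring. Qed.

Lemma cexp0 : cexp 0 = 1. Proof. by rewrite /cexp expR0 cis0 mul1r. Qed.

Lemma modulus_cexp z : modulus (cexp z) = expR (Re z).
Proof. by rewrite /cexp modulusM modulus_cis mulr1 modulusR ger0_norm ?expR_ge0. Qed.

Lemma cexp_neq0 z : cexp z != 0.
Proof. by rewrite -modulus_gt0 modulus_cexp expR_gt0. Qed.

Lemma cder_cexp z : cder cexp z (cexp z).
Proof.
suff D0 : cder cexp 0 1.
  have E : cexp = (fun w => cexp z * (cexp \o (fun w => w - z)) w).
    by apply/funext => w /=; rewrite -cexpD addrC subrK.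
  rewrite {1}E -[X in cder _ _ X]mulr1; apply: cderZ; rewrite -(mulr1 1).
  apply: cder_comp; last by rewrite subrr.
  by have := cderB (cder_id z) (cder_cst z z); rewrite subr0.
(* The remainder of [expR] costs [c m], those of [cos] and [sin] together [4 c m], and the cross
   term [e m / 8]; with [c <= e / 8] the total stays below [e m]. *)
apply/cder_epsP => e e0; pose c := Num.min (e / 8) 1.
have c0 : 0 < c by rewrite lt_min divr_gt0 ?ltr01.
have [r1 r10 h1] := is_derive_eps (is_derive_expR 0) c0.
have [r2 r20 h2] := is_derive_eps (is_derive_cos 0) c0.
have [r3 r30 h3] := is_derive_eps (is_derive_sin 0) c0.
exists (Num.min (Num.min r1 r2) (Num.min r3 (Num.min 1 (e / 8)))).
  by rewrite !lt_min r10 r20 r30 ltr01 divr_gt0.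
move=> w; rewrite subr0 !lt_min cexp0 mul1r => /andP[/andP[w1 w2] /andP[w3 /andP[w4 w5]]].
case: w w1 w2 w3 w4 w5 => x y; set m := modulus _ => w1 w2 w3 w4 w5.
have xm : `|x| <= m := Re_le_modulus (x +i* y).
have ym : `|y| <= m := Im_le_modulus (x +i* y).
have := h1 x (le_lt_trans xm w1); rewrite add0r expR0 mul1r => {}h1.
have := h2 y (le_lt_trans ym w2); rewrite add0r cos0 sin0 oppr0 mul0r subr0 => {}h2.
have := h3 y (le_lt_trans ym w3); rewrite add0r sin0 cos0 mul1r subr0 => {}h3.
have [cle c1] : c <= e / 8 /\ c <= 1 by split; rewrite /c ge_min lexx ?orbT.
set A := expR x - 1 - x in h1; set B := cos y - 1 in h2; set C := sin y - y in h3.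
(* Collects the first-order remainders [A], [B], [C] of [expR], [cos], [sin]; the last summand is
   the second-order term [i x y]. *)
have -> : cexp (x +i* y) - 1 - (x +i* y) =
   A%:C * cis y + (1 + x)%:C * (B +i* C) + (0 +i* (x * y)).
  by apply: complexP; rewrite !(ReD, ReB, ReM, ImD, ImB, ImM) /= /A /B /C; ring.
have m0 : 0 <= m := modulus_ge0 _.
have BC : modulus (B +i* C) <= 2 * c * m.
  apply: le_trans (modulus_le_abs _ _) _.
  have := ler_wpM2l (ltW c0) ym; move: h2 h3; rewrite -/B -/C; lra.
have xy : modulus (0 +i* (x * y)) <= e / 8 * m.
  apply: le_trans (modulus_le_abs _ _) _; rewrite normr0 add0r normrM.
  by rewrite ler_pM// (le_trans xm)// ltW.
have x2 : `|1 + x| <= 2.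
  by rewrite (le_trans (ler_normD _ _))// normr1 -[2%:R]/(1 + 1) lerD2l (le_trans xm)// ltW.
apply: (le_trans (modulusD _ _)); apply: (le_trans (lerD (modulusD _ _) xy)).
rewrite !modulusM modulus_cis mulr1 !modulusR.
have hA : `|A| <= c * m by rewrite (le_trans h1)// ler_wpM2l// ltW.
have hBC : `|1 + x| * modulus (B +i* C) <= 2 * (2 * c * m).
  by rewrite ler_pM// modulus_ge0.
have cm : c * m <= e / 8 * m by rewrite ler_wpM2r.
have em : 0 <= e * m by rewrite mulr_ge0// ltW.
lra.
Qed.

Definition clog z : R[i] := ln (modulus z) +i* principal_arg z.

Lemma cis_principal_arg z : z != 0 -> (modulus z)%:C * cis (principal_arg z) = z.
Proof.
move=> z0; have m0 : 0 < modulus z by rewrite modulus_gt0.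
set c := Re z / modulus z.
have c1 : -1 <= c <= 1.
  rewrite -ler_norml normrM [`|_^-1|]ger0_norm ?invr_ge0 ?modulus_ge0//.
  by rewrite ler_pdivrMr// mul1r Re_le_modulus.
have cosa : cos (acos c) = c by rewrite acosK.
have sina : sin (acos c) = `|Im z| / modulus z.
  rewrite sin_acos//.
  have -> : 1 - c ^+ 2 = (`|Im z| / modulus z) ^+ 2.
    rewrite /c !exprMn real_normK ?num_real// exprVn.
    rewrite -[1](@divff _ (modulus z ^+ 2)) ?expf_neq0 ?gt_eqF// -mulrBl.
    by rewrite modulus_sqr addrAC subrr add0r.
  by rewrite sqrtr_sqr ger0_norm// divr_ge0// ltW.
apply: complexP; rewrite ?ReZ ?ImZ /principal_arg -/c.
  by case: ifP => _ /=; rewrite ?cosN cosa /c mulrC divfK// gt_eqF.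
case: ifP => /= [y0|/negbT]; rewrite ?sinN sina.
  by rewrite ger0_norm// mulrC divfK// gt_eqF.
by rewrite -ltNge => y0; rewrite ltr0_norm// mulNr opprK mulrC divfK// gt_eqF.
Qed.

Lemma cexp_clog z : z != 0 -> cexp (clog z) = z.
Proof.
by move=> z0; rewrite /cexp /clog /= lnK ?posrE ?modulus_gt0// cis_principal_arg.
Qed.

Lemma principal_powerE z (s : R) : z != 0 -> principal_power z s = cexp (s%:C * clog z).
Proof.
move=> z0; rewrite /principal_power /cexp ReZ ImZ /= /powR.
by rewrite modulus_eq0 (negPf z0).
Qed.

Lemma modulus_principal_power z (s : R) : modulus (principal_power z s) = modulus z `^ s.
Proof. by rewrite /principal_power modulusM modulus_cis mulr1 modulusR ger0_norm ?powR_ge0. Qed.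

(** On the right half plane the branch is an arctangent, whose continuity is known; the case
    distinction on the sign of the imaginary part hides it. *)
Lemma principal_argE z : 0 < Re z -> principal_arg z = atan (Im z / Re z).
Proof.
move=> x0; have z0 : z != 0 by apply: contraTN x0 => /eqP ->; rewrite ltxx.
have m0 : 0 < modulus z by rewrite modulus_gt0.
have h := cis_principal_arg z0; set a := principal_arg z in h *.
have ca : cos a = Re z / modulus z by rewrite -[z in Re z]h ReZ /= mulrC mulKf// gt_eqF.
have sa : sin a = Im z / modulus z by rewrite -[z in Im z]h ImZ /= mulrC mulKf// gt_eqF.
have cpos : 0 < cos a by rewrite ca divr_gt0.
have c1 : -1 <= Re z / modulus z <= 1.
  rewrite -ler_norml normrM [`|_^-1|]ger0_norm ?invr_ge0 ?modulus_ge0//.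
  by rewrite ler_pdivrMr// mul1r Re_le_modulus.
(* Otherwise [pi - acos (Re z / modulus z)] would lie in [[-pi/2, pi/2]] and have a nonnegative
   cosine, but its cosine is [- Re z / modulus z < 0]. *)
have lt : acos (Re z / modulus z) < pi / 2.
  rewrite ltNge; apply/negP => h1.
  have := cos_ge0_pihalf; have h2 := acos_lepi c1.
  move=> /(_ R (pi - acos (Re z / modulus z))); rewrite cosB cospi sinpi mulN1r mul0r addr0 acosK//.
  have /[swap]/[apply] : - (pi / 2) <= pi - acos (Re z / modulus z) <= pi / 2.
    by apply/andP; split; have := pi_ge0 R; lra.
  by rewrite oppr_ge0 leNgt divr_gt0.
have ge := acos_ge0 c1.
have -> : Im z / Re z = tan a by rewrite /tan ca sa; field; rewrite !gt_eqF.
rewrite tanK// in_itv /=; rewrite /a /principal_arg.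
by case: ifP => _; have := pi_gt0 R; move: lt ge; set b := acos _ => ? ? ?; apply/andP; split; lra.
Qed.

Lemma ccont_reim u z : (forall e, 0 < e -> exists2 r, 0 < r &
    forall w, modulus (w - z) < r -> `|Re (u w) - Re (u z)| < e) ->
  (forall e, 0 < e -> exists2 r, 0 < r &
    forall w, modulus (w - z) < r -> `|Im (u w) - Im (u z)| < e) -> ccont u z.
Proof.
move=> h1 h2; apply/ccontP => e e0; have e20 : 0 < e / 2 by rewrite divr_gt0.
have [r r0 hr] := h1 _ e20; have [t t0 ht] := h2 _ e20.
exists (Num.min r t); first by rewrite lt_min r0.
move=> w; rewrite lt_min => /andP[/hr a /ht b].
by rewrite (le_lt_trans (modulus_ReIm _))// ReB ImB [e]splitr ltrD.
Qed.

Lemma cont_comp_real (g : R -> R) (k : R[i] -> R) z :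
  {for k z, continuous g} ->
  (forall e, 0 < e -> exists2 r, 0 < r &
    forall w, modulus (w - z) < r -> `|k w - k z| < e) ->
  forall e, 0 < e -> exists2 r, 0 < r &
    forall w, modulus (w - z) < r -> `|g (k w) - g (k z)| < e.
Proof.
move=> /cvgrPdist_lt gc kc e /gc /nbhs_normP[t t0 ht].
have [r r0 hr] := kc _ t0; exists r => // w /hr wr.
by rewrite distrC; apply: ht; rewrite /ball_ /= distrC.
Qed.

Lemma ccont_clog z : 0 < Re z -> ccont clog z.
Proof.
move=> x0; have z0 : z != 0 by apply: contraTN x0 => /eqP ->; rewrite ltxx.
have m0 : 0 < modulus z by rewrite modulus_gt0.
apply: ccont_reim => /=.
  apply: cont_comp_real; first exact: continuous_ln.
  move=> e e0; exists e => // w; exact/le_lt_trans/modulus_dist.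
suff h : forall e, 0 < e -> exists2 r, 0 < r &
    forall w, modulus (w - z) < r -> `|atan (Im w / Re w) - atan (Im z / Re z)| < e.
  move=> e /h[r r0 hr]; exists (Num.min r (Re z)); first by rewrite lt_min r0.
  move=> w; rewrite lt_min => /andP[wr wx]; rewrite !principal_argE//; first exact: hr.
  by have := le_lt_trans (Re_le_modulus _) wx; rewrite ReB ltr_norml => /andP[]; lra.
apply: cont_comp_real; first exact: continuous_atan.
(* Im w / Re w is the imaginary part of w / Re w. *)
move=> e e0; have cR : ccont (fun w => (Re w)%:C) z.
  by apply/ccontP => d d0; exists d => // w; rewrite -realCB modulusR -ReB; exact/le_lt_trans/Re_le_modulus.
have Rz : (Re z)%:C != 0 :> R[i] by rewrite -modulus_gt0 modulusR normr_gt0 gt_eqF.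
have c : ccont (fun w => w * ((fun w => w^-1) \o (fun w => (Re w)%:C)) w) z.
  apply: ccontM; first exact: ccont_id.
  by apply: ccont_comp => //; exact: (cder_ccont (cderV Rz)).
move/ccontP : c => /(_ e e0)[r r0 hr]; exists r => // w /hr; apply: le_lt_trans.
rewrite /= -!realCV; apply: le_trans (Im_le_modulus _).
by rewrite ImB ![_ * _%:C]mulrC !ImZ ![_^-1 * _]mulrC.
Qed.

(** The inverse function rule in Caratheodory's form: the quotient of the logarithm is the inverse
    of that of [cexp] along [clog], which is nonzero near [z] because [cexp] has no zero. *)
Lemma cder_clog z : 0 < Re z -> exists d, cder clog z d.
Proof.
move=> x0; have z0 : z != 0 by apply: contraTN x0 => /eqP ->; rewrite ltxx.
have cl := ccont_clog x0.
have [q [hq qz qc]] := cder_cexp (clog z).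
have qz0 : q (clog z) != 0 by rewrite qz cexp_neq0.
have cq : ccont (q \o clog) z := ccont_comp cl qc.
have ci : ccont ((fun w => w^-1) \o (q \o clog)) z.
  by apply: ccont_comp => //; exact: (cder_ccont (cderV qz0)).
exists (q (clog z))^-1; apply: (cder_near _ _ ci) => //.
move/ccontP : cq => /(_ (modulus (q (clog z)))); rewrite modulus_gt0 => /(_ qz0)[r r0 hr].
exists (Num.min r (Re z)); first by rewrite lt_min r0.
move=> w; rewrite lt_min => /andP[/hr wr wx].
have q0 : q (clog w) != 0.
  by apply: contraTN wr => /eqP /= ->; rewrite sub0r modulusN ltxx.
have w0 : w != 0.
  by apply: contraTN wx => /eqP ->; rewrite sub0r modulusN -leNgt (le_trans (ler_norm _))// Re_le_modulus.
by have := hq (clog w); rewrite !cexp_clog// => -> /=; rewrite mulKf.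
Qed.

Lemma cder_principal_power z (s : R) : 0 < Re z ->
  exists d, cder (fun w => principal_power w s) z d.
Proof.
move=> x0; have [d D] := cder_clog x0.
have D2 := cder_comp (cderZ s%:C D) (cder_cexp _).
eexists; apply: cder_local D2; exists (Re z) => // w wx /=; rewrite principal_powerE//.
by apply: contraTN wx => /eqP ->; rewrite sub0r modulusN -leNgt (le_trans (ler_norm _))// Re_le_modulus.
Qed.

End complex_exponential.

(** * Goursat's theorem for rectangles *)

Section segment_integral.
Context (R : realType).
Implicit Types (z w : R[i]) (f g : R -> R[i]) (G u : R[i] -> R[i]) (a b c d e m r x y t : R).

Definition rcont f x := forall e, 0 < e -> exists2 r, 0 < r &
  forall y, `|y - x| < r -> modulus (f y - f x) < e.

Definition seg_cont a b f := forall x, a <= x <= b -> rcont f x.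

Lemma rcont_comp G (k : R -> R[i]) x : ccont G (k x) -> rcont k x -> rcont (G \o k) x.
Proof.
move=> /ccontP cG ck e /cG[r /ck[t t0 ht] hr]; exists t => // y /ht; exact: hr.
Qed.

Lemma rcontB f g x : rcont f x -> rcont g x -> rcont (fun y => f y - g y) x.
Proof.
move=> cf cg e e0; have e20 : 0 < e / 2 by rewrite divr_gt0.
have [r r0 hr] := cf _ e20; have [t t0 ht] := cg _ e20.
exists (Num.min r t); first by rewrite lt_min r0.
move=> y; rewrite lt_min => /andP[/hr h1 /ht h2].
rewrite (_ : _ - _ = (f y - f x) + (g x - g y)); last by ring.
by rewrite (le_lt_trans (modulusD _ _))// [modulus (g x - _)]modulusBC [e]splitr ltrD.
Qed.

Lemma rcont_affine z w x : rcont (fun t => z + w * t%:C) x.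
Proof.
move=> e e0; exists (e / (modulus w + 1)); first by rewrite divr_gt0// ltr_wpDl// modulus_ge0.
move=> y yx; rewrite (_ : _ - _ = w * (y - x)%:C); last by rewrite realCB; ring.
have w1 : 0 < modulus w + 1 by rewrite ltr_wpDl// modulus_ge0.
move: yx; rewrite ltr_pdivlMr// modulusM modulusR mulrC => h; apply: le_lt_trans h.
by rewrite ler_wpM2r// lerDl.
Qed.

Lemma seg_cinteg a b f : seg_cont a b f -> cinteg leb `[a, b] f.
Proof.
have H (k : R[i] -> R) : (forall z w, `|k z - k w| <= modulus (z - w)) ->
    seg_cont a b f -> leb.-integrable `[a, b] (EFin \o (fun x => k (f x))).
  move=> kl cf; apply: continuous_compact_integrable; first exact: segment_compact.
  apply: continuous_in_subspaceT => x /set_mem; rewrite /= in_itv/= => /cf cx.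
  apply/cvgrPdist_lt => e /cx[r r0 hr]; apply/nbhs_normP; exists r => // y.
  by rewrite /ball_ /= !(distrC x) (distrC (k (f x))) => /hr; exact/le_lt_trans/kl.
move=> cf; split; apply: H => // z w; first by rewrite -ReB Re_le_modulus.
by rewrite -ImB Im_le_modulus.
Qed.

Lemma Cintegral_split a m b f : a <= m <= b -> seg_cont a b f ->
  Cintegral leb `[a, b] f = Cintegral leb `[a, m] f + Cintegral leb `[m, b] f.
Proof.
move=> /andP[am mb] /seg_cinteg [i1 i2].
have H (k : R -> R) : leb.-integrable `[a, b] (EFin \o k) ->
   (\int[leb]_(x in `[a, b]) k x = \int[leb]_(x in `[a, m]) k x + \int[leb]_(x in `[m, b]) k x)%R.
  move=> ik; have := @Rintegral_itvB _ k (BLeft a) (BRight b) m ik.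
  rewrite !bnd_simp => /(_ am mb) E.
  have ik' : leb.-integrable `]m, b] (EFin \o k).
    by apply: integrableS ik => //; apply: subset_itvr; rewrite bnd_simp.
  by rewrite -(Rintegral_itv_obnd_cbnd ik') -E addrC subrK.
by apply: complexP; rewrite ?ReD ?ImD /=; exact: H.
Qed.

Lemma fine_lebesgue_segment a b : a <= b -> fine (leb `[a, b]%classic) = b - a.
Proof.
move=> ab; rewrite lebesgue_measure_itv /= lte_fin.
by case: ltP => //= ba; rewrite (@le_anti _ _ a b) ?subrr// ab.
Qed.

Lemma le_modulus_segment a b f (K : R) : a <= b -> seg_cont a b f ->
  (forall x, a <= x <= b -> modulus (f x) <= K) ->
  modulus (Cintegral leb `[a, b] f) <= K * (b - a).
Proof.
move=> ab cf hK; have i := seg_cinteg cf.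
have m := measurable_segment a b.
have h := le_modulus_Cintegral m i; apply: (le_trans h) => {h}.
rewrite -(fine_lebesgue_segment ab) -(Rintegral_cst leb m); apply: le_Rintegral => //.
- exact: cinteg_modulus.
- apply: continuous_compact_integrable; first exact: segment_compact.
  by apply: continuous_subspaceT => x; exact: cvg_cst.
Qed.

(** The integral of [G] along the boundary of the rectangle, counterclockwise, with opposite sides
    paired. *)
Definition rect_int G a b c d : R[i] :=
  Cintegral leb `[a, b] (fun x => G (x +i* c) - G (x +i* d)) +
  'i%C * Cintegral leb `[c, d] (fun y => G (b +i* y) - G (a +i* y)).

Definition rectangle_cont G a b c d := forall x y, a <= x <= b -> c <= y <= d ->
  ccont G (x +i* y).

Lemma seg_cont_h G a b c d y : rectangle_cont G a b c d -> c <= y <= d ->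
  seg_cont a b (fun x => G (x +i* y)).
Proof.
move=> cG yd x xb; have E : (fun t => t +i* y) = (fun t => (0 +i* y) + 1 * t%:C).
  by apply/funext => t; apply: complexP; rewrite !(ReD, ImD, ReM, ImM) /=; ring.
apply: (rcont_comp (k := fun t => t +i* y)); first exact: cG.
by rewrite E; exact: rcont_affine.
Qed.

Lemma seg_cont_v G a b c d x : rectangle_cont G a b c d -> a <= x <= b ->
  seg_cont c d (fun y => G (x +i* y)).
Proof.
move=> cG xb y yd; have E : (fun t => x +i* t) = (fun t => x%:C + 'i%C * t%:C).
  by apply/funext => t; apply: complexP; rewrite !(ReD, ImD, ReM, ImM) /=; ring.
apply: (rcont_comp (k := fun t => x +i* t)); first exact: cG.
by rewrite E; exact: rcont_affine.
Qed.

Lemma seg_contB a b f g : seg_cont a b f -> seg_cont a b g ->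
  seg_cont a b (fun x => f x - g x).
Proof. by move=> cf cg x xab; apply: rcontB; [exact: cf|exact: cg]. Qed.

Lemma rectangle_split_h G a m b c d : a <= m <= b -> c <= d -> rectangle_cont G a b c d ->
  rect_int G a b c d = rect_int G a m c d + rect_int G m b c d.
Proof.
move=> amb cd cG; have /andP[am mb] := amb; have ab := le_trans am mb.
rewrite /rect_int (Cintegral_split amb); last first.
  by apply: seg_contB; apply: (seg_cont_h cG); rewrite lexx ?cd.
have sv x : a <= x <= b -> cinteg leb `[c, d] (fun y => G (x +i* y)).
  by move=> xab; apply: seg_cinteg; apply: (seg_cont_v cG).
have mI := measurable_segment c d.
have sa : a <= a <= b by rewrite lexx. have sb : a <= b <= b by rewrite lexx ab.
have E x1 x2 (h1 : a <= x1 <= b) (h2 : a <= x2 <= b) := CintegralB mI (sv x1 h1) (sv x2 h2).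
rewrite (E b a)// (E m a)// (E b m)//; ring.
Qed.

Lemma rectangle_split_v G a b c m d : a <= b -> c <= m <= d -> rectangle_cont G a b c d ->
  rect_int G a b c d = rect_int G a b c m + rect_int G a b m d.
Proof.
move=> ab cmd cG; have /andP[cm md] := cmd; have cd := le_trans cm md.
rewrite /rect_int (Cintegral_split (a := c) cmd); last first.
  by apply: seg_contB; apply: (seg_cont_v cG); rewrite lexx ?ab.
have sh y : c <= y <= d -> cinteg leb `[a, b] (fun x => G (x +i* y)).
  by move=> ycd; apply: seg_cinteg; apply: (seg_cont_h cG).
have mI := measurable_segment a b.
have sc : c <= c <= d by rewrite lexx. have sd : c <= d <= d by rewrite lexx cd.
have E y1 y2 (h1 : c <= y1 <= d) (h2 : c <= y2 <= d) := CintegralB mI (sh y1 h1) (sh y2 h2).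
rewrite (E c d)// (E c m)// (E m d)//; ring.
Qed.

Lemma Cintegral_seg_cst a b z : a <= b -> Cintegral leb `[a, b] (fun=> z) = z * (b - a)%:C.
Proof.
move=> ab; have mI := measurable_segment a b.
by apply: complexP; rewrite [RHS]/= ?(mulr0, mul0r, subr0, add0r, addr0) /= Rintegral_cst// (fine_lebesgue_segment ab) ?ReM ?ImM /= ?mulr0 ?subr0 ?add0r.
Qed.

(** Affine functions integrate to 0 over the boundary of a rectangle, so only the deviation of [G]
    from one of them counts. *)
Lemma rect_int_le G a b c d z D e : a <= b -> c <= d -> 0 <= e ->
  rectangle_cont G a b c d ->
  (forall x y, a <= x <= b -> c <= y <= d ->
     modulus (G (x +i* y) - (z + D * (x +i* y))) <= e) ->
  modulus (rect_int G a b c d) <= 2 * e * ((b - a) + (d - c)).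
Proof.
move=> ab cd e0 cG hG; pose L w := z + D * w; pose H w := G w - L w.
have aI : a <= a <= b by rewrite lexx. have bI : a <= b <= b by rewrite lexx ab.
have cI : c <= c <= d by rewrite lexx. have dI : c <= d <= d by rewrite lexx cd.
have cL w : ccont L w.
  by apply: ccontD; [exact: ccont_cst|apply: ccontM; [exact: ccont_cst|exact: ccont_id]].
have cH : rectangle_cont H a b c d.
  move=> x y xI yI; have -> : H = (fun w => G w + (-1) * L w) by apply/funext => w; rewrite mulN1r.
  by apply: ccontD; [exact: cG|apply: ccontM; [exact: ccont_cst|exact: cL]].
have cH1 := seg_contB (seg_cont_h cH cI) (seg_cont_h cH dI).
have cH2 := seg_contB (seg_cont_v cH bI) (seg_cont_v cH aI).
have -> : rect_int G a b c d = rect_int H a b c d.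
  rewrite /rect_int.
  have -> : (fun x => G (x +i* c) - G (x +i* d)) =
      (fun x => (H (x +i* c) - H (x +i* d)) + (D * (0 +i* (c - d)))).
    apply/funext => x; rewrite /H /L.
    rewrite (_ : 0 +i* (c - d) = (x +i* c) - (x +i* d)); first by ring.
    by apply: complexP; rewrite ?ReB ?ImB /= ?subrr.
  have -> : (fun y => G (b +i* y) - G (a +i* y)) =
      (fun y => (H (b +i* y) - H (a +i* y)) + (D * (b - a)%:C)).
    apply/funext => y; rewrite /H /L.
    rewrite (_ : (b - a)%:C = (b +i* y) - (a +i* y)); first by ring.
    by apply: complexP; rewrite ?ReB ?ImB /= ?subrr.
  have ci (p q : R) v : cinteg leb `[p, q] (fun=> v : R[i]).
    by apply: seg_cinteg => x _ k k0; exists 1 => // y _; rewrite subrr modulus0.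
  have m1 := measurable_segment a b.
  have m2 := measurable_segment c d.
  rewrite (CintegralD m1 (seg_cinteg cH1) (ci _ _ _)).
  rewrite (CintegralD m2 (seg_cinteg cH2) (ci _ _ _)).
  rewrite !Cintegral_seg_cst// mulrDr addrACA -[RHS]addr0; congr (_ + _).
  apply: complexP; rewrite !(ReD, ImD, ReM, ImM) /=; ring.
have hH x y : a <= x <= b -> c <= y <= d -> modulus (H (x +i* y)) <= e by exact: hG.
have bnd x y x' y' : a <= x <= b -> c <= y <= d -> a <= x' <= b -> c <= y' <= d ->
    modulus (H (x +i* y) - H (x' +i* y')) <= 2 * e.
  move=> *; rewrite (le_trans (modulusD _ _))// modulusN.
  by rewrite mulr_natl mulr2n lerD// hH.
rewrite /rect_int (le_trans (modulusD _ _))// mulrDr lerD//.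
  by apply: le_modulus_segment => // x xI; exact: bnd.
have -> : modulus ('i%C * Cintegral leb `[c, d] (fun y => H (b +i* y) - H (a +i* y))) =
   modulus (Cintegral leb `[c, d] (fun y => H (b +i* y) - H (a +i* y))).
  by rewrite modulusM modulusE expr0n/= add0r expr1n sqrtr1 mul1r.
by apply: le_modulus_segment => // x xI; exact: bnd.
Qed.

Lemma dist_le x (u v K : R) : x <= u -> u <= x + K -> x <= v -> v <= x + K -> `|u - v| <= K.
Proof. by move=> *; rewrite ler_norml; apply/andP; split; lra. Qed.

(** Bisection: a rectangle whose integral is too large for its size has a quarter with the same
    defect. At the common point of the nested rectangles [G] is affine up to a small error, and
    [rect_int_le] contradicts the defect. *)
Theorem goursat G a b c d : a <= b -> c <= d ->
  (forall x y, a <= x <= b -> c <= y <= d -> exists D, cder G (x +i* y) D) ->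
  rect_int G a b c d = 0.
Proof.
move=> ab cd dG.
have cG : rectangle_cont G a b c d by move=> x y xI yI; have [D /cder_ccont] := dG x y xI yI.
pose A := b - a; pose B := d - c; pose S := A + B.
have A0 : 0 <= A by rewrite subr_ge0. have B0 : 0 <= B by rewrite subr_ge0.
have S0 : 0 <= S by rewrite addr_ge0.
(* At scale [h] the diameter is at most [S h] and [G] deviates from an affine function by at most
   [e S h], so [rect_int_le] gives [2 e S^2 h^2]; this is the threshold at [h = 1]. *)
suff small e : 0 < e -> modulus (rect_int G a b c d) <= 2 * e * S ^+ 2.
  apply/eqP; rewrite -modulus_eq0; apply/eqP/le_anti; rewrite modulus_ge0 andbT.
  apply/ler_addgt0Pr => e e0; rewrite add0r.
  have k0 : 0 < 2 * (S ^+ 2 + 1) by rewrite mulr_gt0// ltr_wpDl// sqr_ge0.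
  apply: le_trans (small _ (divr_gt0 e0 k0)) _.
  have -> : 2 * (e / (2 * (S ^+ 2 + 1))) * S ^+ 2 = e * (S ^+ 2 / (S ^+ 2 + 1)).
    by field; rewrite gt_eqF// ltr_wpDl// sqr_ge0.
  by rewrite ler_piMr ?(ltW e0)// ler_pdivrMr ?ltr_wpDl ?sqr_ge0// mul1r lerDl.
move=> e0; apply: contrapT => /negP; rewrite -ltNge => bad0.
pose h n : R := 2^-1 ^+ n.
have h0 n : 0 < h n by rewrite exprn_gt0// invr_gt0.
have hS n : h n = 2 * h n.+1 by rewrite /h exprS mulrA divff ?mul1r// pnatr_eq0.
(* A state is a level [n] with the lower left corner of a rectangle of sides [A / 2^n] and
   [B / 2^n]. *)
pose bad (p : nat * (R * R)) := [/\ a <= p.2.1, p.2.1 + A * h p.1 <= b, c <= p.2.2,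
   p.2.2 + B * h p.1 <= d & 2 * e * S ^+ 2 * h p.1 ^+ 2 <
   modulus (rect_int G p.2.1 (p.2.1 + A * h p.1) p.2.2 (p.2.2 + B * h p.1))].
pose next (p q : nat * (R * R)) := [/\ q.1 = p.1.+1, p.2.1 <= q.2.1,
   q.2.1 + A * h q.1 <= p.2.1 + A * h p.1, p.2.2 <= q.2.2 &
   q.2.2 + B * h q.1 <= p.2.2 + B * h p.1].
have step p : exists q, bad p -> next p q /\ bad q.
  have [bp|] := pselect (bad p); last by exists p.
  case: p bp => n [x y] [/= ax xb cy yd bp].
  set x' := x + A * h n.+1; set y' := y + B * h n.+1.
  have xE : x' + A * h n.+1 = x + A * h n by rewrite /x' (hS n); ring.
  have yE : y' + B * h n.+1 = y + B * h n by rewrite /y' (hS n); ring.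
  have Ah : 0 <= A * h n.+1 by rewrite mulr_ge0// ltW.
  have Bh : 0 <= B * h n.+1 by rewrite mulr_ge0// ltW.
  apply: contrapT => nex.
  have good s t : (s = x \/ s = x') -> (t = y \/ t = y') ->
     modulus (rect_int G s (s + A * h n.+1) t (t + B * h n.+1)) <= 2 * e * S ^+ 2 * h n.+1 ^+ 2.
    move=> hs ht; rewrite leNgt; apply/negP => lt; apply: nex.
    have q1 : x <= s by case: hs => ->; rewrite ?lexx// lerDl.
    have q2 : s + A * h n.+1 <= x + A * h n.
      by case: hs => ->; rewrite ?xE// -xE lerD2r lerDl.
    have q3 : y <= t by case: ht => ->; rewrite ?lexx// lerDl.
    have q4 : t + B * h n.+1 <= y + B * h n.
      by case: ht => ->; rewrite ?yE// -yE lerD2r lerDl.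
    exists (n.+1, (s, t)) => _; split; split => //=.
    - exact: le_trans q1.
    - exact: le_trans xb.
    - exact: le_trans q3.
    - exact: le_trans yd.
  move: bp; rewrite ltNge => /negP; apply.
  have subc x1 x2 y1 y2 : a <= x1 -> x2 <= b -> c <= y1 -> y2 <= d -> rectangle_cont G x1 x2 y1 y2.
    move=> h1 h2 h3 h4 u v /andP[u1 u2] /andP[v1 v2]; apply: cG.
      by rewrite (le_trans h1 u1) (le_trans u2 h2).
    by rewrite (le_trans h3 v1) (le_trans v2 h4).
  have xx : x <= x' <= x + A * h n by rewrite -xE !lerDl Ah.
  have yy : y <= y' <= y + B * h n by rewrite -yE !lerDl Bh.
  have /andP[x1 x2] := xx; have /andP[y1 y2] := yy.
  have x3 := le_trans x1 x2; have y3 := le_trans y1 y2.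
  have cc := subc x (x + A * h n) y (y + B * h n) ax xb cy yd.
  rewrite (rectangle_split_h xx y3 cc).
  rewrite (rectangle_split_v x1 yy); last by apply: subc => //; exact: le_trans xb.
  rewrite (rectangle_split_v x2 yy); last by apply: subc => //; exact: le_trans x1.
  rewrite -xE -yE.
  have g1 := good x y (or_introl erefl) (or_introl erefl).
  have g2 := good x y' (or_introl erefl) (or_intror erefl).
  have g3 := good x' y (or_intror erefl) (or_introl erefl).
  have g4 := good x' y' (or_intror erefl) (or_intror erefl).
  apply: (le_trans (modulusD _ _)); apply: (le_trans (lerD (modulusD _ _) (modulusD _ _))).
  have -> : 2 * e * S ^+ 2 * h n ^+ 2 = 2 * e * S ^+ 2 * h n.+1 ^+ 2 +
     2 * e * S ^+ 2 * h n.+1 ^+ 2 + (2 * e * S ^+ 2 * h n.+1 ^+ 2 + 2 * e * S ^+ 2 * h n.+1 ^+ 2).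
    by rewrite (hS n); ring.
  by apply: lerD; apply: lerD.
have [nx hnx] := choice step.
pose s n := iter n nx (0%N, (a, c)).
have h00 : h 0%N = 1 by rewrite /h expr0.
have b0 : bad (s 0%N).
  have e1 : a + A = b by rewrite /A addrC subrK. have e2 : c + B = d by rewrite /B addrC subrK.
  by split=> //=; rewrite h00 ?mulr1 ?e1 ?e2// expr1n mulr1.
have bs n : bad (s n) by elim: n => // n ih; have [] := hnx _ ih.
have ns n : next (s n) (s n.+1) by have [] := hnx _ (bs n).
have s1 n : (s n).1 = n by elim: n => // n ih; have [-> *] := ns n; rewrite ih.
pose xs n := (s n).2.1; pose ys n := (s n).2.2.
(* The nested intervals [xs n, xs n + A * h n] have a common point. *)
have nested (us : nat -> R) (K : R) : 0 <= K -> (forall n, us n <= us n.+1) ->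
    (forall n, us n.+1 + K * h n.+1 <= us n + K * h n) ->
    exists p, forall n, us n <= p <= us n + K * h n.
  move=> K0 up dn; have nd : nondecreasing_seq us by apply/nondecreasing_seqP.
  have ni : nonincreasing_seq (fun n => us n + K * h n) by apply/nonincreasing_seqP.
  have ub (m n : nat) : us m <= us n + K * h n.
    have [mn|/ltnW nm] := leqP m n.
      by rewrite (le_trans (nd _ _ mn))// lerDl mulr_ge0// ltW.
    by apply: le_trans (ni _ _ nm); rewrite lerDl mulr_ge0// ltW.
  have cv : cvgn us by apply: nondecreasing_is_cvgn => //; exists (us 0%N + K * h 0%N) => _ [m _ <-].
  exists (limn us) => n; rewrite nondecreasing_cvgn_le//=.
  by apply: limr_le => //; apply: nearW.
have dnx n : xs n.+1 + A * h n.+1 <= xs n + A * h n.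
  by have [_ _ + _ _] := ns n; rewrite !s1.
have dny n : ys n.+1 + B * h n.+1 <= ys n + B * h n.
  by have [_ _ _ _] := ns n; rewrite !s1.
have upx n : xs n <= xs n.+1 by have [_ + _ _ _] := ns n.
have upy n : ys n <= ys n.+1 by have [_ _ _ + _] := ns n.
have [p hp] := nested xs A A0 upx dnx.
have [q hq] := nested ys B B0 upy dny.
have pI : a <= p <= b.
  by have := hp 0%N; rewrite /xs /= h00 mulr1 /A addrCA subrr addr0.
have qI : c <= q <= d.
  by have := hq 0%N; rewrite /ys /= h00 mulr1 /B addrCA subrr addr0.
have [D /cder_epsP/(_ e e0)[r r0 hr]] := dG p q pI qI.
have [n hn] : exists n, S * h n < r.
  have : S * h n @[n --> \oo] --> S * 0.
    apply: cvgM; first exact: cvg_cst.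
    by apply: cvg_expr; rewrite ger0_norm ?invr_ge0// invf_lt1// ltr1n.
  rewrite mulr0 => /cvgrPdist_lt/(_ _ r0)[N _ hN]; exists N; have := hN N (leqnn N).
  by rewrite /= sub0r normrN ger0_norm// mulr_ge0// ltW.
have [] := bs n; rewrite -/(xs n) -/(ys n) s1 => ax xb cy yd; rewrite ltNge => /negP; apply.
have /andP[p1 p2] := hp n; have /andP[q1 q2] := hq n.
have Ah : 0 <= A * h n by rewrite mulr_ge0// ltW.
have Bh : 0 <= B * h n by rewrite mulr_ge0// ltW.
have le := @rect_int_le G (xs n) (xs n + A * h n) (ys n) (ys n + B * h n)
  (G (p +i* q) - D * (p +i* q)) D (e * (S * h n)).
apply: (le_trans (le _ _ _ _ _)).
- by rewrite lerDl.
- by rewrite lerDl.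
- by rewrite !mulr_ge0// ltW.
- move=> u v /andP[u1 u2] /andP[v1 v2]; apply: cG.
    by rewrite (le_trans ax u1) (le_trans u2 xb).
  by rewrite (le_trans cy v1) (le_trans v2 yd).
- move=> u v /andP[u1 u2] /andP[v1 v2].
  have uv : modulus ((u +i* v) - (p +i* q)) <= S * h n.
    apply: (le_trans (modulus_ReIm _)); rewrite ReB ImB /= /S mulrDl.
    by apply: lerD; [apply: (@dist_le (xs n))|apply: (@dist_le (ys n))].
  have -> : G (u +i* v) - (G (p +i* q) - D * (p +i* q) + D * (u +i* v)) =
     G (u +i* v) - G (p +i* q) - D * ((u +i* v) - (p +i* q)) by ring.
  by rewrite (le_trans (hr _ (le_lt_trans uv hn)))// ler_wpM2l// ltW.
- rewrite le_eqVlt; apply/orP; left; apply/eqP; rewrite /S; ring.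
Qed.

End segment_integral.

(** * Cauchy's theorem on circles and Taylor expansion *)

Section taylor.
Context (R : realType).
Implicit Types (z w : R[i]) (f g : R -> R[i]) (G u : R[i] -> R[i]) (e r t : R).

(** The integral in the angle, not along the contour: in terms of [dz] it is the integral of
    [G z / (i z)]. Hence the extra factor [z] when Cauchy's theorem is applied. *)
Definition circle_int G r : R[i] :=
  Cintegral leb `[0, 2 * pi] (fun t : R => G (r%:C * cis t)).

Let pi2 : 0 <= 2 * pi :> R. Proof. by rewrite mulr_ge0// pi_ge0. Qed.

Lemma rcont_cis t : rcont (@cis R) t.
Proof.
have E : @cis R = @cexp R \o (fun t : R => 0 + 'i%C * t%:C).
  apply/funext => x /=; rewrite (_ : 0 + 'i%C * x%:C = 0 +i* x).
    by rewrite /cexp /= expR0 mul1r.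
  by apply: complexP; rewrite !(ReD, ImD, ReM, ImM) /=; ring.
by rewrite E; apply: rcont_comp; [exact: cder_ccont (cder_cexp _)|exact: rcont_affine].
Qed.

Lemma rcont_circle r t : rcont (fun t => r%:C * cis t : R[i]) t.
Proof.
apply: (rcont_comp (G := fun z => r%:C * z)); last exact: rcont_cis.
by apply: ccontM; [exact: ccont_cst|exact: ccont_id].
Qed.

Lemma modulus_circle r t : modulus (r%:C * cis t : R[i]) = `|r|.
Proof. by rewrite modulusM modulus_cis mulr1 modulusR. Qed.

Lemma circle_seg_cont G r a b : (forall z, modulus z = `|r| -> ccont G z) ->
  seg_cont a b (fun t => G (r%:C * cis t)).
Proof.
move=> cG t _; apply: (rcont_comp (k := fun t => r%:C * cis t)); last exact: rcont_circle.
by apply: cG; rewrite modulus_circle.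
Qed.

(* In logarithmic coordinates the annulus is a rectangle, whose horizontal
   sides have the same image. *)
Lemma circle_int_annulus G r1 r2 : 0 < r1 <= r2 ->
  (forall z, r1 <= modulus z <= r2 -> exists d, cder G z d) ->
  circle_int G r1 = circle_int G r2.
Proof.
move=> /andP[r10 r12] dG; have r20 := lt_le_trans r10 r12.
pose F := G \o @cexp R.
have dF x y : ln r1 <= x <= ln r2 -> 0 <= y <= 2 * pi -> exists D, cder F (x +i* y) D.
  move=> /andP[x1 x2] _; have [|d D] := dG (cexp (x +i* y)).
    rewrite modulus_cexp /=; move: x1 x2.
    by rewrite -(ler_expR (ln r1)) -(ler_expR x) !lnK ?posrE// => -> ->.
  by eexists; exact: (cder_comp (cder_cexp _) D).
have ln12 : ln r1 <= ln r2 by rewrite ler_ln ?posrE.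
have := goursat ln12 pi2 dF; rewrite /rect_int.
have -> : (fun x => F (x +i* 0) - F (x +i* (2 * pi))) = (fun=> 0).
  apply/funext => x; rewrite /F /= /cexp /= cis0 /cis mulr_natl cos2pi sin2pi subrr //.
have ci r : 0 < r -> r1 <= r <= r2 ->
    cinteg leb `[0, 2 * pi] (fun y => F (ln r +i* y)).
  move=> r0 rI; apply: seg_cinteg.
  have -> : (fun y => F (ln r +i* y)) = (fun y => G (r%:C * cis y)).
    by apply/funext => y; rewrite /F /= /cexp /= lnK ?posrE.
  apply: circle_seg_cont => z; rewrite ger0_norm ?(ltW r0)// => zr.
  by have [|d /cder_ccont] := dG z; first rewrite zr.
have m2 := measurable_segment 0 (2 * pi : R).
rewrite Cintegral0 add0r (CintegralB m2 (ci _ r20 _) (ci _ r10 _)) ?lexx ?r12//.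
have E r : 0 < r -> Cintegral leb `[0, 2 * pi] (fun y => F (ln r +i* y)) = circle_int G r.
  by move=> r0; congr (Cintegral _ _ _); apply/funext => y; rewrite /F /= /cexp /= lnK ?posrE.
rewrite !E// => /eqP; rewrite mulf_eq0 => /orP[/eqP/(congr1 (@complex.Im R))/= /eqP|].
  by rewrite oner_eq0.
by rewrite subr_eq0 => /eqP.
Qed.

Lemma circle_int_cont G r e : 0 < e -> (forall z, modulus z = `|r| -> ccont G z) ->
  (exists2 k, 0 < k & forall s, `|s - r| < k -> forall z, modulus z = `|s| -> ccont G z) ->
  exists2 k, 0 < k & forall s, `|s - r| < k ->
    modulus (circle_int G s - circle_int G r) <= e.
Proof.
move=> e0 cG [k k0 hk]; have c0 : 0 < e / (2 * pi) by rewrite divr_gt0// mulr_gt0// pi_gt0.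
have nc := (compact_near_coveringP _).1 (segment_compact (a := 0) (b := 2 * pi)).
have : \forall s \near nbhs r, `[0, 2 * pi] `<=` [set t |
     modulus (G (s%:C * cis t) - G (r%:C * cis t)) <= e / (2 * pi)].
  apply: (@nc) => t _; have c20 : 0 < e / (2 * pi) / 2 by rewrite divr_gt0.
  have /ccontP/(_ _ c20)[d d0 hd] := cG (r%:C * cis t) (modulus_circle _ _).
  have d20 : 0 < d / 2 by rewrite divr_gt0.
  have [p p0 hp] := rcont_circle r t d20.
  exists ([set t' | `|t - t'| < p], [set s | `|r - s| < d / 2]) => /=.
    by split; apply/nbhs_normP; [exists p|exists (d / 2)].
  move=> [t' s] /= [tp sd]; rewrite (le_trans (modulus_subD _ _ (G (r%:C * cis t))))//.
  have a1 : modulus (r%:C * cis t' - r%:C * cis t) < d / 2 by apply: hp; rewrite distrC.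
  have a2 : modulus (s%:C * cis t' - r%:C * cis t') < d / 2.
    by rewrite -mulrBl modulusM modulus_cis mulr1 -realCB modulusR distrC.
  rewrite [e / (2 * pi)]splitr lerD//; last first.
    rewrite modulusBC ltW// hd// (lt_trans a1)// ltr_pdivrMr// mulr_natr mulr2n ltrDl//.
  rewrite ltW// hd// (le_lt_trans (modulus_subD _ _ (r%:C * cis t')))//.
  by rewrite [d]splitr ltrD.
move=> /nbhs_normP[q q0 hq]; exists (Num.min q k); first by rewrite lt_min q0.
move=> s; rewrite lt_min => /andP[sq sk].
have m2 := measurable_segment 0 (2 * pi : R).
have c1 := circle_seg_cont (a := 0) (b := 2 * pi) (hk s sk).
have c2 := circle_seg_cont (a := 0) (b := 2 * pi) cG.
rewrite /circle_int -(CintegralB m2 (seg_cinteg c1) (seg_cinteg c2)).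
have := le_modulus_segment (K := e / (2 * pi)) pi2 (seg_contB c1 c2).
rewrite subr0 divfK ?gt_eqF ?mulr_gt0 ?pi_gt0//; apply => t tI.
have bq : ball_ Num.Def.normr r q s by rewrite /ball_ /= distrC.
by apply: (hq s bq); rewrite /= in_itv.
Qed.

(** Passing from radius 1 to radius 2 multiplies the integral by [2^-n], by homogeneity, and leaves
    it unchanged, since [z^-n] is differentiable on the annulus. *)
Lemma circle_int_Xn n r : (0 < n)%N -> 0 < r ->
  circle_int (fun z => z^-1 ^+ n) r = 0.
Proof.
move=> n0; wlog r1 : r / r = 1.
  move=> W r0; have := W 1 erefl ltr01.
  have homog s : 0 < s -> circle_int (fun z => z^-1 ^+ n) s =
      s^-1%:C ^+ n * circle_int (fun z => z^-1 ^+ n) 1.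
    move=> s0; rewrite /circle_int -CintegralZ//.
    - congr (Cintegral _ _ _); apply/funext => t.
      by rewrite mul1r !invfM exprMn realCV.
    - apply: seg_cinteg; apply: (circle_seg_cont (G := fun z => z^-1 ^+ n)) => z; rewrite normr1 => z1.
      have z0 : z != 0 by rewrite -modulus_gt0 z1.
      by have [d' D'] := cderX n (cderV z0); exact: cder_ccont D'.
  by rewrite (homog r r0) => ->; rewrite mulr0.
move=> _; subst r.
have d12 z : 1 <= modulus z <= 2 -> exists d, cder (fun z => z^-1 ^+ n) z d.
  move=> /andP[z1 _]; have z0 : z != 0 by rewrite -modulus_gt0 (lt_le_trans _ z1).
  exact: cderX (cderV z0).
have h12 : ((0 : R) < 1) && ((1 : R) <= 2) by rewrite ltr01 ler1n.
have := circle_int_annulus h12 d12.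
have -> : circle_int (fun z => z^-1 ^+ n) 2 = 2^-1%:C ^+ n * circle_int (fun z => z^-1 ^+ n) 1.
  rewrite /circle_int -CintegralZ//.
  - congr (Cintegral _ _ _); apply/funext => t.
    by rewrite mul1r !invfM exprMn realCV.
  - apply: seg_cinteg; apply: (circle_seg_cont (G := fun z => z^-1 ^+ n)) => z; rewrite normr1 => z1.
    have z0 : z != 0 by rewrite -modulus_gt0 z1.
    by have [d' D'] := cderX n (cderV z0); exact: cder_ccont D'.
move/eqP; rewrite -subr_eq0 -{1}[circle_int _ _]mul1r -mulrBl mulf_eq0 => /orP[|/eqP//].
rewrite subr_eq0 => /eqP/(congr1 (@modulus R)); rewrite modulus1 modulusX modulusR.
rewrite ger0_norm ?invr_ge0// => h; have : (2^-1 : R) ^+ n < 1.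
  by rewrite exprn_ilt1 ?invr_ge0// ?invf_lt1 ?ltr1n// -lt0n.
by rewrite -h ltxx.
Qed.

Lemma circle_int_cst (c : R[i]) r : circle_int (fun=> c) r = c * (2 * pi)%:C.
Proof. by rewrite /circle_int Cintegral_seg_cst// subr0. Qed.

Lemma limit_eq (j : R -> R[i]) x0 (c : R[i]) :
  (forall e, 0 < e -> exists2 k, 0 < k & forall s, `|s - x0| < k -> modulus (j s - j x0) <= e) ->
  (forall k, 0 < k -> exists2 x, `|x - x0| < k & j x = c) -> j x0 = c.
Proof.
move=> h1 h2; apply/eqP; rewrite -subr_eq0 -modulus_eq0; apply/eqP/le_anti.
rewrite modulus_ge0 andbT; apply/ler_addgt0Pr => e /h1[k k0 hk].
by have [x /hk + <-] := h2 k k0; rewrite add0r modulusBC.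
Qed.

(* Cauchy's theorem for [z (u z - u w) / (z - w)], which is continuous on the
   disc and differentiable off w. *)
Lemma circle_int_quotient u q w r : disc w ->
  (forall z, disc z -> exists d, cder u z d) ->
  (forall z, u z - u w = q z * (z - w)) -> ccont q w -> modulus w < r < 1 ->
  circle_int (fun z => z * q z) r = 0.
Proof.
move=> wd du hq qw /andP[wr r1]; set s := modulus w; have s0 : 0 <= s := modulus_ge0 w.
have r0 : 0 < r := le_lt_trans s0 wr.
have dq z : disc z -> z != w -> exists d, cder (fun z => z * q z) z d.
  move=> zd zw; have [d D] := du z zd.
  have zw0 : z - w != 0 by rewrite subr_eq0.
  have [d' D'] := @cder_div R (fun z => u z - u w) (fun z => z - w) z _ _ zw0
    (cderB D (cder_cst z (u w))) (cderB (cder_id z) (cder_cst z w)).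
  eexists; apply: (cderM (cder_id z)); apply: cder_local D'.
  exists (modulus (z - w)); first by rewrite modulus_gt0.
  move=> z' z'z; rewrite hq mulfK// subr_eq0; apply: contraTN z'z => /eqP ->.
  by rewrite modulusBC ltxx.
have cg z : disc z -> ccont (fun z => z * q z) z.
  move=> zd; have [->|zw] := eqVneq z w; first by apply: ccontM => //; exact: ccont_id.
  by have [d /cder_ccont] := dq z zd zw.
set j := circle_int _.
have cj x e : `|x| < 1 -> 0 < e -> exists2 k, 0 < k & forall y, `|y - x| < k -> modulus (j y - j x) <= e.
  move=> x1 e0; apply: circle_int_cont => //.
    by move=> z zx; apply: cg; rewrite /disc /mkset zx.
  exists (1 - `|x|); first by rewrite subr_gt0.
  move=> y yx z zy; apply: cg; rewrite /disc /mkset zy.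
  by have := ler_normD (y - x) x; rewrite subrK; lra.
have jc x y : 0 < x <= y -> y < 1 -> y < s \/ s < x -> j x = j y.
  move=> xy y1 sxy; apply: circle_int_annulus => // z /andP[z1 z2]; apply: dq.
    by rewrite /disc /mkset (le_lt_trans z2).
  apply: contraPN sxy => /eqP zw; rewrite zw -/s in z1 z2.
  by case=> h; [have := le_lt_trans z2 h|have := lt_le_trans h z1]; rewrite ltxx.
have j0 : j 0 = 0.
  rewrite /j /circle_int -[RHS](@Cintegral0 _ _ _ leb `[0, 2 * pi]).
  by congr (Cintegral _ _ _); apply/funext => t; rewrite !mul0r.
(* Inside the circle through [w] the radius can shrink to 0, where the factor [z] makes the integral
   vanish, and continuity at radius 0 concludes. If [w = 0] there is no circle to cross and all
   radii are reached. *)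
have near0 y : 0 < y < 1 -> (y < s \/ s = 0) -> j y = 0.
  move=> /andP[y0 y1] ys; rewrite -j0; apply/esym; apply: limit_eq => [e e0|k k0].
    by apply: cj => //; rewrite normr0.
  have m0 : 0 < Num.min (k / 2) y by rewrite lt_min y0 divr_gt0.
  exists (Num.min (k / 2) y); last first.
    apply: jc => //; first by rewrite m0/= ge_min lexx orbT.
    by case: ys => [|s00]; [left|right; rewrite s00].
  rewrite subr0 gtr0_norm// gt_min ltr_pdivrMr// mulr_natr mulr2n ltrDl k0//.
have [s00|sn0] := eqVneq s 0; first by apply: near0; [rewrite r0|right].
have sp : 0 < s by rewrite lt0r sn0.
have sabs : `|s| < 1 by rewrite ger0_norm.
(* The circle of radius [s] meets [w], where differentiability is unknown. Continuity of [j] joins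
   the radii above [s] to [s] itself, and then [s] to the radii below. *)
have <- : j s = j r.
  apply: limit_eq => [e|k k0]; first exact: cj.
  pose x := Num.min (s + k / 2) r.
  have k20 : 0 < k / 2 by rewrite divr_gt0.
  have sx : s < x by rewrite lt_min wr ltrDl k20.
  exists x; last by apply: jc => //; [rewrite (lt_trans sp sx)/= /x ge_min lexx orbT|right].
  rewrite gtr0_norm ?subr_gt0// ltrBlDl gt_min ltrD2l ltr_pdivrMr// mulr_natr mulr2n ltrDl k0//.
apply: limit_eq => [e|k k0]; first exact: cj.
pose x := Num.max (s - k / 2) (s / 2).
have k20 : 0 < k / 2 by rewrite divr_gt0.
have s20 : 0 < s / 2 by rewrite divr_gt0.
have xs : x < s by rewrite gt_max gtrDl oppr_lt0 k20 ltr_pdivrMr// mulr_natr mulr2n ltrDl.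
exists x.
  rewrite distrC gtr0_norm ?subr_gt0// ltrBlDr -ltrBlDl lt_max; apply/orP; left.
  by rewrite ltrD2l ltrN2 ltr_pdivrMr// mulr_natr mulr2n ltrDl.
apply: near0; last by left.
by rewrite (lt_trans xs wd) andbT lt_max s20 orbT.
Qed.

(** The Cauchy formula is not isolated: the finite geometric sum of [(w / z)^n] turns
    [circle_int_quotient] directly into the Taylor polynomial at [w], with a remainder of order
    [(|w| / r)^N]. *)
Theorem analytic_power_series u : (forall z, disc z -> exists d, cder u z d) ->
  exists a, has_pseries a u.
Proof.
move=> du; pose I n r := circle_int (fun z => u z * z^-1 ^+ n) r.
have dI n z : disc z -> z != 0 -> exists d, cder (fun z => u z * z^-1 ^+ n) z d.
  move=> zd z0; have [d1 D1] := du z zd; have [d2 D2] := cderX n (cderV z0).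
  by eexists; exact: cderM D1 D2.
have Ic n r : 0 < r < 1 -> I n r = I n 2^-1.
  move=> /andP[r0 r1]; have h0 : 0 < 2^-1 :> R by rewrite invr_gt0.
  have h1 : 2^-1 < 1 :> R by rewrite invf_lt1// ltr1n.
  have D x y : 0 < x -> y < 1 -> forall z, x <= modulus z <= y -> exists d, cder (fun z => u z * z^-1 ^+ n) z d.
    move=> x0 y1 z /andP[z1 z2]; apply: dI; first by rewrite /disc /mkset (le_lt_trans z2).
    by rewrite -modulus_gt0 (lt_le_trans x0).
  have [rh|/ltW hr] := leP r 2^-1; first by apply: circle_int_annulus; [rewrite r0|exact: D].
  by apply/esym/circle_int_annulus; [rewrite h0|exact: D].
(* By [Ic] every radius in []0, 1[] gives the same integral; a fixed one makes the coefficients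
   independent of [w]. *)
pose a n := (2 * pi)^-1%:C * I n 2^-1; exists a => w wd.
set s := modulus w; have s0 : 0 <= s := modulus_ge0 w.
have s1 : s < 1 by exact: wd.
pose r := (s + 1) / 2; have sr : s < r by rewrite /r; lra.
have r1 : r < 1 by rewrite /r; lra.
have r0 : 0 < r by rewrite /r; lra.
have rr : `|r| = r by rewrite ger0_norm// ltW.
have [d [q [hq qd qc]]] := du w wd.
have j0 : circle_int (fun z => z * q z) r = 0.
  by apply: (circle_int_quotient wd du hq qc); rewrite sr.
have cd r' : 0 < r' < 1 -> forall z, modulus z = `|r'| -> disc z /\ z != 0.
  by move=> /andP[r'0 r'1] z zr; split; [rewrite /disc /mkset zr ger0_norm// ltW|rewrite -modulus_gt0 zr normr_gt0 gt_eqF].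
have r01 : 0 < r < 1 by rewrite r0.
have qcont z : modulus z = `|r| -> ccont q z.
  move=> zr; have [zd z0] := cd r r01 z zr; have zw : z - w != 0.
    by rewrite subr_eq0; apply: contraTN sr => /eqP zw; rewrite -leNgt -rr -zr zw.
  have [d1 D1] := du z zd.
  have [d' D'] := @cder_div R (fun z => u z - u w) (fun z => z - w) z _ _ zw
    (cderB D1 (cder_cst z (u w))) (cderB (cder_id z) (cder_cst z w)).
  apply: cder_ccont; apply: cder_local D'.
  exists (modulus (z - w)); first by rewrite modulus_gt0.
  move=> z' z'z; rewrite hq mulfK// subr_eq0; apply: contraTN z'z => /eqP ->.
  by rewrite modulusBC ltxx.
have m2 := measurable_segment 0 (2 * pi : R).
have ig : cinteg leb `[0, 2 * pi] (fun t => (fun z => z * q z) (r%:C * cis t)).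
  apply: seg_cinteg; apply: (circle_seg_cont (G := fun z => z * q z)) => z zr.
  by apply: ccontM; [exact: ccont_id|exact: qcont].
pose K := (\int[leb]_(t in `[0, 2 * pi]) modulus ((fun z => z * q z) (r%:C * cis t)))%R.
have bound N : modulus (series (fun n => a n * w ^+ n) N.+1 - u w) <= (2 * pi)^-1 * K * (s / r) ^+ N.+1.
  have iu n : cinteg leb `[0, 2 * pi] (fun t => (fun z => u z * z^-1 ^+ n) (r%:C * cis t)).
    apply: seg_cinteg; apply: (circle_seg_cont (G := fun z => u z * z^-1 ^+ n)) => z zr.
    by have [zd z0] := cd r r01 z zr; have [d1 /cder_ccont] := dI n z zd z0.
  have iX n : cinteg leb `[0, 2 * pi] (fun t => (fun z => z^-1 ^+ n) (r%:C * cis t)).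
    apply: seg_cinteg; apply: (circle_seg_cont (G := fun z => z^-1 ^+ n)) => z zr.
    by have [zd z0] := cd r r01 z zr; have [d1 /cder_ccont] := cderX n (cderV z0).
  pose G z := (w * z^-1) ^+ N.+1 * (z * q z); pose E t := G (r%:C * cis t).
  have iE : cinteg leb `[0, 2 * pi] E.
    apply: seg_cinteg; apply: circle_seg_cont => z zr.
    have [zd z0] := cd r r01 z zr; apply: ccontM.
      by apply/ccontX/ccontM; [exact: ccont_cst|exact: (cder_ccont (cderV z0))].
    by apply: ccontM; [exact: ccont_id|exact: qcont].
  have X n : circle_int (fun z => z^-1 ^+ n) r = (if n is 0 then 2 * pi else 0)%:C.
    by case: n => [|n]; [rewrite (circle_int_cst 1) mul1r|rewrite circle_int_Xn].
  (* With [u z - u w = z q z (1 - w / z)], the geometric sum cancels the factor [1 - w / z] up to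
     [(w / z)^(N+1)]. *)
  have pointwise t : \sum_(n < N.+1) (w ^+ n * (u (r%:C * cis t) * (r%:C * cis t)^-1 ^+ n) -
      (u w * w ^+ n) * (r%:C * cis t)^-1 ^+ n) = (r%:C * cis t) * q (r%:C * cis t) - E t.
    rewrite /E /G; move: (modulus_circle r t); set z := r%:C * cis t => zr.
    have [zd z0] := cd r r01 z zr; have e2 := subrX1 (w / z) N.+1.
    have e1 : u z - u w = z * q z * (1 - w / z).
      by rewrite hq; field; exact: z0.
    have -> : z * q z - (w * z^-1) ^+ N.+1 * (z * q z) = - (z * q z * ((w / z) ^+ N.+1 - 1)) by ring.
    rewrite e2 mulrA -[1 - _]opprB in e1 *.
    have -> : - (z * q z * (w / z - 1) * \sum_(i < N.+1) (w / z) ^+ i) =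
       (u z - u w) * \sum_(i < N.+1) (w / z) ^+ i by rewrite e1; ring.
    by rewrite mulr_sumr; apply: eq_bigr => n _; rewrite exprMn; ring.
  have key : (2 * pi)%:C * (series (fun n => a n * w ^+ n) N.+1 - u w) =
      - Cintegral leb `[0, 2 * pi] E.
    have i1 n := cintegZ m2 (w ^+ n) (iu n).
    have i2 n := cintegZ m2 (u w * w ^+ n) (iX n).
    have i3 n : cinteg leb `[0, 2 * pi] (fun t => w ^+ n * (u (r%:C * cis t) * (r%:C * cis t)^-1 ^+ n) -
      (u w * w ^+ n) * (r%:C * cis t)^-1 ^+ n).
      have := cintegD m2 (i1 n) (cintegZ m2 (-1) (i2 n)).
      by under [X in cinteg _ _ X]eq_fun do rewrite mulN1r.
    transitivity (circle_int (fun z => z * q z) r - Cintegral leb `[0, 2 * pi] E); last by rewrite j0 sub0r.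
    rewrite /circle_int -(CintegralB m2 ig iE).
    have -> : (fun t => (r%:C * cis t) * q (r%:C * cis t) - E t) = (fun t =>
       \sum_(n < N.+1) (w ^+ n * (u (r%:C * cis t) * (r%:C * cis t)^-1 ^+ n) -
      (u w * w ^+ n) * (r%:C * cis t)^-1 ^+ n)) by apply/funext => t; rewrite pointwise.
    rewrite (Cintegral_sum m2 _ (fun n : 'I_N.+1 => i3 n)).
    have each n : Cintegral leb `[0, 2 * pi] (fun t => w ^+ n * (u (r%:C * cis t) * (r%:C * cis t)^-1 ^+ n) -
      (u w * w ^+ n) * (r%:C * cis t)^-1 ^+ n) =
      (2 * pi)%:C * (a n * w ^+ n) - (if n is 0 then (2 * pi)%:C * u w else 0).
      rewrite (CintegralB m2 (i1 n) (i2 n)) (CintegralZ m2 _ (iu n)) (CintegralZ m2 _ (iX n)).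
      have -> : Cintegral leb `[0, 2 * pi] (fun t => u (r%:C * cis t) * (r%:C * cis t)^-1 ^+ n) = I n r by [].
      rewrite -[Cintegral leb _ (fun t => (r%:C * cis t)^-1 ^+ n)]/(circle_int (fun z => z^-1 ^+ n) r) X.
      rewrite (Ic _ _ r01) /a mulrA mulrA -realCM divff ?gt_eqF ?mulr_gt0 ?pi_gt0// mul1r [I _ _ * _]mulrC.
      by case: n => [|n]; rewrite ?mulr0 ?expr0 ?mulr1 ?[u w * _]mulrC.
    under eq_bigr do rewrite each.
    rewrite sumrB -mulr_sumr mulrBr; congr (_ - _); first by rewrite /series /= big_mkord.
    by rewrite big_ord_recl /= big1 ?addr0// => i _.
  have p0 : 0 < 2 * pi :> R by rewrite mulr_gt0// pi_gt0.
  rewrite -(ler_pM2l p0) -[X in X * _ <= _]gtr0_norm// -modulusR -modulusM key modulusN.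
  rewrite !mulrA divff ?gt_eqF// mul1r [K * _]mulrC.
  have h := le_modulus_Cintegral m2 iE; apply: (le_trans h).
  have im := cinteg_modulus m2 ig.
  rewrite /K -RintegralZl//; under eq_Rintegral do rewrite /E /G modulusM modulusX modulusM modulusV modulus_circle rr -/s.
  exact: lexx.
have sr0 : 0 <= s / r by rewrite divr_ge0// ltW.
have sr1 : `|s / r| < 1 by rewrite ger0_norm// ltr_pdivrMr// mul1r.
apply/nearC => e e0.
have : (2 * pi)^-1 * K * (s / r) ^+ n @[n --> \oo] --> (2 * pi)^-1 * K * 0.
  by apply: cvgM; [exact: cvg_cst|exact: cvg_expr].
rewrite mulr0 => /cvgrPdist_lt/(_ e e0)[N _ hN]; exists N.+1 => // -[//|n] /= Nn.
apply: (le_lt_trans (bound n)); apply: le_lt_trans (hN n.+1 (leq_trans (leqnSn _) Nn)).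
by rewrite sub0r normrN ler_norm.
Qed.

End taylor.

(** * Affine substitutions and the Haar measure of the multiplicative group *)

Section line_substitution.
Context (R : realType).
Implicit Types (a b c t x y : R).
Local Notation T1 := (measurableTypeR R).
Local Open Scope ereal_scope.

Definition affine_map c a : T1 -> T1 := fun x => (c * x + a)%R.

Lemma measurable_affine_map c a : measurable_fun setT (affine_map c a).
Proof. by apply: measurable_funD => //; exact: measurable_funM. Qed.

HB.instance Definition _ c a :=
  isMeasurableFun.Build _ _ _ _ (affine_map c a) (measurable_affine_map c a).

(** Lebesgue measure is determined by its values on intervals, and [|c|] times its image under the
    affine map has the same ones. *)
Lemma integral_affine (F : T1 -> \bar R) c a : c != 0%R -> measurable_fun setT F ->
  (forall x, 0 <= F x) ->
  \int[leb]_x F (c * x + a)%R = `|c|^-1%:E * \int[leb]_x F x.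
Proof.
move=> c0 mF F0; have cn0 : (0 < `|c|)%R by rewrite normr_gt0.
pose k : {nonneg R} := NngNum (normr_ge0 c).
have H A : measurable A -> leb A = mscale k (pushforward leb (affine_map c a)) A.
  apply: lebesgue_measure_unique => X /ocitvP[->|[[u v] /= uv ->]].
    by rewrite !measure0.
  rewrite /mscale /= /pushforward lebesgue_measure_itv /= lte_fin uv.
  have [cp|] := ltP 0%R c; last first.
    rewrite le_eqVlt (negPf c0) /= => cn.
    have -> : affine_map c a @^-1` `]u, v]%classic = `[((v - a) / c)%R, ((u - a) / c)%R[%classic.
      apply/seteqP; split=> x /=; rewrite !in_itv/= /affine_map ler_ndivrMr// ltr_ndivlMr// => /andP[? ?];
        apply/andP; split; lra.
    rewrite lebesgue_measure_itv /= lte_fin ltr_nM2r ?invr_lt0// ltrD2r uv.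
    by rewrite ltr0_norm// -!EFinB -EFinM; congr EFin; field.
  have -> : affine_map c a @^-1` `]u, v]%classic = `]((u - a) / c)%R, ((v - a) / c)%R]%classic.
    apply/seteqP; split=> x /=; rewrite !in_itv/= /affine_map ler_pdivlMr// ltr_pdivrMr// => /andP[? ?];
      apply/andP; split; lra.
  rewrite lebesgue_measure_itv /= lte_fin ltr_pM2r ?invr_gt0// ltrD2r uv.
  by rewrite gtr0_norm// -!EFinB -EFinM; congr EFin; field.
rewrite [X in _ = _ * X](@eq_measure_integral _ _ _ _ (mscale k (pushforward leb (affine_map c a))) leb); last first.
  by move=> A mA _; exact: H.
rewrite ge0_integral_mscale// ge0_integral_pushforward//=.
by rewrite muleA -EFinM mulVf ?gt_eqF// mul1e preimage_setT.
Qed.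

Lemma ae_neq0 : {ae leb, forall x : T1, x != 0%R}.
Proof.
exists [set 0%R]; split; [exact: measurable_set1|exact: lebesgue_measure_set1|].
by move=> x /= /negP; rewrite negbK => /eqP.
Qed.

Lemma eq_integral_neq0 (F G : T1 -> \bar R) : measurable_fun setT F -> measurable_fun setT G ->
  (forall x, 0 <= F x) -> (forall x, 0 <= G x) -> (forall x, x != 0%R -> F x = G x) ->
  \int[leb]_x F x = \int[leb]_x G x.
Proof.
move=> mF mG F0 G0 FG; apply: ge0_ae_eq_integral => //.
by have := ae_neq0; apply: filterS => x x0 _; exact: FG.
Qed.

Lemma measurable_invr : measurable_fun setT (fun x : T1 => x^-1%R : T1).
Proof.
rewrite (_ : (fun x : T1 => x^-1%R) = (fun x : T1 => (x * (`|x| `^ (-2)))%R)).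
  apply: measurable_funM => //.
  apply: (measurableT_comp (f := fun x : R => (x `^ (-2))%R)); last exact: normr_measurable.
  exact: measurable_powR.
apply/funext => x; have [->|x0] := eqVneq x 0%R; first by rewrite invr0 mul0r.
rewrite powRN powR_mulrn// real_normK ?num_real//; field; exact: x0.
Qed.

(** The integral against [dx / |x|], invariant under scaling. The inversions of the line and of the
    plane are both reduced to this invariance. *)
Definition haar_int (F : T1 -> \bar R) := \int[leb]_x (F x * `|x|^-1%:E).

Let mabsV : measurable_fun setT (fun x : T1 => `|x|^-1%R : R).
Proof.
apply: (measurableT_comp (f := fun x : T1 => x^-1%R : T1)); first exact: measurable_invr.
exact: normr_measurable.
Qed.

Let mabsVE : measurable_fun setT (fun x : T1 => (`|x|^-1)%:E : \bar R).
Proof. by apply/measurable_EFinP; exact: mabsV. Qed.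

Let abs0 x : 0 <= (`|x|^-1)%:E :> \bar R.
Proof. by rewrite lee_fin invr_ge0. Qed.

(* The density vanishes at 0, where the inverse is 0. *)
Lemma eq_haar (F G : T1 -> \bar R) : (forall x, x != 0%R -> F x = G x) ->
  haar_int F = haar_int G.
Proof.
move=> FG; apply: eq_integral => x _; have [->|x0] := eqVneq x 0%R.
  by rewrite normr0 invr0 !mule0.
by rewrite FG.
Qed.

Lemma haarZ (c : \bar R) (F : T1 -> \bar R) : 0 <= c -> measurable_fun setT F ->
  (forall x, 0 <= F x) -> haar_int (fun x => c * F x) = c * haar_int F.
Proof.
move=> c0 mF F0; rewrite /haar_int; under eq_integral do rewrite -muleA.
rewrite ge0_integralZl//; first by apply: emeasurable_funM => //; exact: mabsVE.
by move=> x _; rewrite mule_ge0.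
Qed.

Lemma haar_ge0 (F : T1 -> \bar R) : (forall x, 0 <= F x) -> 0 <= haar_int F.
Proof. by move=> F0; apply: integral_ge0 => x _; rewrite mule_ge0. Qed.

Lemma measurable_haar (F : T1 * T1 -> \bar R) : measurable_fun setT F -> (forall p, 0 <= F p) ->
  measurable_fun setT (fun y => haar_int (fun x => F (x, y))).
Proof.
move=> mF F0.
apply: (measurable_fun_fubini_tonelli_G (m1 := leb) (fun p : T1 * T1 => F p * `|p.1|^-1%:E)).
  by apply: emeasurable_funM => //; exact: (measurableT_comp mabsVE measurable_fst).
by move=> p; rewrite mule_ge0.
Qed.

Lemma haar_swap (F : T1 * T1 -> \bar R) : measurable_fun setT F -> (forall p, 0 <= F p) ->
  haar_int (fun x => haar_int (fun y => F (x, y))) =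
  haar_int (fun y => haar_int (fun x => F (x, y))).
Proof.
move=> mF F0; rewrite /haar_int.
have E1 x : (\int[leb]_y (F (x, y) * `|y|^-1%:E)) * `|x|^-1%:E =
    \int[leb]_y (F (x, y) * `|y|^-1%:E * `|x|^-1%:E).
  rewrite ge0_integralZr//; last by move=> y _; rewrite mule_ge0.
  by apply: emeasurable_funM; [exact: (measurable_fun_pair2 x mF)|exact: mabsVE].
have E2 y : (\int[leb]_x (F (x, y) * `|x|^-1%:E)) * `|y|^-1%:E =
    \int[leb]_x (F (x, y) * `|y|^-1%:E * `|x|^-1%:E).
  under [RHS]eq_integral do rewrite muleAC.
  rewrite ge0_integralZr//; last by move=> x _; rewrite mule_ge0.
  by apply: emeasurable_funM; [exact: (measurable_fun_pair1 y mF)|exact: mabsVE].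
under eq_integral do rewrite E1; under [RHS]eq_integral do rewrite E2.
apply: (fubini_tonelli (m1 := leb) (m2 := leb)
  (fun p : T1 * T1 => F p * `|p.2|^-1%:E * `|p.1|^-1%:E)).
  apply: emeasurable_funM; first apply: emeasurable_funM => //.
    exact: (measurableT_comp mabsVE measurable_snd).
  exact: (measurableT_comp mabsVE measurable_fst).
by move=> p; rewrite !mule_ge0.
Qed.

Lemma haar_scale (F : T1 -> \bar R) c : c != 0%R -> measurable_fun setT F ->
  (forall x, 0 <= F x) -> haar_int (fun x => F (c * x)%R) = haar_int F.
Proof.
move=> c0 mF F0; rewrite /haar_int.
have wF x : 0 <= F x * `|x|^-1%:E by rewrite mule_ge0.
have E := @integral_affine (fun x => F x * (`|x|^-1)%:E) c 0 c0 (emeasurable_funM mF mabsVE) wF.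
have cn : `|c|%:E * `|c|^-1%:E = 1 :> \bar R by rewrite -EFinM mulfV// normr_eq0.
rewrite -[RHS]mul1e -cn -muleA -E -ge0_integralZl_EFin//.
- by apply: eq_integral => x _; rewrite addr0 normrM invfM EFinM muleCA [X in _ = _ * X]muleA cn mul1e.
- apply: emeasurable_funM; last apply: (measurableT_comp mabsVE); last exact: measurable_affine_map.
  apply: (measurableT_comp mF); exact: measurable_affine_map.
Qed.

(* Uniqueness of the Haar measure of the multiplicative group. *)
Lemma haar_inv (F : T1 -> \bar R) : measurable_fun setT F -> (forall x, 0 <= F x) ->
  haar_int (fun x => F (x^-1)%R) = haar_int F.
Proof.
(* A density with [haar_int g = 1]. Inserting [g (x y)] integrated over [y], exchanging the
   integrals and rescaling [x] by [y] turns [F (1 / x)] into [F (y / x)]; rescaling [y] by [x] then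
   removes the inversion. *)
move=> mF F0; pose g (x : T1) : \bar R := (`|x| * \1_(`[1, 2]%classic : set T1) x)%:E.
have g0 x : 0 <= g x by rewrite lee_fin mulr_ge0.
have mg : measurable_fun setT g.
  apply: measurable_EFinM; first exact: normr_measurable.
  exact: measurable_indic.
have g1 : haar_int g = 1.
  rewrite /haar_int; transitivity (\int[leb]_x (\1_(`[1%R, 2%R]%classic : set T1) x)%:E).
    apply: eq_integral => x _; rewrite /g -EFinM indicE.
    case: (boolP (x \in _)) => [|_]; last by rewrite mulr0 mul0r.
    rewrite inE /= in_itv/= => /andP[x1 _]; rewrite mulr1 divff// normr_eq0 gt_eqF//.
    exact: lt_le_trans x1.
  rewrite integral_indic//= setIT lebesgue_measure_itv /= lte_fin ltr1n/= -EFinB.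
  by congr EFin; lra.
have mFV : measurable_fun setT (fun x => F (x^-1)%R) by exact: (measurableT_comp mF measurable_invr).
have mf1 : measurable_fun setT (fst : T1 * T1 -> T1) by exact: measurable_fst.
have mf2 : measurable_fun setT (snd : T1 * T1 -> T1) by exact: measurable_snd.
have mm : measurable_fun setT (fun p : T1 * T1 => p.1 * p.2 : T1)%R by exact: measurable_funM.
have md : measurable_fun setT (fun p : T1 * T1 => p.2 / p.1 : T1)%R.
  by apply: measurable_funM => //; exact: (measurableT_comp measurable_invr).
have mdx (y : T1) : measurable_fun setT (fun x : T1 => y / x : T1)%R.
  by apply: measurable_funM => //; exact: measurable_invr.
transitivity (haar_int (fun x => haar_int (fun y => F (x^-1)%R * g (x * y)%R))).
  apply: eq_haar => x x0; rewrite haarZ//; last exact: (measurableT_comp mg (measurable_funM _ _)).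
  by rewrite haar_scale// g1 mule1.
rewrite (haar_swap (F := fun p : T1 * T1 => F (p.1^-1)%R * g (p.1 * p.2)%R)); last 2 first.
- apply: emeasurable_funM; first exact: (measurableT_comp mFV mf1).
  exact: (measurableT_comp mg mm).
- by move=> p; rewrite mule_ge0.
transitivity (haar_int (fun y => haar_int (fun x => F (y / x)%R * g x))).
  apply: eq_haar => y y0.
  rewrite -(haar_scale (F := fun x => F (y / x)%R * g x) y0); last 2 first.
  - by apply: emeasurable_funM => //; exact: (measurableT_comp mF (mdx y)).
  - by move=> x; rewrite mule_ge0.
  apply: eq_haar => x x0; rewrite [(y * x)%R]mulrC; congr (F _ * _).
  by rewrite /= invfM mulrCA mulfV// mulr1.
rewrite -(haar_swap (F := fun p : T1 * T1 => F (p.2 / p.1)%R * g p.1)); last 2 first.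
- apply: emeasurable_funM; first exact: (measurableT_comp mF md).
  exact: (measurableT_comp mg mf1).
- by move=> p; rewrite mule_ge0.
transitivity (haar_int (fun x => haar_int F * g x)).
  apply: eq_haar => x x0; under [X in haar_int X]eq_fun do rewrite muleC mulrC /=.
  rewrite haarZ//; last exact: (measurableT_comp mF (measurable_funM _ _)).
  by rewrite haar_scale ?invr_eq0// muleC.
by rewrite haarZ ?g1 ?mule1// haar_ge0.
Qed.

End line_substitution.

(** * Substitution by Moebius maps in the plane *)

Section plane_substitution.
Context (R : realType).
Implicit Types (F : R[i] -> \bar R) (c x y t : R) (b z w : R[i]).
Local Notation T1 := (measurableTypeR R).
Local Notation Re := complex.Re.
Local Notation Im := complex.Im.
Local Open Scope ereal_scope.

Definition pmeas F := measurable_fun setT (F \o @plane_point R).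

Definition pint F := \int[area]_p F (plane_point p).

Lemma pmeas_comp F (h : R[i] -> R[i]) : pmeas F ->
  cmeas setT (h \o @plane_point R) -> pmeas (F \o h).
Proof.
move=> mF [mr mi].
have := measurableT_comp mF (measurable_fun_pair mr mi).
by congr (measurable_fun _ _); apply/funext => p; rewrite /= /plane_point /= -complexE.
Qed.

Lemma pmeasM F G : pmeas F -> pmeas G ->
  pmeas (fun z => F z * G z).
Proof. exact: emeasurable_funM. Qed.

Lemma pmeas_EFin (g : R[i] -> R) :
  measurable_fun setT (g \o @plane_point R) -> pmeas (fun z => (g z)%:E).
Proof. by move=> mg; apply/measurable_EFinP. Qed.

Lemma pintZ F (k : R) : (0 <= k)%R -> pmeas F -> (forall z, 0 <= F z) ->
  pint (fun z => k%:E * F z) = k%:E * pint F.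
Proof. by move=> k0 mF F0; exact: ge0_integralZl_EFin. Qed.

Lemma cmeas_point : cmeas setT (@plane_point R).
Proof. by split; [exact: measurable_fst|exact: measurable_snd]. Qed.

Lemma cmeas_inv d (T : measurableType d) (h : T -> R[i]) : cmeas setT h ->
  cmeas setT (fun s => (h s)^-1%R).
Proof.
move=> mh; have mm := measurableT_comp (@measurable_invr R) (meas_modulus2 mh).
have := cmeasM (cmeas_conj mh) (cmeas_real mm).
congr (cmeas _ _); apply/funext => x /=; have [->|h0] := eqVneq (h x) 0%R.
  by rewrite invr0 raddf0 mul0r.
apply: (mulIf h0); rewrite mulVf// mulrAC [X in (X * _)%R]mulrC mulC_conj -realCM mulfV//.
by rewrite sqrf_eq0 modulus_eq0.
Qed.

Lemma iterated_yx F : pmeas F -> (forall z, 0 <= F z) ->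
  pint F = \int[leb]_x \int[leb]_y F (x +i* y)%C.
Proof. by move=> mF F0; exact: (fubini_tonelli1 (m1 := leb) (m2 := leb) (F \o @plane_point R) mF (fun p => F0 _)). Qed.

Lemma iterated_xy F : pmeas F -> (forall z, 0 <= F z) ->
  pint F = \int[leb]_y \int[leb]_x F (x +i* y)%C.
Proof. by move=> mF F0; exact: (fubini_tonelli2 (m1 := leb) (m2 := leb) (F \o @plane_point R) mF (fun p => F0 _)). Qed.

Lemma pmeas_section1 F x : pmeas F ->
  measurable_fun setT (fun y : T1 => F (x +i* y)%C).
Proof. by move=> mF; exact: (measurable_fun_pair2 x mF). Qed.

Lemma pmeas_section2 F y : pmeas F ->
  measurable_fun setT (fun x : T1 => F (x +i* y)%C).
Proof. by move=> mF; exact: (measurable_fun_pair1 y mF). Qed.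

Let mx : measurable_fun setT (fst : T1 * T1 -> T1). Proof. exact: measurable_fst. Qed.
Let my : measurable_fun setT (snd : T1 * T1 -> T1). Proof. exact: measurable_snd. Qed.

Definition shear_x c (a : T1 -> T1) z : R[i] := (c * Re z + a (Im z))%R +i* Im z.
Definition shear_y c (a : T1 -> T1) z : R[i] := Re z +i* (c * Im z + a (Re z))%R.

Lemma cmeas_shear_x c (a : T1 -> T1) : measurable_fun setT a ->
  cmeas setT (shear_x c a \o @plane_point R).
Proof.
move=> ma; split; last exact: my.
by apply: measurable_funD; [exact: measurable_funM|exact: (measurableT_comp ma my)].
Qed.

Lemma cmeas_shear_y c (a : T1 -> T1) : measurable_fun setT a ->
  cmeas setT (shear_y c a \o @plane_point R).
Proof.
move=> ma; split; first exact: mx.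
by apply: measurable_funD; [exact: measurable_funM|exact: (measurableT_comp ma mx)].
Qed.

Lemma pint_shear_x F c (a : T1 -> T1) : c != 0%R -> measurable_fun setT a ->
  pmeas F -> (forall z, 0 <= F z) ->
  pint (F \o shear_x c a) = `|c|^-1%:E * pint F.
Proof.
move=> c0 ma mF F0; have mG := pmeas_comp mF (cmeas_shear_x c ma).
have G0 z : 0 <= (F \o shear_x c a) z by exact: F0.
rewrite (iterated_xy mG G0) (iterated_xy mF F0) -ge0_integralZl_EFin ?invr_ge0//; last 2 first.
- by move=> y _; apply: integral_ge0.
- exact: (measurable_fun_fubini_tonelli_G (m1 := leb) (F \o @plane_point R) mF (fun=> F0 _)).
apply: eq_integral => y _; rewrite -(integral_affine (a y) c0)//.
exact: pmeas_section2.
Qed.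

Lemma pint_shear_y F c (a : T1 -> T1) : c != 0%R -> measurable_fun setT a ->
  pmeas F -> (forall z, 0 <= F z) ->
  pint (F \o shear_y c a) = `|c|^-1%:E * pint F.
Proof.
move=> c0 ma mF F0; have mG := pmeas_comp mF (cmeas_shear_y c ma).
have G0 z : 0 <= (F \o shear_y c a) z by exact: F0.
rewrite (iterated_yx mG G0) (iterated_yx mF F0) -ge0_integralZl_EFin ?invr_ge0//; last 2 first.
- by move=> y _; apply: integral_ge0.
- exact: (measurable_fun_fubini_tonelli_F (m2 := leb) (F \o @plane_point R) mF (fun=> F0 _)).
apply: eq_integral => y _; rewrite -(integral_affine (a y) c0)//.
exact: pmeas_section1.
Qed.

Lemma cmeas_affine (a b : R[i]) :
  cmeas setT ((fun z => a * z + b)%R \o @plane_point R).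
Proof.
by apply: cmeasD; [apply: cmeasM|]; [exact: cmeas_cst|exact: cmeas_point|exact: cmeas_cst].
Qed.

Lemma pint_shift F b : pmeas F -> (forall z, 0 <= F z) ->
  pint (fun z => F (z + b)%R) = pint F.
Proof.
move=> mF F0; have m c : measurable_fun setT (fun _ : T1 => c : T1) by exact: measurable_cst.
have c1 : 1%R != 0%R :> R by exact: oner_neq0.
have E : (fun z => F (z + b)%R) = (F \o shear_y 1 (fun=> Im b)) \o shear_x 1 (fun=> Re b).
  apply/funext => z /=; congr F; apply: complexP; rewrite /shear_x /shear_y /= mul1r.
    by rewrite ReD.
  by rewrite ImD.
have G0 z : 0 <= (F \o shear_y 1 (fun=> Im b)) z by exact: F0.
rewrite E pint_shear_x// ?pint_shear_y// ?normr1 ?invr1 ?mul1e//.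
exact: (pmeas_comp mF (cmeas_shear_y _ _)).
Qed.

(** Multiplication by [b = p + i q] with [p != 0] is a horizontal shear followed by a vertical one,
    of determinants [p] and [|b|^2 / p]. *)
Let mul_re F b : Re b != 0%R -> pmeas F -> (forall z, 0 <= F z) ->
  pint (fun z => F (b * z)%R) = (modulus b ^- 2)%:E * pint F.
Proof.
move=> p0 mF F0; set p := Re b in p0 *; set q := Im b.
have ml c : measurable_fun setT (fun t : T1 => c * t : T1)%R by exact: measurable_funM.
have b0 : (modulus b ^+ 2 != 0)%R.
  by rewrite sqrf_eq0 modulus_eq0; apply: contra p0 => /eqP b0; rewrite /p b0.
have E : (fun z => F (b * z)%R) =
    (F \o shear_y (modulus b ^+ 2 / p) (fun t => q / p * t)%R) \o shear_x p (fun t => - q * t)%R.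
  apply/funext => z /=; congr F; apply: complexP; rewrite /shear_x /shear_y /=.
    by rewrite ReM mulNr.
  by rewrite ImM modulus_sqr -/p -/q; field.
have c0 : (modulus b ^+ 2 / p != 0)%R by rewrite mulf_neq0// invr_eq0.
have G0 z : 0 <= (F \o shear_y (modulus b ^+ 2 / p) (fun t => q / p * t)%R) z by exact: F0.
rewrite E pint_shear_x ?pint_shear_y//; last exact: (pmeas_comp mF (cmeas_shear_y _ _)).
rewrite muleA -EFinM; congr (EFin _ * _).
rewrite normrM normfV [X in (_ * (X * _)^-1)%R]ger0_norm ?sqr_ge0// invfM invrK mulrCA mulVf ?mulr1//.
by rewrite normr_eq0.
Qed.

Lemma pint_mul F b : b != 0%R -> pmeas F -> (forall z, 0 <= F z) ->
  pint (fun z => F (b * z)%R) = (modulus b ^- 2)%:E * pint F.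
Proof.
move=> b0 mF F0; have [p0|] := eqVneq (Re b) 0%R; last by move=> p0; exact: mul_re.
(* For purely imaginary [b] the shears degenerate, but both [v = 1 + i] and [b / v] have a nonzero
   real part. *)
pose v : R[i] := 1%R +i* 1%R.
have v0 : v != 0%R by apply/eqP => /(congr1 (@complex.Re R))/eqP; rewrite /= oner_eq0.
have Eb : b = (v * (b / v))%R by rewrite mulrCA mulfV// mulr1.
have q0 : Re (b / v)%R != 0%R.
  apply: contra b0 => /eqP h.
  have e1 : Re b = (Re (b / v) - Im (b / v))%R by rewrite {1}Eb [in LHS]ReM /v /= !mul1r.
  have e2 : Im b = (Im (b / v) + Re (b / v))%R by rewrite {1}Eb [in LHS]ImM /v /= !mul1r.
  move: e1 e2; rewrite h p0 sub0r addr0 => /esym/eqP; rewrite oppr_eq0 => /eqP -> e2.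
  by rewrite (complexE b) p0 e2.
have -> : (fun z => F (b * z)%R) = (fun z => (fun z => F (v * z)%R) ((b / v) * z)%R).
  by apply/funext => z; rewrite mulrA -Eb.
rewrite (mul_re (F := fun z => F (v * z)%R) q0)//; last first.
  apply: (pmeas_comp mF); apply: cmeasM; [exact: cmeas_cst|exact: cmeas_point].
rewrite mul_re ?oner_eq0//= muleA -EFinM; congr (EFin _ * _).
have -> : modulus b = (modulus v * modulus (b / v))%R by rewrite -modulusM -Eb.
by rewrite [in RHS]exprMn [in RHS]invfM mulrC.
Qed.

Lemma pint_affine F (a b : R[i]) : a != 0%R -> pmeas F -> (forall z, 0 <= F z) ->
  pint (fun z => F (a * z + b)%R) = (modulus a ^- 2)%:E * pint F.
Proof.
move=> a0 mF F0; rewrite -(pint_shift b mF)//.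
apply: (pint_mul (F := fun z => F (z + b)%R)) => //.
apply: (pmeas_comp mF); have := cmeas_affine 1%R b.
by congr cmeas; apply/funext => p /=; rewrite mul1r.
Qed.

(* The substitution y = x t. *)
Lemma pint_haar F : pmeas F -> (forall z, 0 <= F z) ->
  pint F = \int[leb]_t haar_int (fun x => (x ^+ 2)%:E * F (x +i* (x * t)%R)%C).
Proof.
move=> mF F0; rewrite (iterated_yx mF F0).
have mray : cmeas setT (fun p : T1 * T1 => p.1 +i* (p.1 * p.2)%R).
  by split=> //; exact: measurable_funM.
have mFr : measurable_fun setT (fun p : T1 * T1 => F (p.1 +i* (p.1 * p.2)%R)%C).
  exact: (measurableT_comp mF (measurable_fun_pair mray.1 mray.2)).
have mFx : measurable_fun setT (fun p : T1 * T1 => `|p.1|%:E : \bar R).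
  by apply/measurable_EFinP; exact: (measurableT_comp (@normr_measurable _ _) mx).
have m2 := emeasurable_funM mFx mFr.
transitivity (\int[leb]_x \int[leb]_t (`|x|%:E * F (x +i* (x * t)%R)%C)).
  apply: eq_integral_neq0.
  - exact: (measurable_fun_fubini_tonelli_F (m2 := leb) (F \o @plane_point R) mF (fun=> F0 _)).
  - by apply: (measurable_fun_fubini_tonelli_F (m2 := leb) (fun p : T1 * T1 => `|p.1|%:E * F (p.1 +i* (p.1 * p.2)%R)%C) m2) => p; rewrite mule_ge0.
  - by move=> x; apply: integral_ge0.
  - by move=> x; apply: integral_ge0 => t _; rewrite mule_ge0.
  - move=> x x0; rewrite ge0_integralZl_EFin//; last exact: (measurable_fun_pair2 x mFr).
    have := @integral_affine _ (fun y => F (x +i* y)%C) x 0 x0 (pmeas_section1 x mF) (fun=> F0 _).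
    under [X in X = _ -> _]eq_integral do rewrite addr0.
    by move=> ->; rewrite muleA -EFinM mulfV ?normr_eq0// mul1e.
rewrite (fubini_tonelli (m1 := leb) (m2 := leb) (fun p : T1 * T1 => `|p.1|%:E * F (p.1 +i* (p.1 * p.2)%R)%C) m2); last by move=> p; rewrite mule_ge0.
apply: eq_integral => t _; apply: eq_integral => x _.
rewrite /= muleAC -EFinM; congr (EFin _ * _).
have [->|x0] := eqVneq x 0%R; first by rewrite normr0 invr0 mulr0.
by rewrite -real_normK ?num_real// expr2 mulfK// normr_eq0.
Qed.

Lemma haar_ray_measurable F (g : T1 -> R[i]) : pmeas F -> cmeas setT g ->
  measurable_fun setT (fun x : T1 => (x ^+ 2)%:E * F (g x)).
Proof.
move=> mF mg; apply: emeasurable_funM.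
  by apply/measurable_EFinP; exact: measurable_funX.
have := measurableT_comp mF (measurable_fun_pair mg.1 mg.2).
by congr measurable_fun; apply/funext => x; rewrite /= /plane_point /= -complexE.
Qed.

(** In the coordinates [x] and [t = y / x] of [pint_haar] the inversion sends [t] to [-t] and [x] to
    [1 / ((1 + t^2) x)]: a scaling and an inversion of the line, both neutral for [haar_int]. *)
Lemma pint_inv F : pmeas F -> (forall z, 0 <= F z) ->
  pint (fun z => F z^-1%R * (modulus z ^- 4)%:E) = pint F.
Proof.
move=> mF F0.
have F0' z : 0 <= F z^-1%R * (modulus z ^- 4)%:E by rewrite mule_ge0// lee_fin invr_ge0 exprn_ge0// modulus_ge0.
have mV : cmeas setT (@plane_point R) := cmeas_point.
have mG : pmeas (fun z => F z^-1%R * (modulus z ^- 4)%:E).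
  apply: pmeasM; first exact: (pmeas_comp mF (cmeas_inv mV)).
  apply: pmeas_EFin; apply: (measurableT_comp (@measurable_invr R)).
  exact: (measurable_funX _ (measurable_modulus mV)).
rewrite (pint_haar mG F0') (pint_haar mF F0).
pose H t := haar_int (fun x => (x ^+ 2)%:E * F (x +i* (x * t)%R)%C).
have mray t : cmeas setT (fun x : T1 => x +i* (x * t)%R).
  split; first exact: measurable_id.
  by apply: measurable_funM; [exact: measurable_id|exact: measurable_cst].
transitivity (\int[leb]_t H (- t)%R).
  apply: eq_integral => t _; pose k := (1 + t ^+ 2)%R.
  have k0 : (k != 0)%R by rewrite gt_eqF// ltr_pwDl// sqr_ge0.
  pose h (x : T1) := (x ^+ 2)%:E * F (x +i* (x * - t)%R)%C.
  have mh : measurable_fun setT h by exact: (haar_ray_measurable mF (mray _)).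
  have h0 x : 0 <= h x by rewrite mule_ge0// lee_fin sqr_ge0.
  rewrite /H -/(haar_int h) -(haar_inv mh h0) -(haar_scale (F := fun x => h x^-1%R) k0)//; last exact: (measurableT_comp mh (@measurable_invr R)).
  apply: eq_haar => x x0; rewrite /h.
  have z0 : (x ^+ 2 + (x * t) ^+ 2 != 0)%R.
    by rewrite exprMn -[X in (X + _)%R]mulr1 -mulrDr mulf_neq0// sqrf_eq0.
  have -> : ((x +i* (x * t)%R)%C^-1 = (k * x)^-1 +i* ((k * x)^-1 * - t))%R.
    have e : ((x +i* (x * t)) * ((k * x)^-1 +i* ((k * x)^-1 * - t)) = 1)%R.
      by apply: complexP; rewrite ?ReM ?ImM /= /k; field; rewrite x0 k0.
    have w0 : (x +i* (x * t)%R)%C != 0%R by rewrite -modulus_eq0 -sqrf_eq0 modulus_sqr.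
    by apply: (mulfI w0); rewrite e mulfV.
  rewrite muleCA -EFinM muleC; congr (EFin _ * _).
  rewrite (_ : 4%N = (2 * 2)%N)// exprM modulus_sqr /= /k; field.
  by rewrite k0 x0 exprMn -[X in (X + _)%R]mulr1 -mulrDr mulf_neq0// sqrf_eq0.
have m1 : (-1)%R != 0%R :> R by rewrite oppr_eq0 oner_neq0.
have F2 (p : T1 * T1) : 0 <= (p.1 ^+ 2)%:E * F (p.1 +i* (p.1 * p.2)%R)%C.
  by rewrite mule_ge0// lee_fin sqr_ge0.
have mH : measurable_fun setT H.
  apply: (measurable_haar (F := fun p => (p.1 ^+ 2)%:E * F (p.1 +i* (p.1 * p.2)%R)%C) _ F2).
  apply: emeasurable_funM; first by apply/measurable_EFinP; exact: measurable_funX.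
  have mr : measurable_fun setT (fun p : T1 * T1 => p.1 * p.2)%R by exact: measurable_funM.
  exact: (measurableT_comp mF (measurable_fun_pair mx mr)).
have H0 t : 0 <= H t by apply: haar_ge0 => x; exact: (F2 (x, t)).
have := integral_affine 0 m1 mH H0; rewrite normrN1 invr1 mul1e => <-.
by apply: eq_integral => t _; rewrite addr0 mulN1r.
Qed.

Lemma conjC0 : (0 : R[i])^*%R = 0%R. Proof. exact: rmorph0. Qed.
Lemma mobiusE w z : mobius w z = ((z - w) / (1 - w^* * z))%R. Proof. by []. Qed.

Lemma cmeas_mobius w : cmeas setT (mobius w \o @plane_point R).
Proof.
apply: cmeasM; first by have := cmeas_affine 1%R (- w)%R; congr cmeas; apply/funext => p /=; rewrite mul1r.
apply: cmeas_inv; have := cmeas_affine (- w^*)%R 1%R.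
by congr cmeas; apply/funext => p /=; rewrite mulNr addrC.
Qed.

(* A Moebius map is composed of two affine maps and an inversion. *)
Lemma pint_mobius F w : (modulus w < 1)%R -> pmeas F -> (forall z, 0 <= F z) ->
  pint (fun z => F (mobius w z) *
    (((1 - modulus w ^+ 2) / modulus (1 - w^* * z) ^+ 2) ^+ 2)%:E) = pint F.
Proof.
move=> w1 mF F0; have [->|w0] := eqVneq w 0%R.
  congr pint; apply/funext => z.
  by rewrite mobiusE conjC0 mul0r modulus0 expr0n /= !subr0 modulus1 expr1n !divr1 expr1n mule1.
have d0 : (1 - modulus w ^+ 2 != 0)%R.
  by rewrite subr_eq0 eq_sym lt_eqF// expr_lt1// modulus_ge0.
have wc0 : (w^* != 0)%R by rewrite -modulus_eq0 modulus_conj modulus_eq0.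
(* Partial fractions: [mobius w z = A / (1 - conj w z) + B]. They degenerate at [w = 0], which has
   been settled. *)
pose A := ((1 - modulus w ^+ 2)%:C / w^*)%R; pose B := (- w^*^-1)%R.
have A0 : A != 0%R by rewrite mulf_neq0 ?invr_eq0// -modulus_eq0 modulusR normr_eq0.
have mAff a b : pmeas (fun z => F (a * z + b)%R).
  exact: (pmeas_comp mF (cmeas_affine _ _)).
have F0V z : 0 <= F (A * z^-1 + B)%R * (modulus z ^- 4)%:E.
  by rewrite mule_ge0// lee_fin invr_ge0 exprn_ge0// modulus_ge0.
have mV : cmeas setT (@plane_point R) := cmeas_point.
have mFV : pmeas (fun z => F (A * z^-1 + B)%R * (modulus z ^- 4)%:E).
  apply: pmeasM; first exact: (pmeas_comp (mAff A B) (cmeas_inv mV)).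
  apply: pmeas_EFin; apply: (measurableT_comp (@measurable_invr R)).
  exact: (measurable_funX _ (measurable_modulus mV)).
have N0 : (- w^* != 0)%R by rewrite oppr_eq0.
have mG : pmeas (fun z => F (A * (- w^* * z + 1)^-1 + B)%R * (modulus (- w^* * z + 1) ^- 4)%:E).
  by apply: (pmeas_comp mFV); exact: cmeas_affine.
have := pint_inv (mAff A B) (fun=> F0 _).
have := pint_affine 1%R N0 mFV F0V => /= E1 E2.
rewrite E2 (pint_affine B A0 mF F0) modulusN modulus_conj in E1.
transitivity (pint (fun z => ((1 - modulus w ^+ 2) ^+ 2)%:E *
    (F (A * (- w^* * z + 1)^-1 + B)%R * (modulus (- w^* * z + 1) ^- 4)%:E))).
  congr pint; apply/funext => z.
  have [e|e] := eqVneq (1 - w^* * z)%R 0%R.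
    have e' : (- w^* * z + 1 = 0)%R by rewrite mulNr addrC.
    by rewrite e e' modulus0 !expr0n /= invr0 mulr0 expr0n /= !mule0.
  have e' : (- w^* * z + 1 = 1 - w^* * z)%R by rewrite mulNr addrC.
  rewrite e' muleCA -EFinM; congr (F _ * EFin _).
    rewrite mobiusE /A /B realCB -mulC_conj.
    by field; rewrite e wc0.
  by rewrite expr_div_n -exprM.
rewrite pintZ ?sqr_ge0// E1.
rewrite !muleA -!EFinM -[RHS]mul1e; congr (EFin _ * _).
rewrite /A modulusM modulusV modulus_conj modulusR exprMn -normrX ger0_norm ?sqr_ge0//.
by field; rewrite modulus_eq0 w0 d0.
Qed.

Lemma mobius_den_neq0 w z : (modulus w < 1)%R -> (modulus z <= 1)%R -> (1 - w^* * z != 0)%R.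
Proof.
move=> w1 z1; rewrite subr_eq0; apply/eqP => /(congr1 (@modulus R)).
rewrite modulusM modulus_conj modulus1 => e; have := modulus_ge0 w; have := modulus_ge0 z; nra.
Qed.

Lemma mobius_modulus w z : (1 - w^* * z != 0)%R ->
  (1 - modulus (mobius w z) ^+ 2 =
   (1 - modulus w ^+ 2) * (1 - modulus z ^+ 2) / modulus (1 - w^* * z) ^+ 2)%R.
Proof.
move=> d0; have d1 : (modulus (1 - w^* * z) ^+ 2 != 0)%R by rewrite sqrf_eq0 modulus_eq0.
rewrite mobiusE modulusM modulusV exprMn exprVn.
have -> : ((1 - modulus w ^+ 2) * (1 - modulus z ^+ 2) = modulus (1 - w^* * z) ^+ 2 - modulus (z - w) ^+ 2)%R.
  rewrite !modulus_sqr !ReB !ImB ReM ImM Re_conj Im_conj /=; ring.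
by rewrite mulrBl mulfV.
Qed.

Lemma pint_rotation F t : pmeas F -> (forall z, 0 <= F z) ->
  pint (fun z => F (cis t * z)%R) = pint F.
Proof.
by move=> mF F0; rewrite pint_mul ?cis_neq0// modulus_cis expr1n invr1 mul1e.
Qed.

Lemma integral_discE F : \int[area]_(p in plane_disc) F (plane_point p) = pint (F \_ disc).
Proof.
rewrite integral_mkcond; apply: eq_integral => p _ /=; rewrite !patchE.
by congr (if _ then _ else _); apply/idP/idP; rewrite !inE.
Qed.

Lemma pmeas_disc F : measurable_fun plane_disc (F \o @plane_point R) ->
  pmeas (F \_ disc).
Proof.
by move=> /(measurable_restrictT _ (@measurable_plane_disc R)).
Qed.

(** Cut off outside the disc, so that integrals run over the whole plane, where the substitution
    lemmas hold. *)
Definition lam : R[i] -> \bar R := (fun z => (lambda_weight z)%:E) \_ disc.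

Lemma lambda_ge0 z : (0 <= lambda_weight z)%R.
Proof. by rewrite invr_ge0 mulr_ge0 ?pi_ge0// sqr_ge0. Qed.

Lemma lam_ge0 z : 0 <= lam z.
Proof. by rewrite /lam patchE; case: ifP => // _; rewrite lee_fin lambda_ge0. Qed.

Lemma pmeas_lambda :
  measurable_fun setT (lambda_weight \o @plane_point R).
Proof.
apply: (measurableT_comp (@measurable_invr R)); apply: measurable_funM; first exact: measurable_cst.
apply: measurable_funX; apply: measurable_funB; first exact: measurable_cst.
exact: (measurable_funX _ (measurable_modulus cmeas_point)).
Qed.

Lemma pmeas_lam : pmeas lam.
Proof.
apply: pmeas_disc; apply/measurable_EFinP; exact: (measurable_funTS pmeas_lambda).
Qed.

Lemma lam_mobius w z : disc w ->
  lam (mobius w z) * (((1 - modulus w ^+ 2) / modulus (1 - w^* * z) ^+ 2) ^+ 2)%:E = lam z.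
Proof.
move=> w1; have w2 : (0 < 1 - modulus w ^+ 2)%R by rewrite subr_gt0 expr_lt1// modulus_ge0.
(* At the pole the inverse of 0 is 0, so the left side vanishes; so does [lam z], as the pole lies
   outside the disc. *)
have [e|d0] := eqVneq (1 - w^* * z)%R 0%R.
  rewrite e modulus0 !expr0n invr0 mulr0 expr0n mule0 /lam patchE memNset//.
  move=> z1; have := mobius_den_neq0 w1 (ltW z1); by rewrite e eqxx.
have m0 : (0 < modulus (1 - w^* * z) ^+ 2)%R by rewrite exprn_gt0// modulus_gt0.
have md := mobius_modulus d0.
have lt1 v : ((1 - modulus v ^+ 2 > 0) = (modulus v < 1))%R by rewrite subr_gt0 expr_lt1// modulus_ge0.
have dd : (disc (mobius w z) : Prop) <-> disc z.
  rewrite /disc /mkset -!lt1 md pmulr_lgt0 ?invr_gt0// pmulr_rgt0//.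
rewrite /lam !patchE; case: (pselect (disc z)) => z1; last first.
  by rewrite !memNset ?mul0e// => /dd.
rewrite !mem_set//; last exact/dd.
have z2 : (0 < 1 - modulus z ^+ 2)%R by rewrite lt1.
rewrite -EFinM /lambda_weight md; have := pi_gt0 R; move: pi => q q0; congr EFin; field.
by rewrite !gt_eqF// modulus_gt0.
Qed.

Lemma lambda_mobius F w : disc w -> pmeas F -> (forall z, 0 <= F z) ->
  pint (fun z => F (mobius w z) * lam z) = pint (fun z => F z * lam z).
Proof.
move=> w1 mF F0; rewrite -(pint_mobius (F := fun z => F z * lam z) w1); last 2 first.
- exact: pmeasM mF pmeas_lam.
- by move=> z; rewrite mule_ge0// lam_ge0.
by congr pint; apply/funext => z; rewrite -muleA lam_mobius.
Qed.

End plane_substitution.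

(** * Moments of the Bergman weights *)

Section moments.
Context (R : realType).
Implicit Types (a x s t : R) (n : nat).
Local Notation T1 := (measurableTypeR R).
Local Open Scope ereal_scope.

Lemma integral_even (F : T1 -> \bar R) : measurable_fun setT F -> (forall x, 0 <= F x) ->
  (forall x, F (- x)%R = F x) ->
  \int[leb]_x F x = 2%:E * \int[leb]_(x in `]0%R, +oo[%classic) F x.
Proof.
move=> mF F0 Fe; pose P := (`]0%R, +oo[%classic : set T1).
have mP : measurable P by exact: measurable_itv.
have mFP : measurable_fun setT (F \_ P).
  by apply: (measurable_restrictT _ mP).1; exact: measurable_funTS.
have FP0 x : 0 <= (F \_ P) x by rewrite patchE; case: ifP.
have m1 : (-1)%R != 0%R :> R by rewrite oppr_eq0 oner_neq0.
have mN : measurable_fun setT (fun x => (F \_ P) (-1 * x + 0)%R).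
  by apply: (measurableT_comp mFP); exact: measurable_affine_map.
rewrite [X in _ = _ * X]integral_mkcond -/P.
have -> : 2%:E * \int[leb]_x (F \_ P) x = \int[leb]_x ((F \_ P) x + (F \_ P) (-1 * x + 0)%R).
  rewrite ge0_integralD// (integral_affine 0 m1 mFP FP0) normrN1 invr1 mul1e.
  by rewrite [2%:E](_ : _ = 1 + 1)//  ge0_muleDl// mul1e.
apply: eq_integral_neq0 => //.
- exact: emeasurable_funD.
- by move=> x; rewrite adde_ge0.
move=> x x0; rewrite addr0 mulN1r !patchE.
have PE y : (y \in P) = (0 < y)%R.
  by apply/idP/idP; rewrite inE /P /= in_itv/= andbT.
rewrite !PE oppr_gt0; case: (ltgtP 0%R x) x0 => [h|h|<-]; rewrite ?eqxx// => _.
  by rewrite adde0.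
by rewrite add0e Fe.
Qed.

Lemma integral_oneDsqrV : \int[leb]_t ((1 + t ^+ 2)^-1)%:E = pi%:E :> \bar R.
Proof.
have m : measurable_fun setT (fun t : T1 => ((1 + t ^+ 2)^-1)%:E).
  apply/measurable_EFinP; apply: (measurableT_comp (@measurable_invr R)).
  by apply: measurable_funD; [exact: measurable_cst|exact: measurable_funX].
rewrite integral_even//; last 2 first.
- by move=> t; rewrite lee_fin invr_ge0 addr_ge0// sqr_ge0.
- by move=> t; rewrite sqrrN.
rewrite integral_itv_obnd_cbnd; last exact: measurable_funTS.
rewrite (integral0y_oneDsqr R) -EFinM; congr EFin; lra.
Qed.

(** Polar coordinates without angles: with [t = y / x] one has [|z|^2 = (1 + t^2) x^2], and
    rescaling [x] extracts the factor [1 / (1 + t^2)], whose integral over the slopes is [pi]. *)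
Lemma pint_radial (G : T1 -> \bar R) : measurable_fun setT G -> (forall x, 0 <= G x) ->
  pint (fun z : R[i] => G (modulus z ^+ 2)%R) =
  pi%:E * haar_int (fun x => (x ^+ 2)%:E * G (x ^+ 2)%R).
Proof.
move=> mG G0.
have msq : measurable_fun setT (fun x : T1 => x ^+ 2 : T1)%R by exact: measurable_funX.
pose H (x : T1) := (x ^+ 2)%:E * G (x ^+ 2)%R.
have H0 x : 0 <= H x by rewrite mule_ge0// lee_fin sqr_ge0.
have mH : measurable_fun setT H.
  by apply: emeasurable_funM; [exact/measurable_EFinP|exact: (measurableT_comp mG msq)].
rewrite pint_haar//; last first.
  exact: (measurableT_comp mG (meas_modulus2 (@cmeas_point R))).
transitivity (\int[leb]_t (haar_int H * ((1 + t ^+ 2)^-1)%:E)).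
  apply: eq_integral => t _; set k := (1 + t ^+ 2)%R.
  have k0 : (0 < k)%R by rewrite ltr_pwDl// sqr_ge0.
  have s0 : (Num.sqrt k != 0)%R by rewrite gt_eqF// sqrtr_gt0.
  rewrite -(haar_scale s0 mH H0) muleC -haarZ ?lee_fin ?invr_ge0 ?(ltW k0)//; last first.
    by apply: (measurableT_comp mH); exact: measurable_funM.
  apply: eq_haar => x _; rewrite /H modulus_sqr /= muleA -EFinM.
  have -> : (x ^+ 2 + (x * t) ^+ 2 = (Num.sqrt k * x) ^+ 2)%R.
    by rewrite !exprMn sqr_sqrtr ?(ltW k0)// /k; ring.
  congr (EFin _ * _); by rewrite exprMn sqr_sqrtr ?(ltW k0)// mulrA mulVf ?gt_eqF// mul1r.
rewrite ge0_integralZl//.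
- by rewrite integral_oneDsqrV muleC.
- apply/measurable_EFinP; apply: (measurableT_comp (@measurable_invr R)).
  by apply: measurable_funD; [exact: measurable_cst|exact: measurable_funX].
- by move=> t _; rewrite lee_fin invr_ge0 addr_ge0// sqr_ge0.
- exact: haar_ge0.
Qed.

Local Close Scope ereal_scope.

Definition radial k a x : R := x ^+ k * (1 - x ^+ 2) `^ a.

Lemma powR_small a e : 0 < a -> 0 < e -> exists2 d, 0 < d & forall y, 0 <= y -> y < d -> y `^ a < e.
Proof.
move=> a0 e0; exists (e `^ a^-1); first exact: powR_gt0.
move=> y y0 yd; have -> : e = (e `^ a^-1) `^ a by rewrite -powRrM mulVf ?gt_eqF// powRr1// ltW.
by rewrite gt0_ltr_powR// ?nnegrE ?powR_ge0.
Qed.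

Lemma is_derive_radial k a x : -1 < x -> x < 1 ->
  is_derive x 1 (radial k a)
    (k%:R * x ^+ k.-1 * (1 - x ^+ 2) `^ a - 2 * a * (x ^+ k.+1 * (1 - x ^+ 2) `^ (a - 1))).
Proof.
move=> x0 x1; have y0 : 0 < 1 - x ^+ 2 by rewrite subr_gt0; nra.
have h := is_derive1_powR a y0.
have hX n : is_derive x 1 (fun x : R => x ^+ n) (n%:R * x ^+ n.-1).
  have := @is_deriveX R R id n x 1 1 (is_derive_id x 1).
  by rewrite fctE /= /GRing.scale /= mulr1.
have h2 : is_derive x 1 ((cst 1 : R -> R^o) - (fun x : R => x ^+ 2)) (0 - 2%:R * x ^+ 1).
  exact: (is_deriveB (is_derive_cst _ x 1) (hX 2)).
have h3 := is_derive1_comp (g := fun x : R => 1 - x ^+ 2) h h2.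
have h4 := hX k.
have h5 := is_deriveM h4 h3; apply: is_derive_eq h5 _.
rewrite /GRing.scale /= [x ^+ k.+1]exprS expr1.
by move: (x ^+ k) (x ^+ k.-1) (_ `^ a) (_ `^ (a - 1)) => A B C D; ring.
Qed.

Lemma radial_cvg1 k a : 0 <= a ->
  radial k a x @[x --> 1^'-] --> radial k a 1.
Proof.
move=> a0; have X (f : R -> R) : (continuous f) -> f x @[x --> 1^'-] --> f 1.
  by move=> fc; apply: cvg_at_left_filter; exact: fc.
apply: (@cvgM _ _ _ _ (fun x => x ^+ k) (fun x => (1 - x ^+ 2) `^ a)); first by apply: (X (fun x => x ^+ k)); exact: exprn_continuous.
have [->|a1] := eqVneq a 0.
  rewrite powRr0; under eq_fun do rewrite powRr0; exact: cvg_cst.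
have ap : 0 < a by rewrite lt_neqAle eq_sym a1.
rewrite expr1n subrr powR0//; apply/cvgrPdist_lt => e e0.
have [d d0 hd] := powR_small ap e0.
have cx : 1 - x ^+ 2 @[x --> 1^'-] --> 1 - (1 : R) ^+ 2.
  by apply: cvgB; [exact: cvg_cst|apply: (X (fun x => x ^+ 2)); exact: exprn_continuous].
rewrite expr1n subrr in cx.
near=> x; rewrite sub0r normrN ger0_norm ?powR_ge0//; apply: hd.
  have x1 : x <= 1 by near: x; exact: nbhs_left_le.
  have x0 : 0 <= x by near: x; exact: nbhs_left_ge.
  by rewrite subr_ge0 expr_le1.
near: x; move/cvgrPdist_lt: cx => /(_ d d0); apply: filterS => y.
by rewrite sub0r normrN; exact: (le_lt_trans (ler_norm _)).
Unshelve. all: by end_near. Qed.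

Lemma radial_cvg0 k a : radial k a x @[x --> 0^'+] --> radial k a 0.
Proof.
apply: cvg_at_right_filter.
have [d _] := is_derive_radial k a (ltrN10 R) (ltr01 : 0 < 1 :> R).
by apply: differentiable_continuous; apply/derivable1_diffP.
Qed.

Lemma radial_continuous k a : 0 <= a -> {within `[0, 1], continuous (radial k a)}.
Proof.
move=> a0; apply/continuous_within_itvP; first exact: ltr01; split.
- move=> x; rewrite in_itv/= => /andP[x0 x1].
  have x2 : -1 < x by lra.
  have [d _] := is_derive_radial k a x2 x1.
  by apply: differentiable_continuous; apply/derivable1_diffP.
- exact: radial_cvg0.
- exact: radial_cvg1.
Qed.

Lemma radial_integrable k a : 0 <= a ->
  leb.-integrable `[0, 1] (EFin \o radial k a).
Proof.
by move=> a0; apply: continuous_compact_integrable; [exact: segment_compact|exact: radial_continuous].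
Qed.

Definition radial_moment k a : R := (\int[leb]_(x in `[0, 1]) radial k a x)%R.

(** The fundamental theorem of calculus for [radial k (a + 1)] on [[0, 1]]. At 1 it vanishes, and at
    0 it is nonzero only for [k = 0], where the truncated [k.-1] comes with the factor 0. *)
Lemma radial_moment_FTC k a : 0 <= a ->
  k%:R * radial_moment k.-1 (a + 1) - 2 * (a + 1) * radial_moment k.+1 a = (k == 0)%:R * -1.
Proof.
move=> a0; have a1 : 0 <= a + 1 by rewrite addr_ge0.
pose f x : R := k%:R * radial k.-1 (a + 1) x - 2 * (a + 1) * radial k.+1 a x.
have i1 := radial_integrable k.-1 a1; have i2 := radial_integrable k.+1 a0.
have m1 : measurable (`[0, 1]%classic : set T1) by exact: measurable_itv.
have E : (\int[leb]_(x in `[0, 1]) f x)%R = k%:R * radial_moment k.-1 (a + 1) - 2 * (a + 1) * radial_moment k.+1 a.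
  rewrite RintegralB//; last 2 first.
  - exact: (integrableZl m1 _ i1).
  - exact: (integrableZl m1 _ i2).
  by rewrite !RintegralZl.
rewrite -E /Rintegral (@continuous_FTC2 R f (radial k (a + 1)) 0 1)//.
- have b0 : (a + 1 == 0) = false by rewrite gt_eqF// ltr_wpDl.
  have -> : radial k (a + 1) 1 = 0 by rewrite /radial !expr1n subrr powR0 ?b0// mulr0.
  have -> : radial k (a + 1) 0 = (k == 0)%:R by rewrite /radial !expr0n/= subr0 powR1 mulr1.
  by rewrite -EFinB /= sub0r mulrN1.
- have lim (F : set_system R) (FF : Filter F) y : (forall n b, 0 <= b -> radial n b x @[x --> F] --> radial n b y) ->
    f x @[x --> F] --> f y.
    by move=> h; apply: cvgB; apply: cvgM; [exact: cvg_cst|exact: h|exact: cvg_cst|exact: h].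
  apply/continuous_within_itvP; first exact: ltr01; split.
  + move=> x /= x01; apply: lim => n b b0.
    by have := radial_continuous (k := n) b0; move=> /(continuous_within_itvP _ (ltr01 : 0 < 1 :> R))[/(_ x x01)].
  + by apply: lim => n b _; exact: radial_cvg0.
  + by apply: lim => n b b0; exact: radial_cvg1.
- split; [|exact: radial_cvg0|exact: radial_cvg1].
  move=> x; rewrite in_itv/= => /andP[x0 x1].
  have x2 : -1 < x by lra.
  by have [d _] := is_derive_radial k (a + 1) x2 x1.
- move=> x; rewrite in_itv/= => /andP[x0 x1].
  have x2 : -1 < x by lra.
  have [_ d] := is_derive_radial k (a + 1) x2 x1.
  by rewrite derive1E d /f /radial addrK; ring.
Qed.

(** The number [Gamma(n + a + 2) / (n! Gamma(a + 2))]: the [n]th Taylor coefficient of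
    [(1 - t)^-(a + 2)], and the inverse of the squared norm of [z^n] in the Bergman space of
    parameter [a]. *)
Definition bcoef a n : R := \prod_(k < n) ((k%:R + a + 2) / k.+1%:R).

Lemma bcoef_gt0 a n : 0 <= a -> 0 < bcoef a n.
Proof.
move=> a0; apply: prodr_gt0 => k _; rewrite divr_gt0// ltr_wpDl// addr_ge0//.
Qed.

Lemma bcoefS a n : bcoef a n.+1 = bcoef a n * ((n%:R + a + 2) / n.+1%:R).
Proof. by rewrite /bcoef big_ord_recr. Qed.

Lemma bcoef0 a : bcoef a 0 = 1. Proof. by rewrite /bcoef big_ord0. Qed.

Lemma radial_momentSr k a : 0 <= a -> radial_moment k (a + 1) = radial_moment k a - radial_moment k.+2 a.
Proof.
move=> a0; rewrite -RintegralB//; try exact: radial_integrable.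
apply: eq_Rintegral => x; rewrite inE /= in_itv/= => /andP[x0 x1].
have y0 : 0 <= 1 - x ^+ 2 by rewrite subr_ge0 expr_le1.
have a1 : (a + 1 == 0) = false by rewrite gt_eqF// ltr_wpDl.
by rewrite /radial [x ^+ k.+2]exprS [x ^+ k.+1]exprS powRD ?a1// powRr1//; ring.
Qed.

Lemma radial_momentE n a : 0 <= a -> 2 * (a + 1) * radial_moment (2 * n).+1 a = (bcoef a n)^-1.
Proof.
move=> a0; elim: n => [|n IH].
  have := radial_moment_FTC 0 a0; rewrite mul0r sub0r eqxx mul1r => /oppr_inj.
  by rewrite muln0 bcoef0 invr1.
have := radial_moment_FTC (2 * n).+2 a0; rewrite mul0r radial_momentSr// bcoefS invfM -IH.
rewrite (_ : (2 * n.+1)%N = (2 * n).+2); last by rewrite mulnS.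
move: (radial_moment _ _) (radial_moment _ _) => A B.
have -> : (2 * n).+2%:R = 2 * n.+1%:R :> R by rewrite -natrM mulnS.
rewrite -[n.+1%:R]natr1; have n0 : 0 <= n%:R :> R by [].
move: (n%:R : R) n0 => y y0 h.
(* [A] and [B] are the moments of exponents [2 n + 3] and [2 n + 1]. The derivative identity at
   [k = 2 n + 2], once [radial_momentSr] has lowered [a + 1] to [a], is this recurrence. *)
have e : (y + a + 2) * A = (y + 1) * B by lra.
have y1 : y + a + 2 != 0 by rewrite gt_eqF//; lra.
have y2 : y + 1 != 0 by rewrite gt_eqF//; lra.
have -> : A = (y + 1) * B / (y + a + 2) by rewrite -e mulrC mulKf.
by field; rewrite y1 y2.
Qed.

Local Open Scope ereal_scope.

Lemma bergman_moment a n : (0 <= a)%R ->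
  \int[area]_(p in plane_disc) (bergman_weight a (plane_point p) *
     modulus (plane_point p) ^+ (2 * n))%:E = ((bcoef a n)^-1)%:E :> \bar R.
Proof.
move=> a0; rewrite (integral_discE (fun z => (bergman_weight a z * modulus z ^+ (2 * n))%:E)).
pose P := (`[0%R, 1%R[%classic : set T1).
pose G : T1 -> \bar R := (fun s => ((a + 1) / pi * (1 - s) `^ a * s ^+ n)%:E) \_ P.
have mP : measurable P by exact: measurable_itv.
have mG : measurable_fun setT G.
  apply: (measurable_restrictT _ mP).1; apply: measurable_funTS; apply/measurable_EFinP.
  apply: measurable_funM; first apply: measurable_funM.
  - exact: measurable_cst.
  - by apply: (measurableT_comp (measurable_powR a)); exact: measurable_funB.
  - exact: measurable_funX.
have PE s : (s \in P) = (0 <= s)%R && (s < 1)%R by apply/idP/idP; rewrite inE /P /= in_itv.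
have c0 : (0 <= (a + 1) / pi)%R by rewrite divr_ge0 ?pi_ge0// addr_ge0.
have G0 s : 0 <= G s.
  rewrite /G patchE PE; case: ifP => // /andP[s0 _].
  by rewrite lee_fin mulr_ge0 ?exprn_ge0// mulr_ge0 ?powR_ge0.
transitivity (pint (fun z => G (modulus z ^+ 2)%R)).
  congr pint; apply/funext => z; rewrite /G !patchE PE sqr_ge0 /=.
  have -> : (modulus z ^+ 2 < 1)%R = (z \in disc).
    by apply/idP/idP; rewrite inE /disc /= expr_lt1// modulus_ge0.
  by rewrite -exprM.
have dens0 x : (0 <= x)%R -> (0 <= radial (2 * n).+1 a x)%R.
  by move=> x0; rewrite mulr_ge0 ?powR_ge0 ?exprn_ge0.
have mdens : measurable_fun setT (radial (2 * n).+1 a).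
  apply: measurable_funM; first exact: measurable_funX.
  by apply: (measurableT_comp (measurable_powR a)); apply: measurable_funB => //; exact: measurable_funX.
have mhaar : measurable_fun setT (fun x : T1 => (x ^+ 2)%:E * G (x ^+ 2)%R * (`|x|^-1)%:E).
  apply: emeasurable_funM; first apply: emeasurable_funM.
  - by apply/measurable_EFinP; exact: measurable_funX.
  - by apply: (measurableT_comp mG); exact: measurable_funX.
  - apply/measurable_EFinP; apply: (measurableT_comp (@measurable_invr R)); exact: normr_measurable.
rewrite pint_radial// /haar_int integral_even//; last 2 first.
- by move=> x; rewrite !mule_ge0// ?lee_fin ?invr_ge0// sqr_ge0.
- by move=> x; rewrite sqrrN normrN.
(* The factor [x^2 / |x|] left by [pint_radial] gives the odd exponent [2 n + 1], and [G] cuts the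
   half-line to []0, 1[]. *)
have -> : \int[leb]_(x in `]0%R, +oo[) ((x ^+ 2)%:E * G (x ^+ 2)%R * (`|x|^-1)%:E) =
   \int[leb]_(x in `]0%R, 1%R[) (((a + 1) / pi)%:E * (radial (2 * n).+1 a x)%:E).
  rewrite integral_mkcond [RHS]integral_mkcond; apply: eq_integral => x _; rewrite !patchE.
  have E1 : (x \in `]0%R, +oo[%classic) = (0 < x)%R by apply/idP/idP; rewrite inE /= in_itv/= andbT.
  have E2 : (x \in `]0%R, 1%R[%classic) = (0 < x)%R && (x < 1)%R by apply/idP/idP; rewrite inE /= in_itv.
  rewrite E1 E2 /G patchE PE sqr_ge0 /=; case: ltP => //= x0.
  rewrite expr_lt1 ?ltW//; case: ifP => //= x1; last by rewrite mule0 mul0e.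
  rewrite -!EFinM gtr0_norm//; congr EFin; rewrite /radial -exprM [(x ^+ (2 * n).+1)%R]exprS expr2.
  have x2 : x != 0%R :> R by rewrite gt_eqF.
  have := gt_eqF (pi_gt0 R); move: pi (x ^+ (2 * n))%R (_ `^ a)%R => q A B q0.
  by field; rewrite x2 q0.
rewrite integral_itv_bndo_bndc; last first.
  by apply: measurable_funTS; apply: emeasurable_funM; apply/measurable_EFinP => //; exact: measurable_cst.
rewrite integral_itv_obnd_cbnd; last first.
  by apply: measurable_funTS; apply: emeasurable_funM; apply/measurable_EFinP => //; exact: measurable_cst.
rewrite ge0_integralZl_EFin//; last 2 first.
- by move=> x; rewrite /= in_itv/= => /andP[x0 _]; rewrite lee_fin dens0.
- by apply: measurable_funTS; exact/measurable_EFinP.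
rewrite -(radial_momentE n a0) /radial_moment /Rintegral.
rewrite -[X in _ * (_ * (_ * X))]fineK; last exact: integrable_fin_num (radial_integrable _ a0).
rewrite -!EFinM; congr EFin; move: (fine _) => I.
have := gt_eqF (pi_gt0 R); move: pi => q q0.
by field; rewrite q0.
Qed.

End moments.

(** * Gamma integrals and the coefficients of [V] *)

Section gamma.
Context (R : realType).
Implicit Types (a c s t u : R).
Local Notation T1 := (measurableTypeR R).

Lemma derivable_cvg (f : R -> R) u : derivable f u 1 -> f v @[v --> u] --> f u.
Proof. by move=> d; apply: differentiable_continuous; apply/derivable1_diffP. Qed.

Lemma cvg_expR_pinfty c : 0 < c -> expR (- c * t) @[t --> +oo] --> (0 : R).
Proof.
move=> c0; have := @cvgr_expR R => /cvgrPdist_lt h; apply/cvgrPdist_lt => e e0.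
have [M [Mr hM]] := h e e0; exists (M / c); split; first exact: num_real.
move=> t Mt; rewrite mulNr; apply: hM; by rewrite mulrC -ltr_pdivrMr.
Qed.

Lemma is_derive_expR_lin c t : is_derive t 1 (fun t => expR (- c * t)) (- c * expR (- c * t)).
Proof.
have h : is_derive t 1 (fun t : R => - c * t) (- c).
  have := @is_deriveZ R R R^o id (- c) t 1 1 (is_derive_id t 1).
  by rewrite /GRing.scale /= mulr1.
have := is_derive1_comp (is_derive_expR (- c * t)) h; by rewrite mulrC.
Qed.

Lemma continuous_expR_lin c : continuous (fun t : R => expR (- c * t)).
Proof.
move=> t; have [d _] := is_derive_expR_lin c t.
exact: derivable_cvg d.
Qed.

Lemma integral_expR c u : 0 < c ->
  (\int[leb]_(t in `[u, +oo[) (expR (- c * t))%:E = (expR (- c * u) / c)%:E)%E.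
Proof.
move=> c0.
have dF t : is_derive t 1 (fun t : R => - c^-1 * expR (- c * t)) (expR (- c * t)).
  have := @is_deriveZ R R R^o _ (- c^-1) t 1 _ (is_derive_expR_lin c t).
  rewrite /GRing.scale /= => h; apply: is_derive_eq h _.
  by field; rewrite gt_eqF.
rewrite (@ge0_continuous_FTC2y R _ (fun t => - c^-1 * expR (- c * t)) u 0)//.
- by rewrite sub0e -EFinN; congr EFin; ring.
- by apply: continuous_subspaceT; exact: continuous_expR_lin.
- rewrite -(mulr0 (- c^-1)); apply: cvgM; [exact: cvg_cst|exact: cvg_expR_pinfty].
- apply: cvg_at_right_filter; have [d _] := dF u.
  exact: derivable_cvg d.
- by move=> x _; rewrite derive1E; have [_ ->] := dF x.
Qed.

Lemma powR_cvg_at0 a : 0 < a -> x `^ a @[x --> 0^'+] --> (0 : R).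
Proof.
move=> a0; apply/cvgrPdist_lt => e e0; have [d d0 hd] := powR_small a0 e0.
near=> x; rewrite sub0r normrN ger0_norm ?powR_ge0//; apply: hd.
  by near: x; exact: nbhs_right_ge.
by near: x; exact: nbhs_right_lt.
Unshelve. all: by end_near. Qed.

Lemma powR_continuous_segment a t : 0 < a -> 0 < t -> {within `[0, t], continuous (fun u : R => u `^ a)}.
Proof.
move=> a0 t0; have c u : 0 < u -> v `^ a @[v --> u] --> u `^ a.
  move=> u0; have [d _] := is_derive1_powR a u0.
  exact: derivable_cvg d.
apply/continuous_within_itvP => //; split.
- by move=> u; rewrite in_itv/= => /andP[u0 _]; exact: c.
- by rewrite powR0 ?gt_eqF//; exact: powR_cvg_at0.
- by apply: cvg_at_left_filter; exact: c.
Qed.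

Lemma integral_powR a t : 0 < a -> 0 < t ->
  (\int[leb]_(u in `[0%R, t]) ((a + 1) * u `^ a)%:E = (t `^ (a + 1))%:E)%E.
Proof.
move=> a0 t0; have a1 : 0 < a + 1 by rewrite addr_gt0.
have dF u : 0 < u -> is_derive u 1 (fun u : R => u `^ (a + 1)) ((a + 1) * u `^ a).
  by move=> u0; have := is_derive1_powR (a + 1) u0; rewrite addrK.
rewrite (@continuous_FTC2 R _ (fun u => u `^ (a + 1)) 0 t)//.
- by rewrite powR0 ?gt_eqF// sube0.
- have lim (F : set_system R) (FF : Filter F) y : u `^ a @[u --> F] --> y `^ a ->
    (a + 1) * u `^ a @[u --> F] --> (a + 1) * y `^ a by move=> h; apply: cvgM; [exact: cvg_cst|exact: h].
  have := powR_continuous_segment a0 t0; move=> /(continuous_within_itvP _ t0)[h1 h2 h3].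
  apply/continuous_within_itvP => //; split; [move=> u u0|..]; apply: lim => //; exact: h1.
- split.
  + by move=> u; rewrite in_itv/= => /andP[u0 _]; have [] := dF u u0.
  + by rewrite powR0 ?gt_eqF//; exact: powR_cvg_at0.
  + apply: cvg_at_left_filter; have [d _] := dF t t0.
    exact: derivable_cvg d.
- by move=> u; rewrite in_itv/= => /andP[u0 _]; rewrite derive1E; have [_ ->] := dF u u0.
Qed.

Local Open Scope ereal_scope.

Definition gamma_integral s : \bar R :=
  \int[leb]_(t in `]0%R, +oo[) (t `^ (s - 1) * expR (- t))%:E.

Let mexp : measurable_fun setT (fun t : T1 => expR (- t)%R : R).
Proof. by apply: (measurableT_comp (@measurable_expR R)); exact: oppr_measurable. Qed.

Let mpow a : measurable_fun setT (fun t : T1 => (t `^ a)%R : R).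
Proof. exact: measurable_powR. Qed.

(* t^(a+1) = int_0^t (a+1) u^a du and Tonelli. *)
Lemma gamma_integralS a : (0 < a)%R -> gamma_integral (a + 2) = (a + 1)%:E * gamma_integral (a + 1).
Proof.
move=> a0; have a1 : (0 <= a + 1)%R by rewrite addr_ge0 ?ltW.
pose D := [set p : T1 * T1 | (0 < p.2)%R && (p.2 <= p.1)%R].
pose F (p : T1 * T1) := ((a + 1) * p.2 `^ a * expR (- p.1) * \1_D p)%:E : \bar R.
have mD : measurable D.
  have -> : D = (snd @^-1` `]0%R, +oo[%classic) `&` ((fun p : T1 * T1 => (p.1 - p.2)%R : T1) @^-1` `[0%R, +oo[%classic).
    by apply/seteqP; split=> p; rewrite /D /= !in_itv/= !andbT subr_ge0 => /andP.
  have mB : measurable_fun setT (fun p : T1 * T1 => (p.1 - p.2)%R : T1).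
    by apply: measurable_funB; [exact: measurable_fst|exact: measurable_snd].
  apply: measurableI; rewrite -[X in measurable X]setTI.
    have m2 : measurable_fun setT (snd : T1 * T1 -> T1) by exact: measurable_snd.
    exact: (m2 measurableT _ (measurable_itv _)).
  exact: (mB measurableT _ (measurable_itv _)).
have mF : measurable_fun setT F.
  apply: measurable_EFinM; last exact: measurable_indic.
  apply: measurable_funM; last exact: (measurableT_comp mexp measurable_fst).
  apply: measurable_funM; first exact: measurable_cst.
  exact: (measurableT_comp (mpow a) measurable_snd).
have F0 p : 0 <= F p by rewrite lee_fin !mulr_ge0 ?powR_ge0 ?expR_ge0.
have := @fubini_tonelli _ _ _ _ _ leb leb F mF F0.
have -> : \int[leb]_x \int[leb]_y F (x, y) = gamma_integral (a + 2).
  rewrite /gamma_integral [RHS]integral_mkcond; apply: eq_integral => t _; rewrite patchE.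
  case: ifPn => [|/negP]; rewrite inE /= in_itv/= andbT => t0; last first.
    apply: integral0_eq => u _; rewrite /F indicE memNset ?mulr0// /D /= => /andP[u0 ut].
    by apply: t0; exact: lt_le_trans ut.
  have -> : (a + 2 - 1 = a + 1)%R by ring.
  rewrite EFinM -(integral_powR a0 t0) -integral_itv_obnd_cbnd; last first.
    by apply: measurable_EFinM => //; exact: mpow.
  have m3 : measurable_fun (`]0%R, t]%classic : set T1) (fun u : T1 => ((a + 1) * u `^ a)%:E).
    by apply: measurable_EFinM => //; exact: mpow.
  have p3 (u : T1) : (`]0%R, t]%classic : set T1) u -> 0 <= ((a + 1) * u `^ a)%:E.
    by move=> _; rewrite lee_fin mulr_ge0// powR_ge0.
  rewrite -(ge0_integralZr _ _ m3 p3) ?lee_fin ?expR_ge0//.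
  rewrite [RHS]integral_mkcond; apply: eq_integral => u _; rewrite patchE /F indicE.
  have -> : ((t, u) \in D) = (u \in `]0%R, t]%classic) by apply/idP/idP => /set_mem h; apply/mem_set; move: h; rewrite /D /= in_itv.
  by case: ifP; rewrite ?mulr1 ?mulr0.
have -> // : \int[leb]_y \int[leb]_x F (x, y) = (a + 1)%:E * gamma_integral (a + 1).
rewrite /gamma_integral -ge0_integralZl_EFin//; last 2 first.
- by move=> t _; rewrite lee_fin mulr_ge0 ?powR_ge0 ?expR_ge0.
- apply: measurable_EFinM; [exact: mpow|exact: mexp].
rewrite [RHS]integral_mkcond; apply: eq_integral => u _; rewrite patchE.
case: ifPn => [|/negP]; rewrite inE /= in_itv/= andbT => u0; last first.
  by apply: integral0_eq => t _; rewrite /F indicE memNset ?mulr0// /D /= => /andP[/u0].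
have := integral_expR u (ltr01 : 0 < 1 :> R)%R; rewrite mulN1r divr1 addrK.
under eq_integral do rewrite mulN1r; rewrite EFinM => <-.
have mexpu : measurable_fun (`[u, +oo[%classic : set T1) (fun t : T1 => (expR (- t))%:E).
  by apply/measurable_EFinP; apply: measurable_funTS.
have expu0 (t : T1) : (`[u, +oo[%classic : set T1) t -> 0 <= (expR (- t))%:E.
  by move=> _; rewrite lee_fin expR_ge0.
rewrite muleA -EFinM -(ge0_integralZl_EFin _ _ expu0 mexpu) ?mulr_ge0 ?powR_ge0//.
rewrite [RHS]integral_mkcond; apply: eq_integral => t _; rewrite patchE /F indicE.
have -> : ((t, u) \in D) = (t \in `[u, +oo[%classic) by apply/idP/idP => /set_mem h; apply/mem_set; move: h; rewrite /D /= in_itv/= u0 andbT.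
by case: ifP; rewrite ?mulr1 ?mulr0.
Qed.

Lemma gamma_integral_fin s : (1 <= s)%R -> gamma_integral s < +oo.
Proof.
move=> s1; have [m sm] : exists m : nat, (s - 1 <= m.+1%:R)%R.
  exists (Num.truncn (s - 1)); exact: ltW (truncnS_gt _).
(* From [t^(m+1) <= 2^(m+1) (m+1)! exp(t / 2)], so that [t^(s-1) exp(-t)] is at most
   [K exp(-t / 2)]; the summand 1 serves [t <= 1]. *)
pose K := (1 + m.+1`!%:R * 2 ^+ m.+1 : R)%R.
have K0 : (0 <= K)%R by rewrite addr_ge0// mulr_ge0// exprn_ge0.
apply: (@le_lt_trans _ _ (\int[leb]_(t in `[0%R, +oo[) (K%:E * (expR (- (2^-1) * t))%:E))); last first.
  rewrite ge0_integralZl_EFin//.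
  - by rewrite integral_expR// ltry.
  - apply/measurable_EFinP; apply: measurable_funTS.
    by apply: (measurableT_comp (@measurable_expR R)); exact: measurable_funM.
rewrite -integral_itv_obnd_cbnd; last first.
  apply: measurable_funTS; apply: emeasurable_funM; apply/measurable_EFinP; first exact: measurable_cst.
  by apply: (measurableT_comp (@measurable_expR R)); exact: measurable_funM.
apply: ge0_le_integral => //.
- by move=> t _; rewrite lee_fin mulr_ge0 ?powR_ge0 ?expR_ge0.
- apply: measurable_EFinM; [exact: mpow|exact: mexp].
- apply: measurable_funTS; apply: emeasurable_funM; apply/measurable_EFinP; first exact: measurable_cst.
  by apply: (measurableT_comp (@measurable_expR R)); exact: measurable_funM.
move=> t; rewrite /= in_itv/= andbT => t0; rewrite -EFinM lee_fin.
have -> : (expR (- t) = expR (- 2^-1 * t) * expR (- 2^-1 * t))%R by rewrite -expRD; congr expR; field.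
rewrite mulrA ler_wpM2r ?expR_ge0//.
have e2 : (expR (- 2^-1 * t) * expR (t / 2) = 1)%R by rewrite -expRD -[RHS]expR0; congr expR; field.
rewrite -(ler_pM2r (expR_gt0 (t / 2))) -mulrA e2 mulr1.
have := expR_ge1Dxn m (ltW (divr_gt0 t0 (ltr0n R 2))).
have e1 : (1 <= expR (t / 2))%R by rewrite -expR0 ler_expR divr_ge0// ltW.
have t1 : (t `^ (s - 1) <= 1 + t ^+ m.+1)%R.
  have [h|h] := leP t 1%R.
    apply: (@le_trans _ _ 1%R); last by rewrite lerDl exprn_ge0// ltW.
    have h3 : (t `^ (s - 1) <= 1 `^ (s - 1))%R by rewrite ge0_ler_powR ?nnegrE ?ler01 ?(ltW t0)// subr_ge0.
    by rewrite powR1 in h3.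
  apply: (@le_trans _ _ (t ^+ m.+1)%R); last by rewrite lerDr.
  by rewrite -powR_mulrn ?(ltW t0)//; apply: ler_powR => //; exact: ltW.
have f0 : (0 < m.+1`!%:R :> R)%R by rewrite ltr0n fact_gt0.
have p0 : (0 < 2 ^+ m.+1 :> R)%R by rewrite exprn_gt0.
rewrite expr_div_n => h; apply: (le_trans t1).
rewrite /K mulrDl mul1r lerD//.
have : (t ^+ m.+1 / 2 ^+ m.+1 / m.+1`!%:R <= expR (t / 2))%R by apply: le_trans h; rewrite lerDr.
by rewrite !ler_pdivrMr// -[(_ * _ * 2 ^+ _)%R]mulrA [X in _ -> (_ <= X)%R]mulrC.
Qed.

Lemma gamma_integral_gt0 s : (1 <= s)%R -> 0 < gamma_integral s.
Proof.
move=> s1; have m (D : set T1) : measurable_fun D (fun t : T1 => (t `^ (s - 1) * expR (- t))%:E).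
  by apply: measurable_EFinM; [exact: mpow|exact: mexp].
have p0 t : 0 <= (t `^ (s - 1) * expR (- t))%:E.
  by rewrite lee_fin mulr_ge0 ?powR_ge0 ?expR_ge0.
apply: (@lt_le_trans _ _ (\int[leb]_(t in `[1%R, 2%R]) (expR (- 2))%:E)).
  rewrite integral_cst//= lebesgue_measure_itv /= lte_fin ltr1n -EFinB -EFinM lte_fin.
  by rewrite mulr_gt0 ?expR_gt0// subr_gt0 ltr1n.
apply: (@le_trans _ _ (\int[leb]_(t in `[1%R, 2%R]) (t `^ (s - 1) * expR (- t))%:E)).
  apply: ge0_le_integral => //.
  move=> t; rewrite /= in_itv/= => /andP[t1 t2]; rewrite lee_fin -[leLHS]mul1r.
  have pt : (1 <= t `^ (s - 1))%R by rewrite -[X in (X <= _)%R](powRr0 t) ler_powR// subr_ge0.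
  by rewrite ler_pM ?ler01 ?expR_ge0 ?ler_expR ?lerN2.
apply: ge0_subset_integral => //.
by move=> t; rewrite /= !in_itv/= andbT => /andP[t1 _]; exact: lt_le_trans t1.
Qed.

Local Close Scope ereal_scope.

Lemma EulerGammaE s : 1 <= s -> (EulerGamma s)%:E = gamma_integral s.
Proof.
move=> s1; rewrite /EulerGamma /Rintegral fineK// ge0_fin_numE ?ltW ?gamma_integral_gt0//.
exact: gamma_integral_fin.
Qed.

Lemma EulerGamma_gt0 s : 1 <= s -> 0 < EulerGamma s.
Proof. by move=> s1; rewrite -lte_fin EulerGammaE// gamma_integral_gt0. Qed.

Lemma EulerGammaS a : 0 < a -> EulerGamma (a + 2) = (a + 1) * EulerGamma (a + 1).
Proof.
move=> a0; apply/EFin_inj; rewrite EFinM !EulerGammaE ?gamma_integralS//.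
  by rewrite lerDr ltW.
by rewrite -[leLHS]add0r lerD ?ler1n// ltW.
Qed.

(** Dividing by [(n + 1) bcoef a n] shows that [V] maps [z^n] to a vector of squared norm
    [1 / (n + 1)], which is the squared norm of [z^n] at parameter 0: the coefficients are made for
    an isometry. *)
Lemma V_coef_sqr a n : 0 <= a -> V_coef a n ^+ 2 * n.+1%:R = bcoef a n.
Proof.
move=> a0; have G n' : 1 <= n'%:R + a + 2 by rewrite -[leLHS]add0r lerD ?ler1n// addr_ge0.
have E : EulerGamma (n%:R + a + 2) = bcoef a n * (n`!%:R * EulerGamma (a + 2)).
  elim: n => [|n IH]; first by rewrite bcoef0 fact0 !mul1r add0r.
  have -> : n.+1%:R + a + 2 = (n%:R + a + 1) + 2 by rewrite -natr1; ring.
  rewrite (EulerGammaS (a := n%:R + a + 1)); last by rewrite ltr_wpDl ?addr_ge0.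
  have -> : n%:R + a + 1 + 1 = n%:R + a + 2 by ring.
  rewrite IH bcoefS factS natrM; field; by rewrite addrC natr1 pnatr_eq0.
have G0 : 0 < EulerGamma (a + 2) by apply: EulerGamma_gt0; have := G 0; rewrite add0r.
have f0 : 0 < n`!%:R :> R by rewrite ltr0n fact_gt0.
rewrite /V_coef E mulfK ?mulf_neq0 ?gt_eqF// exprMn exprVn !sqr_sqrtr ?ltW ?bcoef_gt0//.
by rewrite mulrAC mulVf ?mul1r.
Qed.

End gamma.

(** * Parseval's identity on circles *)

Section circle_parseval.
Context (R : realType).
Implicit Types (z w : R[i]) (c : nat -> R[i]) (t : R).
Local Notation T1 := (measurableTypeR R).

Let mI : measurable (`[0, 2 * pi]%classic : set T1). Proof. exact: measurable_itv. Qed.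
Let pi2 : 0 <= 2 * pi :> R. Proof. by rewrite mulr_ge0// pi_ge0. Qed.

Lemma cmeas_cis : cmeas setT (@cis R : T1 -> R[i]).
Proof. by split; apply: continuous_measurable_fun; [exact: continuous_cos|exact: continuous_sin]. Qed.

Lemma integrable_segment_cst x y (k : R) : leb.-integrable `[x, y] (EFin \o (fun=> k)).
Proof.
apply: continuous_compact_integrable; first exact: segment_compact.
by apply: continuous_subspaceT => u; exact: cvg_cst.
Qed.

Lemma cinteg_cis x : cinteg leb `[0, 2 * pi] (fun t => cis (x * t)).
Proof.
apply: (cinteg_bound mI (g := fun=> 1)) => //; last by move=> t _; rewrite modulus_cis.
  have [m1 m2] := cmeas_cis; have mx : measurable_fun setT (fun t : T1 => x * t : T1) by exact: measurable_funM.
  by split; apply: measurable_funTS; [exact: (measurableT_comp m1 mx)|exact: (measurableT_comp m2 mx)].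
exact: integrable_segment_cst.
Qed.

Lemma Cintegral_cis (m n : nat) :
  Cintegral leb `[0, 2 * pi] (fun t => cis (m%:R * t) * (cis (n%:R * t))^*) = (2 * pi * (m == n)%:R)%:C.
Proof.
(* Orthogonality is the vanishing of the circle integrals of [z^-k] at radius 1. *)
have X (k : nat) : (0 < k)%N -> Cintegral leb `[0, 2 * pi] (fun t : R => cis (- (k%:R * t))) = 0.
  move=> k0; have := circle_int_Xn k0 (ltr01 : 0 < 1 :> R); rewrite /circle_int => <-.
  apply: eq_Cintegral => t _; rewrite mul1r -conjC_cis -cisX conjCX; congr (_ ^+ k).
  apply: (mulIf (cis_neq0 t)); by rewrite conjC_cis cisNK mulVf// cis_neq0.
case: (ltngtP m n) => [mn|nm|->].
- rewrite mulr0 -[RHS](X (n - m)%N) ?subn_gt0//; apply: eq_Cintegral => t _.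
  by rewrite conjC_cis -cisD natrB ?(ltnW mn)//; congr cis; ring.
- rewrite mulr0 -[RHS]conjc0 -(X (m - n)%N) ?subn_gt0// -Cintegral_conj//; last first.
    by have := cinteg_cis (- (m - n)%:R); under [X in cinteg _ _ X -> _]eq_fun do rewrite mulNr.
  apply: eq_Cintegral => t _.
  by rewrite !conjC_cis -cisD natrB ?(ltnW nm)//; congr cis; ring.
- rewrite (_ : true%:R = 1)// mulr1; transitivity (Cintegral (@lebesgue_measure R) `[0, 2 * pi] (fun=> 1)); last first.
    by rewrite (Cintegral_seg_cst 1 pi2) mul1r subr0.
  apply: eq_Cintegral => t _.
  by rewrite mulC_conj modulus_cis expr1n.
Qed.

Lemma nneseries_EFin (x : nat -> R) l : series x n @[n --> \oo] --> l ->
  (\sum_(0 <= n <oo) (x n)%:E = l%:E)%E.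
Proof.
move=> xl; apply/cvg_lim => //.
have -> : (fun n => \sum_(0 <= i < n) (x i)%:E)%E = EFin \o series x.
  by apply/funext => n; rewrite /series /= sumEFin.
by apply/fine_cvgP; split; [near=> n|exact: xl].
Unshelve. all: by end_near.
Qed.

Lemma circle_parseval c (s : R -> R[i]) : cvgn (series (fun n => modulus (c n))) ->
  (forall t, series (fun n => c n * cis (n%:R * t)) n @[n --> \oo] --> s t) ->
  (\int[leb]_(t in `[0%R, (2 * pi)%R]) (modulus (s t) ^+ 2)%:E =
  (2 * pi)%:E * \sum_(0 <= n <oo) (modulus (c n) ^+ 2)%:E)%E.
Proof.
move=> c1 cs; pose S N t := series (fun n => c n * cis (n%:R * t)) N.
pose K := limn (series (fun n => modulus (c n))).
have SK N t : modulus (S N t) <= K.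
  apply: (@le_trans _ _ (series (fun n => modulus (c n)) N)).
    apply: (le_trans (modulus_sum _ _ _)); apply: ler_sum => n _.
    by rewrite modulusM modulus_cis mulr1.
  apply: nondecreasing_cvgn_le => //; apply/nondecreasing_seqP => n.
  by rewrite /series /= big_nat_recr//= lerDl modulus_ge0.
have ci n := cinteg_cis n%:R.
have iS N : cinteg leb `[0, 2 * pi] (S N).
  have := cinteg_sum mI (index_iota 0 N) (fun n => cintegZ mI (c n) (ci n)).
  by under [X in _ -> cinteg _ _ X]eq_fun do rewrite /S /series /=.
have mS N := cinteg_cmeas (iS N).
have iK : leb.-integrable `[0, 2 * pi] (EFin \o (fun=> K ^+ 2)) by exact: integrable_segment_cst.
have lim : Cintegral leb `[0, 2 * pi] (fun t => S N t * (S N t)^*) @[N --> \oo] -->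
    Cintegral leb `[0, 2 * pi] (fun t => s t * (s t)^*).
  apply: (Cintegral_cvg mI _ iK).
  - by move=> n; apply: cmeasM => //; exact: cmeas_conj.
  - move=> n t _; rewrite modulusM modulus_conj -expr2 lerXn2r ?nnegrE ?modulus_ge0//.
    by rewrite (le_trans (modulus_ge0 (S 0%N 0))).
  - by move=> t _; apply: cvgCM; [exact: cs|apply: cvgC_conj; exact: cs].
have iT m n : cinteg leb `[0, 2 * pi] (fun t => c m * (c n)^* * (cis (m%:R * t) * (cis (n%:R * t))^*)).
  apply: cintegZ => //; have := cinteg_cis (m%:R - n%:R).
  by under [X in cinteg _ _ X -> _]eq_fun do rewrite mulrBl cisD -conjC_cis.
have val N : Cintegral leb `[0, 2 * pi] (fun t => S N t * (S N t)^*) =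
    (2 * pi * series (fun n => modulus (c n) ^+ 2) N)%:C.
  have -> : (fun t => S N t * (S N t)^*) = (fun t => \sum_(0 <= m < N) \sum_(0 <= n < N)
     c m * (c n)^* * (cis (m%:R * t) * (cis (n%:R * t))^*)).
    apply/funext => t; rewrite /S /series /= conjC_sum mulr_suml; apply: eq_bigr => m _.
    rewrite mulr_sumr; apply: eq_bigr => n _.
    have -> : (cos (n%:R * t) -i* sin (n%:R * t)) = (cis (n%:R * t))^* by [].
    move: (cis (m%:R * t)) (cis (n%:R * t)) => x y; rewrite conjCM; ring.
  rewrite Cintegral_sum//; last by move=> m; apply: cinteg_sum.
  rewrite /series /= mulr_sumr realC_sum !big_mkord; apply: eq_bigr => m _.
  rewrite (Cintegral_sum mI _ (iT m)) big_mkord (bigD1 m)//= CintegralZ//; last first.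
    have := cinteg_cis (m%:R - m%:R).
    by under [X in cinteg _ _ X -> _]eq_fun do rewrite mulrBl cisD -conjC_cis.
  rewrite big1 ?addr0 => [|n nm]; last first.
    rewrite CintegralZ//; last first.
      have := cinteg_cis (m%:R - n%:R).
      by under [X in cinteg _ _ X -> _]eq_fun do rewrite mulrBl cisD -conjC_cis.
    by rewrite Cintegral_cis (_ : (m == n :> nat) = false) ?mulr0//; apply/negbTE; rewrite eq_sym.
  by rewrite Cintegral_cis eqxx mulr1 mulC_conj -realCM mulrC.
have sE : (fun t => s t * (s t)^*) = (fun t => (modulus (s t) ^+ 2)%:C) by apply/funext => t; rewrite mulC_conj.
rewrite sE in lim; pose I := (\int[leb]_(t in `[0%R, (2 * pi)%R]) (modulus (s t) ^+ 2))%R.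
have re : 2 * pi * series (fun n => modulus (c n) ^+ 2) N @[N --> \oo] --> I.
  have /(@cvgC_ReIm _ _ _ _)[+ _] := lim; by under eq_fun do rewrite val.
have p0 : 0 < 2 * pi :> R by rewrite mulr_gt0// pi_gt0.
have ser : series (fun n => modulus (c n) ^+ 2) N @[N --> \oo] --> I / (2 * pi).
  have : (2 * pi)^-1 * (2 * pi * series (fun n => modulus (c n) ^+ 2) N) @[N --> \oo] --> (2 * pi)^-1 * I.
    by apply: cvgM => //; exact: cvg_cst.
  rewrite [X in _ --> X -> _]mulrC (_ : (fun N => _) = series (fun n => modulus (c n) ^+ 2))//.
  by apply/funext => N; rewrite mulKf// gt_eqF.
rewrite (nneseries_EFin ser) -EFinM mulrCA divff ?gt_eqF// mulr1 /I /Rintegral fineK//.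
have ms : cmeas `[0, 2 * pi] s.
  by apply: (cmeas_cvg mI mS) => t _; exact: cs.
apply: integrable_fin_num => //; apply: (le_integrable mI _ _ iK).
  by apply/measurable_EFinP; exact: meas_modulus2.
move=> t _; rewrite /= lee_fin !ger0_norm ?sqr_ge0// lerXn2r ?nnegrE ?modulus_ge0//.
  by rewrite (le_trans (modulus_ge0 (S 0%N 0))).
have ml : modulus (S N t) @[N --> \oo] --> modulus (s t) by exact: cvgC_modulus (cs t).
apply: (ler_cvg_to ml (cvg_cst K)); apply: nearW => n; exact: SK.
Qed.

End circle_parseval.

(** * Bergman norms from Taylor coefficients *)

Section bergman_norm.
Context (R : realType).
Implicit Types (z w : R[i]) (c : nat -> R[i]) (t a : R) (u : R[i] -> R[i]).
Local Notation T1 := (measurableTypeR R).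

(* The library makes products canonically sigma-finite for subprobabilities only. *)
Definition plane_measure : set (T1 * T1) -> \bar R := (leb \x leb)%E.

HB.instance Definition _ := Measure.copy plane_measure (leb \x leb)%E.

Let plane_measure_sigma_finite : sigma_finite setT plane_measure.
Proof.
pose I (n : nat) := (`[- (n%:R), n%:R]%classic : set T1).
have mI n : measurable (I n) by exact: measurable_itv.
exists (fun n => I n `*` I n) => [|n]; last first.
  have lI : (leb (I n) < +oo)%E by rewrite /I lebesgue_measure_itv /=; case: ifP => // _; rewrite -EFinB ltry.
  split; first exact: measurableX.
  by rewrite /plane_measure product_measure1E// lte_mul_pinfty// ge0_fin_numE.
apply/esym/seteqP; split=> // -[x y] _; exists (Num.truncn (`|x| + `|y|)).+1 => //.
have := truncnS_gt (`|x| + `|y|); set n := Num.truncn _ => h.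
by split; rewrite /I /= in_itv/= -ler_norml (le_trans _ (ltW h))// ?lerDl ?lerDr.
Qed.

HB.instance Definition _ := Measure_isSigmaFinite.Build _ _ _ plane_measure plane_measure_sigma_finite.

Local Open Scope ereal_scope.

(** Area is invariant under each rotation; integrating over all of them reduces plane integrals to
    circles without polar coordinates. *)
Lemma rotation_average (F : R[i] -> \bar R) : pmeas F -> (forall z, 0 <= F z) ->
  (2 * pi)%:E * pint F =
  pint (fun z => \int[leb]_(t in `[0%R, (2 * pi)%R]) F (cis t * z)%R).
Proof.
move=> mF F0; pose I := (`[0%R, (2 * pi)%R]%classic : set T1).
have mI : measurable I by exact: measurable_itv.
have p0 : (0 <= 2 * pi :> R)%R by rewrite mulr_ge0// pi_ge0.
have mc : cmeas setT (fun q : T1 * (T1 * T1) => cis q.1 * plane_point q.2)%R.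
  apply: cmeasM.
    have [m1 m2] := @cmeas_cis R.
    by split; [exact: (measurableT_comp m1 measurable_fst)|exact: (measurableT_comp m2 measurable_fst)].
  have [m1 m2] := @cmeas_point R.
  by split; [exact: (measurableT_comp m1 measurable_snd)|exact: (measurableT_comp m2 measurable_snd)].
pose G (q : T1 * (T1 * T1)) := F (cis q.1 * plane_point q.2)%R * (\1_I q.1)%:E.
have mG : measurable_fun setT G.
  apply: emeasurable_funM; last first.
    by apply/measurable_EFinP; exact: (measurableT_comp (measurable_indic _) measurable_fst).
  have := measurableT_comp mF (measurable_fun_pair mc.1 mc.2).
  by congr measurable_fun; apply/funext => q; rewrite /= /plane_point -complexE.
have G0 q : 0 <= G q by rewrite mule_ge0// lee_fin.
have GI (g : T1 -> \bar R) : \int[leb]_(t in I) g t = \int[leb]_t (g t * (\1_I t)%:E).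
  rewrite integral_mkcond; apply: eq_integral => t _; rewrite patchE indicE.
  by case: ifP; rewrite ?mule1 ?mule0.
have FT := fubini_tonelli (m1 := leb) (m2 := plane_measure) _ mG G0.
transitivity (\int[leb]_x \int[plane_measure]_y G (x, y)); last first.
  by rewrite FT; apply: eq_integral => p _; rewrite GI.
transitivity (\int[leb]_(t in I) pint F).
  rewrite integral_cst//= [leb I]lebesgue_measure_itv /= lte_fin muleC.
  by have := p0; rewrite le_eqVlt => /orP[/eqP <-|->]; rewrite ?ltxx ?mule0 ?mul0e// -EFinB subr0.
rewrite GI; apply: eq_integral => t _; rewrite /G /= indicE.
case: (t \in I); last by rewrite mule0; under eq_integral do rewrite mule0; rewrite integral0.
rewrite mule1; under eq_integral do rewrite mule1.
by rewrite -(pint_rotation t mF F0).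
Qed.

Lemma cmeas_power_series c u : has_pseries c u -> cmeas plane_disc (u \o @plane_point R).
Proof.
move=> hu; apply: (cmeas_cvg (h := fun N p => series (fun n => c n * plane_point p ^+ n)%R N)) => //.
- exact: measurable_plane_disc.
- move=> N; apply: cmeas_sum => n; apply: cmeasM; first exact: cmeas_cst.
  elim: n => [|n IH]; first by under eq_fun do rewrite expr0; exact: cmeas_cst.
  under eq_fun do rewrite exprS; apply: cmeasM => //; have [m1 m2] := @cmeas_point R.
  by split; exact: measurable_funTS.
- by move=> p Dp; exact: hu.
Qed.

Lemma measurable_bergman_weight a :
  measurable_fun setT (fun p : T1 * T1 => bergman_weight a (plane_point p)).
Proof.
apply: measurable_funM; first exact: measurable_cst.
apply: (measurableT_comp (measurable_powR a)); apply: measurable_funB; first exact: measurable_cst.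
exact: (meas_modulus2 (@cmeas_point R)).
Qed.

Lemma disc_rotation t z : ((cis t * z)%R \in disc) = (z \in disc).
Proof. by apply/idP/idP; rewrite !inE /disc /mkset modulusM modulus_cis mul1r. Qed.

(** Parseval on every circle, after averaging over rotations, leaves the moments of the monomials.
    Both sides may be infinite, so the identity also decides which power series belong to the
    space. *)
Lemma bergman_parseval a c u : (0 <= a)%R -> has_pseries c u ->
  \int[area]_(p in plane_disc) (bergman_weight a (plane_point p) * modulus (u (plane_point p)) ^+ 2)%:E =
  \sum_(0 <= n <oo) (modulus (c n) ^+ 2 / bcoef a n)%:E.
Proof.
move=> a0 hu; pose F z := (bergman_weight a z * modulus (u z) ^+ 2)%:E.
have b0 : (0 <= a + 1)%R by rewrite addr_ge0.
have mu := cmeas_power_series hu.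
have p0 : (0 < 2 * pi :> R)%R by rewrite mulr_gt0// pi_gt0.
have F0 z : 0 <= F z by rewrite lee_fin mulr_ge0 ?sqr_ge0 ?bergman_weight_ge0.
have mF : pmeas (F \_ disc).
  apply: pmeas_disc; apply/measurable_EFinP; apply: measurable_funM.
    exact: measurable_funTS (measurable_bergman_weight a).
  exact: meas_modulus2.
have FD0 z : 0 <= (F \_ disc) z by rewrite patchE; case: ifP.
pose g n z : \bar R := (modulus (c n) ^+ 2)%:E * (bergman_weight a z * modulus z ^+ (2 * n))%:E.
have w0 n z : 0 <= (bergman_weight a z * modulus z ^+ (2 * n))%:E.
  by rewrite lee_fin mulr_ge0 ?bergman_weight_ge0// exprn_ge0// modulus_ge0.
have c0 n : (0 <= modulus (c n) ^+ 2)%R by exact: sqr_ge0.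
have mw n : measurable_fun plane_disc (fun p : T1 * T1 => (bergman_weight a (plane_point p) * modulus (plane_point p) ^+ (2 * n))%:E).
  apply: measurable_EFinM; first exact: measurable_bergman_weight.
  exact: (measurable_funX _ (measurable_modulus (@cmeas_point R))).
have g0 n z : 0 <= g n z by rewrite mule_ge0// lee_fin.
have mg n : measurable_fun plane_disc (fun p : T1 * T1 => g n (plane_point p)).
  by apply: emeasurable_funM => //; exact: measurable_cst.
have mD := @measurable_plane_disc R.
have rhs : pint ((fun z => \sum_(0 <= n <oo) g n z) \_ disc) =
    \sum_(0 <= n <oo) (modulus (c n) ^+ 2 / bcoef a n)%:E.
  rewrite -integral_discE integral_nneseries//; apply: eq_eseriesr => n _.
  by rewrite ge0_integralZl_EFin// (bergman_moment n a0) -EFinM.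
have E := rotation_average mF FD0.
rewrite (integral_discE F) -rhs -[LHS]mul1e -[RHS]mul1e.
have -> : 1 = (2 * pi)^-1%:E * (2 * pi)%:E :> \bar R by rewrite -EFinM mulVf// gt_eqF.
rewrite -!muleA E; congr (_ * _).
have ms : pmeas ((fun z => \sum_(0 <= n <oo) g n z) \_ disc).
  apply: pmeas_disc; apply: ge0_emeasurable_sum => //.
have s0 z : 0 <= ((fun z => \sum_(0 <= n <oo) g n z) \_ disc) z.
  by rewrite patchE; case: ifP => // _; apply: nneseries_ge0.
rewrite -pintZ ?ltW//; congr pint; apply/funext => z.
rewrite patchE; case: ifPn => zD; last first.
  rewrite mule0 integral0_eq// => t _; by rewrite patchE disc_rotation (negPf zD).
transitivity (\int[leb]_(t in `[0%R, (2 * pi)%R]) ((bergman_weight a z)%:E * (modulus (u (cis t * z)) ^+ 2)%:E)).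
  apply: eq_integral => t _; rewrite patchE disc_rotation zD /F.
  by rewrite /bergman_weight modulusM modulus_cis mul1r.
have zd : disc z by exact: set_mem.
have zt t : disc (cis t * z)%R by apply: set_mem; rewrite disc_rotation.
have z01 : (0 <= modulus z < 1)%R by rewrite modulus_ge0.
have conv t : series (fun n => c n * z ^+ n * cis (n%:R * t))%R n @[n --> \oo] --> u (cis t * z)%R.
  have := hu _ (zt t); apply: cvg_trans; apply: near_eq_cvg; near=> N.
  by apply: eq_bigr => n _; rewrite exprMn cisX mulrA mulrAC.
have abs : cvgn (series (fun n => modulus (c n * z ^+ n)%R)).
  have := power_series_abs_summable hu z01.
  by under [X in cvgn (series X) -> _]eq_fun do rewrite -modulusX -modulusM.
have P := circle_parseval abs conv.
have mt : measurable_fun (`[0%R, (2 * pi)%R]%classic : set T1) (fun t => (modulus (u (cis t * z)) ^+ 2)%:E).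
  apply/measurable_EFinP; apply: meas_modulus2.
  apply: (cmeas_cvg (h := fun N t => series (fun n => c n * z ^+ n * cis (n%:R * t))%R N)) => [//|N|t _]; last exact: conv.
  apply: cmeas_sum => n; apply: cmeasM; first exact: cmeas_cst.
  exact: cinteg_cmeas (cinteg_cis _).
transitivity ((bergman_weight a z)%:E * ((2 * pi)%:E * \sum_(0 <= n <oo) (modulus (c n * z ^+ n)%R ^+ 2)%:E)).
  by rewrite -P; apply: ge0_integralZl_EFin; rewrite ?bergman_weight_ge0// => t _; rewrite lee_fin sqr_ge0.
rewrite muleCA; congr (_ * _).
rewrite -nneseriesZl//; last by move=> n _; rewrite lee_fin sqr_ge0.
apply: eq_eseriesr => n _; rewrite /g -!EFinM modulusM modulusX exprMn mulnC exprM; congr EFin; ring.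
Unshelve. all: by end_near. Qed.

End bergman_norm.

(** * The Bergman space as a Hilbert space *)

Section bergman_hilbert.
Context (R : realType) (a : R).
Hypothesis a0 : 0 <= a.
Local Notation H := (bergman_space a).
Local Notation ip := (@bergman_ip R a).
Local Notation hn := (hnorm ip).
Local Notation gam := (bcoef a).
Local Notation T1 := (measurableTypeR R).
Implicit Types (u v w : H) (z : R[i]) (c : nat -> R[i]).

Let gam_gt0 n : 0 < gam n. Proof. exact: bcoef_gt0. Qed.
Let b0 : 0 <= a + 1. Proof. by rewrite addr_ge0. Qed.
Let mD := @measurable_plane_disc R.

Lemma bergmanP u : bergman a u.
Proof. by case: u => f /= /set_mem. Qed.

Lemma bergman_out u z : ~ disc z -> u z = 0.
Proof. by have [_ h _] := bergmanP u; exact: h. Qed.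

Lemma bergman_series u : has_pseries (pc u) u.
Proof.
have [du _ _] := bergmanP u.
have [c hc] : exists c, has_pseries c u.
  by apply: analytic_power_series => z zd; apply: derivable_cder; exact: du.
by rewrite (power_series_coefE hc).
Qed.

Arguments bergman_series u [z].

Lemma bergman_ext u v : (forall z, disc z -> u z = v z) -> u = v.
Proof.
move=> uv; apply: val_inj; apply/funext => z /=; case: (pselect (disc z)) => [|zd]; first exact: uv.
by rewrite !bergman_out.
Qed.

Lemma bergman_funD (k : R[i]) u v z : (k *: u + v : H) z = k * u z + v z. Proof. by []. Qed.

Lemma pcD (k : R[i]) u v n : pc (k *: u + v) n = k * pc u n + pc v n.
Proof.
have h : has_pseries (fun n => k * pc u n + pc v n) (k *: u + v : H).
  move=> z zd; rewrite bergman_funD.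
  have h1 : k * series (fun n => pc u n * z ^+ n) N + series (fun n => pc v n * z ^+ n) N @[N --> \oo] --> k * u z + v z.
    exact: (cvgCD (cvgCM (@cvgC_cst R _ \oo _ k) (bergman_series u zd)) (bergman_series v zd)).
  apply: cvg_trans h1; apply: near_eq_cvg; apply: nearW => N.
  rewrite /series /= mulr_sumr -big_split; apply: eq_bigr => i _ /=.
  by rewrite mulrDl mulrA.
by rewrite (power_series_coefE h).
Qed.

Definition nterm c n : R := modulus (c n) ^+ 2 / gam n.

Lemma nterm_ge0 c n : 0 <= nterm c n.
Proof. by rewrite divr_ge0 ?sqr_ge0// ltW. Qed.

Lemma bergman_cmeas u : cmeas plane_disc (u \o @plane_point R).
Proof. exact: cmeas_power_series (bergman_series u). Qed.

Let wt (p : T1 * T1) := bergman_weight a (plane_point p).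

Lemma weight_ge0 p : 0 <= wt p. Proof. exact: bergman_weight_ge0. Qed.

Lemma bergman_sqr_integrable u :
  area.-integrable plane_disc (EFin \o (fun p => wt p * modulus (u (plane_point p)) ^+ 2)).
Proof.
have [du _ iu] := bergmanP u; apply/integrableP; split.
  by apply/measurable_EFinP; exact: bergman_integrand_measurable.
rewrite (eq_integral (fun p => (wt p * modulus (u (plane_point p)) ^+ 2)%:E))// => p _.
by congr EFin; apply: ger0_norm; apply: mulr_ge0; [exact: weight_ge0|exact: sqr_ge0].
Qed.

Lemma bergman_ip_integrable u v :
  cinteg area plane_disc (fun p => (wt p)%:C * (u (plane_point p) * (v (plane_point p))^*)).
Proof.
have ig := integrableD mD (bergman_sqr_integrable u) (bergman_sqr_integrable v).
apply: (cinteg_bound mD _ (g := fun p => wt p * modulus (u (plane_point p)) ^+ 2 + wt p * modulus (v (plane_point p)) ^+ 2)).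
- apply: cmeasM; first by apply: cmeas_real; apply: measurable_funTS; exact: measurable_bergman_weight.
  by apply: cmeasM; [exact: bergman_cmeas|apply: cmeas_conj; exact: bergman_cmeas].
- exact: ig.
- move=> p _; rewrite !modulusM modulus_conj modulusR ger0_norm ?weight_ge0// -mulrDr.
  apply: ler_wpM2l; first exact: weight_ge0.
  by have := modulus_ge0 (u (plane_point p)); have := modulus_ge0 (v (plane_point p)); nra.
Qed.

Lemma bergman_ipE u v : ip u v =
  Cintegral area plane_disc (fun p => (wt p)%:C * (u (plane_point p) * (v (plane_point p))^*)).
Proof. by []. Qed.

Lemma Re_bergman_ip u :
  (Re (ip u u))%:E = (\int[area]_(p in plane_disc) (wt p * modulus (u (plane_point p)) ^+ 2)%:E)%E.
Proof.
rewrite /= /Rintegral -(fineK (integrable_fin_num mD (bergman_sqr_integrable u))).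
congr (fine _)%:E; apply: eq_integral => p _; congr EFin.
by rewrite mulC_conj -realCM.
Qed.

Lemma bergman_norm_series u : series (nterm (pc u)) n @[n --> \oo] --> Re (ip u u).
Proof.
have E := Re_bergman_ip u; rewrite (bergman_parseval a0 (bergman_series u)) in E.
have c : (\sum_(0 <= k < n) (nterm (pc u) k)%:E)%E @[n --> \oo] --> (Re (ip u u))%:E.
  by rewrite E; apply: is_cvg_nneseries => n _ _; rewrite lee_fin nterm_ge0.
have -> : series (nterm (pc u)) = fine \o (fun n => \sum_(0 <= k < n) (nterm (pc u) k)%:E)%E.
  by apply/funext => n; rewrite /series /= sumEFin.
by apply: fine_cvg.
Qed.

Arguments bergman_norm_series u : clear implicits.

Lemma bergman_inner_product : inner_product ip.
Proof.
split.
- move=> k u v w; rewrite !bergman_ipE -(CintegralZ mD _ (bergman_ip_integrable u w)).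
  rewrite -(CintegralD mD (cintegZ mD k (bergman_ip_integrable u w)) (bergman_ip_integrable v w)).
  by apply: eq_Cintegral => p _; rewrite bergman_funD; ring.
- move=> u v; rewrite !bergman_ipE -(Cintegral_conj mD (bergman_ip_integrable u v)).
  by apply: eq_Cintegral => p _; rewrite !conjCM conjcK conjc_real; ring.
- by move=> u; rewrite -lee_fin Re_bergman_ip; apply: integral_ge0 => p _; rewrite lee_fin mulr_ge0 ?sqr_ge0 ?weight_ge0.
- move=> u u0; have := bergman_norm_series u; rewrite u0 => h.
  have c0 n : pc u n = 0.
    have nd : nondecreasing_seq (series (nterm (pc u))).
      by apply/nondecreasing_seqP => m; rewrite /series /= big_nat_recr//= lerDl nterm_ge0.
    have := nondecreasing_cvgn_le nd (cvgP _ h) n.+1; rewrite (cvg_lim _ h)//.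
    rewrite /series /= big_nat_recr//= => le0.
    have s0 : 0 <= \sum_(0 <= i < n) nterm (pc u) i by apply: sumr_ge0 => i _; exact: nterm_ge0.
    have := nterm_ge0 (pc u) n => t0; have : nterm (pc u) n = 0 by apply/le_anti; rewrite t0 andbT; lra.
    move/eqP; rewrite mulf_eq0 invr_eq0 (gt_eqF (gam_gt0 n)) orbF sqrf_eq0 modulus_eq0 => /eqP //.
  apply: bergman_ext => z zd; apply: (cvgC_unique (bergman_series u zd)).
  have -> : series (fun n => pc u n * z ^+ n) = (fun=> 0).
    by apply/funext => N; rewrite /series /= big1// => i _; rewrite c0 mul0r.
  exact: (@cvgC_cst R _ \oo _ 0).
Qed.

Let Hip := bergman_inner_product.

Lemma hn_series u : series (nterm (pc u)) n @[n --> \oo] --> hn u ^+ 2.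
Proof. rewrite (hnorm_sqr Hip); exact: bergman_norm_series. Qed.
Arguments hn_series u : clear implicits.

Lemma bergman_intro c f : has_pseries c f -> cvgn (series (nterm c)) ->
  exists u : H, (forall z, disc z -> u z = f z) /\ pc u = c.
Proof.
move=> hf cc; pose g z := if z \in disc then f z else 0.
have gE z : disc z -> g z = f z by move=> zd; rewrite /g mem_set.
have hg : has_pseries c g by move=> z zd; rewrite gE//; exact: hf.
have bg : bergman a g.
  split=> [z zd|z zd|]; last first.
  - rewrite (bergman_parseval a0 hg).
    by have /cvg_ex[l hl] := cc; rewrite (nneseries_EFin hl) ltry.
  - by rewrite /g memNset.
  - have [d hd] := power_series_cder hg zd; exact: cder_derivable hd.
have bm : g \in bergman_pred a by exact: mem_set.
exists (BergmanSpace bm); split=> [z zd|]; first exact: gE.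
exact: (power_series_coefE (u := g)).
Qed.

(* The ratio y (n+a+2)/(n+1) of consecutive terms is eventually at most 1. *)
Lemma bcoef_bounded y : 0 <= y < 1 -> exists K, forall n, gam n * y ^+ n <= K.
Proof.
move=> /andP[y0 y1]; pose q := Num.truncn ((a + 1) / (1 - y)).
have hq n : (q < n)%N -> y * (n%:R + a + 2) <= n.+1%:R.
  move=> qn; have : (a + 1) / (1 - y) <= n%:R.
    by apply: le_trans (ltW (truncnS_gt _)) _; rewrite ler_nat.
  rewrite ler_pdivrMr ?subr_gt0// -[n.+1%:R]natr1 => h.
  have : y * (a + 1) <= a + 1 by rewrite ler_piMl// ltW.
  by move: (n%:R) h => x h; nra.
pose K := \sum_(i < q.+2) gam i * y ^+ i.
have tg i : 0 <= gam i * y ^+ i by rewrite mulr_ge0 ?exprn_ge0// ltW.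
exists K; elim=> [|n IH].
  by rewrite /K (bigD1 ord0)//= lerDl sumr_ge0.
have [qn|nq] := ltnP q n.
  apply: le_trans IH; rewrite bcoefS exprSr.
  have -> : gam n * ((n%:R + a + 2) / n.+1%:R) * (y ^+ n * y) = gam n * y ^+ n * (y * (n%:R + a + 2) / n.+1%:R) by ring.
  by rewrite ler_piMr// ler_pdivrMr ?ltr0n// mul1r hq.
have iq : (n.+1 < q.+2)%N by rewrite ltnS.
by rewrite /K (bigD1 (Ordinal iq))//= lerDl sumr_ge0.
Qed.

Lemma bcoef_summable x : 0 <= x < 1 -> cvgn (series (fun n => gam n * x ^+ n)).
Proof.
move=> /andP[x0 x1]; pose y := (x + 1) / 2.
have xy : 0 <= x < y by rewrite x0 /y; lra.
have [K hK] : exists K, forall n, gam n * y ^+ n <= K by apply: bcoef_bounded; rewrite /y; lra.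
have := bounded_geometric_cvg (fun n => ltW (gam_gt0 n)) hK xy.
apply: series_le_cvg => n.
- by rewrite mulr_ge0 ?exprn_ge0// ltW.
- by rewrite !mulr_ge0 ?exprn_ge0// ltW.
- by rewrite ler_wpM2r ?exprn_ge0// ler_peMl ?ler1n// ltW.
Qed.

(** By the arithmetic-geometric inequality [|c n| x^n <= |c n|^2 / gam n + gam n x^(2n)], a sum of
    two summable sequences. *)
Lemma nterm_summable c : cvgn (series (nterm c)) -> summable_coefs c.
Proof.
move=> cc x /andP[x0 x1].
have x2 : 0 <= x ^+ 2 < 1 by rewrite sqr_ge0 expr_lt1.
have := is_cvg_seriesD cc (bcoef_summable x2).
apply: series_le_cvg => n.
- by rewrite mulr_ge0 ?exprn_ge0 ?modulus_ge0.
- by rewrite addr_ge0 ?nterm_ge0// mulr_ge0 ?exprn_ge0 ?sqr_ge0// ltW.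
- change (modulus (c n) * x ^+ n <= nterm c n + gam n * x ^+ 2 ^+ n).
  rewrite /nterm -exprM mulnC exprM; set m := modulus (c n); set y := x ^+ n; set g := gam n.
  have g0 : 0 < g by exact: gam_gt0. have m0 : 0 <= m by exact: modulus_ge0.
  have y0 : 0 <= y by rewrite exprn_ge0.
  have e1 : (m / g - y) ^+ 2 * g = m ^+ 2 / g - 2 * (m * y) + g * y ^+ 2 by field; rewrite gt_eqF.
  have : 0 <= (m / g - y) ^+ 2 * g by rewrite mulr_ge0 ?sqr_ge0// ltW.
  have : 0 <= m * y by rewrite mulr_ge0.
  rewrite e1; lra.
Qed.

Lemma bergman_synthesis c : cvgn (series (nterm c)) -> exists u : H, pc u = c.
Proof.
move=> cc; have [f hf] := summable_has_pseries (nterm_summable cc).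
by have [u [_ hu]] := bergman_intro hf cc; exists u.
Qed.

Lemma pcZ (k : R[i]) u n : pc (k *: u) n = k * pc u n.
Proof.
have := pcD k u 0 n; rewrite addr0 => ->.
have -> : pc (0 : H) n = 0; last by rewrite addr0.
have := pcD (-1) (0 : H) 0 n; rewrite scaler0 addr0 => e.
by have /eqP := e; rewrite mulN1r addNr => /eqP.
Qed.

Lemma pc_sum (I : Type) (r : seq I) (F : I -> H) n : pc (\sum_(i <- r) F i) n = \sum_(i <- r) pc (F i) n.
Proof.
elim: r => [|i r IH]; first by rewrite !big_nil; have := pcZ 0 (0 : H) n; rewrite scaler0 mul0r.
by rewrite !big_cons -IH -[F i]scale1r pcD mul1r scale1r.
Qed.

Lemma monomial_ex n : exists u : H, pc u = (fun k => (k == n)%:R).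
Proof.
apply: bergman_synthesis; apply/cvg_ex; exists (gam n)^-1.
apply: cvg_near_cst; exists n.+1 => // N /= nN.
rewrite /series /= (big_cat_nat (n := n.+1))//= big_nat_recr//= big_nat_cond big1.
  rewrite add0r /nterm eqxx modulus1 expr1n mul1r big_nat_cond big1 ?addr0//.
  move=> i /andP[/andP[ni _] _]; rewrite gtn_eqF// modulus0 expr0n mul0r//.
by move=> i /andP[/andP[_ ni] _]; rewrite /nterm ltn_eqF// modulus0 expr0n mul0r.
Qed.

Definition monomial n : H := sval (cid (monomial_ex n)).

Lemma pc_monomial n : pc (monomial n) = fun k => (k == n)%:R.
Proof. exact: (svalP (cid (monomial_ex n))). Qed.

Lemma hn_finite u N : (forall n, (N <= n)%N -> pc u n = 0) -> hn u ^+ 2 = series (nterm (pc u)) N.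
Proof.
move=> h; apply/esym; apply: (cvg_unique _ _ (hn_series u)); first exact: Rhausdorff.
apply: cvg_near_cst; exists N => // M /= NM.
rewrite /series /= (big_cat_nat (n := N))//= -[RHS]addr0; congr (_ + _).
by rewrite big_nat_cond big1// => i /andP[/andP[Ni _] _]; rewrite /nterm h// modulus0 expr0n mul0r.
Qed.

(** Orthogonality is read off norms. The norm series of [k z^m + z^n] is the sum of the two separate
    ones, so polarization gives [Re (k <z^m, z^n>) = 0] for every [k]; [k = 1] and [k = -i] yield
    both parts. *)
Lemma ip_monomial m n : ip (monomial m) (monomial n) = ((gam n)^-1 * (m == n)%:R)%:C.
Proof.
have nm k : hn (monomial k) ^+ 2 = (gam k)^-1.
  rewrite (hn_finite (N := k.+1)) => [|i ki]; last by rewrite pc_monomial gtn_eqF.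
  rewrite /series /= big_nat_recr//= big_nat_cond big1 ?add0r => [|i /andP[/andP[_ ik] _]].
    by rewrite /nterm pc_monomial eqxx modulus1 expr1n mul1r.
  by rewrite /nterm pc_monomial ltn_eqF// modulus0 expr0n mul0r.
have [->|mn] := eqVneq m n; first by rewrite (ip_self Hip) nm mulr1.
have orth (k : R[i]) : Re (k * ip (monomial m) (monomial n)) = 0.
  have h2 : hn (k *: monomial m) ^+ 2 = modulus k ^+ 2 * (gam m)^-1 by rewrite (hnormZ Hip) exprMn nm.
  have := hnorm_sqrD Hip (k *: monomial m) (monomial n); rewrite h2 nm (ipZl Hip).
  have pk i : pc (k *: monomial m + monomial n) i = k * (i == m)%:R + (i == n)%:R by rewrite pcD !pc_monomial.
  rewrite (hn_finite (N := (m + n).+1)) => [|i mni]; last first.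
    rewrite pk !gtn_eqF ?mulr0 ?addr0//; apply: leq_ltn_trans mni; [exact: leq_addl|exact: leq_addr].
  have mi : (m < (m + n).+1)%N by rewrite ltnS leq_addr.
  have ni : (n < (m + n).+1)%N by rewrite ltnS leq_addl.
  have E : series (nterm (pc (k *: monomial m + monomial n))) (m + n).+1 = modulus k ^+ 2 * (gam m)^-1 + (gam n)^-1.
    rewrite /series /= big_mkord (bigD1 (Ordinal mi))//= (bigD1 (Ordinal ni))/=; last by rewrite -val_eqE /= eq_sym.
    rewrite big1 => [|i /andP[im ni']].
      rewrite addr0 /nterm !pk !eqxx (negPf mn) eq_sym (negPf mn) mulr0 mulr1 addr0 add0r modulus1 expr1n mul1r//.
    move: im ni'; rewrite -!val_eqE /= => /negPf im /negPf ni'.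
    by rewrite /nterm pk im ni' mulr0 addr0 modulus0 expr0n mul0r.
  rewrite E => h; lra.
rewrite mulr0; apply: complexP; first by have := orth 1; rewrite mul1r.
by have := orth (- 'i%C); rewrite ReM /= oppr0 mul0r sub0r mulN1r opprK.
Qed.

Definition partial_sum u N : H := \sum_(n < N) pc u n *: monomial n.

Lemma pc_partial_sum u N n : pc (partial_sum u N) n = if (n < N)%N then pc u n else 0.
Proof.
rewrite /partial_sum pc_sum; under eq_bigr do rewrite pcZ pc_monomial.
case: ltnP => nN.
  rewrite (bigD1 (Ordinal nN))//= eqxx mulr1 big1 ?addr0// => i; rewrite -val_eqE /= eq_sym => /negPf ->.
  by rewrite mulr0.
by rewrite big1// => i _; rewrite gtn_eqF ?mulr0//; exact: leq_trans (ltn_ord i) nN.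
Qed.

Lemma partial_sum_cvg u : hcvg ip (partial_sum u) u.
Proof.
have E N : hn (partial_sum u N - u) ^+ 2 = hn u ^+ 2 - series (nterm (pc u)) N.
  apply: (cvg_unique _ (hn_series _)); first exact: Rhausdorff.
  have : series (nterm (pc u)) M - series (nterm (pc u)) N @[M --> \oo] --> hn u ^+ 2 - series (nterm (pc u)) N.
    by apply: cvgB; [exact: hn_series|exact: cvg_cst].
  apply: cvg_trans; apply: near_eq_cvg; exists N => // M /= NM.
  have tail (c d : nat -> R) : (forall i, (i < N)%N -> d i = 0) -> (forall i, (N <= i)%N -> d i = c i) ->
    series c M - series c N = series d M.
    move=> d0 dc; rewrite /series /= (big_cat_nat (n := N))//= [RHS](big_cat_nat (n := N))//=.
    have -> : \sum_(0 <= i < N) d i = 0 by rewrite big_nat_cond big1// => i /andP[/andP[_ iN] _]; exact: d0.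
    rewrite [X in X - _]addrC addrK add0r; apply: eq_big_nat => i /andP[Ni _]; by rewrite dc.
  have pE n : pc (partial_sum u N - u) n = (if (n < N)%N then pc u n else 0) - pc u n.
    by rewrite -scaleN1r addrC pcD pc_partial_sum mulN1r addrC.
  apply: tail => i iN; rewrite /nterm pE; first by rewrite iN subrr modulus0 expr0n mul0r.
  by rewrite ltnNge iN sub0r modulusN.
apply/cvgrPdist_lt => e e0.
have /cvgrPdist_lt/(_ _ (exprn_gt0 2 e0))[N _ hN] := hn_series u; exists N => // M /= /hN h.
rewrite sub0r normrN ger0_norm ?hn_ge0// -(@ltr_pXn2r _ 2) ?nnegrE ?hn_ge0 ?(ltW e0)// E.
exact: le_lt_trans (ler_norm _) h.
Qed.

Lemma ip_monomialr u n : ip u (monomial n) = pc u n / (gam n)%:C.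
Proof.
apply: (cvgC_unique (hcvg_ip Hip (v := monomial n) (partial_sum_cvg u))).
have -> : (fun N => ip (partial_sum u N) (monomial n)) = fun N => if (n < N)%N then pc u n / (gam n)%:C else 0.
  apply/funext => N; rewrite /partial_sum (ip_suml Hip); under eq_bigr do rewrite (ipZl Hip) ip_monomial.
  case: ltnP => nN.
    rewrite (bigD1 (Ordinal nN))//= eqxx mulr1 realCV big1 ?addr0// => i; rewrite -val_eqE /= => /negPf ->.
    by rewrite mulr0 mulr0.
  by rewrite big1// => i _; rewrite ltn_eqF ?mulr0//; exact: leq_trans (ltn_ord i) nN.
by apply/nearC => e e0; exists n.+1 => // N /= nN; rewrite nN subrr modulus0.
Qed.

Lemma bergman_riesz : riesz_property ip.
Proof.
(* The coefficients are forced, since [<z^n, w>] is the conjugate of the [n]th coefficient of [w]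
   divided by [gam n]. *)
move=> phi lphi [M hM]; pose b n := (gam n)%:C * (phi (monomial n))^*.
have linphi (N : nat) (c : nat -> R[i]) : phi (\sum_(n < N) c n *: monomial n) = \sum_(n < N) c n * phi (monomial n).
  elim: N => [|N IH]; last by rewrite !big_ord_recr /= addrC lphi IH addrC.
  rewrite !big_ord0; have := lphi (-1) 0 0; rewrite scaler0 addr0 mulN1r addNr => h; exact: h.
pose S N := series (nterm b) N.
have S0 N : 0 <= S N by apply: sumr_ge0 => i _; exact: nterm_ge0.
(* On the truncated candidate [u] the functional equals [|u|^2], whence [|u|^2 <= M |u|]. *)
have SM N : S N <= M ^+ 2.
  pose u : H := \sum_(n < N) b n *: monomial n.
  have pu n : pc u n = if (n < N)%N then b n else 0.
    rewrite /u pc_sum; under eq_bigr do rewrite pcZ pc_monomial.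
    case: ltnP => nN.
      rewrite (bigD1 (Ordinal nN))//= eqxx mulr1 big1 ?addr0// => i; rewrite -val_eqE /= eq_sym => /negPf ->.
      by rewrite mulr0.
    by rewrite big1// => i _; rewrite gtn_eqF ?mulr0//; exact: leq_trans (ltn_ord i) nN.
  have nu : hn u ^+ 2 = S N.
    rewrite (hn_finite (N := N)) => [|n Nn]; last by rewrite pu ltnNge Nn.
    by apply: eq_big_nat => i /andP[_ iN]; rewrite /nterm pu iN.
  have pS : phi u = (S N)%:C.
    rewrite /u linphi /S /series /= big_mkord realC_sum; apply: eq_bigr => i _.
    rewrite /nterm /b modulusM modulus_conj modulusR gtr0_norm// exprMn -mulrA [_^* * _]mulrC mulC_conj -realCM.
    by congr (_%:C); field; rewrite gt_eqF.
  have := hM u; rewrite pS modulusR ger0_norm// => h1.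
  have u0 := hn_ge0 ip u; rewrite -nu in h1 *.
  have [->|un] := eqVneq (hn u) 0; first by rewrite expr0n sqr_ge0.
  have u1 : 0 < hn u by rewrite lt0r un.
  by rewrite expr2 ler_pM2r// in h1; rewrite lerXn2r ?nnegrE// (le_trans u0 h1).
have cS : cvgn (series (nterm b)).
  apply: nondecreasing_is_cvgn; last by exists (M ^+ 2) => _ [N _ <-]; exact: SM.
  by apply/nondecreasing_seqP => n; rewrite /series /= big_nat_recr//= lerDl nterm_ge0.
have [w hw] := bergman_synthesis cS; exists w => u.
have phicvg : phi (partial_sum u N) @[N --> \oo] --> phi u.
  apply/nearC => e e0; have M0 : 0 < `|M| + 1 by rewrite ltr_wpDl.
  have /cvgrPdist_lt/(_ _ (divr_gt0 e0 M0))[N _ hN] := partial_sum_cvg u; exists N => // n /= /hN.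
  rewrite sub0r normrN ger0_norm ?hn_ge0// ltr_pdivlMr// => h.
  have -> : phi (partial_sum u n) - phi u = phi (partial_sum u n - u).
    by have := lphi (-1) u (partial_sum u n); rewrite scaleN1r mulN1r addrC => ->; rewrite addrC.
  apply: (le_lt_trans (hM _)); apply: le_lt_trans h; rewrite mulrC ler_wpM2l ?hn_ge0//.
  by rewrite (le_trans (ler_norm M))// lerDl.
apply: (cvgC_unique phicvg).
have -> : (fun N => phi (partial_sum u N)) = (fun N => ip (partial_sum u N) w).
  apply/funext => N; rewrite /partial_sum linphi (ip_suml Hip); apply: eq_bigr => i _.
  rewrite (ipZl Hip) (ip_sym Hip w) ip_monomialr hw /b; congr (_ * _).
  by rewrite mulrAC mulfV ?mul1r ?conjcK// -modulus_eq0 modulusR normr_eq0 gt_eqF.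
exact: (hcvg_ip Hip (partial_sum_cvg u)).
Qed.

Lemma bergman_hilbert : hilbert ip.
Proof. by split; [exact: bergman_inner_product|exact: bergman_riesz]. Qed.

Definition ebasis n : H := (Num.sqrt (gam n))%:C *: monomial n.

Lemma ip_ebasis u n : ip u (ebasis n) = pc u n / (Num.sqrt (gam n))%:C.
Proof.
have s0 : 0 < Num.sqrt (gam n) by rewrite sqrtr_gt0.
rewrite (ipZr Hip) conjc_real ip_monomialr mulrCA; congr (_ * _).
rewrite -!realCV -realCM; congr (_%:C); move: s0 (sqr_sqrtr (ltW (gam_gt0 n))).
by set s := Num.sqrt _ => s0 <-; field; rewrite gt_eqF.
Qed.

Lemma ebasis_basis : orthonormal_basis ip ebasis.
Proof.
have s0 n : 0 < Num.sqrt (gam n) by rewrite sqrtr_gt0.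
have sC n : (Num.sqrt (gam n))%:C != 0 :> R[i] by rewrite -modulus_eq0 modulusR normr_eq0 gt_eqF.
split=> [i j|u].
  rewrite (ipZl Hip) ip_ebasis pc_monomial eq_sym; case: eqVneq => [->|_]; last by rewrite mul0r mulr0.
  by rewrite mul1r mulfV.
have := partial_sum_cvg u; apply: cvg_trans; apply: near_eq_cvg; apply: nearW => N.
rewrite (hnormBC Hip); congr (hn (_ - _)); apply: eq_bigr => i _.
by rewrite ip_ebasis /ebasis scalerA divfK.
Qed.

End bergman_hilbert.

Lemma summable_scale_le (R : realType) (f g : nat -> R) (k : R) : cvgn (series g) ->
  (forall n, 0 <= f n) -> (forall n, f n <= k * g n) -> cvgn (series f).
Proof.
move=> cg f0 fg; have cz : cvgn (series (fun n => k * g n)).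
  have /cvg_ex[l hl] := cg; apply/cvg_ex; exists (k * l).
  have : k * series g n @[n --> \oo] --> k * l by apply: cvgM; [exact: cvg_cst|exact: hl].
  by rewrite (_ : series (fun n => k * g n) = (fun n => k * series g n))//; apply/funext => n; rewrite /series /= mulr_sumr.
apply: series_le_cvg cz => n //; exact: le_trans (f0 n) (fg n).
Qed.

(** * The binomial series *)

Section binomial_series.
Context (R : realType) (a : R).
Hypothesis a0 : 0 <= a.
Local Notation gam := (bcoef a).
Implicit Types (x t : R).

Let gam_gt0 n : 0 < gam n. Proof. exact: bcoef_gt0. Qed.

Lemma bcoef_diffs n : pseries_diffs gam n = (n%:R + a + 2) * gam n.
Proof. by rewrite /pseries_diffs bcoefS; field; rewrite addrC natr1 pnatr_eq0. Qed.

Lemma natr_bcoef_summable x : 0 <= x < 1 -> cvgn (series (fun n => n.+1%:R * gam n * x ^+ n)).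
Proof.
move=> /andP[x0 x1]; pose y := (x + 1) / 2.
have xy : 0 <= x < y by rewrite x0 /y; lra.
have [K hK] : exists K, forall n, gam n * y ^+ n <= K by apply: (bcoef_bounded a0); rewrite /y; lra.
exact: bounded_geometric_cvg (fun n => ltW (gam_gt0 n)) hK xy.
Qed.

Lemma natr2_bcoef_summable x : 0 <= x < 1 ->
  cvgn (series (fun n => n.+1%:R * (n.+1%:R * gam n) * x ^+ n)).
Proof.
move=> /andP[x0 x1]; pose y := (x + 1) / 2.
have xy : 0 <= x < y by rewrite x0 /y; lra.
have y01 : 0 <= y < 1 by rewrite /y; lra.
have [K hK] := cvg_series_bounded (natr_bcoef_summable y01).
apply: (@bounded_geometric_cvg _ _ x y K) => // n; first by rewrite mulr_ge0// ltW.
exact: le_trans (ler_norm _) (hK n).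
Qed.

Let Kser t : R := limn (pseries gam t).

Lemma is_derive_binomial t : 0 <= t < 1 -> is_derive t 1 Kser (limn (pseries (pseries_diffs gam) t)).
Proof.
move=> /andP[t0 t1]; pose K := (t + 1) / 2; have K01 : 0 <= K < 1 by rewrite /K; lra.
have K0 : 0 <= K by case/andP: K01.
have c1 := natr_bcoef_summable K01; have c2 := natr2_bcoef_summable K01.
pose C := a + 2; have C0 : 0 <= C by rewrite addr_ge0.
have nC n : n%:R + C <= (1 + C) * n.+1%:R.
  by rewrite -[n.+1%:R]natr1; have : 0 <= n%:R :> R by []; move: (n%:R) => y y0; nra.
apply: (@pseries_snd_diffs _ _ K).
- exact: (bcoef_summable a0 K01).
- apply: (summable_scale_le (k := 1 + C) c1) => n.
    by rewrite /= bcoef_diffs !mulr_ge0 ?exprn_ge0 ?addr_ge0// ltW.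
  rewrite /= bcoef_diffs -addrA -/C !mulrA.
  by rewrite ler_wpM2r ?exprn_ge0// ler_wpM2r// ltW.
- have E n : pseries_diffs (pseries_diffs gam) n = (n.+1%:R + C) * ((n%:R + C) * gam n).
    rewrite /pseries_diffs -[_ * gam n.+2]/(pseries_diffs gam n.+1) bcoef_diffs mulrCA.
    by rewrite -[_ * gam n.+1]/(pseries_diffs gam n) bcoef_diffs -!addrA.
  apply: (summable_scale_le (k := (1 + C) * (2 + C)) c2) => n; rewrite /= E.
    by rewrite !mulr_ge0 ?exprn_ge0 ?addr_ge0// ltW.
  rewrite !mulrA ler_wpM2r ?exprn_ge0// ler_wpM2r ?(ltW (gam_gt0 n))//.
  apply: (@le_trans _ _ ((2 + C) * n.+1%:R * ((1 + C) * n.+1%:R))); last by rewrite le_eqVlt; apply/orP; left; apply/eqP; ring.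
  apply: ler_pM; rewrite ?addr_ge0//.
  by rewrite -[n.+1%:R]natr1; have : 0 <= n%:R :> R by []; move: (n%:R) => y y0; nra.
- by rewrite !ger0_norm//; rewrite /K; lra.
Qed.

(** The partial sums satisfy the equation up to the term [N gam N t^N], which tends to 0. *)
Lemma binomial_ode t : 0 <= t < 1 -> (1 - t) * limn (pseries (pseries_diffs gam) t) = (a + 2) * Kser t.
Proof.
move=> t01; have /andP[t0 t1] := t01.
have cK := bcoef_summable a0 t01; have c1 := natr_bcoef_summable t01.
have cD : cvgn (pseries (pseries_diffs gam) t).
  apply: (summable_scale_le (k := a + 2) c1) => n; rewrite /= bcoef_diffs.
    by rewrite !mulr_ge0 ?exprn_ge0 ?addr_ge0// ltW.
  rewrite !mulrA ler_wpM2r ?exprn_ge0// ler_wpM2r ?(ltW (gam_gt0 n))// -[n.+1%:R]natr1.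
  have n0 : 0 <= n%:R :> R by [].
  by have := mulr_ge0 a0 n0; nra.
have E N : (1 - t) * pseries (pseries_diffs gam) t N =
    (a + 2) * series (fun n => gam n * t ^+ n) N - N%:R * gam N * t ^+ N.
  elim: N => [|N IH]; first by rewrite /pseries /series /= !big_geq//; ring.
  rewrite /pseries /series /= !big_nat_recr//= -/(series _ N) mulrDr [X in X + _]IH bcoef_diffs.
  have e := bcoef_diffs N; rewrite /pseries_diffs in e.
  by rewrite exprS e /series /=; ring.
have l1 : (1 - t) * pseries (pseries_diffs gam) t N @[N --> \oo] --> (1 - t) * limn (pseries (pseries_diffs gam) t).
  by apply: cvgM; [exact: cvg_cst|exact: cD].
have z : N%:R * gam N * t ^+ N @[N --> \oo] --> (0 : R).
  apply: (squeeze_cvgr (f := fun=> 0) (h := fun N => N.+1%:R * gam N * t ^+ N)); last 2 first.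
  - exact: cvg_cst.
  - exact: cvg_series_cvg_0 c1.
  apply: nearW => N; rewrite !mulr_ge0 ?exprn_ge0//= ?(ltW (gam_gt0 _))//.
  by rewrite ler_wpM2r ?exprn_ge0// ler_wpM2r ?ler_nat// ltW.
have l2 : (a + 2) * series (fun n => gam n * t ^+ n) N - N%:R * gam N * t ^+ N @[N --> \oo] --> (a + 2) * Kser t - 0.
  by apply: cvgB; [apply: cvgM; [exact: cvg_cst|exact: cK]|exact: z].
rewrite subr0 in l2; apply: (cvg_unique _ l1); first exact: Rhausdorff.
have EE : (fun N => (1 - t) * pseries (pseries_diffs gam) t N) = (fun N =>
    (a + 2) * series (fun n => gam n * t ^+ n) N - N%:R * gam N * t ^+ N) by apply/funext.
by rewrite -EE in l2.
Qed.

(** By the differential equation, [Kser t (1 - t)^(a + 2)] has derivative 0, and its value at 0 is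
    1. *)
Lemma binomial_sum t : 0 <= t < 1 -> limn (series (fun n => gam n * t ^+ n)) = (1 - t) `^ (- (a + 2)).
Proof.
have K0 : Kser 0 = 1.
  apply: cvg_lim; first exact: Rhausdorff.
  apply: cvg_near_cst; exists 1%N => // -[//|N] _.
  rewrite /pseries /series /= big_nat_recl//= expr0 bcoef0 mulr1 big1 ?addr0// => i _; by rewrite expr0n mulr0.
move=> /andP[]; rewrite le_eqVlt => /orP[/eqP <- _|t0 t1].
  by rewrite subr0 powR1; exact: K0.
pose h x := Kser x * (1 - x) `^ (a + 2).
have dh x : 0 <= x < 1 -> is_derive x 1 h 0.
  move=> x01; have /andP[x0 x1] := x01; have y0 : 0 < 1 - x by rewrite subr_gt0.
  have d2 : is_derive x 1 ((cst 1 : R -> R^o) - id) (0 - 1).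
    exact: (is_deriveB (is_derive_cst _ x 1) (is_derive_id x 1)).
  have d1 := is_derive1_comp (g := fun x : R => 1 - x) (is_derive1_powR (a + 2) y0) d2.
  have := is_deriveM (is_derive_binomial x01) d1; move=> hh; apply: is_derive_eq hh _.
  rewrite /GRing.scale /=; have p : (1 - x) `^ (a + 2) = (1 - x) * (1 - x) `^ (a + 2 - 1).
    by rewrite mulr_powRB1 ?ltW// ltr_wpDl.
  have := binomial_ode x01; rewrite p; move: (limn _) (Kser x) (_ `^ _) => A B C e.
  have -> : B * ((a + 2) * C * (0 - 1)) + (1 - x) * C * A = C * ((1 - x) * A - (a + 2) * B) by ring.
  by rewrite e subrr mulr0.
have [c _] : exists2 c, c \in `]0, t[%R & h t - h 0 = 0 * (t - 0).
  apply: (@MVT _ h (fun=> 0) 0 t t0) => [x|].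
    by rewrite in_itv/= => /andP[x0 xt]; apply: dh; rewrite ltW// (lt_trans xt).
  apply: derivable_within_continuous => x; rewrite in_itv/= => /andP[x0 xt].
  by have [] := dh x _ => //; rewrite x0 (le_lt_trans xt).
rewrite mul0r => /eqP; rewrite subr_eq0 /h K0 subr0 powR1 mulr1 => /eqP e.
have p0 : 0 < (1 - t) `^ (a + 2) by rewrite powR_gt0// subr_gt0.
by rewrite powRN -[RHS]mul1r -[X in X * _]e mulfK// gt_eqF.
Qed.

End binomial_series.

(** * Reproducing kernels *)

Section kernel.
Context (R : realType) (a : R).
Hypothesis a0 : 0 <= a.
Local Notation H := (bergman_space a).
Local Notation ip := (@bergman_ip R a).
Local Notation hn := (hnorm ip).
Local Notation gam := (bcoef a).
Local Notation mono := (monomial a0).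
Implicit Types (u v w : H) (z : R[i]).

Let gam_gt0 n : 0 < gam n. Proof. exact: bcoef_gt0. Qed.
Let Hip := bergman_inner_product a0.

Lemma disc_sqr z : disc z -> 0 <= modulus z ^+ 2 < 1.
Proof. by move=> zd; rewrite sqr_ge0 expr_lt1 ?modulus_ge0. Qed.

Lemma kernel_ex z : exists u : H, disc z -> pc u = fun n => (gam n)%:C * z^* ^+ n.
Proof.
have [zd|] := pselect (disc z); last by exists 0.
have [|u hu] := bergman_synthesis a0 (c := fun n => (gam n)%:C * z^* ^+ n); last by exists u.
have := bcoef_summable a0 (disc_sqr zd).
suff -> : nterm a (fun n => (gam n)%:C * z^* ^+ n) = (fun n => gam n * (modulus z ^+ 2) ^+ n) by [].
apply/funext => n; have g0 := gt_eqF (gam_gt0 n).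
rewrite /nterm modulusM modulusR modulusX modulus_conj gtr0_norm// exprMn -!exprM mulnC.
by rewrite mulrAC expr2 mulfK// g0.
Qed.

(** The reproducing kernel at [z], as a function of its analytic variable. Outside the disc it is an
    unspecified vector. *)
Definition kernel z : H := sval (cid (kernel_ex z)).

Lemma pc_kernel z : disc z -> pc (kernel z) = fun n => (gam n)%:C * z^* ^+ n.
Proof. exact: (svalP (cid (kernel_ex z))). Qed.

Lemma ip_series u v : series (fun n => pc u n * (pc v n)^* / (gam n)%:C) n @[n --> \oo] --> ip u v.
Proof.
have h := hcvg_ip Hip (v := v) (partial_sum_cvg a0 u); apply: cvg_trans h.
apply: near_eq_cvg; apply: nearW => N; rewrite /partial_sum (ip_suml Hip) /series /= big_mkord.
apply: eq_bigr => n _; rewrite (ipZl Hip) (ip_sym Hip v) ip_monomialr.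
by rewrite conjCM -realCV conjc_real mulrA.
Qed.

Lemma reproducing u z : disc z -> ip u (kernel z) = u z.
Proof.
move=> zd; apply: (cvgC_unique (@ip_series u (kernel z))); have h := @bergman_series _ _ u z zd.
apply: cvg_trans h; apply: near_eq_cvg; apply: nearW => N; apply: eq_bigr => n _.
rewrite pc_kernel// conjCM conjc_real conjCX conjcK.
have g0 : (gam n)%:C != 0 :> R[i] by rewrite -modulus_eq0 modulusR normr_eq0 gt_eqF.
by field.
Qed.

Lemma kernel_diag z : disc z -> kernel z z = ((1 - modulus z ^+ 2) `^ (- (a + 2)))%:C.
Proof.
move=> zd; apply: (cvgC_unique (@bergman_series _ _ (kernel z) z zd)).
have h : series (fun n => gam n * (modulus z ^+ 2) ^+ n) N @[N --> \oo] --> (1 - modulus z ^+ 2) `^ (- (a + 2)).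
  by rewrite -(binomial_sum a0 (disc_sqr zd)); exact: (bcoef_summable a0 (disc_sqr zd)).
have hC := cvgC_real h.
rewrite (_ : series _ = (fun N => (series (fun n => gam n * (modulus z ^+ 2) ^+ n) N)%:C)); first exact: hC.
apply/funext => N; rewrite /series /= realC_sum; apply: eq_bigr => n _.
rewrite pc_kernel// realCM realCX -mulC_conj exprMn -mulrA; congr (_ * _); exact: mulrC.
Qed.

Lemma hn_kernel z : disc z -> hn (kernel z) ^+ 2 = (1 - modulus z ^+ 2) `^ (- (a + 2)).
Proof. by move=> zd; rewrite (hnorm_sqr Hip) reproducing// kernel_diag. Qed.

(** [(1 - |z|^2)^(a + 2)] is the inverse of the kernel on the diagonal: the Bergman measure is
    [a + 1] times the invariant measure divided by [kernel z z]. *)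
Lemma weightE z : disc z ->
  bergman_weight a z = (a + 1) * (1 - modulus z ^+ 2) `^ (a + 2) * lambda_weight z.
Proof.
move=> zd; have y0 : 0 < 1 - modulus z ^+ 2 by have /andP[_] := disc_sqr zd; rewrite subr_gt0.
rewrite /bergman_weight /lambda_weight powRD; last by rewrite (gt_eqF y0) implybT.
move: y0; set y := 1 - _ => y0; have -> : y `^ 2 = y ^+ 2 := powR_mulrn 2 (ltW y0).
have := gt_eqF (pi_gt0 R); move: pi (y `^ a) => q A q0.
by field; rewrite q0 gt_eqF.
Qed.

End kernel.

(** * Coherent states: the Moebius action and rotations *)

Section cstates.
Context (R : realType) (a : R).
Hypothesis a0 : 0 <= a.
Local Notation H := (bergman_space a).
Local Notation ip := (@bergman_ip R a).
Local Notation hn := (hnorm ip).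
Local Notation gam := (bcoef a).
Local Notation T1 := (measurableTypeR R).
Implicit Types (u v g : H) (z w : R[i]) (t : R).

Let gam_gt0 n : 0 < gam n. Proof. exact: bcoef_gt0. Qed.
Let Hip := bergman_inner_product a0.

Lemma bergman_intro_integral (f : R[i] -> R[i]) (l : R) : (forall z, disc z -> exists d, cder f z d) ->
  (\int[area]_(p in plane_disc) (bergman_weight a (plane_point p) * modulus (f (plane_point p)) ^+ 2)%:E = l%:E)%E ->
  exists u : H, (forall z, disc z -> u z = f z) /\ hn u ^+ 2 = l.
Proof.
move=> df E; have [c hf] := analytic_power_series df.
have c0 n : 0 <= nterm a c n := nterm_ge0 a0 c n.
have [|u [uf uc]] := bergman_intro a0 hf.
  rewrite (bergman_parseval a0 hf) in E.
  have cv : (\sum_(0 <= k < n) (nterm a c k)%:E)%E @[n --> \oo] --> l%:E.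
    by rewrite -E; apply: is_cvg_nneseries => n _ _; rewrite lee_fin.
  apply/cvg_ex; exists l.
  have -> : series (nterm a c) = fine \o (fun n => \sum_(0 <= k < n) (nterm a c k)%:E)%E.
    by apply/funext => n; rewrite /series /= sumEFin.
  exact: fine_cvg.
exists u; split=> //; apply: EFin_inj; rewrite -E (hnorm_sqr Hip) Re_bergman_ip//.
by apply: eq_integral => p /set_mem pd; rewrite uf.
Qed.

Lemma mobius_disc w z : disc w -> disc z -> disc (mobius w z).
Proof.
move=> wd zd; have d0 := mobius_den_neq0 wd (ltW zd); have E := mobius_modulus d0.
have /andP[_ w1] := disc_sqr wd; have /andP[_ z1] := disc_sqr zd.
have : 0 < 1 - modulus (mobius w z) ^+ 2.
  by rewrite E; apply: divr_gt0; [rewrite mulr_gt0 ?subr_gt0|rewrite exprn_gt0// modulus_gt0].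
by rewrite subr_gt0 expr_lt1// modulus_ge0.
Qed.

Lemma mobius_den_Re w z : disc w -> disc z -> 0 < Re (1 - w^* * z).
Proof.
move=> wd zd; rewrite ReB /= subr_gt0; apply: (le_lt_trans (ler_norm _)).
apply: (le_lt_trans (Re_le_modulus _)); rewrite modulusM modulus_conj.
by rewrite (le_lt_trans _ zd)// ler_piMl ?modulus_ge0// ltW.
Qed.

Lemma mobius_den_Re_neq0 w z : disc w -> disc z -> 1 - w^* * z != 0.
Proof. by move=> wd zd; exact: mobius_den_neq0 wd (ltW zd). Qed.

(** The reason why [U] is isometric. Its two scalar factors are those of [mobius_modulus], so the
    function [|f|^2 (1 - |z|^2)^(2 + a)], whose integral against the invariant measure is the
    squared norm up to [a + 1], is carried along by the Moebius map. *)
Lemma coherent_sqr w (f : R[i] -> R[i]) z : disc w -> disc z ->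
  modulus (U a w f z) ^+ 2 * (1 - modulus z ^+ 2) `^ (2 + a) =
  modulus (f (mobius w z)) ^+ 2 * (1 - modulus (mobius w z) ^+ 2) `^ (2 + a).
Proof.
move=> wd zd; have d0 := mobius_den_Re_neq0 wd zd; rewrite (mobius_modulus d0).
have A0 : 0 < 1 - modulus w ^+ 2 by rewrite subr_gt0; have /andP[] := disc_sqr wd.
have B0 : 0 < 1 - modulus z ^+ 2 by rewrite subr_gt0; have /andP[] := disc_sqr zd.
have y0 : 0 < modulus (1 - w^* * z) by rewrite modulus_gt0.
rewrite /U -[X in principal_power X]/(1 - w^* * z) !modulusM modulusV modulus_principal_power modulusR.
rewrite ger0_norm ?powR_ge0//; move: y0 A0 B0; move: (modulus (1 - _)) => y.
move: (1 - modulus w ^+ 2) (1 - modulus z ^+ 2) (modulus (f _)) => A B F y0 A0 B0.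
rewrite powRM ?mulr_ge0 ?invr_ge0 ?sqr_ge0 ?(ltW A0) ?(ltW B0)// powRM ?(ltW A0) ?(ltW B0)//.
have -> : (y ^- 2) `^ (2 + a) = (y `^ (2 + a)) ^- 2.
  rewrite -(powR_mulrn 2 (ltW y0)) -powRN -powRrM -(powR_mulrn 2 (powR_ge0 _ _)) -powRrM -powRN.
  by congr (_ `^ _); ring.
have -> : A `^ (2 + a) = (A `^ ((2 + a) / 2)) ^+ 2.
  by rewrite -powR_mulrn ?powR_ge0// -powRrM; congr (_ `^ _); field.
by rewrite !exprMn exprVn; ring.
Qed.

Lemma bergman_weight_coherent w (f : R[i] -> R[i]) z : disc w -> disc z ->
  bergman_weight a z * modulus (U a w f z) ^+ 2 =
  (a + 1) * (modulus (f (mobius w z)) ^+ 2 * (1 - modulus (mobius w z) ^+ 2) `^ (2 + a)) * lambda_weight z.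
Proof.
move=> wd zd; rewrite -coherent_sqr// weightE// [2 + a]addrC.
have gen (A B C D : R) : D * A * B * C = D * (C * A) * B by ring.
exact: gen.
Qed.

Lemma bergman_cder u z : disc z -> exists d, cder u z d.
Proof. by move=> zd; exact: power_series_cder (@bergman_series R a u) zd. Qed.

Lemma coherent_cder w u z : disc w -> disc z -> exists d, cder (U a w u) z d.
Proof.
move=> wd zd; have d0 := mobius_den_Re_neq0 wd zd.
have den : cder (fun z => 1 - w^* * z) z (0 - w^* * 1) by apply: cderB; [exact: cder_cst|apply: cderZ; exact: cder_id].
have [d1 h1] := @cder_div R (fun z => z - w) (fun z => 1 - w^* * z) z _ _ d0 (cderB (cder_id z) (cder_cst z w)) den.
have [d2 h2] := bergman_cder u (mobius_disc wd zd).
have h3 := cder_comp h1 h2.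
have h4 := cderM h3 (cder_cst z ((1 - modulus w ^+ 2) `^ ((2 + a) / 2))%:C).
have [d5 h5] := @cder_principal_power R _ (2 + a) (mobius_den_Re wd zd).
have h6 := cder_comp den h5.
have p0 : principal_power (1 - w^* * z) (2 + a) != 0.
  by rewrite -modulus_gt0 modulus_principal_power powR_gt0// modulus_gt0.
have [d7 h7] := @cder_div R _ (fun w' => principal_power (1 - w^* * w') (2 + a)) z _ _ p0 h4 h6.
by exists d7.
Qed.

Lemma pmeas_bergman u (c : R -> R) :
  measurable_fun setT c ->
  pmeas ((fun z => (modulus (u z) ^+ 2 * c (modulus z))%:E) \_ disc).
Proof.
move=> mc; apply: pmeas_disc; apply/measurable_EFinP; apply: measurable_funM.
  apply: meas_modulus2; exact: bergman_cmeas.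
apply: measurableT_comp mc _; apply: measurable_funTS.
exact: (measurable_modulus (cmeas_point R)).
Qed.

Lemma measurable_powR_sub (s : R) : measurable_fun setT (fun x : T1 => (1 - x ^+ 2) `^ s).
Proof.
apply: (measurableT_comp (measurable_powR s)); exact: measurable_funB.
Qed.

Lemma coherent_integral w u : disc w ->
  (\int[area]_(p in plane_disc) (bergman_weight a (plane_point p) *
     modulus (U a w u (plane_point p)) ^+ 2)%:E = (hn u ^+ 2)%:E)%E.
Proof.
move=> wd; pose k x := (a + 1) * (1 - x ^+ 2) `^ (2 + a).
pose F := (fun z => (modulus (u z) ^+ 2 * k (modulus z))%:E) \_ disc.
have mF : pmeas F.
  apply: (@pmeas_bergman u k); apply: measurable_funM => //; exact: measurable_powR_sub.
have F0 z : (0 <= F z)%E.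
  by rewrite /F patchE; case: ifP => // _; rewrite lee_fin mulr_ge0 ?sqr_ge0// mulr_ge0 ?powR_ge0// addr_ge0.
have E (w' : R[i]) (f : R[i] -> R[i]) : disc w' -> (forall z, disc z -> modulus (f z) = modulus (U a w' u z)) ->
    (\int[area]_(p in plane_disc) (bergman_weight a (plane_point p) * modulus (f (plane_point p)) ^+ 2)%:E =
     pint (fun z => F (mobius w' z) * lam z))%E.
  move=> wd' fE; rewrite (integral_discE (fun z => (bergman_weight a z * modulus (f z) ^+ 2)%:E)).
  congr pint; apply/funext => z; rewrite /lam !patchE.
  case: ifPn => [/set_mem zd|_]; last by rewrite mule0.
  rewrite fE// bergman_weight_coherent// /F patchE mem_set; last exact: mobius_disc.
  by rewrite -EFinM /k; congr EFin; ring.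
(* [mobius 0] is the identity, so the substitution at 0 identifies the same integral with the norm
   of [u]. *)
rewrite (E w)// lambda_mobius// -(@lambda_mobius _ F 0)//; last exact: disc0.
rewrite (hnorm_sqr Hip) Re_bergman_ip// (E 0)//; first exact: disc0.
move=> z zd; have e0 : (0 : R[i])^* = 0 := conjC0 R.
rewrite /U mobiusE -[X in principal_power X _]/(1 - (0 : R[i])^* * z) e0 !mul0r !subr0 !divr1.
rewrite modulus0 expr0n subr0 powR1 mulr1.
by rewrite modulusM modulusV modulus_principal_power modulus1 powR1 invr1 mulr1.
Qed.

Lemma coherent_ex w u : exists v, disc w -> (forall z, disc z -> v z = U a w u z) /\ hn v ^+ 2 = hn u ^+ 2.
Proof.
have [wd|wd] := pselect (disc w); last by exists 0.
have [v hv] := bergman_intro_integral (fun z => coherent_cder u wd) (coherent_integral u wd).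
by exists v.
Qed.

(* Zero outside the disc, so that it is measurable on the plane. *)
Definition coherent w u : H := if w \in disc then sval (cid (coherent_ex w u)) else 0.

Lemma coherentE w u z : disc w -> disc z -> coherent w u z = U a w u z.
Proof. by move=> wd zd; rewrite /coherent mem_set//; case: cid => v /= /(_ wd)[+ _]; exact. Qed.

Lemma hn_coherent w u : disc w -> hn (coherent w u) ^+ 2 = hn u ^+ 2.
Proof. by move=> wd; rewrite /coherent mem_set//; case: cid => v /= /(_ wd)[_]. Qed.

Lemma coherent_out w u : ~ disc w -> coherent w u = 0.
Proof. by move=> wd; rewrite /coherent memNset. Qed.

Lemma rotated_ex t u : exists v, pc v = fun n => cis (n%:R * t) * pc u n.
Proof.
apply: (bergman_synthesis a0).
have -> : nterm a (fun n => cis (n%:R * t) * pc u n) = nterm a (pc u).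
  by apply/funext => n; rewrite /nterm modulusM modulus_cis mul1r.
by apply/cvg_ex; exists (hn u ^+ 2); exact: hn_series.
Qed.

Definition rotated t u : H := sval (cid (rotated_ex t u)).

Lemma pc_rotated t u : pc (rotated t u) = fun n => cis (n%:R * t) * pc u n.
Proof. exact: (svalP (cid (rotated_ex t u))). Qed.

Lemma hn_rotated t u : hn (rotated t u) ^+ 2 = hn u ^+ 2.
Proof.
apply: (cvg_unique _ (@hn_series R a a0 (rotated t u))); first exact: Rhausdorff.
have -> : nterm a (pc (rotated t u)) = nterm a (pc u).
  by apply/funext => n; rewrite pc_rotated /nterm modulusM modulus_cis mul1r.
exact: hn_series.
Qed.

Lemma disc_cis t z : disc (cis t * z) = disc z.
Proof. by rewrite /disc /mkset modulusM modulus_cis mul1r. Qed.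

Lemma rotatedE t u z : disc z -> rotated t u z = rotation t u z.
Proof.
move=> zd; apply: (cvgC_unique (@bergman_series _ _ (rotated t u) z zd)).
have tz : disc (cis t * z) by rewrite disc_cis.
have h := @bergman_series _ _ u _ tz.
rewrite (_ : series _ = series (fun n => pc u n * (cis t * z) ^+ n)); first exact: h.
by apply/funext => N; apply: eq_bigr => n _; rewrite pc_rotated exprMn cisX mulrA [cis _ * _]mulrC.
Qed.

Lemma rotated0 t : rotated t 0 = 0.
Proof.
have := hn_rotated t 0; rewrite (hnorm0 Hip) expr0n /= => /eqP; rewrite sqrf_eq0 (hnorm_eq0 Hip) => /eqP.
exact.
Qed.

(** Rotations normalize the Moebius action, at the price of rotating the base point. The angle then
    acts on Taylor coefficients through the factors [cis (n t)], while area absorbs the rotation of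
    the point. *)
Lemma coherent_rotated t w u : coherent w (rotated t u) = rotated t (coherent (cis t * w) u).
Proof.
have [wd|wd] := pselect (disc w); last first.
  by rewrite coherent_out// coherent_out ?rotated0// disc_cis.
have twd : disc (cis t * w) by rewrite disc_cis.
apply: bergman_ext => z zd; have tzd : disc (cis t * z) by rewrite disc_cis.
rewrite coherentE// rotatedE// /rotation coherentE//.
have e : (cis t * w)^* * (cis t * z) = w^* * z.
  by rewrite conjCM mulrACA conjC_cis cisNK mul1r.
rewrite /U rotatedE; last exact: mobius_disc.
rewrite /rotation -/(cis t * w)^* e modulusM modulus_cis mul1r; congr (u _ * _ / _).
by rewrite !mobiusE e -mulrBr mulrA.
Qed.

Lemma ccont_cmeas (F : R[i] -> R[i]) : (forall z, disc z -> ccont F z) ->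
  cmeas plane_disc (F \o @plane_point R).
Proof.
move=> cF; split; [apply: (@measurable_disc_continuous R (Re \o F))|apply: (@measurable_disc_continuous R (Im \o F))] => z zd e e0;
  have /ccontP/(_ e e0)[d d0 hd] := cF z zd; exists d => // w /hd; apply: le_lt_trans.
  by rewrite /= -ReB Re_le_modulus.
by rewrite /= -ImB Im_le_modulus.
Qed.

Lemma ccont_conj z : ccont (fun w : R[i] => w^*) z.
Proof. by apply/ccontP => e e0; exists e => // w; rewrite -conjCB modulus_conj. Qed.

Lemma measurable_disc_patch (g : R[i] -> R) : measurable_fun plane_disc (g \o @plane_point R) ->
  (forall z, ~ disc z -> g z = 0) -> measurable_fun setT (g \o @plane_point R).
Proof.
move=> mg g0; have := (measurable_restrictT (g \o @plane_point R) (@measurable_plane_disc R)).1 mg.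
suff -> : (g \o @plane_point R) \_ plane_disc = g \o @plane_point R by [].
apply/funext => p; rewrite patchE; case: ifPn => // /negP h; rewrite /= g0// => pd.
by apply: h; exact: mem_set.
Qed.

Lemma cmeas_disc_patch (F : R[i] -> R[i]) : cmeas plane_disc (F \o @plane_point R) ->
  (forall z, ~ disc z -> F z = 0) -> cmeas setT (F \o @plane_point R).
Proof.
move=> [mR mI] F0; split.
- by apply: (@measurable_disc_patch (Re \o F)) => // z /F0 /= ->.
- by apply: (@measurable_disc_patch (Im \o F)) => // z /F0 /= ->.
Qed.

Lemma cmeas_bergmanT u : cmeas setT (u \o @plane_point R).
Proof. by apply: cmeas_disc_patch; [exact: bergman_cmeas|exact: bergman_out]. Qed.

Lemma cmeas_comp (F h : R[i] -> R[i]) : cmeas setT (F \o @plane_point R) ->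
  cmeas setT (h \o @plane_point R) -> cmeas setT ((F \o h) \o @plane_point R).
Proof.
move=> [mR mI] mh; split; apply/measurable_EFinP.
- by apply: (@pmeas_comp _ (EFin \o (Re \o F)) h) => //; apply/measurable_EFinP.
- by apply: (@pmeas_comp _ (EFin \o (Im \o F)) h) => //; apply/measurable_EFinP.
Qed.

Lemma cmeas_coherent u x : disc x -> cmeas setT (fun p => coherent (plane_point p) u x).
Proof.
move=> xd; apply: (@cmeas_disc_patch (fun w => coherent w u x)); last first.
  by move=> w wd; rewrite coherent_out.
have mc := cmeas_conj (cmeas_point R).
have den : cmeas setT (fun p => 1 - (plane_point p)^* * x : R[i]).
  by apply: cmeasB; [exact: cmeas_cst|apply: cmeasM mc _; exact: cmeas_cst].
have mu : cmeas setT (fun p => u (mobius (plane_point p) x)).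
  apply: (@cmeas_comp u (fun w => mobius w x)); first exact: cmeas_bergmanT.
  apply: cmeasM (cmeas_inv den).
  by apply: cmeasB; [exact: cmeas_cst|exact: cmeas_point].
have mp : cmeas plane_disc (fun p => principal_power (1 - (plane_point p)^* * x) (2 + a)).
  apply: (@ccont_cmeas (fun w => principal_power (1 - w^* * x) (2 + a))) => w wd.
  have [d hd] := @cder_principal_power R _ (2 + a) (mobius_den_Re wd xd).
  apply: (@ccont_comp _ (fun y => principal_power y (2 + a)) (fun w => 1 - w^* * x)); last exact: cder_ccont hd.
  have c1 := ccontM (@ccont_cst R w (- 1)) (ccontM (ccont_conj w) (@ccont_cst R w x)).
  have := ccontD (@ccont_cst R w 1) c1.
  by congr ccont; apply/funext => y; rewrite mulN1r.
have TD F : cmeas setT F -> cmeas plane_disc F.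
  by move=> [m1 m2]; split; exact: measurable_funTS.
(* [cmeas_inv] applies on the whole plane, while the principal power [q] is known to be measurable
   on the disc; hence [1 / q] is spelled out as [conj q / |q|^2]. *)
pose G p : R[i] := u (mobius (plane_point p) x) * ((1 - modulus (plane_point p) ^+ 2) `^ ((2 + a) / 2))%:C
  * ((modulus (principal_power (1 - (plane_point p)^* * x) (2 + a)) ^+ 2)^-1)%:C *
  (principal_power (1 - (plane_point p)^* * x) (2 + a))^*.
have mG : cmeas plane_disc G.
  apply: cmeasM (cmeas_conj mp); apply: cmeasM; first (apply: cmeasM; first exact: TD).
    apply: cmeas_real; apply: measurable_funTS.
    apply: (measurableT_comp (measurable_powR_sub ((2 + a) / 2))).
    exact: (measurable_modulus (cmeas_point R)).
  apply: cmeas_real; apply: (measurableT_comp (@measurable_invr R)).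
  exact: meas_modulus2.
have GE p : plane_disc p -> G p = coherent (plane_point p) u x.
  move=> pd; rewrite coherentE// /G /U -[(_ - _^* * x) in RHS]/(1 - (plane_point p)^* * x).
  set q := principal_power _ _; rewrite -mulrA; congr (_ * _).
  have q0 : q != 0 by rewrite -modulus_gt0 modulus_principal_power powR_gt0// modulus_gt0 mobius_den_Re_neq0.
  rewrite realCV -mulC_conj; have c0 : q^* != 0 by rewrite -modulus_eq0 modulus_conj modulus_eq0.
  by rewrite invfM mulfVK.
by case: mG => m1 m2; split; [apply: eq_measurable_fun m1|apply: eq_measurable_fun m2] => p /set_mem pd; rewrite GE.
Qed.

Lemma disc_inv_nat k : disc (k.+2%:R^-1 : R[i]).
Proof. by rewrite /disc /mkset modulusV modulus_nat invf_lt1 ?ltr0n// ltr1n. Qed.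

(** Each coefficient is a limit of expressions in point values and lower coefficients, and point
    values are measurable in the parameter. *)
Lemma cmeas_pc_coherent u n : cmeas setT (fun p => pc (coherent (plane_point p) u) n).
Proof.
elim/ltn_ind: n => n IH.
pose h k p : R[i] := k.+2%:R ^+ n * (coherent (plane_point p) u k.+2%:R^-1 -
  \sum_(j < n) pc (coherent (plane_point p) u) j * k.+2%:R^-1 ^+ j).
apply: (@cmeas_cvg _ _ _ setT h) => // [k|p _]; last exact: (@power_series_coef_limit _ _ _ n (@bergman_series R a (coherent (plane_point p) u))).
apply: cmeasM; first exact: cmeas_cst.
apply: cmeasB; first exact: cmeas_coherent (disc_inv_nat k).
apply: cmeas_sum => j; apply: cmeasM; first exact: IH.
exact: cmeas_cst.
Qed.

End cstates.

(** * Polynomials of an operator at approximate eigenvectors *)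

Section polynomial_difference.
Context (R : realType) (H : lmodType R[i]) (ip : H -> H -> R[i]).
Hypothesis Hip : inner_product ip.
Local Notation hn := (hnorm ip).
Variables (L : H -> H) (M : R).
Hypotheses (lL : linear L) (M0 : 0 <= M) (bL : forall u, hn (L u) <= M * hn u).

Lemma iter_linear k : linear (iter k L).
Proof. by elim: k => [|k IH] c u v //=; rewrite IH lL. Qed.

Lemma hn_iter k u : hn (iter k L u) <= M ^+ k * hn u.
Proof.
elim: k => [|k IH] /=; first by rewrite expr0 mul1r.
by apply: le_trans (bL _) _; rewrite exprS -mulrA ler_wpM2l.
Qed.

(** The derivative at [M] of the polynomial with coefficients [|p_k|]: a Lipschitz constant of [p]
    on [[0, M]]. *)
Definition poly_lipschitz (p : {poly R[i]}) : R := \sum_(k < size p) modulus p`_k * (k%:R * M ^+ k.-1).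

Lemma hn_iter_diff (c : R) u k : 0 <= c <= M ->
  hn (iter k L u - c%:C ^+ k *: u) <= k%:R * M ^+ k.-1 * hn (L u - c%:C *: u).
Proof.
move=> /andP[c0 cM]; elim: k => [|k IH]; first by rewrite expr0 scale1r subrr (hnorm0 Hip) mul0r mul0r.
have -> : iter k.+1 L u - c%:C ^+ k.+1 *: u =
    iter k L (L u - c%:C *: u) + c%:C *: (iter k L u - c%:C ^+ k *: u).
  rewrite (linearB' _ _ (iter_linear k)) (linearZ' _ _ (iter_linear k)) -iterSr scalerBr scalerA -exprS.
  by rewrite [RHS]addrA subrK.
apply: le_trans (hnormD Hip _ _) _; rewrite (hnormZ Hip) modulusR ger0_norm//.
apply: le_trans (lerD (hn_iter k _) (ler_pM c0 (hn_ge0 _ _) cM IH)) _.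
rewrite /= mulrA -mulrDl; apply: ler_wpM2r; first exact: hn_ge0.
case: k {IH} => [|k] /=; first by rewrite !expr0 mul0r mulr0 addr0 mulr1.
by rewrite [M * _]mulrCA -exprS -[in leRHS]natr1 mulrDl mul1r addrC.
Qed.

(** An approximate eigenvector of [L] for [c] is one of [p(L)] for [p(c)], the loss being the
    Lipschitz constant of [p], since [L^(k+1) - c^(k+1) = L^k (L - c) + c (L^k - c^k)]. *)
Lemma operator_poly_diff (p : {poly R[i]}) (c : R) u : 0 <= c <= M ->
  hn (operator_poly p L u - p.[c%:C] *: u) <= poly_lipschitz p * hn (L u - c%:C *: u).
Proof.
move=> cM; rewrite /operator_poly horner_coef scaler_suml -sumrB /poly_lipschitz mulr_suml.
apply: le_trans (hnorm_sum Hip _ _ _) _; apply: ler_sum => k _.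
by rewrite -scalerA -scalerBr (hnormZ Hip) -mulrA ler_wpM2l ?modulus_ge0// hn_iter_diff.
Qed.

Lemma poly_lipschitz_ge0 p : 0 <= poly_lipschitz p.
Proof. by apply: sumr_ge0 => k _; rewrite !mulr_ge0 ?modulus_ge0 ?exprn_ge0. Qed.

End polynomial_difference.

(** * Orthonormal bases and Parseval's identity *)

Section orthonormal_expansion.
Context (R : realType) (H : lmodType R[i]) (ip : H -> H -> R[i]).
Hypothesis Hip : inner_product ip.
Local Notation hn := (hnorm ip).
Variable e : nat -> H.
Hypothesis He : orthonormal_basis ip e.
Implicit Types (u v : H).

Definition basis_sum u N : H := \sum_(i < N) ip u (e i) *: e i.

Lemma basis_sum_cvg u : hcvg ip (basis_sum u) u.
Proof.
have [_ h] := He; have := h u; rewrite /hcvg.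
suff -> : (fun n => hn (basis_sum u n - u)) = (fun n => hn (u - \sum_(i < n) ip u (e i) *: e i)) by [].
by apply/funext => n; rewrite (hnormBC Hip).
Qed.

Lemma ip_basis_sum u N : ip (basis_sum u N) u = (series (fun n => modulus (ip u (e n)) ^+ 2) N)%:C.
Proof.
rewrite /basis_sum (ip_suml Hip) /series /= big_mkord realC_sum; apply: eq_bigr => i _.
by rewrite (ipZl Hip) (ip_sym Hip u) mulC_conj.
Qed.

Lemma hn_basis_sum u N : hn (basis_sum u N) ^+ 2 = series (fun n => modulus (ip u (e n)) ^+ 2) N.
Proof.
have [ee _] := He; rewrite (hnorm_sqr Hip); have E : ip (basis_sum u N) (basis_sum u N) = ip (basis_sum u N) u.
  rewrite /basis_sum !(ip_suml Hip); apply: eq_bigr => i _; rewrite !(ipZl Hip) (ip_sumr Hip); congr (_ * _).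
  rewrite (bigD1 i)//= (ipZr Hip) ee eqxx mulr1 big1 ?addr0 -?(ip_sym Hip)// => j ji.
  by rewrite (ipZr Hip) ee eq_sym val_eqE (negPf ji) mulr0.
by rewrite E ip_basis_sum.
Qed.

Lemma parseval u : series (fun n => modulus (ip u (e n)) ^+ 2) N @[N --> \oo] --> hn u ^+ 2.
Proof.
have h := hcvg_norm Hip (basis_sum_cvg u).
rewrite (_ : series _ = fun N => hn (basis_sum u N) ^+ 2); last by apply/funext => N; rewrite hn_basis_sum.
by rewrite expr2; apply: cvgM; exact: h.
Qed.

Lemma hn_basis_sum_le u N : hn (basis_sum u N) <= hn u.
Proof.
have h := cauchy_schwarz Hip (basis_sum u N) u; move: h.
rewrite ip_basis_sum -hn_basis_sum modulusR ger0_norm ?sqr_ge0// expr2.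
have := hn_ge0 ip (basis_sum u N); rewrite le_eqVlt => /orP[/eqP <- _|h0]; first exact: hn_ge0.
by rewrite ler_pM2l.
Qed.

End orthonormal_expansion.

(** * Operators with a symbol in a continuous Parseval frame *)

Section localization_operator.
Context (R : realType) (H : lmodType R[i]) (ip : H -> H -> R[i]).
Hypothesis Hip : hilbert ip.
Let Hpre : inner_product ip. Proof. exact: Hip. Qed.
Local Notation hn := (hnorm ip).
Context d (T : measurableType d) (m : {measure set T -> \bar R}).
Variables (v : T -> H) (f : T -> R) (M : R).
Hypotheses (mv : forall g, cmeas setT (fun x => ip (v x) g)) (mf : measurable_fun setT f).
Hypotheses (M0 : 0 <= M) (f0 : forall x, 0 <= f x) (fM : forall x, f x <= M).
Hypothesis frame : forall g, (\int[m]_x (modulus (ip (v x) g) ^+ 2)%:E = (hn g ^+ 2)%:E)%E.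
Hypothesis fv : m.-integrable setT (EFin \o (fun x => f x * hn (v x) ^+ 2)).
Implicit Types (g h u : H).

Let mv2 g : measurable_fun setT (fun x => modulus (ip (v x) g) ^+ 2).
Proof. exact: meas_modulus2. Qed.

Let iv2 g : m.-integrable setT (EFin \o (fun x => modulus (ip (v x) g) ^+ 2)).
Proof.
apply/integrableP; split; first by apply/measurable_EFinP.
under eq_integral do rewrite /= ger0_norm ?sqr_ge0//.
by rewrite frame ltry.
Qed.

Let integrand g h x : R[i] := (f x)%:C * (ip (v x) g)^* * ip (v x) h.

Let mintegrand g h : cmeas setT (integrand g h).
Proof.
apply: cmeasM; last exact: mv.
by apply: cmeasM; [exact: cmeas_real|apply: cmeas_conj; exact: mv].
Qed.

Let integrand_le g h x : modulus (integrand g h x) <= M * (modulus (ip (v x) g) ^+ 2 + modulus (ip (v x) h) ^+ 2).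
Proof.
rewrite /integrand !modulusM modulus_conj modulusR ger0_norm// -mulrA.
have gen (a b : R) : 0 <= a -> 0 <= b -> a * b <= a ^+ 2 + b ^+ 2 by move=> *; nra.
by apply: ler_pM; rewrite ?mulr_ge0 ?modulus_ge0// gen ?modulus_ge0.
Qed.

Let ibound g h : m.-integrable setT (EFin \o (fun x => M * (modulus (ip (v x) g) ^+ 2 + modulus (ip (v x) h) ^+ 2))).
Proof.
have := integrableD measurableT (iv2 g) (iv2 h) => /(integrableZl measurableT M).
by apply: eq_integrable.
Qed.

Lemma frame_form_integrable g h : cinteg m setT (integrand g h).
Proof. by apply: (cinteg_bound measurableT (mintegrand g h) (ibound g h)) => x _; exact: integrand_le. Qed.

Definition frame_form g h : R[i] := Cintegral m setT (integrand g h).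

Lemma frame_formDl (k : R[i]) g g' h : frame_form (k *: g + g') h = k * frame_form g h + frame_form g' h.
Proof.
rewrite /frame_form -(CintegralZ measurableT k (frame_form_integrable g h)).
rewrite -(CintegralD measurableT (cintegZ measurableT k (frame_form_integrable g h)) (frame_form_integrable g' h)).
apply: eq_Cintegral => x _; rewrite /integrand (ipDr Hpre) (ipZr Hpre) conjCD conjCM conjcK.
by rewrite mulrDr mulrDl; congr (_ + _); rewrite !mulrA; congr (_ * _ * _); exact: mulrC.
Qed.

Lemma frame_form_sym g h : frame_form h g = (frame_form g h)^*.
Proof.
rewrite -(Cintegral_conj measurableT (frame_form_integrable g h)); apply: eq_Cintegral => x _.
by rewrite /integrand !conjCM conjcK conjc_real -mulrA [(ip _ h)^* * _]mulrC mulrA.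
Qed.

Let Rint (F : T -> R) := (\int[m]_x F x)%R.

Let Rv2 g : Rint (fun x => modulus (ip (v x) g) ^+ 2) = hn g ^+ 2.
Proof. by rewrite /Rint /Rintegral frame. Qed.

Lemma frame_form_bound g h : modulus (frame_form g h) <= M * (hn g ^+ 2 + hn h ^+ 2).
Proof.
apply: le_trans (le_modulus_Cintegral measurableT (frame_form_integrable g h)) _.
rewrite -(Rv2 g) -(Rv2 h) -(RintegralD measurableT (iv2 g) (iv2 h)).
rewrite -RintegralZl//; last exact: (integrableD measurableT (iv2 g) (iv2 h)).
apply: (le_Rintegral measurableT (cinteg_modulus measurableT (frame_form_integrable g h)) (ibound g h)).
by move=> x _; exact: integrand_le.
Qed.

Lemma frame_form0 h : frame_form 0 h = 0.
Proof.
rewrite -(Cintegral0 m setT); apply: eq_Cintegral => x _.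
have c0 : (0 : R[i])^* = 0 by exact: rmorph0.
by rewrite /integrand (ip0r Hpre) c0 mulr0 mul0r.
Qed.

Lemma frame_formZ k g h : frame_form (k *: g) h = k * frame_form g h.
Proof. by rewrite -[k *: g]addr0 frame_formDl frame_form0 addr0. Qed.

Lemma frame_operator_ex : exists L : H -> H, forall g h, ip (L g) h = frame_form g h.
Proof.
suff /choice[L hL] : forall g, exists w, forall h, ip w h = frame_form g h by exists L.
move=> g; have [||w hw] := riesz Hip (phi := fun h => frame_form h g).
- by move=> k h h'; exact: frame_formDl.
(* [frame_form_bound] is not homogeneous in [h]; scaling [h] to norm 1 turns it into a linear bound
   with this constant. *)
- exists (M * (1 + hn g ^+ 2)) => h; have [/eqP|h0] := eqVneq (hn h) 0.
    by rewrite (hnorm_eq0 Hpre) => /eqP ->; rewrite (hnorm0 Hpre) mulr0 frame_form0 modulus0.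
  have hp : 0 < hn h by rewrite lt0r h0 hn_ge0.
  pose k : R[i] := (hn h)%:C; have k0 : k != 0 by rewrite -modulus_eq0 modulusR normr_eq0.
  have -> : frame_form h g = k * frame_form (k^-1 *: h) g by rewrite frame_formZ mulrA mulfV// mul1r.
  rewrite modulusM modulusR (gtr0_norm hp) mulrC ler_pM2r//.
  apply: le_trans (frame_form_bound _ _) _; rewrite (hnormZ Hpre) modulusV modulusR (gtr0_norm hp) mulVf//.
  by rewrite expr1n.
by exists w => h; rewrite (ip_sym Hpre h) -hw frame_form_sym conjcK.
Qed.

Section operator.
Variable L : H -> H.
Hypothesis LE : forall g h, ip (L g) h = frame_form g h.

Lemma frame_operator_linear : linear L.
Proof.
move=> k g h; apply: (ip_ext Hpre) => w.
by rewrite LE frame_formDl (ipDl Hpre) (ipZl Hpre) !LE.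
Qed.

Lemma frame_operator_selfadj g h : ip (L g) h = ip g (L h).
Proof. by rewrite (ip_sym Hpre (L h)) !LE; exact: frame_form_sym. Qed.

Let ifv2 g : m.-integrable setT (EFin \o (fun x => f x * modulus (ip (v x) g) ^+ 2)).
Proof.
apply: (le_integrable measurableT _ _ (integrableZl measurableT M (iv2 g))).
  by apply/measurable_EFinP; exact: measurable_funM.
move=> x _ /=; rewrite lee_fin !ger0_norm ?mulr_ge0 ?sqr_ge0 ?exprn_ge0 ?modulus_ge0//.
by rewrite ler_wpM2r ?sqr_ge0.
Qed.

Lemma Re_frame_operator g : Re (ip (L g) g) = Rint (fun x => f x * modulus (ip (v x) g) ^+ 2).
Proof.
rewrite LE /=; congr fine; apply: eq_integral => x _; congr EFin.
by rewrite /integrand -mulrA [(ip _ _)^* * _]mulrC mulC_conj -realCM.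
Qed.

Lemma frame_operator_range g : 0 <= Re (ip (L g) g) <= M * hn g ^+ 2.
Proof.
rewrite Re_frame_operator; apply/andP; split.
  by apply: Rintegral_ge0 => x _; rewrite mulr_ge0 ?sqr_ge0.
rewrite -Rv2 /Rint -RintegralZl//.
apply: (le_Rintegral measurableT (ifv2 g) (integrableZl measurableT M (iv2 g))).
by move=> x _; rewrite ler_wpM2r ?sqr_ge0.
Qed.

Lemma frame_operator_norm g : hn (L g) <= M * hn g.
Proof.
exact: (positive_operator_norm Hip g frame_operator_linear frame_operator_selfadj frame_operator_range).
Qed.

Section trace.
Variable e : nat -> H.
Hypothesis He : orthonormal_basis ip e.
Variables (S : H -> H) (K : R).
Hypotheses (lS : linear S) (bS : forall u, hn (S u) <= K * hn u).

Let S_sum x N : ip (S (basis_sum ip e (v x) N)) (v x) = \sum_(i < N) ip (v x) (e i) * ip (S (e i)) (v x).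
Proof.
rewrite /basis_sum (linear_sum' _ _ _ lS) (ip_suml Hpre); apply: eq_bigr => i _.
by rewrite (linearZ' _ _ lS) (ipZl Hpre).
Qed.

Let mSv g : cmeas setT (fun x => ip g (v x)).
Proof.
have := cmeas_conj (mv g); congr cmeas; apply/funext => x.
by rewrite -(ip_sym Hpre).
Qed.

(** Expand one copy of [v x] in the basis: the partial sums of the trace are integrals of
    [f <S P_N v, v>], with [P_N] the projections on the first basis vectors, dominated by
    [|K| f |v|^2]. The limit does not mention the basis, as [is_trace] requires. *)
Lemma frame_operator_trace :
  series (fun n => ip (L (S (e n))) (e n)) N @[N --> \oo] --> Cintegral m setT (fun x => (f x)%:C * ip (S (v x)) (v x)).
Proof.
pose h N x : R[i] := (f x)%:C * ip (S (basis_sum ip e (v x) N)) (v x).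
have -> : series (fun n => ip (L (S (e n))) (e n)) = fun N => Cintegral m setT (h N).
  apply/funext => N; rewrite /series /= big_mkord.
  under eq_bigr do rewrite LE /frame_form.
  rewrite -(Cintegral_sum measurableT _ (fun i : 'I_N => frame_form_integrable (S (e i)) (e i))).
  apply: eq_Cintegral => x _; rewrite /h S_sum mulr_sumr; apply: eq_bigr => i _.
  by rewrite /integrand -(ip_sym Hpre) -mulrA; congr (_ * _); exact: mulrC.
apply: (@Cintegral_cvg _ _ _ m _ measurableT h _ (fun x => `|K| * (f x * hn (v x) ^+ 2))).
- move=> N; rewrite /h; under eq_fun do rewrite S_sum; apply: cmeasM; first exact: cmeas_real.
  by apply: cmeas_sum => i; apply: cmeasM => //; exact: mv.
- exact: (integrableZl measurableT `|K| fv).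
- move=> N x _; rewrite /h modulusM modulusR ger0_norm// mulrCA ler_wpM2l//.
  apply: le_trans (cauchy_schwarz Hpre _ _) _; rewrite expr2 mulrA ler_wpM2r ?hn_ge0//.
  apply: le_trans (bS _) _; apply: le_trans (ler_wpM2r (hn_ge0 _ _) (ler_norm K)) _.
  by rewrite ler_wpM2l//; exact: hn_basis_sum_le.
- move=> x _; have h1 := hcvg_ip Hpre (v := v x) (hcvg_bounded lS bS (basis_sum_cvg Hpre He (v x))).
  exact: (cvgCM (@cvgC_cst R _ \oo _ (f x)%:C) h1).
Qed.

End trace.

Variable e : nat -> H.
Hypothesis He : orthonormal_basis ip e.

Let lL := frame_operator_linear.
Let sL := frame_operator_selfadj.
Let bL := frame_operator_norm.

(** The trace of the square of [L], as [frame_operator_trace] gives it for [S = L]. *)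
Definition frame_trace2 : R := Re (Cintegral m setT (fun x => (f x)%:C * ip (L (v x)) (v x))).

Lemma frame_trace2E : series (fun n => hn (L (e n)) ^+ 2) N @[N --> \oo] --> frame_trace2.
Proof.
have h := frame_operator_trace He lL bL; have /cvgC_ReIm[hr _] := h.
rewrite (_ : series _ = fun N => Re (series (fun n => ip (L (L (e n))) (e n)) N)); first exact: hr.
apply/funext => N; rewrite /series /= Re_sum; apply: eq_bigr => n _.
by rewrite sL (hnorm_sqr Hpre).
Qed.

Let mLv g : cmeas setT (fun x => ip (L (v x)) g).
Proof.
have := mv (L g); congr cmeas; apply/funext => x.
by rewrite sL.
Qed.

Let hnLv x : (hn (L (v x)) ^+ 2)%:E = (\sum_(0 <= n <oo) (modulus (ip (v x) (L (e n))) ^+ 2)%:E)%E.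
Proof.
rewrite -(nneseries_EFin (@parseval _ _ _ Hpre e He (L (v x)))).
by apply: eq_eseriesr => n _; rewrite sL.
Qed.

(** By the frame identity the integral of [|<L v, e>|^2 = |<v, L e>|^2] is [|L e|^2]; summed over a
    basis, this is a second expression of the same trace, the one that completes the square in
    [frame_variance]. *)
Lemma integral_frame_operator : (\int[m]_x (hn (L (v x)) ^+ 2)%:E = frame_trace2%:E)%E.
Proof.
under eq_integral do rewrite hnLv.
rewrite integral_nneseries//.
- by rewrite -(nneseries_EFin frame_trace2E); apply: eq_eseriesr => n _; exact: frame.
- by move=> n; apply/measurable_EFinP.
- by move=> n x _; rewrite lee_fin sqr_ge0.
Qed.

Let mhv : measurable_fun setT (fun x => hn (v x) ^+ 2).
Proof.
apply/measurable_EFinP.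
rewrite (_ : EFin \o _ = fun x => (\sum_(0 <= n <oo) (modulus (ip (v x) (e n)) ^+ 2)%:E)%E); last first.
  by apply/funext => x; rewrite /= -(nneseries_EFin (@parseval _ _ _ Hpre e He (v x))).
by apply: ge0_emeasurable_sum => [n x _ _|n _]; [rewrite lee_fin sqr_ge0|apply/measurable_EFinP].
Qed.

Let mhLv : measurable_fun setT (fun x => hn (L (v x)) ^+ 2).
Proof.
apply/measurable_EFinP; rewrite (_ : EFin \o _ = fun x => (\sum_(0 <= n <oo) (modulus (ip (v x) (L (e n))) ^+ 2)%:E)%E); last first.
  by apply/funext => x; rewrite /= hnLv.
by apply: ge0_emeasurable_sum => [n x _ _|n _]; [rewrite lee_fin sqr_ge0|apply/measurable_EFinP].
Qed.

Lemma cmeas_operator_ip S (K : R) : linear S -> (forall u, hn (S u) <= K * hn u) ->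
  cmeas setT (fun x => ip (S (v x)) (v x)).
Proof.
move=> lS bS; apply: (@cmeas_cvg _ _ _ setT (fun N x => \sum_(i < N) ip (v x) (e i) * ip (S (e i)) (v x))) => //.
  move=> N; apply: cmeas_sum => i; apply: cmeasM; first exact: mv.
  have := cmeas_conj (mv (S (e i))); congr cmeas; apply/funext => x.
  by rewrite -(ip_sym Hpre).
move=> x _; have h := hcvg_ip Hpre (v := v x) (hcvg_bounded lS bS (basis_sum_cvg Hpre He (v x))).
rewrite (_ : (fun N => _) = fun N => ip (S (basis_sum ip e (v x) N)) (v x)); first exact: h.
apply/funext => N; rewrite /basis_sum (linear_sum' _ _ _ lS) (ip_suml Hpre); apply: eq_bigr => i _.
by rewrite (linearZ' _ _ lS) (ipZl Hpre).
Qed.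

Let iLv2 : m.-integrable setT (EFin \o (fun x => hn (L (v x)) ^+ 2)).
Proof.
apply/integrableP; split; first exact/measurable_EFinP.
under eq_integral do rewrite /= ger0_norm ?sqr_ge0//.
by rewrite integral_frame_operator ltry.
Qed.

Let if2 : m.-integrable setT (EFin \o (fun x => f x ^+ 2 * hn (v x) ^+ 2)).
Proof.
apply: (le_integrable measurableT _ _ (integrableZl measurableT M fv)).
  by apply: measurable_EFinM => //; exact: measurable_funX.
move=> x _ /=; rewrite lee_fin !ger0_norm ?mulr_ge0 ?sqr_ge0 ?hn_ge0//.
by rewrite [f x ^+ 2]expr2 -[leLHS]mulrA; apply: ler_wpM2r; rewrite ?mulr_ge0 ?sqr_ge0 ?hn_ge0.
Qed.

Let iLf : m.-integrable setT (EFin \o (fun x => f x * Re (ip (L (v x)) (v x)))).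
Proof.
apply: (le_integrable measurableT _ _ (integrableZl measurableT M fv)).
  by apply: measurable_EFinM => //; have [] := cmeas_operator_ip lL bL.
move=> x _ /=; rewrite lee_fin normrM ger0_norm// [leRHS]ger0_norm ?mulr_ge0 ?sqr_ge0 ?hn_ge0//.
rewrite mulrCA ler_wpM2l//; apply: le_trans (Re_le_modulus _) _; apply: le_trans (cauchy_schwarz Hpre _ _) _.
by rewrite expr2 mulrA ler_wpM2r ?hn_ge0//; exact: bL.
Qed.

Let hn_diff x : hn (L (v x) - (f x)%:C *: v x) ^+ 2 =
  hn (L (v x)) ^+ 2 - 2 * (f x * Re (ip (L (v x)) (v x))) + f x ^+ 2 * hn (v x) ^+ 2.
Proof.
rewrite -[- _](scaleN1r) scalerA mulN1r -realCN (hnorm_sqrD Hpre) (hnorm_sqr Hpre (_ *: _)) (ipZr Hpre) conjc_real ReZ.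
rewrite (ipZl Hpre) (ipZr Hpre) conjc_real !ReZ -(hnorm_sqr Hpre); ring.
Qed.

(* The mean square of (L - f) v is the defect between the trace of L^2 and that of f^2. *)
Lemma frame_variance : m.-integrable setT (EFin \o (fun x => hn (L (v x) - (f x)%:C *: v x) ^+ 2)) /\
  Rint (fun x => hn (L (v x) - (f x)%:C *: v x) ^+ 2) = Rint (fun x => f x ^+ 2 * hn (v x) ^+ 2) - frame_trace2.
Proof.
have i2 := integrableZl measurableT 2 iLf.
have i3 := integrableB measurableT iLv2 i2.
have -> : (fun x => hn (L (v x) - (f x)%:C *: v x) ^+ 2) =
    (fun x => (hn (L (v x)) ^+ 2 - 2 * (f x * Re (ip (L (v x)) (v x)))) + f x ^+ 2 * hn (v x) ^+ 2).
  by apply/funext => x; rewrite hn_diff.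
split; first exact: (integrableD measurableT i3 if2).
rewrite /Rint (RintegralD measurableT i3 if2) (RintegralB measurableT iLv2 i2) RintegralZl//.
have -> : (\int[m]_x (hn (L (v x)) ^+ 2))%R = frame_trace2 by rewrite /Rintegral integral_frame_operator.
have -> : (\int[m]_x (f x * Re (ip (L (v x)) (v x))))%R = frame_trace2.
  rewrite /frame_trace2 /=; congr fine; apply: eq_integral => x _; congr EFin.
  by rewrite ReZ.
by ring.
Qed.

Variables (S : H -> H) (h : R -> R[i]) (p : {poly R[i]}) (eps kap : R).
Hypotheses (lS : linear S) (eps0 : 0 <= eps) (kap0 : 0 < kap).
Hypothesis mh : cmeas setT (fun x => h (f x)).
Hypothesis ph : forall x : R, 0 <= x <= M -> modulus (p.[x%:C] - h x) <= eps.
Hypothesis pS : forall u, hn (operator_poly p L u - S u) <= eps * hn u.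

Let hM x : 0 <= f x <= M. Proof. by rewrite f0 fM. Qed.

(** The difference of the integrands splits into [<(p(L) - p(f)) v, v>], [<(p(L) - S) v, v>] and
    [(p(f) - h(f)) |v|^2]. The last two cost [eps |v|^2] each. The first is governed by
    [|(L - f) v| |v|] through [operator_poly_diff], and [kap] is the weight in the
    arithmetic-geometric inequality that separates this product into squares. *)
Theorem frame_trace_estimate (K : R) : (forall u, hn (S u) <= K * hn u) ->
  modulus (Cintegral m setT (fun x => (f x)%:C * ip (S (v x)) (v x)) -
      Cintegral m setT (fun x => (f x * hn (v x) ^+ 2)%:C * h (f x))) <=
    2 * eps * Rint (fun x => f x * hn (v x) ^+ 2) +
    poly_lipschitz M p * (kap / 2 * Rint (fun x => f x ^+ 2 * hn (v x) ^+ 2) +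
      (2 * kap)^-1 * (Rint (fun x => f x ^+ 2 * hn (v x) ^+ 2) - frame_trace2)).
Proof.
move=> bS; have [iV <-] := frame_variance.
pose D := poly_lipschitz M p; have D0 : 0 <= D := poly_lipschitz_ge0 M0 p.
pose V x := hn (L (v x) - (f x)%:C *: v x) ^+ 2.
have [B hB] : exists B, forall x : R, 0 <= x <= M -> modulus (h x) <= B.
  exists (eps + \sum_(k < size p) modulus p`_k * M ^+ k) => x xM; have /andP[x0 x1] := xM.
  rewrite -[h x](subKr p.[x%:C]); apply: le_trans (modulusD _ _) _; rewrite modulusN addrC lerD ?ph//.
  rewrite horner_coef; apply: le_trans (modulus_sum _ _ _) _; apply: ler_sum => k _.
  by rewrite modulusM modulusX modulusR ger0_norm// ler_wpM2l ?modulus_ge0// lerXn2r.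
have i1 : cinteg m setT (fun x => (f x)%:C * ip (S (v x)) (v x)).
  apply: (cinteg_bound measurableT _ (integrableZl measurableT `|K| fv)).
    by apply: cmeasM; [exact: cmeas_real|exact: cmeas_operator_ip lS bS].
  move=> x _; rewrite modulusM modulusR ger0_norm// mulrCA ler_wpM2l//.
  apply: le_trans (cauchy_schwarz Hpre _ _) _; rewrite expr2 mulrA ler_wpM2r ?hn_ge0//.
  by apply: le_trans (bS _) _; rewrite ler_wpM2r ?hn_ge0// ler_norm.
have i2 : cinteg m setT (fun x => (f x * hn (v x) ^+ 2)%:C * h (f x)).
  apply: (cinteg_bound measurableT _ (integrableZl measurableT B fv)).
    by apply: cmeasM => //; apply: cmeas_real; exact: measurable_funM.
  move=> x _; rewrite modulusM modulusR ger0_norm ?mulr_ge0 ?sqr_ge0 ?hn_ge0// mulrC.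
  by rewrite ler_wpM2r ?mulr_ge0 ?sqr_ge0 ?hn_ge0// hB.
pose G x := 2 * eps * (f x * hn (v x) ^+ 2) + D * (kap / 2 * (f x ^+ 2 * hn (v x) ^+ 2) + (2 * kap)^-1 * V x).
have iG1 := integrableZl measurableT (2 * eps) fv.
have iG2 := integrableZl measurableT (kap / 2) if2.
have iG3 := integrableZl measurableT (2 * kap)^-1 iV.
have iG4 := integrableD measurableT iG2 iG3.
have iG5 := integrableZl measurableT D iG4.
have iG := integrableD measurableT iG1 iG5.
have EG : Rint G = 2 * eps * Rint (fun x => f x * hn (v x) ^+ 2) +
    D * (kap / 2 * Rint (fun x => f x ^+ 2 * hn (v x) ^+ 2) + (2 * kap)^-1 * Rint V).
  by rewrite /Rint /G RintegralD// RintegralZl// RintegralZl// RintegralD// !RintegralZl.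
rewrite -[X in _ <= X]EG -(CintegralB measurableT i1 i2).
have i3 : cinteg m setT (fun x => (f x)%:C * ip (S (v x)) (v x) - (f x * hn (v x) ^+ 2)%:C * h (f x)).
  have := cintegD measurableT i1 (cintegZ measurableT (- 1) i2).
  by congr cinteg; apply/funext => x; rewrite mulN1r.
apply: le_trans (le_modulus_Cintegral measurableT i3) _.
apply: (le_Rintegral measurableT (cinteg_modulus measurableT i3) iG) => x _.
set q := v x; pose c := (f x)%:C.
have -> : (f x)%:C * ip (S q) q - (f x * hn q ^+ 2)%:C * h (f x) =
    (f x)%:C * (ip (operator_poly p L q - p.[c] *: q) q - ip (operator_poly p L q - S q) q + (p.[c] - h (f x)) * (hn q ^+ 2)%:C).
  by rewrite !(ipBl Hpre) (ipZl Hpre) (ip_self Hpre) realCM; ring.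
rewrite modulusM modulusR ger0_norm//.
have q0 : 0 <= hn q := hn_ge0 _ _.
have e1 : modulus (ip (operator_poly p L q - p.[c] *: q) q) <= D * hn (L q - c *: q) * hn q.
  apply: le_trans (cauchy_schwarz Hpre _ _) _; rewrite ler_wpM2r//.
  by apply: (operator_poly_diff Hpre lL M0 bL); rewrite hM.
have e2 : modulus (ip (operator_poly p L q - S q) q) <= eps * hn q ^+ 2.
  by apply: le_trans (cauchy_schwarz Hpre _ _) _; rewrite expr2 mulrA ler_wpM2r.
have e3 : modulus ((p.[c] - h (f x)) * (hn q ^+ 2)%:C) <= eps * hn q ^+ 2.
  by rewrite modulusM modulusR ger0_norm ?sqr_ge0// ler_wpM2r ?sqr_ge0// ph ?hM.
have e4 : modulus (ip (operator_poly p L q - p.[c] *: q) q - ip (operator_poly p L q - S q) q + (p.[c] - h (f x)) * (hn q ^+ 2)%:C) <=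
    D * hn (L q - c *: q) * hn q + eps * hn q ^+ 2 + eps * hn q ^+ 2.
  apply: le_trans (modulusD _ _) _; apply: lerD e3; apply: le_trans (modulusD _ _) _.
  by rewrite modulusN lerD.
apply: le_trans (ler_wpM2l (f0 x) e4) _; rewrite /G /V -/q -/c.
have := hn_ge0 ip (L q - c *: q); move: (hn (L q - c *: q)) (hn q) q0 (f x) (f0 x) => A B' q0 F F0 A0.
have am : F * B' * A <= kap / 2 * (F ^+ 2 * B' ^+ 2) + (2 * kap)^-1 * A ^+ 2.
  have := sqr_ge0 (kap * (F * B') - A); rewrite -(pmulr_rge0 _ (_ : 0 < (2 * kap)^-1)) ?invr_gt0 ?mulr_gt0// => h1.
  rewrite -subr_ge0; move: h1; congr (0 <= _); field; exact: lt0r_neq0.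
have := ler_wpM2l D0 am; move: (_ + _ * A ^+ 2) => Y; nra.
Qed.

End operator.
End localization_operator.

Lemma cmeas_map d (T : measurableType d) (R : realType) (F : R[i] -> R[i]) (h : T -> R[i]) :
  cmeas setT (F \o @plane_point R) -> cmeas setT h -> cmeas setT (F \o h).
Proof.
move=> [mr mi] [m1 m2]; have mp := measurable_fun_pair m1 m2.
split; [have := measurableT_comp mr mp|have := measurableT_comp mi mp];
  by congr measurable_fun; apply/funext => p; rewrite /= /plane_point -complexE.
Qed.

Lemma pmeas_map d (T : measurableType d) (R : realType) (F : R[i] -> \bar R) (h : T -> R[i]) :
  pmeas F -> cmeas setT h -> measurable_fun setT (F \o h).
Proof.
move=> mF [m1 m2]; have := measurableT_comp mF (measurable_fun_pair m1 m2).
by congr measurable_fun; apply/funext => p; rewrite /= /plane_point -complexE.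
Qed.

(** * Power series that vanish on a radius *)

Section real_identity.
Context (R : realType).
Implicit Types (b : nat -> R[i]).

Lemma power_series_real0 b f : has_pseries b f ->
  (forall t : R, 0 <= t < 1 -> f t%:C = 0) -> forall n, b n = 0.
Proof.
move=> hb f0; elim/ltn_ind => n IH; apply: (cvgC_unique (@power_series_coef_limit _ _ _ n hb)).
apply: cvg_near_cst; apply: nearW => k.
have -> : (k.+2%:R^-1 : R[i]) = (k.+2%:R^-1)%:C by rewrite realCV realCn.
rewrite f0; last by rewrite invr_ge0 ler0n invf_lt1 ?ltr0n// ltr1n.
by rewrite big1 ?subr0 ?mulr0// => i _; rewrite IH ?mul0r.
Qed.
End real_identity.

(** * Resolution of the identity by coherent states *)

Section frame.
Context (R : realType) (a : R).
Hypothesis a0 : (0 <= a)%R.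
Local Notation H := (bergman_space a).
Local Notation ip := (@bergman_ip R a).
Local Notation hn := (hnorm ip).
Local Notation gam := (bcoef a).
Local Notation T1 := (measurableTypeR R).
Local Notation T3 := (T1 * (T1 * T1))%type.
Local Notation m3 := (leb \x @plane_measure R)%E.
Local Notation lam := (@lam R).
Implicit Types (u v g : H) (z w : R[i]) (t : R).
Local Open Scope ereal_scope.

Let gam_gt0 n : (0 < gam n)%R. Proof. exact: bcoef_gt0. Qed.
Let Hip := bergman_inner_product a0.
Let I := (`[0%R, (2 * pi)%R]%classic : set T1).
Let mI : measurable I. Proof. exact: measurable_itv. Qed.
Let p0 : (0 < 2 * pi :> R)%R. Proof. by rewrite mulr_gt0// pi_gt0. Qed.
Let nt c n : (0 <= nterm a c n)%R. Proof. exact: nterm_ge0. Qed.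

Definition cstate u (x : T3) : H := coherent a0 (pp x.2) (rotated a0 x.1 u).

Let angle : R := ((a + 1) / (2 * pi))%R.
Let angle0 : (0 <= angle)%R. Proof. by rewrite divr_ge0 ?(ltW p0)// addr_ge0. Qed.

(** The density of [(a + 1) dt / (2 pi) dlambda(z)] with respect to Lebesgue measure, zero outside
    the parameter domain. *)
Definition frame_weight (x : T3) : R :=
  (((a + 1) / (2 * pi)) * (\1_I x.1 * (lambda_weight \_ disc) (pp x.2)))%R.

Lemma lamE z : lam z = ((lambda_weight \_ disc) z)%:E.
Proof. by rewrite /lam !patchE; case: ifP. Qed.

Lemma frame_weight_ge0 x : (0 <= frame_weight x)%R.
Proof.
by rewrite /frame_weight mulr_ge0// mulr_ge0// patchE; case: ifP => // _; exact: lambda_ge0.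
Qed.

Lemma measurable_frame_weight : measurable_fun setT frame_weight.
Proof.
apply: measurable_funM => //; apply: measurable_funM.
  exact: (measurableT_comp (measurable_indic _) measurable_fst).
apply: (@measurableT_comp _ _ _ _ _ _ ((lambda_weight \_ disc) \o pp) _ snd) => //.
have := @pmeas_lam R; rewrite /pmeas.
have -> : lam \o pp = EFin \o ((lambda_weight \_ disc) \o pp) by apply/funext => p; rewrite /= lamE.
by move=> /measurable_EFinP.
Qed.

Lemma frame_weight_out x : ~ disc (pp x.2) -> frame_weight x = 0%R.
Proof. by move=> h; rewrite /frame_weight patchE memNset// !mulr0. Qed.

Section fubini.
Variable (G : T3 -> \bar R).
Hypotheses (mG : measurable_fun setT G) (G0 : forall x, 0 <= G x).

Let GW x := G x * (frame_weight x)%:E.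
Let mGW : measurable_fun setT GW.
Proof. by apply: emeasurable_funM => //; apply/measurable_EFinP; exact: measurable_frame_weight. Qed.
Let GW0 x : 0 <= GW x. Proof. by rewrite mule_ge0// lee_fin frame_weight_ge0. Qed.

Let mGt t : measurable_fun setT (fun p => G (t, p)).
Proof. exact: measurableT_comp mG (measurable_pair1 t). Qed.
Let mGp p : measurable_fun setT (fun t => G (t, p)).
Proof. exact: measurableT_comp mG (measurable_pair2 p). Qed.
Let mlam : measurable_fun setT (lam \o pp). Proof. exact: (@pmeas_lam R). Qed.

Lemma measurable_angle_integral : measurable_fun setT (fun p => \int[leb]_(t in I) G (t, p)).
Proof.
pose G' (x : T3) := G x * (\1_I x.1)%:E.
have mG' : measurable_fun setT G'.
  by apply: emeasurable_funM => //; apply/measurable_EFinP; exact: (measurableT_comp (measurable_indic _) measurable_fst).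
have G'0 x : 0 <= G' x by rewrite mule_ge0// lee_fin.
have := measurable_fun_fubini_tonelli_G (m1 := leb) _ mG' G'0; congr measurable_fun; apply/funext => p.
rewrite /fubini_G [RHS]integral_mkcond; apply: eq_integral => t _; rewrite patchE /G' /= indicE.
by case: ifP; rewrite ?mule1 ?mule0.
Qed.

Lemma frame_integral_angle_inner :
  \int[m3]_x (G x * (frame_weight x)%:E) =
  ((a + 1) / (2 * pi))%:E * \int[area]_p (lam (pp p) * \int[leb]_(t in I) G (t, p)).
Proof.
rewrite (fubini_tonelli2 (m1 := leb) (m2 := @plane_measure R) _ mGW GW0).
have E p : fubini_G leb GW p = angle%:E * (lam (pp p) * \int[leb]_(t in I) G (t, p)).
  rewrite muleA -ge0_integralZl//; last 2 first.
  - exact: (measurable_funTS (mGp p)).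
  - by rewrite mule_ge0// ?lam_ge0.
  rewrite /fubini_G [RHS]integral_mkcond; apply: eq_integral => t _.
  rewrite patchE /GW /frame_weight /= indicE lamE.
  case: ifP => _; last by rewrite mul0r mulr0 mule0.
  by rewrite mul1r muleC EFinM.
transitivity (\int[area]_p (angle%:E * (lam (pp p) * \int[leb]_(t in I) G (t, p)))).
  by apply: eq_integral => p _; exact: E.
rewrite ge0_integralZl_EFin//.
- by move=> p _; rewrite mule_ge0 ?lam_ge0// integral_ge0.
- exact: (emeasurable_funM mlam measurable_angle_integral).
Qed.

Lemma frame_integral_angle_outer :
  \int[m3]_x (G x * (frame_weight x)%:E) =
  \int[leb]_(t in I) (((a + 1) / (2 * pi))%:E * \int[area]_p (lam (pp p) * G (t, p))).
Proof.
rewrite (fubini_tonelli1 (m1 := leb) (m2 := @plane_measure R) _ mGW GW0).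
rewrite [RHS]integral_mkcond; apply: eq_integral => t _.
rewrite patchE /fubini_F /GW /frame_weight /= indicE; case: ifP => _; last first.
  by rewrite integral0_eq// => p _; rewrite mul0r mulr0 mule0.
rewrite -ge0_integralZl_EFin//; last 2 first.
- by move=> p _; rewrite mule_ge0 ?lam_ge0.
- exact: emeasurable_funM.
by apply: (@eq_integral _ _ _ (@plane_measure R)) => p _; rewrite mul1r lamE EFinM muleC -muleA.
Qed.

End fubini.

(** The sum is the mean of [|u|^2] on the circle through [z], by [circle_average]. Against the
    invariant measure this is a radial density of mass [|u|^2], the kernel of the Berezin
    transform. *)
Definition berezin u z : \bar R := ((a + 1) * (1 - modulus z ^+ 2) `^ (2 + a))%:E *
  \sum_(0 <= n <oo) (modulus (pc u n) ^+ 2 * modulus z ^+ (2 * n))%:E.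

Lemma berezin_ge0 u z : 0 <= berezin u z.
Proof.
rewrite mule_ge0//; last by apply: nneseries_ge0 => n _ _; rewrite lee_fin mulr_ge0 ?sqr_ge0// exprn_ge0// modulus_ge0.
by rewrite lee_fin mulr_ge0 ?powR_ge0// addr_ge0.
Qed.

Lemma berezin_radial u z w : modulus z = modulus w -> berezin u z = berezin u w.
Proof. by rewrite /berezin => ->. Qed.

Lemma pmeas_berezin u : pmeas (berezin u).
Proof.
have mm := measurable_modulus (@cmeas_point R).
apply: emeasurable_funM.
  apply: measurable_EFinM => //.
  exact: (measurableT_comp (measurable_powR_sub (2 + a)) mm).
apply: ge0_emeasurable_sum => [n p _ _|n _].
  by rewrite lee_fin mulr_ge0 ?sqr_ge0// exprn_ge0// modulus_ge0.
by apply: measurable_EFinM => //; exact: (measurable_funX _ mm).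
Qed.

(** The prefactor and the invariant measure combine to the Bergman weight, so the [n]th term
    contributes the squared norm of [z^(n + j)]. The case [j = 0] gives the mass and [j = 1] the
    second moment. *)
Lemma berezin_moment u j :
  pint (fun z => (modulus z ^+ (2 * j))%:E * berezin u z * lam z) =
  \sum_(0 <= n <oo) (modulus (pc u n) ^+ 2 / gam (n + j))%:E.
Proof.
pose g n z : \bar R := (modulus (pc u n) ^+ 2)%:E * (bergman_weight a z * modulus z ^+ (2 * (n + j)))%:E.
have b0 : (0 <= a + 1)%R by rewrite addr_ge0.
have w0 n z : 0 <= (bergman_weight a z * modulus z ^+ (2 * n))%:E.
  by rewrite lee_fin mulr_ge0 ?bergman_weight_ge0// exprn_ge0// modulus_ge0.
have mw n : measurable_fun plane_disc (fun p : T1 * T1 => (bergman_weight a (plane_point p) * modulus (plane_point p) ^+ (2 * n))%:E).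
  apply: measurable_EFinM; first exact: measurable_bergman_weight.
  exact: (measurable_funX _ (measurable_modulus (@cmeas_point R))).
have c0 n : (0 <= modulus (pc u n) ^+ 2)%R by exact: sqr_ge0.
have g0 n z : 0 <= g n z by rewrite mule_ge0// lee_fin.
have mg n : measurable_fun plane_disc (fun p : T1 * T1 => g n (plane_point p)).
  by apply: emeasurable_funM => //; exact: measurable_cst.
have mD := @measurable_plane_disc R.
transitivity (pint ((fun z => \sum_(0 <= n <oo) g n z) \_ disc)); last first.
  rewrite -integral_discE integral_nneseries//; apply: eq_eseriesr => n _.
  by rewrite ge0_integralZl_EFin// (bergman_moment _ a0) -EFinM.
congr pint; apply/funext => z; rewrite /lam !patchE; case: ifPn => [/set_mem zd|_]; last by rewrite mule0.
have m0 k : (0 <= modulus z ^+ k)%R by rewrite exprn_ge0// modulus_ge0.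
rewrite /berezin muleA -EFinM muleAC -EFinM -nneseriesZl; last first.
  by move=> n _; rewrite lee_fin mulr_ge0.
apply: eq_eseriesr => n _; rewrite /g weightE// -!EFinM mulnDr exprD [(a + 2)%R]addrC; congr EFin.
have gen (A B C D E F : R) : (A * (B * C) * D * (E * F) = E * (B * C * D * (F * A)))%R by ring.
exact: gen.
Qed.

Lemma berezin_mass u : pint (fun z => berezin u z * lam z) = (hn u ^+ 2)%:E.
Proof.
have := berezin_moment u 0.
have -> : (fun z : R[i] => (modulus z ^+ (2 * 0))%:E * berezin u z * lam z) = (fun z => berezin u z * lam z).
  by apply/funext => z; rewrite muln0 expr0 mul1e.
move=> ->; rewrite -(nneseries_EFin (@hn_series R a a0 u)).
by apply: eq_eseriesr => n _; rewrite addn0.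
Qed.

Lemma circle_average u z : disc z ->
  \int[leb]_(t in I) (modulus (u (cis t * z)%R) ^+ 2)%:E =
  (2 * pi)%:E * \sum_(0 <= n <oo) (modulus (pc u n) ^+ 2 * modulus z ^+ (2 * n))%:E.
Proof.
move=> zd; rewrite (@circle_parseval _ (fun n => pc u n * z ^+ n)%R); first last.
- move=> t; have tz : disc (cis t * z)%R by rewrite disc_cis.
  have h := @bergman_series _ _ u _ tz.
  rewrite (_ : series _ = series (fun n => pc u n * (cis t * z) ^+ n))%R; first exact: h.
  by apply/funext => N; apply: eq_bigr => n _; rewrite exprMn cisX mulrA mulrAC.
- have z01 : (0 <= modulus z < 1)%R by rewrite modulus_ge0.
  have := power_series_abs_summable (@bergman_series R a u) z01.
  suff -> : (fun n => modulus (pc u n) * modulus z ^+ n)%R = (fun n => modulus (pc u n * z ^+ n))%R by [].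
  by apply/funext => n; rewrite modulusM modulusX.
congr (_ * _); apply: eq_eseriesr => n _; congr EFin.
by rewrite modulusM modulusX exprMn -exprM mulnC.
Qed.

(** The pseudohyperbolic distance. Its symmetry makes averaging against a radial density a symmetric
    operation. *)
Lemma modulus_mobiusC w z : disc w -> disc z -> modulus (mobius w z) = modulus (mobius z w).
Proof.
move=> wd zd; rewrite !mobiusE !modulusM !modulusV modulusBC; congr (_ / _)%R.
by rewrite -modulus_conj conjCB conjCM conjcK conjc1 mulrC.
Qed.

Lemma cstate_sqr u t (p : T1 * T1) z : disc (pp p) -> disc z ->
  (modulus (cstate u (t, p) z) ^+ 2 = (1 - modulus z ^+ 2) `^ (- (2 + a)) *
    (1 - modulus (mobius (pp p) z) ^+ 2) `^ (2 + a) * modulus (u (cis t * mobius (pp p) z)) ^+ 2)%R.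
Proof.
rewrite /cstate -[(t, p).2]/p -[(t, p).1]/t; move: (pp p) => w wd zd; set x := mobius w z.
have z1 : (0 < 1 - modulus z ^+ 2)%R by rewrite subr_gt0; have /andP[] := disc_sqr zd.
have xd : disc x by exact: mobius_disc.
have := coherent_sqr a (rotated a0 t u) wd zd; rewrite coherentE// rotatedE//.
rewrite -/x /rotation powRN => E.
have P0 := gt_eqF (powR_gt0 (2 + a) z1); apply: (@mulIf _ ((1 - modulus z ^+ 2) `^ (2 + a))); first by rewrite P0.
by rewrite E; move: P0; set P := ((1 - modulus z ^+ 2) `^ (2 + a))%R => P0; field; rewrite P0.
Qed.

Lemma cstate_average u (p : T1 * T1) z : disc (pp p) -> disc z ->
  ((a + 1) / (2 * pi))%:E *
    \int[leb]_(t in I) (modulus (cstate u (t, p) z) ^+ 2)%:E =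
  ((1 - modulus z ^+ 2) `^ (- (2 + a)))%:E * berezin u (mobius z (pp p)).
Proof.
move=> wd zd; rewrite (berezin_radial u (modulus_mobiusC zd wd)).
under eq_integral do rewrite cstate_sqr//.
move: (mobius_disc wd zd); move: (mobius (pp p) z) => x xd.
pose k := ((1 - modulus z ^+ 2) `^ (- (2 + a)) * (1 - modulus x ^+ 2) `^ (2 + a))%R.
have k0 : (0 <= k)%R by rewrite mulr_ge0 ?powR_ge0.
under eq_integral do rewrite EFinM.
have mux : measurable_fun I (fun t => (modulus (u (cis t * x)%R) ^+ 2)%:E).
  apply/measurable_EFinP; apply: measurable_funTS; apply: meas_modulus2.
  apply: (@cmeas_map _ _ _ u (fun t : T1 => cis t * x)%R); first exact: cmeas_bergmanT.
  by apply: cmeasM; [exact: cmeas_cis|exact: cmeas_cst].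
rewrite ge0_integralZl_EFin//; last by move=> t _; rewrite lee_fin sqr_ge0.
rewrite circle_average// /berezin !muleA -!EFinM; congr (_%:E * _).
by rewrite mulrAC /angle divfK ?gt_eqF// /k mulrCA.
Qed.

Section state.
Variable u : H.

Lemma cstateE t p : cstate u (t, p) = rotated a0 t (coherent a0 (cis t * pp p)%R u).
Proof. exact: coherent_rotated. Qed.

Lemma cmeas_coherent_coef g n : cmeas setT (fun x : T3 =>
  pc (cstate u x) n * (pc g n)^* / (gam n)%:C)%R.
Proof.
apply: cmeasM; last exact: cmeas_cst.
apply: cmeasM; last exact: cmeas_cst.
have mc (k : R) : cmeas setT (fun x : T3 => cis (k * x.1)%R).
  have mk : measurable_fun setT (fun x : T3 => (k * x.1)%R) by apply: measurable_funM => //; exact: measurable_fst.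
  have [m1 m2] := @cmeas_cis R.
  by split; [exact: (measurableT_comp m1 mk)|exact: (measurableT_comp m2 mk)].
have mp : cmeas setT (fun x : T3 => pp x.2).
  have [m1 m2] := @cmeas_point R.
  by split; [exact: (measurableT_comp m1 measurable_snd)|exact: (measurableT_comp m2 measurable_snd)].
have m1 : cmeas setT (fun x : T3 => pc (coherent a0 (cis (1 * x.1) * pp x.2) u) n)%R.
  apply: (@cmeas_map _ _ _ (fun w => pc (coherent a0 w u) n) (fun x : T3 => cis (1 * x.1) * pp x.2)%R).
    exact: cmeas_pc_coherent.
  exact: cmeasM.
have E x : pc (cstate u x) n = (cis (n%:R * x.1) * pc (coherent a0 (cis (1 * x.1) * pp x.2) u) n)%R.
  by rewrite /cstate coherent_rotated pc_rotated mul1r.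
by rewrite (_ : (fun x => _) = fun x => (cis (n%:R * x.1) * pc (coherent a0 (cis (1 * x.1) * pp x.2) u) n)%R);
  [exact: cmeasM|apply/funext].
Qed.

Lemma cmeas_coherent_ip g : cmeas setT (fun x : T3 => ip (cstate u x) g).
Proof.
apply: (@cmeas_cvg _ _ _ setT (fun N x => series (fun n => pc (cstate u x) n * (pc g n)^* / (gam n)%:C)%R N)) => //.
  by move=> N; rewrite /series /=; apply: cmeas_sum => n; exact: cmeas_coherent_coef.
by move=> x _; exact: (@ip_series R a a0 (cstate u x) g).
Qed.

(** Evaluating a state at [z] is pairing it with the kernel at [z], and after integration over the
    angle the square depends on the point through [|mobius z w|] alone. With [phi = 1] this tests
    the resolution of the identity on kernels; with [phi = f] it produces the Berezin transform of
    [f]. *)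
Lemma frame_kernel (phi : R[i] -> \bar R) z : pmeas phi -> (forall w, 0 <= phi w) -> disc z ->
  \int[m3]_x ((modulus (cstate u x z) ^+ 2)%:E * phi (pp x.2) * (frame_weight x)%:E) =
  ((1 - modulus z ^+ 2) `^ (- (2 + a)))%:E *
    pint (fun w => berezin u (mobius z w) * phi w * lam w).
Proof.
move=> mphi phi0 zd.
have mcz : measurable_fun setT (fun x : T3 => (modulus (cstate u x z) ^+ 2)%:E).
  apply/measurable_EFinP; apply: meas_modulus2.
  have := cmeas_coherent_ip (kernel a0 z); congr cmeas; apply/funext => x.
  by rewrite reproducing.
have mp2 : measurable_fun setT (fun x : T3 => phi (pp x.2)) by exact: (measurableT_comp mphi measurable_snd).
rewrite (frame_integral_angle_inner (G := fun x => (modulus (cstate u x z) ^+ 2)%:E * phi (pp x.2))); last 2 first.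
- exact: emeasurable_funM.
- by move=> x; rewrite mule_ge0// lee_fin sqr_ge0.
have mB : pmeas (fun w => berezin u (mobius z w) * phi w * lam w).
  apply: pmeasM; last exact: pmeas_lam.
  apply: pmeasM => //; apply: pmeas_comp; first exact: pmeas_berezin.
  exact: cmeas_mobius.
rewrite -pintZ ?powR_ge0//; last first.
  by move=> w; apply: mule_ge0 (lam_ge0 _); apply: mule_ge0 => //; exact: berezin_ge0.
have mG : measurable_fun setT (fun x : T3 => (modulus (cstate u x z) ^+ 2)%:E * phi (pp x.2)).
  exact: emeasurable_funM.
have G0 (x : T3) : 0 <= (modulus (cstate u x z) ^+ 2)%:E * phi (pp x.2).
  by rewrite mule_ge0// lee_fin sqr_ge0.
have mG1 p : measurable_fun I (fun t => (modulus (cstate u (t, p) z) ^+ 2)%:E).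
  by apply: measurable_funTS; exact: (measurableT_comp mcz (measurable_pair2 p)).
rewrite -ge0_integralZl_EFin//; last 2 first.
- by move=> p _; rewrite mule_ge0 ?lam_ge0// integral_ge0.
- apply: emeasurable_funM; [exact: pmeas_lam|exact: (measurable_angle_integral mG G0)].
apply: eq_integral => p _.
have [pd|pd] := pselect (disc (pp p)); last by rewrite lamE patchE memNset// mul0e !mule0.
transitivity (angle%:E * (lam (pp p) *
    (\int[leb]_(t in I) (modulus (cstate u (t, p) z) ^+ 2)%:E * phi (pp p)))).
  by rewrite -ge0_integralZr// => t _; rewrite lee_fin sqr_ge0.
have gen (A X P L C B : \bar R) : A * X = C * B -> A * (L * (X * P)) = C * (B * P * L).
  by move=> E; rewrite [L * _]muleC !muleA E.
by apply: gen; exact: cstate_average.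
Qed.

(** The [n]th diagonal entry of the frame operator in the normalized monomials; rotations make the
    other entries vanish. *)
Definition coherent_moment n : \bar R :=
  (a + 1)%:E * pint (fun w => (nterm a (pc (coherent a0 w u)) n)%:E * lam w).

(** A rotation multiplies the [n]th coefficient by [cis (n t)], so the pairing is a trigonometric
    series in [t] and Parseval removes the cross terms. *)
Lemma rotated_average g v :
  \int[leb]_(t in I) (modulus (ip (rotated a0 t v) g) ^+ 2)%:E =
  (2 * pi)%:E * \sum_(0 <= n <oo) (nterm a (pc g) n * nterm a (pc v) n)%:E.
Proof.
rewrite (@circle_parseval _ (fun n => pc v n * (pc g n)^* / (gam n)%:C)%R); first last.
- move=> t; have h := @ip_series R a a0 (rotated a0 t v) g.
  rewrite (_ : series _ = series (fun n => pc (rotated a0 t v) n * (pc g n)^* / (gam n)%:C))%R; first exact: h.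
  apply/funext => N; apply: eq_bigr => n _; rewrite pc_rotated.
  by rewrite -!mulrA [RHS]mulrC -!mulrA.
- pose S n := (nterm a (pc g) n + nterm a (pc v) n)%R.
  have cS : cvgn (series S).
    have h : (series (nterm a (pc g)) N + series (nterm a (pc v)) N)%R @[N --> \oo] --> (hn g ^+ 2 + hn v ^+ 2)%R.
      by apply: cvgD; exact: hn_series.
    apply/cvg_ex; exists (hn g ^+ 2 + hn v ^+ 2)%R.
    rewrite (_ : series S = fun N => series (nterm a (pc g)) N + series (nterm a (pc v)) N)%R; first exact: h.
    by apply/funext => N; rewrite /series /= big_split.
  apply: series_le_cvg cS => n; rewrite ?modulus_ge0 ?addr_ge0//.
  rewrite !modulusM modulusV modulus_conj modulusR gtr0_norm// /S /nterm -mulrDl.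
  rewrite ler_wpM2r ?invr_ge0 ?(ltW (gam_gt0 n))//.
  have gen (x y : R) : (0 <= x -> 0 <= y -> x * y <= y ^+ 2 + x ^+ 2)%R by move=> x0 y0; nra.
  by apply: gen; exact: modulus_ge0.
congr (_ * _); apply: eq_eseriesr => n _; congr EFin.
rewrite !modulusM modulusV modulus_conj modulusR (gtr0_norm (gam_gt0 n)) /nterm.
have gen (A x y : R) : A != 0%R -> ((x * y / A) ^+ 2 = y ^+ 2 / A * (x ^+ 2 / A))%R by move=> A0; field.
by apply: gen; rewrite gt_eqF.
Qed.

Lemma pmeas_coherent_term n :
  pmeas (fun w => (nterm a (pc (coherent a0 w u)) n)%:E).
Proof.
apply: measurable_EFinM => //.
apply: meas_modulus2; exact: cmeas_pc_coherent.
Qed.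

Lemma frame_expansion g :
  \int[m3]_x ((modulus (ip (cstate u x) g) ^+ 2)%:E * (frame_weight x)%:E) =
  \sum_(0 <= n <oo) ((nterm a (pc g) n)%:E * coherent_moment n).
Proof.
have mip : measurable_fun setT (fun x : T3 => (modulus (ip (cstate u x) g) ^+ 2)%:E).
  by apply/measurable_EFinP; apply: meas_modulus2; exact: cmeas_coherent_ip.
have s0 (z : R[i]) : 0 <= (modulus z ^+ 2)%:E by rewrite lee_fin sqr_ge0.
(* The rotation of w turns the inner angular dependence into that of a single rotated vector. *)
pose G (x : T3) := (modulus (ip (rotated a0 x.1 (coherent a0 (pp x.2) u)) g) ^+ 2)%:E.
have mG : measurable_fun setT G.
  have mr : cmeas setT (fun x : T3 => cis (- x.1) * pp x.2)%R.
    apply: cmeasM.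
      have mN : measurable_fun setT (fun x : T3 => - x.1)%R by apply: measurableT_comp => //.
      have [m1 m2] := @cmeas_cis R.
      by split; [exact: (measurableT_comp m1 mN)|exact: (measurableT_comp m2 mN)].
    have [m1 m2] := @cmeas_point R.
    by split; [exact: (measurableT_comp m1 measurable_snd)|exact: (measurableT_comp m2 measurable_snd)].
  have mq : measurable_fun setT (fun x : T3 => (x.1, (complex.Re (cis (- x.1) * pp x.2), complex.Im (cis (- x.1) * pp x.2)))%R).
    apply: measurable_fun_pair; first exact: measurable_fst.
    exact: measurable_fun_pair mr.1 mr.2.
  have := measurableT_comp mip mq; congr measurable_fun; apply/funext => x; rewrite [LHS]/comp cstateE.
  have e : (cis x.1 * pp (complex.Re (cis (- x.1) * pp x.2), complex.Im (cis (- x.1) * pp x.2)))%R = pp x.2.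
    by rewrite {1}/plane_point -complexE mulrA -[X in (cis X * _)%R]opprK cisNK mul1r.
  by rewrite e.
transitivity (\int[m3]_x (G x * (frame_weight x)%:E)).
  apply: etrans (frame_integral_angle_outer mip (fun x => s0 _)) _.
  apply: etrans _ (esym (frame_integral_angle_outer mG (fun x => s0 _))).
  apply: eq_integral => t _; apply: (congr1 (mule _)).
  pose F z := lam z * (modulus (ip (rotated a0 t (coherent a0 z u)) g) ^+ 2)%:E.
  have mF : pmeas F.
    apply: pmeasM; first exact: pmeas_lam.
    exact: (measurableT_comp mG (measurable_pair1 t)).
  rewrite -[RHS](pint_rotation t mF); last by move=> z; rewrite mule_ge0 ?lam_ge0.
  apply: eq_integral => p _; rewrite /F cstateE; apply: (congr1 (mule^~ _)).
  by rewrite !lamE !patchE disc_rotation /lambda_weight modulusM modulus_cis mul1r.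
apply: etrans (frame_integral_angle_inner mG (fun x => s0 _)) _.
have mT n : pmeas (fun w => (nterm a (pc g) n)%:E * ((nterm a (pc (coherent a0 w u)) n)%:E * lam w)).
  apply: emeasurable_funM; first exact: measurable_cst.
  by apply: emeasurable_funM; [exact: pmeas_coherent_term|exact: pmeas_lam].
have t0 n w : 0 <= (nterm a (pc g) n)%:E * ((nterm a (pc (coherent a0 w u)) n)%:E * lam w).
  by rewrite !mule_ge0 ?lam_ge0// lee_fin.
transitivity ((a + 1)%:E * \int[area]_p \sum_(0 <= n <oo)
    ((nterm a (pc g) n)%:E * ((nterm a (pc (coherent a0 (pp p) u)) n)%:E * lam (pp p)))).
  have -> : (a + 1)%:E = ((a + 1) / (2 * pi))%:E * (2 * pi)%:E.
    by rewrite -EFinM divfK// gt_eqF.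
  rewrite -muleA; apply: (congr1 (mule _)); rewrite -ge0_integralZl_EFin ?(ltW p0)//; last 2 first.
  - by move=> p _; apply: nneseries_ge0 => n _ _; exact: t0.
  - by apply: ge0_emeasurable_sum => // n _; exact: mT.
  have GE t p : G (t, p) = (modulus (ip (rotated a0 t (coherent a0 (pp p) u)) g) ^+ 2)%:E by [].
  apply: eq_integral => p _; under eq_integral do rewrite GE.
  rewrite rotated_average muleCA; apply: (congr1 (mule _)).
  rewrite lamE -nneseriesZl; last by move=> n _; rewrite lee_fin mulr_ge0.
  by apply: eq_eseriesr => n _; rewrite EFinM muleC muleA.
rewrite integral_nneseries; [|exact: measurableT|exact: mT|by move=> n p _; exact: t0].
rewrite -nneseriesZl; last by move=> n _; apply: integral_ge0 => p _; exact: t0.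
apply: eq_eseriesr => n _; rewrite /coherent_moment [RHS]muleCA; apply: (congr1 (mule _)).
have m1 : pmeas (fun w => (nterm a (pc (coherent a0 w u)) n)%:E * lam w).
  by apply: emeasurable_funM; [exact: pmeas_coherent_term|exact: pmeas_lam].
have p1 w : 0 <= (nterm a (pc (coherent a0 w u)) n)%:E * lam w by rewrite mule_ge0 ?lam_ge0// lee_fin.
exact: (pintZ (nt (pc g) n) m1 p1).
Qed.

Lemma coherent_moment_ge0 n : 0 <= coherent_moment n.
Proof.
rewrite mule_ge0 ?lee_fin ?addr_ge0//; apply: integral_ge0 => p _.
by rewrite mule_ge0 ?lam_ge0// lee_fin.
Qed.

Lemma frame_at_kernel z : disc z ->
  \sum_(0 <= n <oo) ((gam n * (modulus z ^+ 2) ^+ n)%:E * coherent_moment n) =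
  ((1 - modulus z ^+ 2) `^ (- (2 + a)) * hn u ^+ 2)%:E.
Proof.
move=> zd; have mB : pmeas (berezin u) by exact: pmeas_berezin.
have mc : pmeas (cst 1 : R[i] -> \bar R) by exact: measurable_cst.
have c0 (w : R[i]) : 0 <= (cst 1 : R[i] -> \bar R) w by exact: lee01.
have := @frame_kernel (cst 1) z mc c0 zd.
have -> : pint (fun w => berezin u (mobius z w) * cst 1 w * lam w) = (hn u ^+ 2)%:E.
  rewrite -berezin_mass -(lambda_mobius zd mB (@berezin_ge0 u)).
  by apply: eq_integral => p _; rewrite /= mule1.
rewrite -EFinM => <-.
rewrite (_ : (fun x => _) = (fun x => (modulus (ip (cstate u x) (kernel a0 z)) ^+ 2)%:E * (frame_weight x)%:E)).
  rewrite frame_expansion; apply: eq_eseriesr => n _; congr (_%:E * _).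
  rewrite /nterm pc_kernel// modulusM modulusR modulusX modulus_conj (gtr0_norm (gam_gt0 n)).
  have gen (A X : R) k : A != 0%R -> (A * (X ^+ 2) ^+ k = (A * X ^+ k) ^+ 2 / A)%R.
    by move=> A0; rewrite [in RHS]exprMn -!exprM mulnC mulrAC expr2 mulfK.
  by apply: gen; rewrite gt_eqF.
by apply/funext => x; rewrite reproducing// mule1.
Qed.

Hypothesis u1 : hn u = 1%R.

(** On kernels the frame identity is known. It says there that the series of [gam n t^n] weighted by
    the moments has the same sum [(1 - t)^-(a + 2)] as the unweighted one, for all [t] in [[0, 1[].
    Uniqueness of power series then forces every moment to be 1. *)
Lemma coherent_moment1 n : coherent_moment n = 1.
Proof.
(* At the single point [1/2] the sum is finite with positive coefficients, which bounds every
   moment. *)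
have fin k : coherent_moment k \is a fin_num.
  pose h2 : R[i] := (2^-1)%R.
  have zd : disc h2 := @disc_inv_nat R 0.
  have : \sum_(0 <= n <oo) ((gam n * (modulus h2 ^+ 2) ^+ n)%:E * coherent_moment n) < +oo.
    by rewrite frame_at_kernel// ltry.
  pose f j := (gam j * (modulus h2 ^+ 2) ^+ j)%:E * coherent_moment j;
  have f0 j : 0 <= f j.
    apply: mule_ge0 (coherent_moment_ge0 _); rewrite lee_fin.
    by apply: mulr_ge0; [exact: ltW|apply: exprn_ge0; exact: sqr_ge0].
  have h := @nneseries_lim_ge R f xpredT 0 k.+1 (fun j _ _ => f0 j).
  rewrite -[X in X < _]/(\sum_(0 <= j <oo) f j) => /(le_lt_trans h); rewrite big_nat_recr//= => hlt.
  have : f k < +oo.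
    by apply: le_lt_trans hlt; rewrite leeDr// sume_ge0.
  rewrite /f ge0_fin_numE ?coherent_moment_ge0//.
  have c0 : (0 < gam k * (modulus h2 ^+ 2) ^+ k)%R.
    by rewrite mulr_gt0// !exprn_gt0// modulus_gt0 invr_neq0// pnatr_eq0.
  have := coherent_moment_ge0 k; case: coherent_moment => [r _ _||] //; first exact: ltry.
  by rewrite gt0_muley ?lte_fin.
pose q k := fine (coherent_moment k); have qE k : coherent_moment k = (q k)%:E by rewrite fineK.
pose b k : R[i] := (gam k * (q k - 1))%:C.
have conv t : (0 <= t < 1)%R -> series (fun k => gam k * t ^+ k * q k)%R N @[N --> \oo] --> ((1 - t) `^ (- (2 + a)))%R.
  move=> /andP[t0 t1]; pose z : R[i] := (Num.sqrt t)%:C.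
  have zt : (modulus z ^+ 2 = t)%R by rewrite modulusR ger0_norm ?sqrtr_ge0// sqr_sqrtr.
  have zd : disc z by rewrite /disc /mkset -(@expr_lt1 _ 2) ?modulus_ge0// zt.
  have := frame_at_kernel zd; rewrite zt u1 expr1n mulr1 => E.
  have cv : (\sum_(0 <= k < n) (gam k * t ^+ k * q k)%:E)%E @[n --> \oo] --> ((1 - t) `^ (- (2 + a)))%:E.
    rewrite -E; rewrite [X in _ --> X](_ : _ = \sum_(0 <= k <oo) (gam k * t ^+ k * q k)%:E).
      apply: is_cvg_nneseries => k _ _; rewrite lee_fin mulr_ge0//.
        by rewrite mulr_ge0 ?exprn_ge0// ltW.
      by rewrite -lee_fin -qE coherent_moment_ge0.
    by apply: eq_eseriesr => k _; rewrite qE EFinM.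
  have -> : series (fun k => gam k * t ^+ k * q k)%R = fine \o (fun n => \sum_(0 <= k < n) (gam k * t ^+ k * q k)%:E)%E.
    by apply/funext => N; rewrite /series /= sumEFin.
  exact: fine_cvg.
have q0 k : (0 <= q k)%R by rewrite -lee_fin -qE coherent_moment_ge0.
have conv1 t : (0 <= t < 1)%R -> series (fun k => gam k * t ^+ k)%R N @[N --> \oo] --> ((1 - t) `^ (- (2 + a)))%R.
  by move=> t01; rewrite [(2 + a)%R]addrC -(binomial_sum a0 t01); exact: (bcoef_summable a0 t01).
have sb : summable_coefs b.
  move=> t t01; have /andP[t0 t1] := t01.
  have c : cvgn (series (fun k => gam k * t ^+ k * q k + gam k * t ^+ k)%R).
    apply/cvg_ex; exists ((1 - t) `^ (- (2 + a)) + (1 - t) `^ (- (2 + a)))%R.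
    have h := cvgD (conv _ t01) (conv1 _ t01).
    rewrite (_ : series _ = (fun N => series (fun k => gam k * t ^+ k * q k) N + series (fun k => gam k * t ^+ k) N)%R); first exact: h.
    by apply/funext => N; rewrite /series /= big_split.
  apply: series_le_cvg c => k.
  - by rewrite mulr_ge0 ?modulus_ge0 ?exprn_ge0.
  - by rewrite addr_ge0// !mulr_ge0 ?exprn_ge0// ltW.
  rewrite /b modulusR normrM (gtr0_norm (gam_gt0 k)).
  have le1 : (`|q k - 1| <= q k + 1)%R by rewrite ler_norml; apply/andP; split; have := q0 k; lra.
  have e : (gam k * t ^+ k * q k + gam k * t ^+ k = gam k * (q k + 1) * t ^+ k)%R by ring.
  by rewrite e ler_wpM2r ?exprn_ge0// ler_wpM2l// ltW.
have [f hf] := summable_has_pseries sb.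
have bz := power_series_real0 hf _ n.
have /eqP : b n = 0%R.
  apply: bz => t t01; have td : disc (t%:C : R[i]) by have /andP[t0 t1] := t01; rewrite /disc /mkset modulusR ger0_norm.
  apply: (cvgC_unique (hf _ td)).
  have h := cvgC_real (cvgB (conv _ t01) (conv1 _ t01)); rewrite subrr in h.
  rewrite (_ : series _ = (fun N => (series (fun k => gam k * t ^+ k * q k) N - series (fun k => gam k * t ^+ k) N)%:C)%R); first exact: h.
  apply/funext => N; rewrite /series /= -sumrB realC_sum; apply: eq_bigr => k _.
  by rewrite /b -realCX -realCM; congr (_%:C)%C; ring.
rewrite /b -modulus_eq0 modulusR normr_eq0 mulf_eq0 (gt_eqF (gam_gt0 n)) /= subr_eq0 => /eqP qn.
by rewrite qE qn.
Qed.

Lemma frame_identity g :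
  \int[m3]_x ((modulus (ip (cstate u x) g) ^+ 2)%:E * (frame_weight x)%:E) = (hn g ^+ 2)%:E.
Proof.
rewrite frame_expansion -(nneseries_EFin (@hn_series R a a0 g)).
by apply: eq_eseriesr => n _; rewrite coherent_moment1 mule1.
Qed.

End state.
End frame.

(** * Fubini's theorem for real and complex integrals *)

Section fubini.
Context d1 d2 (T1 : measurableType d1) (T2 : measurableType d2) (R : realType).
Variables (m1 : {sigma_finite_measure set T1 -> \bar R}) (m2 : {sigma_finite_measure set T2 -> \bar R}).

Lemma Rintegral_fubini (F : T1 * T2 -> R) : (m1 \x m2)%E.-integrable setT (EFin \o F) ->
  m1.-integrable setT (EFin \o (fun x => \int[m2]_y F (x, y))%R) /\
  (\int[m1]_x (\int[m2]_y F (x, y)) = \int[(m1 \x m2)%E]_z F z)%R.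
Proof.
move=> iF; pose G := fubini_F m2 (EFin \o F).
have mG : measurable_fun setT G by exact: (measurable_fubini_F iF).
have iG : m1.-integrable setT G by exact: (integrable_fubini_F iF).
have mfG : measurable_fun setT (EFin \o (fun x => fine (G x))).
  by apply/measurable_EFinP; exact: (measurableT_comp (fine_measurable measurableT) mG).
(* Off a null set the inner integral is finite, so that [fine] does not change it. *)
have ae : ae_eq m1 setT G (EFin \o (fun x => fine (G x))).
  apply: filterS (ae_integrable1 iF) => x ix _; rewrite /= fineK//.
  exact: integrable_fin_num.
split.
  apply: (le_integrable measurableT mfG _ iG) => x _ /=.
  by rewrite -/(G x); case: (G x) => //= *; rewrite leey.
rewrite /Rintegral -(integral12_prod_meas1 iF); congr fine.
by apply: ae_eq_integral => //; apply: ae_eq_sym.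
Qed.

Lemma Cintegral_fubini (F : T1 * T2 -> R[i]) : cinteg (m1 \x m2)%E setT F ->
  cinteg m1 setT (fun x => Cintegral m2 setT (fun y => F (x, y))) /\
  Cintegral m1 setT (fun x => Cintegral m2 setT (fun y => F (x, y))) = Cintegral (m1 \x m2)%E setT F.
Proof.
move=> [iR iI]; have [jR eR] := Rintegral_fubini iR; have [jI eI] := Rintegral_fubini iI.
by split=> //; rewrite /Cintegral -eR -eI.
Qed.

End fubini.

Lemma Cintegral_mkcond d (T : measurableType d) (R : realType) (mu : {measure set T -> \bar R})
  (D : set T) (F : T -> R[i]) : Cintegral mu D F = Cintegral mu setT (F \_ D).
Proof.
by rewrite /Cintegral /Rintegral; congr (fine _ +i* fine _); rewrite integral_mkcond;
  apply: eq_integral => x _; rewrite !patchE; case: ifP.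
Qed.

(** * The localization form as an integral over the states *)

Section bergman_states.
Context (R : realType) (a : R).
Hypothesis a0 : 0 <= a.
Local Notation H := (bergman_space a).
Local Notation ip := (@bergman_ip R a).
Local Notation hn := (hnorm ip).
Local Notation gam := (bcoef a).
Local Notation T1 := (measurableTypeR R).
Local Notation T3 := (T1 * (T1 * T1))%type.
Local Notation m3 := (leb \x @plane_measure R)%E.
Local Notation lam := (@lam R).

Let Hip := bergman_inner_product a0.
Let mI : measurable (`[0, 2 * pi]%classic : set T1). Proof. exact: measurable_itv. Qed.
Let p0 : 0 < 2 * pi :> R. Proof. by rewrite mulr_gt0// pi_gt0. Qed.

(** The norm series of [V psi] is that of [psi] term by term. The last clause records this: the mass
    in degree [n] is independent of [a], so the second moments at all parameters come from one
    sequence. *)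
Lemma V_vector (psi : bergman_space (0 : R)) : exists u : H,
  [/\ (u : R[i] -> R[i]) = V a psi, hn u ^+ 2 = hnorm (bergman_ip 0) psi ^+ 2 &
    forall n, modulus (pc u n) ^+ 2 / gam n = modulus (pc psi n) ^+ 2 / n.+1%:R].
Proof.
have g0 n : bcoef (0 : R) n = n.+1%:R.
  elim: n => [|n IH]; first by rewrite bcoef0.
  rewrite bcoefS IH addr0; have n0 : n.+1%:R != 0 :> R by rewrite pnatr_eq0.
  by rewrite mulrCA mulfV// mulr1 -natrD addn2.
pose c n := pc psi n * (V_coef a n)%:C.
have E n : nterm a c n = nterm 0 (pc psi) n.
  rewrite /nterm modulusM modulusR exprMn real_normK ?num_real// g0 -(V_coef_sqr n a0).
  have V0 : V_coef a n ^+ 2 != 0.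
    apply/eqP => V00; have := bcoef_gt0 n a0.
    by rewrite -(V_coef_sqr n a0) V00 mul0r ltxx.
  have n0 : n.+1%:R != 0 :> R by rewrite pnatr_eq0.
  by move: V0 n0; move: (V_coef a n ^+ 2) (n.+1%:R) (modulus _ ^+ 2) => A B C A0 B0; field; rewrite A0 B0.
have EE : nterm a c = nterm 0 (pc psi) by apply/funext.
have [|u uc] := bergman_synthesis a0 (c := c).
  by rewrite EE; apply/cvg_ex; exists (hnorm (bergman_ip 0) psi ^+ 2); exact: (@hn_series R 0 (lexx 0)).
exists u; split.
- apply/funext => z; rewrite /V; case: ifPn => [/set_mem zd|zd].
    have := @bergman_series _ _ u z zd; rewrite uc => h.
    by rewrite (cvgC_lim h).
  by rewrite bergman_out// => h; move/negP: zd; apply; exact: mem_set.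
- apply: (cvg_unique _ (@hn_series R a a0 u)); first exact: Rhausdorff.
  by rewrite uc EE; exact: (@hn_series R 0 (lexx 0)).
- by move=> n; have := E n; rewrite /nterm -uc g0.
Qed.

Variable u : H.
Hypothesis u1 : hn u = 1.
Local Notation cs := (cstate a0 u).
Local Notation w := (@frame_weight R a).

(** The square root of the density is put into the state, which makes the family a frame for
    Lebesgue measure itself, with [|v|^2] equal to the density. *)
Definition wstate (x : T3) : H := (Num.sqrt (w x))%:C *: cs x.

Let w0 x : 0 <= w x. Proof. exact: frame_weight_ge0. Qed.

Lemma hn_cstate x : disc (pp x.2) -> hn (cs x) ^+ 2 = 1.
Proof. by move=> xd; rewrite /cstate hn_coherent// hn_rotated u1 expr1n. Qed.

Lemma hn_wstate x : hn (wstate x) ^+ 2 = w x.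
Proof.
rewrite /wstate (hnormZ Hip) modulusR ger0_norm ?sqrtr_ge0// exprMn sqr_sqrtr//.
have [xd|xd] := pselect (disc (pp x.2)); first by rewrite hn_cstate// mulr1.
by rewrite frame_weight_out// mul0r.
Qed.

Lemma cmeas_wstate g : cmeas setT (fun x => ip (wstate x) g).
Proof.
have ms : measurable_fun setT (fun x : T3 => Num.sqrt (w x)).
  rewrite (_ : (fun x => _) = fun x => w x `^ 2^-1); last by apply/funext => x; rewrite powR12_sqrt.
  exact: (measurableT_comp (measurable_powR _) (measurable_frame_weight a)).
have := cmeasM (cmeas_real ms) (cmeas_coherent_ip a0 u g).
by congr cmeas; apply/funext => x; rewrite /wstate (ipZl Hip).
Qed.

Lemma wstate_frame g :
  (\int[m3]_x (modulus (ip (wstate x) g) ^+ 2)%:E = (hn g ^+ 2)%:E)%E.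
Proof.
rewrite -(frame_identity a0 u1 g); apply: eq_integral => x _; rewrite -EFinM; congr EFin.
by rewrite /wstate (ipZl Hip) modulusM modulusR ger0_norm ?sqrtr_ge0// exprMn sqr_sqrtr// mulrC.
Qed.

Lemma frame_weight_integral (phi : R[i] -> \bar R) : pmeas phi -> (forall z, 0 <= phi z)%E ->
  (\int[m3]_x (phi (pp x.2) * (w x)%:E) = (a + 1)%:E * pint (fun z => phi z * lam z))%E.
Proof.
move=> mphi phi0; have mG : measurable_fun setT (fun x : T3 => phi (pp x.2)) by exact: (measurableT_comp mphi measurable_snd).
rewrite (frame_integral_angle_inner a0 mG (fun x => phi0 _)).
have -> : (a + 1)%:E = (((a + 1) / (2 * pi))%:E * (2 * pi)%:E)%E by rewrite -EFinM divfK// gt_eqF.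
have mF : pmeas (fun z => phi z * lam z)%E by exact: pmeasM mphi (@pmeas_lam R).
have F0 z : (0 <= phi z * lam z)%E by rewrite mule_ge0 ?lam_ge0.
rewrite -muleA; apply: (congr1 (mule _)); rewrite -pintZ ?(ltW p0)//.
apply: eq_integral => p _.
have -> : (\int[leb]_(t in `[0%R, (2 * pi)%R]) phi (pp (t, p).2) = phi (pp p) * (2 * pi)%:E)%E.
  transitivity (\int[leb]_(t in `[0%R, (2 * pi)%R]) cst (phi (pp p)) t)%E => //.
  by rewrite integral_cst//= lebesgue_measure_itv /= lte_fin p0 -EFinB subr0.
by rewrite [in LHS]muleA [in LHS]muleC [(lam _ * _)%E]muleC.
Qed.

Lemma Rintegral_frame_weight (g : R[i] -> R) : measurable_fun setT (g \o pp) ->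
  area.-integrable plane_disc (EFin \o (fun p => g (pp p) * lambda_weight (pp p))) ->
  m3.-integrable setT (EFin \o (fun x => g (pp x.2) * w x)) /\
  (\int[m3]_x (g (pp x.2) * w x) = (a + 1) * \int[area]_(p in plane_disc) (g (pp p) * lambda_weight (pp p)))%R.
Proof.
move=> mg ig.
(* Positive and negative parts are treated apart, as [frame_weight_integral] rests on Tonelli's
   theorem. *)
have pos (k : R[i] -> R) : measurable_fun setT (k \o pp) -> (forall z, 0 <= k z) ->
    (forall z, k z <= `|g z|) ->
    [/\ m3.-integrable setT (EFin \o (fun x => k (pp x.2) * w x)),
      area.-integrable plane_disc (EFin \o (fun p => k (pp p) * lambda_weight (pp p))) &
    (\int[m3]_x (k (pp x.2) * w x) = (a + 1) * \int[area]_(p in plane_disc) (k (pp p) * lambda_weight (pp p)))%R].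
  move=> mk k0 kg.
  have mkl : measurable_fun plane_disc (fun p => k (pp p) * lambda_weight (pp p)).
    apply: measurable_funTS; apply: measurable_funM => //; exact: pmeas_lambda.
  have i1 : area.-integrable plane_disc (EFin \o (fun p => k (pp p) * lambda_weight (pp p))).
    apply: (le_integrable (@measurable_plane_disc R) _ _ ig); first exact/measurable_EFinP.
    move=> p _ /=; rewrite lee_fin !normrM ler_wpM2r// ger0_norm//; exact: kg.
  have E : (\int[m3]_x (k (pp x.2) * w x)%:E = (a + 1)%:E * \int[area]_(p in plane_disc) (k (pp p) * lambda_weight (pp p))%:E)%E.
    have kE0 z : (0 <= (EFin \o k) z)%E by rewrite /= lee_fin.
    have := @frame_weight_integral (EFin \o k) (pmeas_EFin mk) kE0.
    rewrite (integral_discE (fun z => (k z * lambda_weight z)%:E)) => h.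
    rewrite [LHS](_ : _ = \int[m3]_x ((EFin \o k) (pp x.2) * (w x)%:E))%E; last by apply: eq_integral => x _.
    rewrite h; apply: (congr1 (mule _)); congr pint; apply/funext => z; rewrite /lam !patchE.
    by case: ifP; rewrite ?mule0.
  have fin := integrable_fin_num (@measurable_plane_disc R) i1.
  split=> //; last by rewrite /Rintegral E -(fineK fin) -EFinM.
  apply/integrableP; split.
    apply: measurable_EFinM; last exact: measurable_frame_weight.
    exact: (measurableT_comp mk measurable_snd).
  rewrite [X in (X < _)%E](_ : _ = \int[m3]_x (k (pp x.2) * w x)%:E)%E; last first.
    by apply: eq_integral => x _ /=; rewrite ger0_norm// mulr_ge0.
  by rewrite E -(fineK fin) -EFinM ltry.
have [|||i1 j1 e1] := pos (fun z => Num.max (g z) 0).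
- exact: measurable_maxr.
- by move=> z; rewrite le_max lexx orbT.
- by move=> z; rewrite ge_max normr_ge0 ler_norm.
have [|||i2 j2 e2] := pos (fun z => Num.max (- g z) 0).
- by apply: measurable_maxr => //; exact: measurableT_comp.
- by move=> z; rewrite le_max lexx orbT.
- by move=> z; rewrite ge_max normr_ge0 -normrN ler_norm.
have gE z : g z = Num.max (g z) 0 - Num.max (- g z) 0.
  have [h|h] := leP (g z) 0; first by rewrite max_l ?oppr_ge0// opprK add0r.
  by rewrite max_r ?oppr_le0 ?subr0// ltW.
split.
  apply: eq_integrable (integrableB measurableT i1 i2) => // x _.
  by rewrite /= [in RHS]gE mulrBl EFinB.
transitivity (\int[m3]_x (Num.max (g (pp x.2)) 0 * w x - Num.max (- g (pp x.2)) 0 * w x))%R.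
  by apply: eq_Rintegral => x _; rewrite [in LHS]gE mulrBl.
rewrite (RintegralB measurableT i1 i2) e1 e2 -mulrBr -(RintegralB (@measurable_plane_disc R) j1 j2).
by congr (_ * _); apply: eq_Rintegral => x _; rewrite -mulrBl -gE.
Qed.

Section form.
Variables (f : R[i] -> R) (M : R).
Hypotheses (mf : measurable_fun setT (f \o pp)) (f0 : forall z, 0 <= f z) (fM : forall z, f z <= M).

Let mf2 : measurable_fun setT (fun x : T3 => f (pp x.2)).
Proof. exact: (measurableT_comp mf measurable_snd). Qed.

Let Phi g h x : R[i] := (f (pp x.2))%:C * (ip (cs x) g)^* * ip (cs x) h.

Lemma disc_ip_coherent z t (g : H) : disc z ->
  disc_ip a (U a z (rotation t u)) g = ip (coherent a0 z (rotated a0 t u)) g /\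
  disc_ip a g (U a z (rotation t u)) = ip g (coherent a0 z (rotated a0 t u)).
Proof.
move=> zd; have E x : disc x -> U a z (rotation t u) x = coherent a0 z (rotated a0 t u) x.
  by move=> xd; rewrite coherentE// /U rotatedE//; exact: mobius_disc.
by split; apply: eq_Cintegral => p pd; rewrite E.
Qed.

(** The definition is an iterated integral, meaningful for integrable functions only; the frame
    identity gives integrability on the product, and Fubini identifies the two. *)
Lemma localization_formE (g h : H) :
  localization_form a u f g h = frame_form ip m3 wstate (fun x => f (pp x.2)) g h.
Proof.
pose c : R := (2 * pi)^-1; have c0 : c != 0 by rewrite invr_neq0// gt_eqF.
pose ind x : R := \1_(`[0, 2 * pi]%classic : set T1) x.1 * (lambda_weight \_ disc) (pp x.2).
pose F x : R[i] := (ind x)%:C * Phi g h x.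
have wE x : w x = (a + 1) * c * ind x by [].
have a1 : a + 1 != 0 by rewrite gt_eqF// ltr_wpDl.
have FE x : F x = ((a + 1) * c)^-1%:C * ((f (pp x.2))%:C * (ip (wstate x) g)^* * ip (wstate x) h).
  rewrite /wstate !(ipZl Hip) conjCM conjc_real /F /Phi.
  have -> : ind x = ((a + 1) * c)^-1 * (Num.sqrt (w x) * Num.sqrt (w x)).
    by rewrite -expr2 sqr_sqrtr// wE mulrA mulVf ?mul1r// mulf_neq0.
  by rewrite (realCM _ (_ * _)) (realCM (Num.sqrt _)); move: (Num.sqrt _)%:C => s; ring.
have iF : cinteg m3 setT F.
  have := cintegZ measurableT ((a + 1) * c)^-1%:C
    (@frame_form_integrable R H ip _ _ m3 wstate _ M cmeas_wstate mf2
      (fun x => f0 (pp x.2)) (fun x => fM (pp x.2)) wstate_frame g h).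
  by congr cinteg; apply/funext => x; rewrite FE.
have [iJ eJ] := Cintegral_fubini iF.
have -> : frame_form ip m3 wstate (fun x => f (pp x.2)) g h = ((a + 1) * c)%:C * Cintegral m3 setT F.
  rewrite -(CintegralZ measurableT _ iF); apply: eq_Cintegral => x _.
  by rewrite FE mulrA -realCM mulfV ?mulf_neq0// mul1r.
rewrite -eJ realCM -mulrA -(CintegralZ measurableT c%:C iJ) /localization_form; apply: (congr1 ( *%R _)).
rewrite Cintegral_mkcond; apply: eq_Cintegral => t _; rewrite patchE.
case: ifPn => tI; last first.
  rewrite (@eq_Cintegral _ _ _ _ setT _ (fun=> 0)) ?Cintegral0 ?mulr0// => p _.
  by rewrite /F /ind indicE (negPf tI) mul0r mul0r.
apply: (congr1 ( *%R _)); rewrite /disc_integral Cintegral_mkcond; apply: eq_Cintegral => p _.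
rewrite patchE /F /ind indicE tI mul1r patchE.
have -> : (p \in plane_disc) = (pp p \in disc) by apply/idP/idP; rewrite !inE.
case: ifPn => [/set_mem pd|_]; last by rewrite mul0r.
have [e1 _] := disc_ip_coherent t h pd; have [_ e2] := disc_ip_coherent t g pd.
by rewrite e1 e2 /Phi -(ip_sym Hip).
Qed.

End form.

End bergman_states.

(** * Averages against radial densities that concentrate at the origin *)

Section approximate_identity.
Context (R : realType).
Local Notation T1 := (measurableTypeR R).
Local Notation T2 := (T1 * T1)%type.
Local Notation lam := (@lam R).
Implicit Types (s : R[i] -> R) (z w : R[i]) (k : nat).

Variables (kap : nat -> R[i] -> \bar R) (e : nat -> R).
Hypotheses (mkap : forall k, pmeas (kap k)) (kap0 : forall k z, (0 <= kap k z)%E).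
Hypothesis kap_radial : forall k z w, modulus z = modulus w -> kap k z = kap k w.
Hypothesis kap_mass : forall k, pint (fun z => kap k z * lam z)%E = 1%E.
Hypothesis kap_moment : forall k,
  pint (fun z => (modulus z ^+ 2)%:E * kap k z * lam z)%E = (e k)%:E.
Hypothesis e_cvg0 : e k @[k --> \oo] --> (0 : R).

Let mlam := @pmeas_lam R.

Let mkm k w : pmeas (fun z => kap k (mobius w z)).
Proof. by apply: pmeas_comp => //; exact: cmeas_mobius. Qed.

Let mass_mobius k w : disc w -> pint (fun z => kap k (mobius w z) * lam z)%E = 1%E.
Proof. by move=> wd; rewrite lambda_mobius. Qed.

Let moment_mobius k w : disc w ->
  pint (fun z => (modulus (mobius w z) ^+ 2)%:E * kap k (mobius w z) * lam z)%E = (e k)%:E.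
Proof.
move=> wd; rewrite -(kap_moment k) -(@lambda_mobius _ (fun z => (modulus z ^+ 2)%:E * kap k z)%E _ wd)//.
- apply: pmeasM => //; apply: pmeas_EFin.
  exact: (meas_modulus2 (@cmeas_point R)).
- by move=> z; rewrite mule_ge0// lee_fin sqr_ge0.
Qed.

Definition avg_fun k s w z : \bar R := (kap k (mobius w z) * (s z)%:E * lam z)%E.

Definition average k s w : R := fine (pint (avg_fun k s w)).

Section bounded.
Variables (s : R[i] -> R) (C : R).
Hypotheses (ms : measurable_fun setT (s \o pp)) (s0 : forall z, 0 <= s z) (sC : forall z, s z <= C).

Let C0 : 0 <= C. Proof. exact: le_trans (s0 0) (sC 0). Qed.

Let mint k w : pmeas (avg_fun k s w).
Proof. by apply: pmeasM => //; apply: pmeasM => //; exact: pmeas_EFin. Qed.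

Let int0 k w z : (0 <= avg_fun k s w z)%E.
Proof. by rewrite !mule_ge0 ?lam_ge0// lee_fin. Qed.

Lemma pint_average_le k w : disc w -> (pint (avg_fun k s w) <= C%:E)%E.
Proof.
move=> wd; rewrite -[C%:E]mule1 -(mass_mobius k wd) -pintZ//; last 2 first.
- exact: pmeasM.
- by move=> z; rewrite mule_ge0 ?lam_ge0.
apply: ge0_le_integral => //.
- exact: mint.
- apply: emeasurable_funM; first exact: measurable_cst.
  by apply: emeasurable_funM; [exact: mkm|exact: mlam].
move=> p _; rewrite /avg_fun muleA [(C%:E * _)%E]muleC; apply: lee_wpmul2r; first exact: lam_ge0.
by apply: lee_wpmul2l => //; rewrite lee_fin.
Qed.

Lemma averageE k w : disc w -> (average k s w)%:E = pint (avg_fun k s w).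
Proof.
move=> wd; rewrite /average fineK// ge0_fin_numE; last by apply: integral_ge0 => p _; exact: int0.
exact: le_lt_trans (pint_average_le k wd) (ltry _).
Qed.

Lemma average_ge0 k w : 0 <= average k s w.
Proof. by rewrite fine_ge0//; apply: integral_ge0 => p _; exact: int0. Qed.

Lemma average_le k w : disc w -> average k s w <= C.
Proof. by move=> wd; rewrite -lee_fin averageE// pint_average_le. Qed.

Let mjoint k : measurable_fun setT (fun q : T2 * T2 => kap k (mobius (pp q.1) (pp q.2))).
Proof.
apply: (@pmeas_map _ _ _ (kap k) (fun q : T2 * T2 => mobius (pp q.1) (pp q.2))) => //.
have [r1 r2] := @cmeas_point R.
have m1 : cmeas setT (fun q : T2 * T2 => pp q.1).
  by split; [exact: (measurableT_comp r1 measurable_fst)|exact: (measurableT_comp r2 measurable_fst)].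
have m2 : cmeas setT (fun q : T2 * T2 => pp q.2).
  by split; [exact: (measurableT_comp r1 measurable_snd)|exact: (measurableT_comp r2 measurable_snd)].
apply: cmeasM; first exact: cmeasB.
apply: cmeas_inv; apply: cmeasB; first exact: cmeas_cst.
by apply: cmeasM => //; exact: cmeas_conj.
Qed.

Lemma measurable_joint_average k (g : R[i] -> \bar R) : pmeas g ->
  measurable_fun setT (fun q : T2 * T2 => avg_fun k s (pp q.1) (pp q.2) * g (pp q.1))%E.
Proof.
move=> mg; apply: emeasurable_funM; last exact: (measurableT_comp mg measurable_fst).
apply: emeasurable_funM; last exact: (measurableT_comp mlam measurable_snd).
apply: emeasurable_funM => //; apply/measurable_EFinP; exact: (measurableT_comp ms measurable_snd).
Qed.

Lemma measurable_average k : measurable_fun setT (average k s \o pp).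
Proof.
have m1 := @measurable_joint_average k (cst 1%E) (@measurable_cst _ _ _ _ _ _).
have n1 (q : T2 * T2) : (0 <= avg_fun k s (pp q.1) (pp q.2) * cst 1%E (pp q.1))%E by rewrite mule1.
have := measurable_fun_fubini_tonelli_F (m2 := @plane_measure R) _ m1 n1.
move=> /(measurableT_comp (fine_measurable measurableT)); congr measurable_fun; apply/funext => p.
by rewrite /= /average /fubini_F /=; congr fine; apply: eq_integral => q _; rewrite mule1.
Qed.

(* z - w = mobius w z * (1 - conj w * z), so that z is close to w where |mobius w z| is small. *)
Lemma average_cvg w : disc w ->
  (forall eps, 0 < eps -> exists2 d, 0 < d & forall z, modulus (z - w) < d -> `|s z - s w| < eps) ->
  average k s w @[k --> \oo] --> s w.
Proof.
move=> wd sc; apply/cvgrPdist_le => eps eps0.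
have [d d0 hd] := sc (eps / 2) (divr_gt0 eps0 (ltr0n _ 2)).
(* If [|z - w| >= d] then [|mobius w z| >= d / 2], because [|1 - conj w z| <= 2]; there
   [|s z - s w| <= C <= K |mobius w z|^2]. *)
pose K := C * (2 / d) ^+ 2; have K0 : 0 <= K by rewrite mulr_ge0 ?sqr_ge0.
have near_s z : disc z -> `|s z - s w| <= eps / 2 + K * modulus (mobius w z) ^+ 2.
  move=> zd; have E : modulus (z - w) = modulus (mobius w z) * modulus (1 - w^* * z).
    by rewrite -modulusM mobiusE divfK// mobius_den_neq0// ltW.
  have m2 : modulus (1 - w^* * z) <= 2.
    apply: le_trans (modulusD _ _) _; rewrite modulus1 modulusN modulusM modulus_conj.
    have : modulus w * modulus z <= 1 by rewrite mulr_ile1 ?modulus_ge0// ltW.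
    lra.
  have [zw|zw] := ltP (modulus (z - w)) d.
    by apply: le_trans (ltW (hd _ zw)) _; rewrite lerDl mulr_ge0 ?sqr_ge0.
  have x0 := modulus_ge0 (mobius w z).
  have dx : d <= 2 * modulus (mobius w z).
    apply: le_trans zw _; rewrite E mulrC ler_wpM2r//.
  have h1 : 1 <= (2 / d) ^+ 2 * modulus (mobius w z) ^+ 2.
    by rewrite -exprMn exprn_ege1// mulrAC ler_pdivlMr// mul1r.
  have : `|s z - s w| <= C.
    by rewrite ler_norml; apply/andP; split; have := s0 z; have := s0 w; have := sC z; have := sC w; lra.
  move=> h2; apply: le_trans h2 _; apply: le_trans (ler_peMr C0 h1) _.
  by rewrite mulrA lerDr divr_ge0// ltW.
have ek : \forall k \near \oo, K * e k < eps / 2.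
  have h : K * e k @[k --> \oo] --> K * 0 by apply: cvgM; [exact: cvg_cst|exact: e_cvg0].
  rewrite mulr0 in h; apply: (cvgr_lt _ h); exact: divr_gt0.
have mono (g1 g2 : R[i] -> R) k : (forall z, disc z -> g1 z <= g2 z) ->
    measurable_fun setT (g1 \o pp) -> measurable_fun setT (g2 \o pp) -> (forall z, 0 <= g1 z) -> (forall z, 0 <= g2 z) ->
    (pint (avg_fun k g1 w) <= pint (avg_fun k g2 w))%E.
  move=> g12 m1 m2 g10 g20.
  have mm (g : R[i] -> R) : measurable_fun setT (g \o pp) -> pmeas (avg_fun k g w).
    by move=> mg; apply: pmeasM => //; apply: pmeasM => //; exact: pmeas_EFin.
  apply: ge0_le_integral => //.
  - by move=> p _; rewrite !mule_ge0 ?lam_ge0// lee_fin.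
  - exact: mm.
  - exact: mm.
  move=> p _; rewrite /avg_fun /lam patchE; case: ifPn => [/set_mem pd|_]; last by rewrite !mule0.
  apply: lee_wpmul2r; first by rewrite lee_fin lambda_ge0.
  by apply: lee_wpmul2l => //; rewrite lee_fin g12.
have mq : measurable_fun setT ((fun z => modulus (mobius w z) ^+ 2) \o pp).
  exact: (meas_modulus2 (cmeas_mobius w)).
have affine k (A B : R) : 0 <= A -> 0 <= B ->
    pint (avg_fun k (fun z => A + B * modulus (mobius w z) ^+ 2) w) = (A + B * e k)%:E.
  move=> A0 B0.
  have -> : (A + B * e k)%:E = (pint (fun z => A%:E * (kap k (mobius w z) * lam z)) +
     pint (fun z => B%:E * ((modulus (mobius w z) ^+ 2)%:E * kap k (mobius w z) * lam z)))%E.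
    rewrite !pintZ// ?mass_mobius// ?moment_mobius// ?mule1//.
    - apply: pmeasM => //; apply: pmeasM => //; exact: pmeas_EFin.
    - by move=> z; rewrite !mule_ge0 ?lam_ge0// lee_fin sqr_ge0.
    - exact: pmeasM.
    - by move=> z; rewrite mule_ge0 ?lam_ge0.
  rewrite -ge0_integralD//.
  - apply: eq_integral => p _; rewrite /avg_fun EFinD EFinM.
    have A0' : (0 <= A%:E)%E by rewrite lee_fin.
    have B0' : (0 <= B%:E * (modulus (mobius w (pp p)) ^+ 2)%:E)%E by rewrite mule_ge0 ?lee_fin ?sqr_ge0.
    rewrite (ge0_muleDr _ A0' B0') ge0_muleDl ?(mule_ge0 (kap0 _ _))//.
    congr (_ + _)%E; first by rewrite muleA [(A%:E * _)%E]muleC.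
    by rewrite !muleA [(kap _ _ * B%:E)%E]muleC -!muleA; congr (_ * _)%E; rewrite muleCA.
  - by move=> p _; rewrite !mule_ge0 ?lam_ge0.
  - apply: emeasurable_funM; first exact: measurable_cst.
    by apply: emeasurable_funM; [exact: mkm|exact: mlam].
  - by move=> p _; rewrite !mule_ge0 ?lam_ge0// lee_fin sqr_ge0.
  - apply: emeasurable_funM; first exact: measurable_cst.
    apply: emeasurable_funM; last exact: mlam.
    apply: emeasurable_funM; last exact: mkm.
    exact/measurable_EFinP.
near=> k.
have hk : K * e k < eps / 2 by near: k.
have maff (A B : R) : measurable_fun setT ((fun z => A + B * modulus (mobius w z) ^+ 2) \o pp).
  by apply: measurable_funD => //; apply: measurable_funM.
have aff0 (A B : R) z : 0 <= A -> 0 <= B -> 0 <= A + B * modulus (mobius w z) ^+ 2.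
  by move=> A0 B0; rewrite addr_ge0// mulr_ge0 ?sqr_ge0.
have e20 : 0 <= eps / 2 by rewrite divr_ge0// ltW.
have up : average k s w <= s w + eps / 2 + K * e k.
  rewrite -lee_fin averageE// -(affine k _ _ (addr_ge0 (s0 w) e20) K0).
  apply: mono => //; last by move=> z; rewrite aff0// addr_ge0.
  by move=> z zd; have := near_s z zd; rewrite ler_norml => /andP[_]; lra.
(* Only nonnegative functions are averaged, so the lower bound comes from averaging [s w <= s z +
   (eps / 2 + K |mobius w z|^2)]. *)
have lo : s w <= average k s w + eps / 2 + K * e k.
  have h := @mono (fun z => s w + 0 * modulus (mobius w z) ^+ 2) (fun z => s z + (eps / 2 + K * modulus (mobius w z) ^+ 2)) k.
  have : (pint (avg_fun k (fun z => s z + (eps / 2 + K * modulus (mobius w z) ^+ 2))%R w) =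
      pint (avg_fun k s w) + (eps / 2 + K * e k)%:E)%E.
    rewrite -(affine k _ _ e20 K0) -ge0_integralD//.
    - apply: eq_integral => p _; rewrite /avg_fun EFinD ge0_muleDr ?lee_fin ?aff0//.
      have x1 : (0 <= kap k (mobius w (pp p)) * (s (pp p))%:E)%E by apply: mule_ge0; rewrite ?lee_fin.
      have x2 : (0 <= kap k (mobius w (pp p)) * (eps / 2 + K * modulus (mobius w (pp p)) ^+ 2)%:E)%E.
        by apply: mule_ge0; rewrite ?lee_fin ?aff0.
      by rewrite (ge0_muleDl _ x1 x2).
    - exact: mint.
    - by move=> p _; rewrite !mule_ge0 ?lam_ge0// lee_fin aff0.
    - apply: emeasurable_funM; last exact: mlam.
      by apply: emeasurable_funM; [exact: mkm|apply/measurable_EFinP; exact: maff].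
  move=> E; rewrite E (affine k _ _ (s0 w) (lexx 0)) mul0r addr0 -averageE// -EFinD lee_fin in h.
  rewrite -addrA; apply: h => //.
  - by move=> z zd; rewrite mul0r addr0; have := near_s z zd; rewrite ler_norml => /andP[+ _]; lra.
  - by apply: measurable_funD => //; exact: maff.
  - by move=> z; exact: aff0.
  - by move=> z; rewrite addr_ge0// aff0.
by rewrite ler_norml; apply/andP; split; lra.
Unshelve. all: by end_near.
Qed.

End bounded.

Section weak_limit.
Variables (f : R[i] -> R) (M : R).
Hypotheses (mf : measurable_fun setT (f \o pp)) (f0 : forall z, 0 <= f z) (fM : forall z, f z <= M).
Hypothesis fL : area.-integrable plane_disc (EFin \o (fun p => f (pp p) * lambda_weight (pp p))).

Lemma lambda_intE (g : R[i] -> R) :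
  pint (fun z => (g z)%:E * lam z)%E = (\int[area]_(p in plane_disc) (g (pp p) * lambda_weight (pp p))%:E)%E.
Proof.
rewrite (integral_discE (fun z => (g z * lambda_weight z)%:E)); congr pint; apply/funext => z.
by rewrite /lam !patchE; case: ifP; rewrite ?mule0.
Qed.

(** The density depends on [|mobius w z|], which is symmetric in [w] and [z], and Tonelli exchanges
    the two integrations. *)
Lemma average_sym s C k : measurable_fun setT (s \o pp) -> (forall z, 0 <= s z) -> (forall z, s z <= C) ->
  pint (fun z => (average k f z * s z)%:E * lam z)%E =
  pint (fun w => (f w * average k s w)%:E * lam w)%E.
Proof.
move=> ms s0 sC.
have lam0 z : ~ disc z -> lam z = 0%E by move=> zd; rewrite /lam patchE memNset.
pose G (q : T2 * T2) := (avg_fun k f (pp q.1) (pp q.2) * ((s (pp q.1))%:E * lam (pp q.1)))%E.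
have mG : measurable_fun setT G.
  apply: (@measurable_joint_average f mf k (fun z => (s z)%:E * lam z)%E).
  by apply: pmeasM => //; exact: pmeas_EFin.
have G0 q : (0 <= G q)%E by rewrite !mule_ge0 ?lam_ge0// lee_fin.
have FT := fubini_tonelli (m1 := @plane_measure R) (m2 := @plane_measure R) _ mG G0.
have i0 (g : R[i] -> R) z w : (forall z, 0 <= g z) -> (0 <= avg_fun k g z w)%E.
  move=> g0; rewrite /avg_fun; apply: mule_ge0 (lam_ge0 _).
  by apply: mule_ge0; [exact: kap0|rewrite lee_fin].
have mi (g : R[i] -> R) z : measurable_fun setT (g \o pp) -> pmeas (avg_fun k g z).
  move=> mg; rewrite /avg_fun; apply: pmeasM; last exact: mlam.
  by apply: pmeasM; [exact: mkm|exact: pmeas_EFin].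
transitivity (\int[@plane_measure R]_p \int[@plane_measure R]_q G (p, q))%E.
  apply: eq_integral => p _; have [pd|pd] := pselect (disc (pp p)); last first.
    rewrite (lam0 _ pd) mule0; symmetry; apply: integral0_eq => q _.
    by rewrite /G [(p, q).1]/= (lam0 _ pd) mule0 mule0.
  rewrite EFinM (averageE mf f0 fM k pd) -muleA -ge0_integralZr; [by apply: (@eq_integral _ _ _ (@plane_measure R)) => q _; rewrite /G|exact: measurableT|exact: mi|by move=> q _; exact: i0|].
  by apply: mule_ge0; [rewrite lee_fin|exact: lam_ge0].
rewrite FT; apply: eq_integral => q _; have [qd|qd] := pselect (disc (pp q)); last first.
  rewrite [in RHS](lam0 _ qd) mule0; apply: integral0_eq => p _.
  by rewrite /G /avg_fun [(p, q).2]/= (lam0 _ qd) mule0 mul0e.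
rewrite mulrC EFinM (averageE ms s0 sC k qd) -muleA -ge0_integralZr; last 4 first.
- exact: measurableT.
- exact: mi.
- by move=> p _; exact: i0.
- by apply: mule_ge0; [rewrite lee_fin|exact: lam_ge0].
apply: eq_integral => p _; rewrite /G /avg_fun /=.
have [pd|pd] := pselect (disc (pp p)); last by rewrite !(lam0 _ pd) !mule0 mul0e.
rewrite (kap_radial _ (modulus_mobiusC pd qd)).
have gen (A B C' D E : \bar R) : (A * B * C' * (D * E) = A * D * E * (B * C'))%E.
  by rewrite !muleA; rewrite -!muleA; congr (_ * _)%E; rewrite muleA muleC -!muleA; congr (_ * _)%E; rewrite muleCA.
exact: gen.
Qed.

Let Lam (g : R[i] -> R) : R := (\int[area]_(p in plane_disc) (g (pp p) * lambda_weight (pp p)))%R.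

Let mD := @measurable_plane_disc R.

Lemma Rintegral_cvg d (T : measurableType d) (mu : {measure set T -> \bar R}) (D : set T) (mD' : measurable D)
    (h : nat -> T -> R) (F g : T -> R) : (forall n, measurable_fun D (h n)) -> mu.-integrable D (EFin \o g) ->
  (forall n x, D x -> `|h n x| <= g x) -> (forall x, D x -> h n x @[n --> \oo] --> F x) ->
  (\int[mu]_(x in D) h n x)%R @[n --> \oo] --> (\int[mu]_(x in D) F x)%R.
Proof.
move=> mh ig hg hF; have := @Cintegral_cvg _ _ _ mu D mD' (fun n x => (h n x)%:C) (fun x => (F x)%:C) g.
move=> /(_ (fun n => cmeas_real (mh n)) ig) /(_ _ _)/cvgC_ReIm[]//.
- by move=> n x Dx; rewrite modulusR hg.
- by move=> x Dx; have /cvgC_real := hF x Dx; exact.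
Qed.

(** The average is moved from [f], merely measurable, to the continuous [s], where it converges
    pointwise on the disc; [f] itself dominates. *)
Lemma average_weak_cvg s : measurable_fun setT (s \o pp) -> (forall z, 0 <= s z <= 1) ->
  (forall w, disc w -> s z @[z --> w] --> s w) ->
  Lam (fun z => average k f z * s z) @[k --> \oo] --> Lam (fun z => f z * s z).
Proof.
move=> ms s01 sc; have s0 z : 0 <= s z by have /andP[] := s01 z.
have s1 z : s z <= 1 by have /andP[] := s01 z.
have -> : (fun k => Lam (fun z => average k f z * s z)) = (fun k => Lam (fun z => f z * average k s z)).
  by apply/funext => k; rewrite /Lam /Rintegral -(lambda_intE (fun z => average k f z * s z)) -(lambda_intE (fun z => f z * average k s z)) (average_sym k ms s0 s1).
apply: (Rintegral_cvg mD _ fL) => [k|k p pd|p pd].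
- apply: measurable_funTS; apply: measurable_funM; last exact: pmeas_lambda.
  by apply: measurable_funM => //; exact: measurable_average.
- rewrite ger0_norm; last by rewrite !mulr_ge0 ?lambda_ge0 ?average_ge0.
  rewrite ler_wpM2r ?lambda_ge0//; apply: ler_piMr; first exact: f0.
  exact: (average_le ms s0 s1).
- apply: cvgM; last exact: cvg_cst.
  apply: cvgM; first exact: cvg_cst.
  apply: (average_cvg ms s0 s1) => // eps eps0.
  have /cvgrPdist_lt/(_ eps eps0)/nbhsC[r r0 hr] := sc _ pd; exists r => // z /hr.
  by rewrite distrC.
Qed.

End weak_limit.

End approximate_identity.

(** * Weak convergence tested on bounded functions *)

Section weak_convergence.
Context (R : realType) d (T : measurableType d) (mu : {measure set T -> \bar R}) (D : set T).
Hypothesis mD : measurable D.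
Variables (w : T -> R) (b : nat -> T -> R) (f : T -> R) (M : R).
Hypotheses (w0 : forall x, 0 <= w x) (iw : mu.-integrable D (EFin \o w)).
Hypotheses (mb : forall k, measurable_fun D (b k)) (bM : forall k x, D x -> `|b k x| <= M).
Hypotheses (mf : measurable_fun D f) (fM : forall x, D x -> `|f x| <= M).
Implicit Types (s g : T -> R).

Definition weighted_integral (h s : T -> R) : R := (\int[mu]_(x in D) (h x * s x * w x))%R.

Local Notation J := weighted_integral.

Let mw : measurable_fun D w. Proof. by have /integrableP[/measurable_EFinP] := iw. Qed.

Let iJ (h : T -> R) s (C : R) : measurable_fun D h -> (forall x, D x -> `|h x| <= M) ->
  measurable_fun setT s -> (forall x, `|s x| <= C) -> mu.-integrable D (EFin \o (fun x => h x * s x * w x)).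
Proof.
move=> mh hM ms sC; apply: (le_integrable mD _ _ (integrableZl mD (M * C) iw)).
  apply/measurable_EFinP; apply: measurable_funM => //; apply: measurable_funM => //.
  exact: measurable_funTS.
move=> x Dx /=; rewrite lee_fin !normrM; apply: ler_pM; rewrite ?mulr_ge0//.
have M0 : 0 <= M := le_trans (normr_ge0 _) (hM x Dx).
have C0 : 0 <= C := le_trans (normr_ge0 _) (sC x).
by rewrite (ger0_norm M0) (ger0_norm C0) ler_pM// hM.
Qed.

(** The test functions for which convergence holds. They are closed under linear combinations and
    under bounded pointwise limits, which is what a monotone class argument needs. *)
Definition weak_test s := [/\ measurable_fun setT s, exists C, forall x, `|s x| <= C &
  J (b k) s @[k --> \oo] --> J f s].

Lemma weak_test_comb (c : R) s g : weak_test s -> weak_test g -> weak_test (fun x => s x + c * g x).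
Proof.
move=> [ms [C1 s1] cs] [mg [C2 g2] cg].
have E (h : T -> R) : measurable_fun D h -> (forall x, D x -> `|h x| <= M) -> J h (fun x => s x + c * g x) = J h s + c * J h g.
  move=> mh hM; have i1 := iJ mh hM ms s1; have i2 := iJ mh hM mg g2.
  rewrite /J -RintegralZl// -(RintegralD mD i1 (integrableZl mD c i2)).
  by apply: eq_Rintegral => x _; ring.
split.
- by apply: measurable_funD => //; apply: measurable_funM.
- exists (C1 + `|c| * C2) => x; apply: le_trans (ler_normD _ _) _; rewrite lerD// normrM ler_wpM2l//.
- rewrite (E f)//; have -> : (fun k => J (b k) (fun x => s x + c * g x)) = (fun k => J (b k) s + c * J (b k) g).
    by apply/funext => k; apply: E => // x; exact: bM.
  by apply: cvgD => //; apply: cvgM => //; exact: cvg_cst.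
Qed.

(** Replacing [s] by [s_ n] costs at most [M] times the integral of [|s_ n - s| w], uniformly in
    [k], and this tends to 0 by dominated convergence. *)
Lemma weak_test_lim (s_ : nat -> T -> R) s (C : R) : (forall n, weak_test (s_ n)) ->
  (forall n x, `|s_ n x| <= C) -> (forall x, s_ n x @[n --> \oo] --> s x) -> weak_test s.
Proof.
move=> ws sC cs.
have ms : measurable_fun setT s by apply: (@measurable_fun_cvg _ _ _ setT s_) => // n; have [] := ws n.
have sC' x : `|s x| <= C.
  apply: (ler_cvg_to (cvg_norm (cs x)) (cvg_cst C)); apply: nearW => n; exact: sC.
split=> //; first by exists C.
have e0 : (\int[mu]_(x in D) (`|s_ n x - s x| * w x))%R @[n --> \oo] --> (0 : R).
  have -> : 0 = (\int[mu]_(x in D) ((fun=> 0) x))%R :> R by rewrite Rintegral_cst// mul0r.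
  apply: (Rintegral_cvg mD (g := fun x => 2 * C * w x)) => [n||n x Dx|x Dx].
  - apply: measurable_funM => //; apply: measurable_funTS; apply: measurableT_comp => //.
    by apply: measurable_funB => //; have [] := ws n.
  - exact: (integrableZl mD (2 * C) iw).
  - rewrite normrM normr_id (ger0_norm (w0 x)) ler_wpM2r//; apply: le_trans (ler_normB _ _) _.
    by have := sC n x; have := sC' x; lra.
  - rewrite -[X in _ --> X](mul0r (w x)); apply: cvgM; last exact: cvg_cst.
    by rewrite -[X in _ --> X](normr0 R) -(subrr (s x)); apply: cvg_norm; apply: cvgB => //; exact: cvg_cst.
have lip (h : T -> R) n : measurable_fun D h -> (forall x, D x -> `|h x| <= M) ->
    `|J h (s_ n) - J h s| <= M * (\int[mu]_(x in D) (`|s_ n x - s x| * w x))%R.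
  move=> mh hM; have [msn _ _] := ws n; have i1 := iJ mh hM msn (sC n); have i2 := iJ mh hM ms sC'.
  have mm : measurable_fun setT (fun x => s_ n x - s x) by exact: measurable_funB.
  have dC x : `|s_ n x - s x| <= C + C by apply: le_trans (ler_normB _ _) _; rewrite lerD.
  have i3 : mu.-integrable D (EFin \o (fun x => `|s_ n x - s x| * w x)).
    apply: (le_integrable mD _ _ (integrableZl mD (C + C) iw)).
      apply/measurable_EFinP; apply: measurable_funM => //; apply: measurable_funTS.
      exact: measurableT_comp.
    move=> x _ /=; rewrite lee_fin !normrM normr_id ler_wpM2r//.
    exact: le_trans (dC x) (ler_norm _).
  have i4 := iJ mh hM mm dC.
  have -> : J h (s_ n) - J h s = J h (fun x => s_ n x - s x).
    by rewrite /J -(RintegralB mD i1 i2); apply: eq_Rintegral => x _; ring.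
  apply: le_trans (le_normr_Rintegral mD i4) _.
  rewrite -RintegralZl//; apply: (le_Rintegral mD (integrable_norm i4) (integrableZl mD M i3)) => x Dx.
  by rewrite /= !normrM (ger0_norm (w0 x)) mulrA ler_wpM2r// ler_wpM2r// hM.
apply/cvgrPdist_le => eps eps0.
have M1 : 0 < `|M| + 1 by rewrite ltr_wpDl.
have : \forall n \near \oo, (\int[mu]_(x in D) (`|s_ n x - s x| * w x))%R < eps / (3 * (`|M| + 1)).
  by apply: (cvgr_lt _ e0); rewrite divr_gt0// mulr_gt0.
move=> [n0 _ hn0]; have En := hn0 n0 (leqnn n0); set E := (\int[mu]_(x in D) _)%R in En.
have ME : M * E <= eps / 3.
  have E0 : 0 <= E by apply: Rintegral_ge0 => x _; rewrite mulr_ge0.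
  apply: le_trans (ler_wpM2r E0 (le_trans (ler_norm M) (_ : `|M| <= `|M| + 1))) _; first by rewrite lerDl.
  move: En; rewrite ltr_pdivlMr ?mulr_gt0//; nra.
have [_ _ /cvgrPdist_le/(_ (eps / 3) (divr_gt0 eps0 (ltr0n _ 3)))] := ws n0.
apply: filterS => k hk.
have h1 := lip f n0 mf fM; have h2 := lip (b k) n0 (mb k) (bM k); rewrite -/E in h1 h2.
move: hk h1 h2; rewrite !ler_norml => /andP[a1 a2] /andP[b1 b2] /andP[c1 c2]; apply/andP; split; lra.
Qed.

(** The fixed factor [g] and the projection [pi_] let sets be introduced one coordinate at a
    time. *)
Lemma weak_test_lambda (Y : Type) (pi_ : T -> Y) g : weak_test g ->
  lambda_system setT [set A : set Y | weak_test (fun x => \1_A (pi_ x) * g x)].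
Proof.
move=> wg; split => //=.
- have -> : (fun x => \1_setT (pi_ x) * g x) = g by apply/funext => x; rewrite indicT mul1r.
  exact: wg.
- move=> A B BA /= wA wB; have := weak_test_comb (- 1) wA wB.
  congr weak_test; apply/funext => x; rewrite mulN1r -mulrBl !indicE in_setD; congr (_ * _).
  case: (boolP (pi_ x \in B)) => [/set_mem/BA/mem_set ->|_]; first by rewrite subrr.
  by rewrite andbT subr0.
move=> F ndF /= wF; have [_ [C gC] _] := wg.
apply: (weak_test_lim (C := C) wF) => [n x|x].
  rewrite normrM; apply: le_trans (gC x); rewrite ler_piMl// indicE; case: (_ \in _) => /=; by rewrite ?normr1 ?normr0.
apply: cvgM; last exact: cvg_cst.
apply: cvg_near_cst; rewrite !indicE; case: (boolP (_ \in \bigcup_i _)) => [/set_mem[n _ Fn]|nF].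
  exists n => // m /= nm; rewrite indicE mem_set//; have /subsetPset := ndF _ _ nm; exact.
apply: nearW => n; rewrite indicE; case: (boolP (_ \in F n)) => // /set_mem Fn.
by move/negP: nF; case; apply: mem_set; exists n.
Qed.

End weak_convergence.

(** * From continuous test functions to measurable sets of the plane *)

Section plane_weak_convergence.
Context (R : realType).
Local Notation T1 := (measurableTypeR R).
Local Notation T2 := (T1 * T1)%type.
Variables (mu : {measure set T2 -> \bar R}) (D : set T2).
Hypothesis mD : measurable D.
Variables (w : T2 -> R) (b : nat -> T2 -> R) (f : T2 -> R) (M : R).
Hypotheses (w0 : forall x, 0 <= w x) (iw : mu.-integrable D (EFin \o w)).
Hypotheses (mb : forall k, measurable_fun D (b k)) (bM : forall k x, D x -> `|b k x| <= M).
Hypotheses (mf : measurable_fun D f) (fM : forall x, D x -> `|f x| <= M).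
Local Notation wt := (weak_test mu D w b f).
Hypothesis wt_continuous : forall phi psi : R -> R, continuous phi -> continuous psi ->
  (forall x, 0 <= phi x <= 1) -> (forall x, 0 <= psi x <= 1) -> wt (fun p => phi p.1 * psi p.2).

(** Continuous functions that increase to the indicator of the open half-line beyond [c]. *)
Definition ramp (c : R) (n : nat) (x : R) : R := Num.min 1 (n%:R * Num.max (x - c) 0).

Lemma ramp_continuous c n : continuous (ramp c n).
Proof.
move=> x; apply: (@continuous_min _ _ (fun=> 1) (fun x => n%:R * Num.max (x - c) 0)); first exact: cvg_cst.
apply: cvgM; first exact: cvg_cst.
apply: (@continuous_max _ _ (fun x => x - c) (fun=> 0)); last exact: cvg_cst.
by apply: cvgB; [exact: cvg_id|exact: cvg_cst].
Qed.

Lemma ramp01 c n x : 0 <= ramp c n x <= 1.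
Proof. by rewrite le_min ler01 mulr_ge0 ?le_max ?lexx ?orbT//= ge_min lexx. Qed.

Lemma ramp_cvg c x : ramp c n x @[n --> \oo] --> (\1_(`]c, +oo[%classic) x : R).
Proof.
rewrite indicE; apply: cvg_near_cst; have [xc|cx] := leP x c.
  rewrite memNset; last by rewrite /= in_itv/= andbT => h; have := lt_le_trans h xc; rewrite ltxx.
  apply: nearW => n; rewrite /ramp max_r ?subr_le0// mulr0; exact: min_r.
rewrite mem_set; last by rewrite /= in_itv/= andbT.
have y0 : 0 < x - c by rewrite subr_gt0.
exists (Num.truncn (x - c)^-1).+1 => // n /= hn; rewrite /ramp max_l ?(ltW y0)// min_l//.
rewrite -ler_pdivrMr// div1r; apply: ltW; apply: lt_le_trans (_ : (Num.truncn (x - c)^-1).+1%:R <= _); last by rewrite ler_nat.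
exact: truncnS_gt.
Qed.

Let c1 : continuous ((fun=> 1) : R -> R). Proof. by move=> x; exact: cvg_cst. Qed.
Let o1 (x : R) : 0 <= ((fun=> 1) : R -> R) x <= 1. Proof. by rewrite ler01 lexx. Qed.

Let rays_setI : setI_closed (@RGenOInfty.G R).
Proof.
move=> _ _ [x ->] [y ->]; exists (Num.max x y); apply/seteqP; split => z /=; rewrite !in_itv/= !andbT.
  by move=> [h1 h2]; rewrite gt_max h1 h2.
by rewrite gt_max => /andP[].
Qed.

Let from_rays (P : set (set T1)) : lambda_system setT P -> (forall c : R, P (`]c, +oo[%classic)) ->
  forall A : set T1, measurable A -> P A.
Proof.
move=> lP rP A mA; have : <<s (@RGenOInfty.G R) >> A by rewrite -[X in X A]/((RGenOInfty.G (R := R)).-sigma.-measurable) -RGenOInfty.measurableE.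
by apply: (lambda_system_subset rays_setI lP) => // _ [c ->]; exact: rP.
Qed.

(** Open half-lines generate the measurable sets of the line and are stable under intersection, so a
    lambda system that contains them is everything; the other coordinate stays continuous
    meanwhile. *)
Lemma weak_test_strip (A : set T1) (psi : R -> R) : measurable A -> continuous psi ->
  (forall x, 0 <= psi x <= 1) -> wt (fun p => \1_A p.1 * psi p.2).
Proof.
move=> mA cpsi psi01; move: A mA; apply: from_rays.
  apply: (weak_test_lambda mD w0 iw mb bM mf fM fst (g := fun p => psi p.2)).
  have := wt_continuous c1 cpsi o1 psi01; congr wt; apply/funext => p; exact: mul1r.
move=> c; apply: (weak_test_lim mD w0 iw mb bM mf fM (s_ := fun n p => ramp c n p.1 * psi p.2) (C := 1)) => [n|n p|p].
- by apply: wt_continuous => //; [exact: ramp_continuous|exact: ramp01].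
- have /andP[r0 r1] := ramp01 c n p.1; have /andP[p0 p1] := psi01 p.2.
  by rewrite ger0_norm ?mulr_ge0// mulr_ile1.
- by apply: cvgM; [exact: ramp_cvg|exact: cvg_cst].
Qed.

Lemma weak_test_rect (A B : set T1) : measurable A -> measurable B -> wt (fun p => \1_B p.2 * \1_A p.1).
Proof.
move=> mA; have i01 (x : T1) : 0 <= (\1_A x : R) <= 1 by rewrite indicE; case: (_ \in _); rewrite ?lexx ?ler01.
have sw (h : T1 -> R) : (fun p : T2 => h p.2 * \1_A p.1) = (fun p => \1_A p.1 * h p.2) by apply/funext => p; exact: mulrC.
move: B; apply: from_rays.
  apply: (weak_test_lambda mD w0 iw mb bM mf fM snd (g := fun p => \1_A p.1)).
  have := weak_test_strip mA c1 o1; congr wt; apply/funext => p; exact: mulr1.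
move=> c; rewrite (sw (\1_(`]c, +oo[%classic : set T1))).
apply: (weak_test_lim mD w0 iw mb bM mf fM (s_ := fun n p => \1_A p.1 * ramp c n p.2) (C := 1)) => [n|n p|p].
- by apply: weak_test_strip => //; [exact: ramp_continuous|exact: ramp01].
- have /andP[r0 r1] := ramp01 c n p.2; have /andP[p0 p1] := i01 p.1.
  by rewrite ger0_norm ?mulr_ge0// mulr_ile1.
- by apply: cvgM; [exact: cvg_cst|exact: ramp_cvg].
Qed.

Lemma weak_test_measurable (A : set T2) : measurable A -> wt (fun p => \1_A p).
Proof.
move=> mA; have : wt (fun p => \1_A (id p) * (fun=> 1) p); last first.
  by congr wt; apply/funext => p; exact: mulr1.
move: mA; rewrite measurable_prod_measurableType.
apply: (@lambda_system_subset _ [set A `*` B | A in measurable & B in measurable] _ setT [set A : set T2 | wt (fun p => \1_A (id p) * (fun=> 1) p)]) => //.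
- move=> _ _ [A1 mA1 [B1 mB1 <-]] [A2 mA2 [B2 mB2 <-]]; exists (A1 `&` A2); first exact: measurableI.
  by exists (B1 `&` B2); [exact: measurableI|rewrite setXI].
- apply: (weak_test_lambda mD w0 iw mb bM mf fM id (g := fun=> 1)).
  have := wt_continuous c1 c1 o1 o1; congr wt; apply/funext => p; exact: mul1r.
move=> _ [A1 mA1 [B1 mB1 <-]] /=; have := weak_test_rect mA1 mB1; congr wt; apply/funext => p.
rewrite mulr1 !indicE in_setX; case: (p.1 \in A1); case: (p.2 \in B1) => /=; by rewrite ?mulr1 ?mulr0.
Qed.

End plane_weak_convergence.

(** * Lower semicontinuity of the integral of squares *)

Section square_liminf.
Context (R : realType).
Local Notation T1 := (measurableTypeR R).
Local Notation T2 := (T1 * T1)%type.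
Implicit Types (s : R[i] -> R) (z w : R[i]).

Let mD := @measurable_plane_disc R.

Definition lambda_int (g : R[i] -> R) : R := (\int[area]_(p in plane_disc) (g (pp p) * lambda_weight (pp p)))%R.
Local Notation Lam := lambda_int.

(** The invariant measure has infinite mass; times this continuous factor its density is at most
    [j / pi], so that bounded functions become integrable. The factor tends to 1 on the disc. *)
Definition cutoff (j : nat) z : R := Num.min 1 (j%:R * (1 - modulus z ^+ 2) ^+ 2).

Lemma cutoff01 j z : 0 <= cutoff j z <= 1.
Proof. by rewrite le_min ler01 mulr_ge0 ?sqr_ge0//= ge_min lexx. Qed.

Lemma cutoff_cvg_at (T : Type) (F : set_system T) (FF : Filter F) j (m : T -> R) (l : R) : m x @[x --> F] --> l ->
  Num.min 1 (j%:R * (1 - m x ^+ 2) ^+ 2) @[x --> F] --> Num.min 1 (j%:R * (1 - l ^+ 2) ^+ 2).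
Proof.
move=> h; have cm : continuous (fun y : R => Num.min 1 y).
  by move=> y; apply: (@continuous_min _ _ (fun=> 1) id); [exact: cvg_cst|exact: cvg_id].
apply: (@cvg_comp _ _ _ (fun x => j%:R * (1 - m x ^+ 2) ^+ 2) (fun y : R => Num.min 1 y)); last exact: cm.
apply: cvgM; first exact: cvg_cst.
have h1 : 1 - m x ^+ 2 @[x --> F] --> 1 - l ^+ 2.
  by apply: cvgB; [exact: cvg_cst|rewrite expr2; apply: cvgM].
by rewrite [X in _ --> X]expr2; apply: cvgM.
Qed.

Lemma cutoff_continuous j w : cutoff j z @[z --> w] --> cutoff j w.
Proof.
have h := @cvgC_modulus R _ (nbhs w) (nbhs_filter w) id w cvg_id.
by apply: (@cutoff_cvg_at _ (nbhs w) (nbhs_filter w) j (@modulus R) (modulus w)); exact: h.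
Qed.

Lemma cutoff_cvg z : disc z -> cutoff j z @[j --> \oo] --> (1 : R).
Proof.
move=> zd; have y0 : 0 < (1 - modulus z ^+ 2) ^+ 2.
  by rewrite exprn_gt0// subr_gt0; have /andP[] := disc_sqr zd.
apply: cvg_near_cst; exists (Num.truncn ((1 - modulus z ^+ 2) ^+ 2)^-1).+1 => // n /= hn; rewrite /cutoff min_l//.
rewrite -ler_pdivrMr// div1r; apply: ltW.
apply: lt_le_trans (_ : (Num.truncn ((1 - modulus z ^+ 2) ^+ 2)^-1).+1%:R <= _); last by rewrite ler_nat.
exact: truncnS_gt.
Qed.

Lemma measurable_cutoff j : measurable_fun setT (cutoff j \o pp).
Proof.
apply: measurable_minr; first exact: measurable_cst.
apply: measurable_funM; first exact: measurable_cst.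
apply: measurable_funX; apply: measurable_funB; first exact: measurable_cst.
exact: (meas_modulus2 (@cmeas_point R)).
Qed.

Lemma cutoff_lambda_integrable j : area.-integrable plane_disc (EFin \o (fun p => cutoff j (pp p) * lambda_weight (pp p))).
Proof.
(* The constant [1 / pi] on the disc, written as the weight of parameter 0 so that its integral is a
   known moment. *)
pose k0 (p : T2) : R := bergman_weight 0 (pp p) * modulus (pp p) ^+ (2 * 0).
have k0E p : plane_disc p -> k0 p = pi^-1.
  move=> pd; rewrite /k0 muln0 expr0 mulr1 /bergman_weight powRr0 add0r mulr1; exact: mul1r.
have i0 : area.-integrable plane_disc (EFin \o k0).
  apply/integrableP; split.
    apply: measurable_EFinM; first exact: measurable_bergman_weight.
    exact: (measurable_funX _ (measurable_modulus (@cmeas_point R))).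
  have := bergman_moment 0 (lexx (0 : R)) => E.
  rewrite [X in (X < _)%E](_ : _ = ((bcoef (0 : R) 0)^-1)%:E) ?ltry// -E.
  by apply: eq_integral => p /set_mem pd; rewrite /= ger0_norm// k0E// invr_ge0 pi_ge0.
apply: (le_integrable mD _ _ (integrableZl mD j%:R i0)).
  apply: measurable_EFinM; first exact: measurable_cutoff.
  exact: pmeas_lambda.
move=> p pd /=; rewrite lee_fin k0E// ger0_norm; last first.
  by rewrite mulr_ge0 ?lambda_ge0//; have /andP[] := cutoff01 j (pp p).
rewrite ger0_norm ?mulr_ge0 ?invr_ge0 ?pi_ge0//.
have y0 : 0 < 1 - modulus (pp p) ^+ 2 by rewrite subr_gt0; have /andP[] := disc_sqr pd.
have -> : j%:R / pi = j%:R * (1 - modulus (pp p) ^+ 2) ^+ 2 * lambda_weight (pp p) :> R.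
  by rewrite /lambda_weight; have := gt_eqF (pi_gt0 R); move: pi => q q0; field; rewrite q0 gt_eqF.
by rewrite ler_wpM2r ?lambda_ge0// ge_min lexx orbT.
Qed.

(** For [y >= 0] this is [min(n, floor y)], as a sum of indicators, so that its composite with [f]
    is a combination of indicators of measurable sets. *)
Definition stairs (n : nat) (y : R) : R := \sum_(i < n) (i.+1%:R <= y)%R%:R.

Lemma stairs_bounds n y : 0 <= y -> stairs n y <= y /\ (y <= n%:R -> y - 1 <= stairs n y).
Proof.
move=> y0; suff [h1 [h2 h3]] : stairs n y <= y /\ (n%:R <= y -> stairs n y = n%:R) /\ (y <= n%:R -> y - 1 <= stairs n y) by [].
elim: n => [|n [h1 [h2 h3]]].
  by rewrite /stairs big_ord0; split=> //; split=> // y1; rewrite subr_le0 (le_trans y1).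
have E : stairs n.+1 y = stairs n y + (n.+1%:R <= y)%R%:R by rewrite /stairs big_ord_recr.
rewrite E; case: (leP (n.+1%:R : R) y) => hn /=.
  have ny : n%:R <= y by apply: le_trans hn; rewrite ler_nat.
  rewrite h2//; have e1 : n%:R + 1 = n.+1%:R :> R by rewrite natr1.
  by rewrite e1; split=> //; split=> // yn; lra.
rewrite addr0; split=> //; split=> [//|_].
have [yn|ny] := leP y n%:R; first exact: h3.
by rewrite (h2 (ltW ny)); rewrite -natr1 in hn; lra.
Qed.

Lemma stairs_ge0 n y : 0 <= stairs n y.
Proof. by apply: sumr_ge0 => i _; rewrite ler0n. Qed.

Variables (f : R[i] -> R) (b : nat -> R[i] -> R) (M : R).
Hypotheses (mf : measurable_fun setT (f \o pp)) (f0 : forall z, 0 <= f z) (fM : forall z, f z <= M).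
Hypothesis fL : area.-integrable plane_disc (EFin \o (fun p => f (pp p) * lambda_weight (pp p))).
Hypotheses (mb : forall k, measurable_fun setT (b k \o pp)) (b0 : forall k z, 0 <= b k z).
Hypothesis bM : forall k z, disc z -> b k z <= M.
Hypothesis weak : forall s, measurable_fun setT (s \o pp) -> (forall z, 0 <= s z <= 1) ->
  (forall w, disc w -> s z @[z --> w] --> s w) -> Lam (fun z => b k z * s z) @[k --> \oo] --> Lam (fun z => f z * s z).

(** A minorant of [f] with steps of height [1 / (j + 1)], enough of them to reach [M], cut off near
    the circle: a simple function times the cutoff, hence an admissible test function. *)
Let grid j z : R := cutoff j.+1 z * (stairs (j.+1 * (Num.truncn M).+1) (j.+1%:R * f z) / j.+1%:R).

Let wj j (p : T2) : R := cutoff j (pp p) * lambda_weight (pp p).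
Let wt j := weak_test area plane_disc (wj j) (fun k p => b k (pp p)) (f \o pp).

Let wj0 j p : 0 <= wj j p.
Proof. by rewrite mulr_ge0 ?lambda_ge0//; have /andP[] := cutoff01 j (pp p). Qed.

Let bM' k p : plane_disc p -> `|b k (pp p)| <= M.
Proof. by move=> pd; rewrite ger0_norm// bM. Qed.

Let fM' p : plane_disc p -> `|(f \o pp) p| <= M.
Proof. by move=> _; rewrite /= ger0_norm. Qed.

Let mb' k : measurable_fun plane_disc (fun p => b k (pp p)).
Proof. exact: measurable_funTS (mb k). Qed.

Let mf' : measurable_fun plane_disc (f \o pp).
Proof. exact: measurable_funTS mf. Qed.

(** [weak] concerns continuous functions on the disc; products of continuous functions of the two
    coordinates, times the cutoff, are of this kind. *)
Let weak_sets j (A : set T2) : measurable A -> wt j (fun p => \1_A p).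
Proof.
apply: (@weak_test_measurable R area plane_disc mD (wj j) (fun k p => b k (pp p)) (f \o pp) M (wj0 j) (cutoff_lambda_integrable j)).
- exact: mb'.
- exact: bM'.
- exact: mf'.
- exact: fM'.
move=> phi psi cphi cpsi phi01 psi01.
have mphi (h : R -> R) : continuous h -> measurable_fun setT (h : T1 -> T1).
  by move=> ch; exact: continuous_measurable_fun.
split.
- by apply: measurable_funM; [exact: (measurableT_comp (mphi _ cphi) measurable_fst)|exact: (measurableT_comp (mphi _ cpsi) measurable_snd)].
- exists 1 => p; have /andP[r0 r1] := phi01 p.1; have /andP[p0 p1] := psi01 p.2.
  by rewrite ger0_norm ?mulr_ge0// mulr_ile1.
have := @weak (fun z => phi (Re z) * psi (Im z) * cutoff j z) _ _ _.
have E (h : R[i] -> R) : weighted_integral area plane_disc (wj j) (h \o pp) (fun p => phi p.1 * psi p.2) =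
    Lam (fun z => h z * (phi (Re z) * psi (Im z) * cutoff j z)).
  by apply: eq_Rintegral => p _; rewrite /wj /= !mulrA.
rewrite -E; have -> : (fun k => Lam (fun z => b k z * (phi (Re z) * psi (Im z) * cutoff j z))) =
    (fun k => weighted_integral area plane_disc (wj j) (fun p => b k (pp p)) (fun p => phi p.1 * psi p.2)).
  by apply/funext => k; rewrite -E.
apply.
- apply: measurable_funM; last exact: measurable_cutoff.
  by apply: measurable_funM; [exact: (measurableT_comp (mphi _ cphi) measurable_fst)|exact: (measurableT_comp (mphi _ cpsi) measurable_snd)].
- move=> z; have /andP[r0 r1] := phi01 (Re z); have /andP[p0 p1] := psi01 (Im z); have /andP[q0 q1] := cutoff01 j z.
  by rewrite !mulr_ge0//= !mulr_ile1// mulr_ge0.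
move=> w _; have /cvgC_ReIm[hr hi] : id z @[z --> w] --> w by exact: cvg_id.
have gen (T : Type) (F : set_system T) (FF : Filter F) (x y z : T -> R) (x0 y0 z0 : R) : x t @[t --> F] --> x0 ->
    y t @[t --> F] --> y0 -> z t @[t --> F] --> z0 -> phi (x t) * psi (y t) * z t @[t --> F] --> phi x0 * psi y0 * z0.
  move=> hx hy hz; apply: cvgM => //; apply: cvgM.
    by apply: (@cvg_comp _ _ _ x phi _ _ _ hx); exact: cphi.
  by apply: (@cvg_comp _ _ _ y psi _ _ _ hy); exact: cpsi.
exact: (gen _ _ (nbhs_filter w) _ _ _ _ _ _ hr hi (cutoff_continuous (j := j) (w := w))).
Qed.

Let weak_stairs j n (c : R) : wt j (fun p => stairs n (c * f (pp p))).
Proof.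
elim: n => [|n IH].
  have := weak_sets j (@measurable0 _ _); congr (wt j); apply/funext => p.
  by rewrite /stairs big_ord0 indic0.
have mA : measurable [set p : T2 | n.+1%:R <= c * f (pp p)].
  have mc : measurable_fun setT (fun p : T2 => c * f (pp p)) by apply: measurable_funM.
  have := mc measurableT _ (measurable_itv `[n.+1%:R, +oo[).
  by rewrite setTI; congr measurable; apply/seteqP; split => p; rewrite /= in_itv/= andbT.
have := weak_test_comb mD (cutoff_lambda_integrable j) mb' bM' mf' fM' 1 IH (weak_sets j mA).
congr (wt j); apply/funext => p; rewrite mul1r /stairs big_ord_recr /=; congr (_ + _).
by rewrite indicE; case: (boolP (n.+1%:R <= c * f (pp p))) => h; [rewrite mem_set|rewrite memNset//; exact/negP].
Qed.

Let grid01 j z : 0 <= grid j z /\ grid j z <= f z.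
Proof.
have /andP[q0 q1] := cutoff01 j.+1 z; have y0 : 0 <= j.+1%:R * f z by rewrite mulr_ge0.
have [h1 _] := stairs_bounds (j.+1 * (Num.truncn M).+1) y0; have h0 := stairs_ge0 (j.+1 * (Num.truncn M).+1) (j.+1%:R * f z).
split; first by rewrite mulr_ge0// divr_ge0.
apply: le_trans (ler_piMl _ q1) _; first by rewrite divr_ge0.
by rewrite ler_pdivrMr// [f z * _]mulrC.
Qed.

Let grid_cvg z : disc z -> grid j z @[j --> \oo] --> f z.
Proof.
move=> zd; rewrite -[X in _ --> X]mul1r; apply: cvgM.
  by have := cutoff_cvg zd; rewrite -cvg_shiftS.
apply: (squeeze_cvgr (f := fun j => f z - j.+1%:R^-1) (h := fun=> f z)).
- apply: nearW => j; have y0 : 0 <= j.+1%:R * f z by rewrite mulr_ge0.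
  have [h1 h2] := stairs_bounds (j.+1 * (Num.truncn M).+1) y0.
  rewrite ler_pdivrMr// [f z * _]mulrC h1 andbT ler_pdivlMr// mulrBl mulVf ?pnatr_eq0// mulrC.
  apply: h2; rewrite natrM ler_wpM2l//; apply: le_trans (fM z) _; apply: ltW; exact: truncnS_gt.
- rewrite -[X in _ --> X]subr0; apply: cvgB; first exact: cvg_cst.
  exact: cvg_harmonic.
- exact: cvg_cst.
Qed.

Let mgrid j : measurable_fun setT (grid j \o pp).
Proof.
have [ms _ _] := weak_stairs j.+1 (j.+1 * (Num.truncn M).+1) j.+1%:R.
apply: measurable_funM; first exact: measurable_cutoff.
by apply: measurable_funM => //; exact: ms.
Qed.

Let grid_weak j : Lam (fun z => b k z * grid j z) @[k --> \oo] --> Lam (fun z => f z * grid j z).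
Proof.
pose S (p : T2) : R := stairs (j.+1 * (Num.truncn M).+1) (j.+1%:R * f (pp p)).
have ws : wt j.+1 S by exact: weak_stairs.
have E (g : R[i] -> R) : Lam (fun z => g z * grid j z) = weighted_integral area plane_disc (wj j.+1) (g \o pp) (fun p => 0 + j.+1%:R^-1 * S p).
  by apply: eq_Rintegral => p _; rewrite /grid /wj /S /=; ring.
have w0 : wt j.+1 (fun=> 0).
  have := weak_sets j.+1 (@measurable0 _ _); congr (wt j.+1); apply/funext => p.
  by rewrite indic0.
have [_ _ hh] := weak_test_comb mD (cutoff_lambda_integrable j.+1) mb' bM' mf' fM' j.+1%:R^-1 w0 ws.
rewrite E; rewrite (_ : (fun k => _) = fun k => weighted_integral area plane_disc (wj j.+1) (fun p => b k (pp p)) (fun p => 0 + j.+1%:R^-1 * S p)); first exact: hh.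
by apply/funext => k; rewrite E.
Qed.

Let iff (g : R[i] -> R) (C : R) : measurable_fun setT (g \o pp) -> (forall z, disc z -> `|g z| <= C * f z) ->
  area.-integrable plane_disc (EFin \o (fun p => g (pp p) * lambda_weight (pp p))).
Proof.
move=> mg gC; apply: (le_integrable mD _ _ (integrableZl mD C fL)).
  apply: measurable_EFinM => //; exact: pmeas_lambda.
move=> p pd /=; rewrite lee_fin normrM (ger0_norm (lambda_ge0 _)); apply: le_trans (ler_norm _).
by rewrite mulrA ler_wpM2r ?lambda_ge0// gC.
Qed.

(** Integrate [b^2 >= 2 b g - g^2] for a fixed minorant [g = grid j] of [f]: weak convergence
    replaces [b] by [f], and [2 f g - g^2] is close to [f^2] when [g] is close to [f]. The integral
    of [b^2] may be infinite, hence the extended reals. *)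
Lemma square_liminf (eta : R) : 0 < eta -> \forall k \near \oo,
  ((Lam (fun z => f z ^+ 2) - eta)%:E <= \int[area]_(p in plane_disc) (b k (pp p) ^+ 2 * lambda_weight (pp p))%:E)%E.
Proof.
move=> eta0; have M0 : 0 <= M := le_trans (f0 0) (fM 0).
have l0 (z : R[i]) := lambda_ge0 z.
have c1 : Lam (fun z => 2 * (f z * grid j z) - grid j z ^+ 2) @[j --> \oo] --> Lam (fun z => 2 * (f z * f z) - f z ^+ 2).
  apply: (Rintegral_cvg mD (g := fun p => 2 * M * (f (pp p) * lambda_weight (pp p)))) => [j||j p _|p pd].
  - apply: measurable_funTS; apply: measurable_funM; last exact: pmeas_lambda.
    apply: measurable_funB; last exact: (measurable_funX 2 (mgrid j)).
    by apply: measurable_funM => //; apply: measurable_funM => //; exact: mgrid.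
  - exact: (integrableZl mD (2 * M) fL).
  - rewrite normrM (ger0_norm (l0 _)) [leRHS]mulrA ler_wpM2r//; have [g0 g1] := grid01 j (pp p).
    have := fM (pp p); have := f0 (pp p); move: (f _) (grid _ _) g0 g1 => F G G0 GF F0 FM.
    by rewrite ger0_norm; nra.
  - apply: cvgM; last exact: cvg_cst.
    have g1 := grid_cvg pd; apply: cvgB; last by rewrite !expr2; apply: cvgM.
    by apply: cvgM; [exact: cvg_cst|apply: cvgM; [exact: cvg_cst|exact: g1]].
have e1 : Lam (fun z => 2 * (f z * f z) - f z ^+ 2) = Lam (fun z => f z ^+ 2).
  by apply: eq_Rintegral => p _; ring.
rewrite e1 in c1.
have [j _ hj] : \forall j \near \oo, Lam (fun z => f z ^+ 2) - eta / 2 < Lam (fun z => 2 * (f z * grid j z) - grid j z ^+ 2).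
  by apply: (cvgr_gt _ c1); rewrite ltrBlDr ltrDl divr_gt0.
have {}hj := hj j (leqnn j); pose g := grid j.
have g0 z : 0 <= g z by have [] := grid01 j z.
have gf z : g z <= f z by have [] := grid01 j z.
have iff2 : area.-integrable plane_disc (EFin \o (fun p => f (pp p) * g (pp p) * lambda_weight (pp p))).
  apply: (@iff (fun z => f z * g z) M) => [|z _]; first by apply: measurable_funM => //; exact: mgrid.
  rewrite ger0_norm; last by apply: mulr_ge0; [exact: f0|exact: g0].
  by rewrite mulrC; apply: ler_wpM2r; [exact: f0|exact: le_trans (gf z) (fM z)].
have ig2 : area.-integrable plane_disc (EFin \o (fun p => g (pp p) ^+ 2 * lambda_weight (pp p))).
  apply: (@iff (fun z => g z ^+ 2) M) => [|z _]; first exact: (measurable_funX 2 (mgrid j)).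
  rewrite ger0_norm ?sqr_ge0// expr2; apply: ler_pM => //; exact: le_trans (gf z) (fM z).
have split2 : Lam (fun z => 2 * (f z * g z) - g z ^+ 2) = 2 * Lam (fun z => f z * g z) - Lam (fun z => g z ^+ 2).
  rewrite /lambda_int -RintegralZl// -(RintegralB mD (integrableZl mD 2 iff2) ig2).
  by apply: eq_Rintegral => p _; ring.
rewrite split2 in hj.
have : \forall k \near \oo, Lam (fun z => f z * g z) - eta / 4 < Lam (fun z => b k z * g z).
  have gw : Lam (fun z => b k z * g z) @[k --> \oo] --> Lam (fun z => f z * g z) by exact: grid_weak.
  by apply: (cvgr_gt _ gw); rewrite ltrBlDr ltrDl divr_gt0.
apply: filterS => k hk.
have ibg : area.-integrable plane_disc (EFin \o (fun p => b k (pp p) * g (pp p) * lambda_weight (pp p))).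
  apply: (@iff (fun z => b k z * g z) M) => [|z zd]; first by apply: measurable_funM; [exact: mb|exact: mgrid].
  rewrite ger0_norm; last by apply: mulr_ge0; [exact: b0|exact: g0].
  by apply: ler_pM; [exact: b0|exact: g0|exact: bM|exact: gf].
have mbk : measurable_fun plane_disc (fun p => (b k (pp p) ^+ 2 * lambda_weight (pp p))%:E).
  apply: measurable_EFinM; last exact: pmeas_lambda.
  exact: (measurable_funX 2 (mb k)).
have /integrableP[mg2 _] := ig2; have /integrableP[mbg _] := ibg.
have E2 : (\int[area]_(p in plane_disc) (g (pp p) ^+ 2 * lambda_weight (pp p))%:E)%E = (Lam (fun z => g z ^+ 2))%:E.
  by rewrite /lambda_int /Rintegral fineK//; exact: (integrable_fin_num mD ig2).
have E3 : (\int[area]_(p in plane_disc) (b k (pp p) * g (pp p) * lambda_weight (pp p))%:E)%E = (Lam (fun z => b k z * g z))%:E.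
  by rewrite /lambda_int /Rintegral fineK//; exact: (integrable_fin_num mD ibg).
have : (2%:E * \int[area]_(p in plane_disc) (b k (pp p) * g (pp p) * lambda_weight (pp p))%:E <=
   \int[area]_(p in plane_disc) (b k (pp p) ^+ 2 * lambda_weight (pp p))%:E +
   \int[area]_(p in plane_disc) (g (pp p) ^+ 2 * lambda_weight (pp p))%:E)%E.
  have bg0 p : 0 <= b k (pp p) * g (pp p) * lambda_weight (pp p).
    by apply: mulr_ge0 (l0 _); apply: mulr_ge0; [exact: b0|exact: g0].
  rewrite -ge0_integralZl_EFin//; last by move=> p _; rewrite lee_fin.
  rewrite -ge0_integralD//; last 2 first.
  - by move=> p _; rewrite lee_fin mulr_ge0 ?sqr_ge0.
  - by move=> p _; rewrite lee_fin mulr_ge0 ?sqr_ge0.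
  apply: ge0_le_integral => //.
  - by move=> p _; rewrite mule_ge0// lee_fin.
  - by apply: emeasurable_funM.
  - by apply: emeasurable_funD.
  move=> p _; rewrite -EFinM -EFinD lee_fin; have := l0 (pp p).
  have := sqr_ge0 (b k (pp p) - g (pp p)); move: (b _ _) (g _) (lambda_weight _) => B G L h1 L0.
  have := mulr_ge0 h1 L0; rewrite sqrrB; lra.
rewrite E2 E3; case: (integral _ _ _) => [r| _|].
- by rewrite -EFinM -EFinD !lee_fin; lra.
- exact: leey.
- by rewrite -EFinM addNye leeNy_eq.
Qed.

End square_liminf.

(** * Uniform limits of polynomials on a segment *)

Definition poly_approximable (R : realType) (M : R) (h : R -> R[i]) := forall eps : R, 0 < eps ->
  exists p : {poly R[i]}, forall x : R, 0 <= x <= M -> modulus (p.[x%:C] - h x) <= eps.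

Section poly_approximable.
Context (R : realType) (M : R) (h : R -> R[i]).
Hypothesis ap : poly_approximable M h.

Lemma poly_approximable_bounded : 0 <= M -> exists2 C : R, 0 <= C & forall x : R, 0 <= x <= M -> modulus (h x) <= C.
Proof.
move=> M0; have [p hp] := ap ltr01.
have s0 : 0 <= \sum_(i < size p) modulus p`_i * M ^+ i by apply: sumr_ge0 => i _; rewrite mulr_ge0 ?modulus_ge0 ?exprn_ge0.
exists (1 + \sum_(i < size p) modulus p`_i * M ^+ i); first by rewrite addr_ge0.
move=> x xM; have := modulusD (h x - p.[x%:C]) p.[x%:C]; rewrite subrK modulusBC => /le_trans; apply.
apply: lerD; first exact: hp.
have /andP[x0 xM'] := xM.
rewrite horner_coef; apply: le_trans (modulus_sum _ _ _) _; apply: ler_sum => i _.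
by rewrite modulusM modulusX modulusR (ger0_norm x0) ler_wpM2l ?modulus_ge0// lerXn2r.
Qed.

(** [h] is arbitrary off [[0, M]], so measurability of the composite is obtained from approximating
    polynomials rather than from [h]. *)
Lemma cmeas_poly_approximable d (T : measurableType d) (g : T -> R) : measurable_fun setT g ->
  (forall x, 0 <= g x <= M) -> cmeas setT (fun x => h (g x)).
Proof.
move=> mg gM.
have [p hp] := choice (fun n : nat => ap (eps := n.+1%:R^-1) ltac:(by rewrite invr_gt0)).
apply: (cmeas_cvg (h := fun n x => (p n).[(g x)%:C])) => // [n|x _].
  have -> : (fun x => (p n).[(g x)%:C]) = (fun x => \sum_(i < size (p n)) (p n)`_i * (g x ^+ i)%:C).
    by apply/funext => x; rewrite horner_coef; apply: eq_bigr => i _; rewrite realCX.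
  by apply: cmeas_sum => i; apply: cmeasM; [exact: cmeas_cst|apply: cmeas_real; exact: measurable_funX].
apply/nearC => eps e0; have := @near_infty_natSinv_lt R (PosNum e0); apply: filterS => n /=.
by apply: le_lt_trans; exact: hp.
Qed.

End poly_approximable.

(** * Traces of localization operators at a fixed parameter *)

Section trace_bound.
Context (R : realType) (a : R).
Hypothesis a0 : 0 <= a.
Local Notation H := (bergman_space a).
Local Notation ip := (@bergman_ip R a).
Local Notation hn := (hnorm ip).
Local Notation T1 := (measurableTypeR R).
Local Notation T3 := (T1 * (T1 * T1))%type.
Local Notation m3 := (leb \x @plane_measure R)%E.
Local Notation lam := (@lam R).
Local Notation Lam := (@lambda_int R).

Let Hip := bergman_inner_product a0.
Let Hh := bergman_hilbert a0.

Variables (u : H) (f : R[i] -> R) (M : R).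
Hypothesis u1 : hn u = 1.
Hypotheses (mf : measurable_fun setT (f \o pp)) (f0 : forall z, 0 <= f z) (fM : forall z, f z <= M).
Hypothesis fL : area.-integrable plane_disc (EFin \o (fun p => f (pp p) * lambda_weight (pp p))).

Let fx (x : T3) : R := f (pp x.2).
Local Notation v := (wstate a0 u).
Let M0 : 0 <= M. Proof. exact: le_trans (f0 0) (fM 0). Qed.
Let mfx : measurable_fun setT fx. Proof. exact: (measurableT_comp mf measurable_snd). Qed.
Let fx0 x : 0 <= fx x. Proof. exact: f0. Qed.
Let fxM x : fx x <= M. Proof. exact: fM. Qed.
Let mv := cmeas_wstate a0 u.
Let frame := wstate_frame a0 u1.
Let mD := @measurable_plane_disc R.

Let weighted (g : R[i] -> R) (C : R) : measurable_fun setT (g \o pp) -> (forall z, `|g z| <= C * f z) ->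
  area.-integrable plane_disc (EFin \o (fun p => g (pp p) * lambda_weight (pp p))) /\
  m3.-integrable setT (EFin \o (fun x => g (pp x.2) * hn (v x) ^+ 2)) /\
  (\int[m3]_x (g (pp x.2) * hn (v x) ^+ 2))%R = (a + 1) * Lam g.
Proof.
move=> mg gC.
have ig : area.-integrable plane_disc (EFin \o (fun p => g (pp p) * lambda_weight (pp p))).
  apply: (le_integrable mD _ _ (integrableZl mD C fL)).
    apply: measurable_EFinM => //; exact: pmeas_lambda.
  move=> p pd /=; rewrite lee_fin normrM (ger0_norm (lambda_ge0 _)); apply: le_trans (ler_norm _).
  by rewrite mulrA ler_wpM2r ?lambda_ge0.
have [i1 e1] := Rintegral_frame_weight a0 mg ig; split=> //; split.
  by apply: eq_integrable i1 => // x _; rewrite /= hn_wstate.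
by rewrite -e1; apply: eq_Rintegral => x _; rewrite hn_wstate.
Qed.

Let wf := weighted mf (C := 1) (fun z => ltac:(by rewrite ger0_norm// mul1r)).
Let fv : m3.-integrable setT (EFin \o (fun x => fx x * hn (v x) ^+ 2)). Proof. exact: wf.2.1. Qed.

Variable L : H -> H.
Hypothesis LE : forall g h, ip (L g) h = frame_form ip m3 v fx g h.
Let tau := frame_trace2 ip m3 v fx L.
Let lL := frame_operator_linear Hh mv mfx fx0 fxM frame LE.
Let sL := frame_operator_selfadj Hh mv mfx fx0 fxM frame LE.
(** The Berezin transform of [f], presented as a term of a constant sequence of densities so that
    the results on [average] apply at one parameter. *)
Let B := average (fun=> berezin u) 0 f.

Let mff : pmeas (EFin \o f). Proof. exact: pmeas_EFin. Qed.
Let mk : forall k : nat, pmeas (berezin u). Proof. by move=> _; exact: pmeas_berezin. Qed.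
Let k0 : forall (k : nat) z, (0%R <= berezin u z)%E. Proof. by move=> _ z; exact: berezin_ge0. Qed.
Let k1 : forall k : nat, pint (fun z => berezin u z * lam z)%E = 1%E.
Proof. by move=> _; rewrite berezin_mass// u1 expr1n. Qed.

(** [frame_kernel] at [phi = f]. The power of [1 - |z|^2] is the squared norm of the kernel, so
    [B z] is the mean of [L] in the normalized kernel. *)
Lemma frame_operator_kernel z : disc z ->
  Re (ip (L (kernel a0 z)) (kernel a0 z)) = (1 - modulus z ^+ 2) `^ (- (2 + a)) * B z.
Proof.
move=> zd; rewrite (Re_frame_operator LE).
have ff0 w : (0 <= (EFin \o f) w)%E by rewrite /= lee_fin.
have := frame_kernel a0 u mff ff0 zd.
have -> : pint (fun w => berezin u (mobius z w) * (EFin \o f) w * lam w)%E = (B z)%:E.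
  rewrite /B (averageE (kap := fun=> berezin u) mk k0 k1 mf f0 fM)//.
rewrite -EFinM => E; apply: EFin_inj; rewrite -E /Rintegral.
have Eq : (\int[m3]_x ((modulus (cstate a0 u x z) ^+ 2)%:E * (EFin \o f) (pp x.2) * (frame_weight a x)%:E) = \int[m3]_x (fx x * modulus (ip (v x) (kernel a0 z)) ^+ 2)%:E)%E.
  apply: eq_integral => x _; rewrite -!EFinM; congr EFin.
  have gen (A b w : R) : A * b * w = b * (w * A) by ring.
  by rewrite /wstate (ipZl Hip) modulusM modulusR ger0_norm ?sqrtr_ge0// exprMn sqr_sqrtr ?frame_weight_ge0// (reproducing a0 _ zd) gen.
by rewrite -Eq E.
Qed.

Let e := @ebasis R a a0.
Let He := ebasis_basis a0.

(** With [K_z] the kernel, [L e_n] at [z] is [<e_n, L K_z>], so Parseval turns the sum of the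
    [|L e_n|^2] into the integral of [|L K_z|^2] over the Bergman measure. Cauchy-Schwarz gives [|L
    K_z| |K_z| >= <L K_z, K_z> = |K_z|^2 B z]. *)
Lemma frame_trace2_ge :
  (\int[area]_(p in plane_disc) ((a + 1) * (B (pp p) ^+ 2 * lambda_weight (pp p)))%:E <= tau%:E)%E.
Proof.
have := @frame_trace2E _ _ _ Hh _ _ m3 v fx M mv mfx M0 fx0 fxM frame fv L LE e He.
move=> /nneseries_EFin; rewrite -/tau => <-.
have -> : (\sum_(0 <= n <oo) (hn (L (e n)) ^+ 2)%:E = \sum_(0 <= n <oo) \int[area]_(p in plane_disc) (bergman_weight a (pp p) * modulus (L (e n) (pp p)) ^+ 2)%:E)%E.
  by apply: eq_eseriesr => n _; rewrite (hnorm_sqr Hip) Re_bergman_ip.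
have mt n : measurable_fun plane_disc (fun p => (bergman_weight a (pp p) * modulus (L (e n) (pp p)) ^+ 2)%:E).
  by apply: (measurable_int area); exact: bergman_sqr_integrable.
have mterm0 n p : plane_disc p -> (0 <= (bergman_weight a (pp p) * modulus (L (e n) (pp p)) ^+ 2)%:E)%E.
  by move=> _; rewrite lee_fin; exact: mulr_ge0 (weight_ge0 a0 p) (sqr_ge0 _).
rewrite -integral_nneseries//.
apply: ge0_le_integral => //.
- by move=> p pd; rewrite lee_fin; exact: mulr_ge0 (addr_ge0 a0 ler01) (mulr_ge0 (sqr_ge0 _) (lambda_ge0 _)).
- apply: measurable_EFinM => //; apply: measurable_funM; last exact: pmeas_lambda.
  by apply: measurable_funX; exact: (@measurable_average _ (fun=> berezin u) mk k0 f mf f0 0%N).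
- by apply: ge0_emeasurable_sum => [n p pd _|n _]; [exact: mterm0|exact: mt].
move=> p pd; set z := pp p; have zd : disc z by [].
have s n : modulus (L (e n) z) = modulus (ip (L (kernel a0 z)) (e n)).
  by rewrite -(reproducing a0 _ zd) sL (ip_sym Hip) modulus_conj.
have -> : (\sum_(0 <= n <oo) (bergman_weight a z * modulus (L (e n) z) ^+ 2)%:E = (bergman_weight a z * hn (L (kernel a0 z)) ^+ 2)%:E)%E.
  apply: nneseries_EFin.
  have -> : series (fun n => bergman_weight a z * modulus (L (e n) z) ^+ 2) = (fun N => bergman_weight a z * series (fun n => modulus (ip (L (kernel a0 z)) (e n)) ^+ 2) N).
    by apply/funext => N; rewrite /series/= mulr_sumr; apply: eq_bigr => n _; rewrite s.
  by apply: cvgMl_tmp; exact: (@parseval _ _ _ Hip e He).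
rewrite lee_fin weightE//.
have gen (A c d k : R) : A * c * d * k = A * (c * k * d) by ring.
rewrite gen ler_wpM2l ?addr_ge0// ler_wpM2r ?lambda_ge0//.
set X := (1 - modulus z ^+ 2) `^ (- (a + 2)).
have w0 : 0 < 1 - modulus z ^+ 2 by have /andP[_ h] := disc_sqr zd; rewrite subr_gt0.
have X0 : 0 < X by exact: powR_gt0.
have XV : (1 - modulus z ^+ 2) `^ (a + 2) = X^-1 by rewrite /X powRN invrK.
have hK : hn (kernel a0 z) ^+ 2 = X by exact: hn_kernel.
have := frame_operator_kernel zd; rewrite (addrC 2 a) -/X => hB.
have B0 : 0 <= B z by exact: average_ge0.
have : X * B z <= hn (L (kernel a0 z)) * hn (kernel a0 z).
  by rewrite -hB (le_trans (ler_norm _))// (le_trans (Re_le_modulus _))// cauchy_schwarz.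
move=> /(lerXn2r 2); rewrite !nnegrE !mulr_ge0 ?hn_ge0 ?(ltW X0)// => /(_ isT isT).
rewrite [leRHS]exprMn hK exprMn XV => h.
have gen2 (k : R) : X ^+ 2 * (X^-1 * k) = k * X by field; rewrite gt_eqF.
by rewrite -(ler_pM2l (exprn_gt0 2 X0)) (le_trans h)// gen2.
Qed.

Let wf2 := weighted (C := M) (g := fun z => f z ^+ 2) (measurable_funX 2 mf)
  (fun z => ltac:(by rewrite ger0_norm ?sqr_ge0// expr2 ler_wpM2r)).
Variable h : R -> R[i].
Hypothesis ap : poly_approximable M h.
Let S := cfc ip L h.
Let rL := frame_operator_range mv mfx M0 fx0 fxM frame LE.
Let cfcS := @cfcP _ _ _ Hh _ _ lL sL M0 rL h ap.
Let bS : exists K, forall w, hn (S w) <= K * hn w.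
Proof.
have [p hp] := ap ltr01.
have bL := frame_operator_norm Hh mv mfx M0 fx0 fxM frame LE.
have [C C0 hC] := operator_poly_bounded Hh p bL.
exists (C + 1) => w; have := hnormB Hip (operator_poly p L w) (operator_poly p L w - S w).
rewrite opprB addrC subrK => /le_trans; apply; rewrite mulrDl; apply: lerD; first exact: hC.
exact: (cfcS.2 p 1 ler01 hp).
Qed.

(** [trace] is a choice: the integral qualifies in every orthonormal basis by
    [frame_operator_trace], and the basis [ebasis] shows that nothing else does. *)
Lemma trace_functional_calculus :
  trace ip (L \o S) = Cintegral m3 setT (fun x => (fx x)%:C * ip (S (v x)) (v x)).
Proof.
have [K hK] := bS; apply: xget_unique => [e' He'|t ht].
  exact: (@frame_operator_trace _ _ _ Hh _ _ m3 v fx M mv mfx fx0 fxM frame fv L LE e' He' S K cfcS.1 hK).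
apply: cvgC_unique (ht e He) _.
exact: (@frame_operator_trace _ _ _ Hh _ _ m3 v fx M mv mfx fx0 fxM frame fv L LE e He S K cfcS.1 hK).
Qed.

Let DI := disc_integral lambda_weight (fun z => (f z)%:C * h (f z)).

Let fxh : Cintegral m3 setT (fun x => (fx x * hn (v x) ^+ 2)%:C * h (fx x)) = (a + 1)%:C * DI.
Proof.
have [C C0 hC] := poly_approximable_bounded ap M0.
have [mRe mIm] := cmeas_poly_approximable ap mf (fun p => ltac:(by rewrite f0 fM)).
have part (q : R[i] -> R) : (forall z, `|q z| <= modulus z) -> measurable_fun setT (fun p => q (h (f (pp p)))) ->
    (\int[m3]_x (f (pp x.2) * q (h (f (pp x.2))) * hn (v x) ^+ 2))%R = (a + 1) * Lam (fun z => f z * q (h (f z))).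
  move=> qm mq; apply: (weighted (g := fun z => f z * q (h (f z))) (C := C) _ _).2.2; first exact: measurable_funM.
  by move=> z; rewrite normrM ger0_norm// mulrC ler_wpM2r// (le_trans (qm _))// hC// f0 fM.
have gen1 (x y z : R) : x * z * y = x * y * z by ring.
have gen2 (x y z : R) : x * (y * z) = y * z * x by ring.
rewrite /DI /disc_integral /Cintegral; apply: complexP.
  rewrite ReZ/=; transitivity ((a + 1) * Lam (fun z => f z * Re (h (f z)))).
    rewrite -(part _ (@Re_le_modulus R) mRe); apply: eq_Rintegral => x _; by rewrite ReZ /fx gen1.
  by rewrite /Lam; apply: (congr1 ( *%R _)); apply: eq_Rintegral => p _; rewrite !ReZ gen2.
rewrite ImZ/=; transitivity ((a + 1) * Lam (fun z => f z * Im (h (f z)))).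
  rewrite -(part _ (@Im_le_modulus R) mIm); apply: eq_Rintegral => x _; by rewrite ImZ /fx gen1.
by rewrite /Lam; apply: (congr1 ( *%R _)); apply: eq_Rintegral => p _; rewrite !ImZ gen2.
Qed.

Lemma trace_error (p : {poly R[i]}) (eps kap : R) : 0 <= eps -> 0 < kap ->
  (forall x : R, 0 <= x <= M -> modulus (p.[x%:C] - h x) <= eps) ->
  modulus (trace ip (L \o S) / (a + 1)%:C - DI) <=
  2 * eps * Lam f + poly_lipschitz M p * (kap / 2 * Lam (fun z => f z ^+ 2) +
    (2 * kap)^-1 * (Lam (fun z => f z ^+ 2) - tau / (a + 1))).
Proof.
move=> e0 k0' hp; have [K hK] := bS.
have a1 : 0 < a + 1 by rewrite ltr_wpDl.
have mh := cmeas_poly_approximable ap mfx (fun x => ltac:(by rewrite fx0 fxM)).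
have := @frame_trace_estimate _ _ _ Hh _ _ m3 v fx M mv mfx M0 fx0 fxM frame fv L LE e He S h p eps kap
  cfcS.1 k0' mh hp (cfcS.2 p eps e0 hp) K hK.
rewrite -trace_functional_calculus fxh -/tau (wf.2.2 : (\int[m3]_x (fx x * hn (v x) ^+ 2))%R = _) (wf2.2.2 : (\int[m3]_x (fx x ^+ 2 * hn (v x) ^+ 2))%R = _).
set t := trace _ _.
have -> : t - (a + 1)%:C * DI = (a + 1)%:C * (t / (a + 1)%:C - DI).
  by rewrite mulrBr mulrCA divff ?mulr1// -modulus_gt0 modulusR gtr0_norm.
rewrite modulusM modulusR (gtr0_norm a1) mulrC -ler_pdivlMr// => /le_trans; apply.
set P := poly_lipschitz _ _; set F2 := Lam _; set F1 := Lam _.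
have gen (A c k d x y r : R) : 0 < A -> 0 < k ->
    (2 * d * (A * x) + c * (k / 2 * (A * y) + (2 * k)^-1 * (A * y - r))) / A = 2 * d * x + c * (k / 2 * y + (2 * k)^-1 * (y - r / A)).
  by move=> A0 k0''; field; rewrite !gt_eqF.
by rewrite gen.
Qed.

End trace_bound.

(** * Integrals and null sets *)

Section null_sets.
Import HBNNSimple.
Context d (T : measurableType d) (R : realType) (mu : {measure set T -> \bar R}).
Variables (N : set T).
Hypotheses (mN : measurable N) (N0 : mu N = 0%E).

Let sup_le (g1 g2 : T -> \bar R) : (forall x, 0 <= g2 x)%E -> (forall x, ~ N x -> g1 x = g2 x) ->
  (ereal_sup [set sintegral mu h | h in [set h : {nnsfun T >-> R} | forall x, ((h x)%:E <= g1 x)%E]] <=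
   ereal_sup [set sintegral mu h | h in [set h : {nnsfun T >-> R} | forall x, ((h x)%:E <= g2 x)%E]])%E.
Proof.
move=> g0 e; apply: ge_ereal_sup => _ [h /= hg1 <-].
have mC := measurableC mN.
(* Multiplying a simple function by the indicator of the complement of [N] keeps its integral and
   makes it admissible for [g2]. *)
apply: ereal_sup_ubound => /=; exists (proj_nnsfun h mC).
  move=> x; rewrite /= /mindic/= indicE in_setC; case: (boolP (x \in N)) => xN /=.
    by rewrite mulr0.
  by rewrite mulr1 -e ?hg1//; move/mem_set; rewrite (negbTE xN).
rewrite -!integralT_nnsfun; apply: ae_eq_integral => //.
- exact/measurable_EFinP.
- exact/measurable_EFinP.
exists N; split=> // x /= nx; apply: contrapT => xN; apply: nx => _.
by rewrite /= /mindic indicE in_setC memNset//= mulr1.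
Qed.

(* No measurability of F and G is assumed: the integral is a supremum over simple functions. *)
Lemma eq_integral_off_null (D : set T) (F G : T -> \bar R) : (forall x, D x -> ~ N x -> F x = G x) ->
  (\int[mu]_(x in D) F x = \int[mu]_(x in D) G x)%E.
Proof.
move=> FG.
have e x : ~ N x -> (F \_ D) x = (G \_ D) x.
  by move=> xN; rewrite /patch; case: ifPn => // /set_mem xD; exact: FG.
rewrite /integral; congr (_ - _)%E; apply/eqP; rewrite eq_le; apply/andP; split; apply: sup_le => x.
all: try exact: funepos_ge0.
all: try exact: funeneg_ge0.
all: by move=> xN; rewrite ?funeposE ?funenegE e.
Qed.

Lemma eq_Cintegral_off_null (D : set T) (F G : T -> R[i]) : (forall x, D x -> ~ N x -> F x = G x) ->
  Cintegral mu D F = Cintegral mu D G.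
Proof.
move=> FG; rewrite /Cintegral /Rintegral.
by congr (fine _ +i* fine _); apply: eq_integral_off_null => x xD xN; rewrite FG.
Qed.

End null_sets.

(** * Replacing [f] by a function bounded everywhere *)

Section truncation.
Context (R : realType).
Local Notation T1 := (measurableTypeR R).
Local Notation T2 := (T1 * T1)%type.

(** The bounds on [f] hold almost everywhere only; here they hold at every point, inside the disc
    and outside, as the frame estimates ask. *)
Definition truncate (M : R) (f : R[i] -> R) (z : R[i]) : R :=
  if z \in disc then Num.min M (Num.max 0 (f z)) else 0.

Variables (f : R[i] -> R).
Hypotheses (f_meas : disc_measurable f) (f_ge0 : disc_ae_nonneg f) (f_L1 : lambda_integrable f)
  (f_Loo : (disc_esssup f < +oo)%E).
Let M := fine (disc_esssup f).
Local Notation ft := (truncate M f).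

Lemma esssup_fine_ge0 : 0 <= M. Proof. by apply: fine_ge0; exact: Lnorm_ge0. Qed.

Lemma truncate_ge0 z : 0 <= ft z.
Proof. by rewrite /truncate; case: ifP => // _; rewrite le_min le_max lexx esssup_fine_ge0. Qed.

Lemma truncate_le z : ft z <= M.
Proof. by rewrite /truncate; case: ifP => _; [rewrite ge_min lexx|exact: esssup_fine_ge0]. Qed.

Lemma measurable_truncate : measurable_fun setT (ft \o pp).
Proof.
have -> : ft \o pp = (fun p => Num.min M (Num.max 0 (f (pp p)))) \_ plane_disc.
  by apply/funext => p; rewrite /truncate /patch /=; congr (if _ then _ else _); apply/idP/idP => /set_mem h; exact/mem_set.
apply/(measurable_restrictT _ (@measurable_plane_disc R)).
by apply: measurable_minr; [exact: measurable_cst|apply: measurable_maxr; [exact: measurable_cst|exact: f_meas]].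
Qed.

Lemma integrable_truncate : area.-integrable plane_disc (EFin \o (fun p => ft (pp p) * lambda_weight (pp p))).
Proof.
apply: (le_integrable (@measurable_plane_disc R) _ _ f_L1).
  apply: measurable_EFinM; [exact: measurable_truncate|exact: pmeas_lambda].
move=> p pd; rewrite /= lee_fin !normrM ler_wpM2r// (ger0_norm (truncate_ge0 _)) /truncate mem_set//.
by rewrite ge_min; apply/orP; right; rewrite ge_max normr_ge0 ler_norm.
Qed.

Lemma truncate_ae : exists N : set T2, [/\ measurable N, area N = 0%E &
  forall p, plane_disc p -> ~ N p -> f (pp p) = ft (pp p)].
Proof.
(* The norm ['N] at [+oo] is defined by cases on whether the measure vanishes; if it does, every set
   is null. *)
have [T0|T0] := leP (area [set: T2]) 0%E.
  exists setT; split=> [||p _ []//]; first exact: measurableT.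
  by apply/eqP; rewrite eq_le T0; exact: measure_ge0.
have : \forall p \ae area, plane_disc p -> f (pp p) <= M.
  have := @ess_sup_ge _ _ R area (abse \o [eta (fun p => (f (pp p))%:E) \_ plane_disc]).
  have ge0 : (0%R <= disc_esssup f)%E by exact: Lnorm_ge0.
  have fin : disc_esssup f \is a fin_num by rewrite ge0_fin_numE.
  move: fin; rewrite /M /disc_esssup unlock T0 => fin.
  apply: filterS => p; rewrite /= -[leRHS](fineK fin) /patch => + pd.
  by rewrite mem_set// abse_EFin lee_fin; apply: le_trans; exact: ler_norm.
move=> h; have [N [mN N0 hN]] := filterI h f_ge0.
exists N; split=> // p pd pN.
have [h1 h2] : (plane_disc p -> f (pp p) <= M) /\ (plane_disc p -> 0 <= f (pp p)).
  by apply: contrapT => nh; apply: pN; apply: hN.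
by rewrite /truncate mem_set// max_r ?h2// min_r ?h1.
Qed.

End truncation.

(** * The second moments tend to zero *)

Section moment_convergence.
Context (R : realType) (beta : nat -> R).
Hypotheses (beta0 : forall n, 0 <= beta n) (beta1 : series beta n @[n --> \oo] --> (1 : R)).

Let term (x : R) n := beta n * (n.+1%:R / (n%:R + x + 2)).

Let ratio_ge0 (x : R) n : 0 <= x -> 0 <= n.+1%:R / (n%:R + x + 2).
Proof. by move=> x0; rewrite divr_ge0// !addr_ge0. Qed.

Let ratio_le1 (x : R) n : 0 <= x -> n.+1%:R / (n%:R + x + 2) <= 1.
Proof. by move=> x0; rewrite ler_pdivrMr ?ltr_wpDl ?addr_ge0// mul1r -natr1 -addrA lerD2l -[leLHS]add0r lerD// ler1n. Qed.

Let ratio_le (x : R) n N : 0 <= x -> (n < N)%N -> n.+1%:R / (n%:R + x + 2) <= N%:R / (x + 2).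
Proof.
by move=> x0 nN; rewrite ler_pM ?invr_ge0 ?addr_ge0// ?ler_nat// lef_pV2 ?posrE ?ltr_wpDl ?addr_ge0// lerD2r lerDr.
Qed.

Lemma moment_series_cvg (x : R) : 0 <= x -> cvgn (series (term x)).
Proof.
move=> x0; apply: (series_le_cvg (v_ := beta)) => [n|//|n|]; last by apply/cvg_ex; exists 1.
  by rewrite mulr_ge0// ratio_ge0.
by rewrite ler_piMr// ratio_le1.
Qed.

(** The first [N] ratios are at most [N / (x + 2)]; the others are at most 1, and the remaining mass
    [1 - series beta N] controls them. *)
Lemma moment_series_le (x : R) N : 0 <= x ->
  limn (series (term x)) <= N%:R / (x + 2) + (1 - series beta N).
Proof.
move=> x0; apply: limr_le; first exact: moment_series_cvg.
have nd : nondecreasing_seq (series beta).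
  by apply/nondecreasing_seqP => n; rewrite /series/= big_nat_recr//= lerDl.
have b1 n : series beta n <= 1.
  rewrite -(cvg_lim _ beta1)//; apply: nondecreasing_cvgn_le => //.
  by apply/cvg_ex; exists 1.
have step j : series (term x) (N + j)%N <= N%:R / (x + 2) * series beta N + (series beta (N + j)%N - series beta N).
  elim: j => [|j ih].
    rewrite addn0 subrr addr0 /series/= mulr_sumr big_nat [leRHS]big_nat; apply: ler_sum => n nN.
    by rewrite [leRHS]mulrC ler_wpM2l// ratio_le.
  rewrite addnS /series/= !big_nat_recr//= -!/(series _ _) addrAC addrA lerD//.
  by rewrite ler_piMr// ratio_le1.
near=> K; have NK : (N <= K)%N by near: K; exact: nbhs_infty_ge.
rewrite -(subnKC NK); apply: le_trans (step _) _; apply: lerD; last by rewrite lerD2r.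
by rewrite ler_piMr// divr_ge0// addr_ge0.
Unshelve. all: by end_near. Qed.

Lemma moment_series_cvg0 (x : nat -> R) : (forall k, k%:R <= x k) ->
  limn (series (term (x k))) @[k --> \oo] --> (0 : R).
Proof.
move=> kx; have x0 k : 0 <= x k by exact: le_trans (kx k).
apply/cvgrPdist_lt => e e0; have e2 : 0 < e / 2 by rewrite divr_gt0.
have [N _ hN] : \forall n \near \oo, `|1 - series beta n| < e / 2 by move/cvgrPdist_lt : beta1; exact.
have [K _ hK] := near_infty_natSinv_lt (PosNum (divr_gt0 e2 (ltr0Sn R N))).
exists K => // k /= Kk.
have t0 : 0 <= limn (series (term (x k))).
  apply: limr_ge; first exact: moment_series_cvg.
  by apply: nearW => n; rewrite /series/= sumr_ge0// => i _; rewrite mulr_ge0// ratio_ge0.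
rewrite sub0r normrN ger0_norm//; apply: le_lt_trans (moment_series_le N (x0 k)) _.
rewrite [e]splitr; apply: ltrD; last by apply: le_lt_trans (ler_norm _) _; apply: hN => /=.
have := hK k Kk; rewrite /= ltr_pdivlMr// => h; apply: le_lt_trans h.
rewrite mulrC; apply: ler_pM => //; first by rewrite invr_ge0 addr_ge0.
rewrite lef_pV2 ?posrE// ?ltr_wpDl//; apply: le_trans (_ : x k + 1 <= _); last by rewrite lerD2l ler1n.
  by rewrite -natr1 lerD2r.
by rewrite ler_nat.
Qed.

End moment_convergence.

(** * The trace ratio along a sequence of parameters *)

Section localization_trace.
Context (R : realType).
Local Notation T1 := (measurableTypeR R).
Local Notation T3 := (T1 * (T1 * T1))%type.
Local Notation m3 := (leb \x @plane_measure R)%E.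
Local Notation Lam := (@lambda_int R).

Variables (psi : bergman_space (0 : R)) (f : R[i] -> R) (h : R -> R[i]).
Hypothesis psi_unit : hnorm (bergman_ip 0) psi = 1.
Hypotheses (f_meas : disc_measurable f) (f_ge0 : disc_ae_nonneg f) (f_L1 : lambda_integrable f)
  (f_Loo : (disc_esssup f < +oo)%E).
Let M := fine (disc_esssup f).
Hypothesis h_cont : {within `[0, M], continuous h}.
Let ft := truncate M f.
Let L a := localization a (V a psi) f.
Let DI := disc_integral lambda_weight (fun z => (f z)%:C * h (f z)).

Let M0 : 0 <= M. Proof. exact: esssup_fine_ge0. Qed.
Let ft0 z : 0 <= ft z. Proof. exact: truncate_ge0. Qed.
Let ftM z : ft z <= M. Proof. exact: truncate_le. Qed.
Let mft : measurable_fun setT (ft \o pp). Proof. exact: measurable_truncate. Qed.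
Let ftL := integrable_truncate f_meas f_L1.
Let ap : poly_approximable M h. Proof. by move=> e e0; exact: weierstrass_approximation. Qed.

Lemma localization_form_truncate (a : R) w (g k : R[i] -> R[i]) :
  localization_form a w f g k = localization_form a w ft g k.
Proof.
have [N [mN N0 fN]] := truncate_ae f_ge0 f_Loo.
rewrite /localization_form; apply: (congr1 ( *%R _)); apply: eq_Cintegral => t _; apply: (congr1 ( *%R _)).
by apply: (eq_Cintegral_off_null mN N0) => p pd pN; rewrite fN.
Qed.

Lemma disc_integral_truncate : DI = disc_integral lambda_weight (fun z => (ft z)%:C * h (ft z)).
Proof.
have [N [mN N0 fN]] := truncate_ae f_ge0 f_Loo.
by apply: (eq_Cintegral_off_null mN N0) => p pd pN; rewrite fN.
Qed.

(** [localization] is picked among the maps that represent the form; [frame_operator_ex] provides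
    one, once [f] has been replaced by its truncation. *)
Lemma localization_frame (a : R) (a0 : 0 <= a) (u : bergman_space a) : (u : R[i] -> R[i]) = V a psi -> hnorm (bergman_ip a) u = 1 ->
  forall g k, bergman_ip a (@L a g) k = frame_form (bergman_ip a) m3 (wstate a0 u) (fun x : T3 => ft (pp x.2)) g k.
Proof.
move=> uV u1; have E (g k : bergman_space a) : localization_form a (V a psi) f g k = frame_form (bergman_ip a) m3 (wstate a0 u) (fun x : T3 => ft (pp x.2)) g k.
  by rewrite localization_form_truncate -uV; exact: (localization_formE a0 u1 mft ft0 ftM).
have mfx : measurable_fun setT (fun x : T3 => ft (pp x.2)) by exact: (measurableT_comp mft measurable_snd).
have [L' hL'] := frame_operator_ex (bergman_hilbert a0) (cmeas_wstate a0 u) mfx (fun x => ft0 _) (fun x => ftM _) (wstate_frame a0 u1).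
move=> g k; rewrite -E; rewrite /L /localization.
by apply: (@xgetPex _ _ [set L : bergman_space a -> bergman_space a | forall g h, bergman_ip a (L g) h = localization_form a (V a psi) f g h]); exists L' => g' k'; rewrite E.
Qed.

Let beta n := modulus (power_series_coef psi n) ^+ 2 / n.+1%:R.

Variables (al : nat -> R) (kal : forall k, k%:R <= al k).
Let al0 k : 0 <= al k. Proof. exact: le_trans (kal k). Qed.
Let u k : bergman_space (al k) := sval (cid (V_vector (al0 k) psi)).
Let uV k : (u k : R[i] -> R[i]) = V (al k) psi. Proof. by rewrite /u; case: cid => ? []. Qed.
Let u1 k : hnorm (bergman_ip (al k)) (u k) = 1.
Proof.
rewrite /u; case: cid => w /= [_ E _]; apply/eqP.
by rewrite -(@eqrXn2 _ 2) ?ler01 ?hn_ge0// E psi_unit.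
Qed.
Let ub k n : modulus (power_series_coef (u k) n) ^+ 2 / bcoef (al k) n = beta n.
Proof. by rewrite /u; case: cid => ? []. Qed.

Let beta1 : series beta n @[n --> \oo] --> (1 : R).
Proof.
have := @hn_series R (al 0) (al0 0) (u 0); rewrite u1 expr1n.
by have -> : nterm (al 0) (power_series_coef (u 0)) = beta by apply/funext => n; rewrite -(ub 0).
Qed.

Let beta0 n : 0 <= beta n. Proof. by rewrite divr_ge0 ?exprn_ge0 ?modulus_ge0. Qed.
Let kap k := berezin (u k).
(** The second moments. The ratio comes from [bcoef a n / bcoef a n.+1 = (n + 1) / (n + a + 2)], and
    [beta n] is the mass in degree [n], common to all parameters. *)
Let mom k := limn (series (fun n => beta n * (n.+1%:R / (n%:R + al k + 2)))).
Let kap_mass k : pint (fun z => kap k z * lam z)%E = 1%E.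
Proof. by rewrite berezin_mass// u1 expr1n. Qed.

Let kap_moment k : pint (fun z => (modulus z ^+ 2)%:E * kap k z * lam z)%E = (mom k)%:E.
Proof.
have := berezin_moment (al0 k) (u k) 1; rewrite muln1 => ->.
apply: nneseries_EFin.
have -> : (fun n => modulus (power_series_coef (u k) n) ^+ 2 / bcoef (al k) (n + 1)) = (fun n => beta n * (n.+1%:R / (n%:R + al k + 2))).
  apply/funext => n; rewrite -(ub k) addn1 bcoefS invfM invf_div.
  by rewrite mulrA.
exact: moment_series_cvg.
Qed.

Let mkap k : pmeas (kap k). Proof. exact: pmeas_berezin. Qed.
Let kap0 k z : (0%R <= kap k z)%E. Proof. exact: berezin_ge0. Qed.
Let b := average kap ^~ ft.
Let tau k := frame_trace2 (bergman_ip (al k)) m3 (wstate (al0 k) (u k)) (fun x : T3 => ft (pp x.2)) (@L (al k)).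

(** [frame_trace2_ge] bounds the trace below by the integral of the squared Berezin transforms, and
    these play the role of [b] in [square_liminf]. *)
Let tau_ge (delta : R) : 0 < delta -> \forall k \near \oo, Lam (fun z => ft z ^+ 2) - tau k / (al k + 1) <= delta.
Proof.
move=> d0.
have weak s (ms : measurable_fun setT (s \o pp)) s01 sc :=
  @average_weak_cvg R kap mom mkap kap0 (fun k => @berezin_radial _ _ (u k)) kap_mass kap_moment
   (moment_series_cvg0 beta0 beta1 kal) ft M mft ft0 ftM ftL s ms s01 sc.
have bM k z : disc z -> b k z <= M by exact: average_le.
have mb k : measurable_fun setT (b k \o pp) by exact: (@measurable_average R kap mkap kap0 ft mft ft0 k).
have b0 k z : 0 <= b k z by exact: average_ge0.
have := square_liminf mft ft0 ftM ftL mb b0 bM weak d0.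
apply: filterS => k hk.
have a1 : 0 < al k + 1 by rewrite ltr_wpDl.
have := frame_trace2_ge (u1 k) mft ft0 ftM ftL (localization_frame (al0 k) (uV k) (u1 k)).
have -> : (\int[area]_(p in plane_disc) ((al k + 1) * (average (fun=> berezin (u k)) 0 ft (pp p) ^+ 2 * lambda_weight (pp p)))%:E
   = (al k + 1)%:E * \int[area]_(p in plane_disc) (b k (pp p) ^+ 2 * lambda_weight (pp p))%:E)%E.
  rewrite -ge0_integralZl_EFin ?(ltW a1)//.
  - exact: measurable_plane_disc.
  - by move=> p pd; rewrite lee_fin; exact: mulr_ge0 (sqr_ge0 _) (lambda_ge0 _).
  - apply: measurable_EFinM; [exact: (measurable_funX 2 (mb k))|exact: pmeas_lambda].
move=> ht; rewrite lerBlDr -lerBlDl ler_pdivlMr// mulrC -lee_fin.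
by apply: (le_trans _ ht); rewrite EFinM; apply: lee_wpmul2l; rewrite ?lee_fin ?(ltW a1).
Qed.

Lemma trace_ratio_near (eta : R) : 0 < eta -> \forall k \near \oo,
  modulus (trace (bergman_ip (al k)) (@L (al k) \o cfc (bergman_ip (al k)) (@L (al k)) h) / (al k + 1)%:C - DI) < eta.
Proof.
move=> eta0; set F1 := Lam ft; set F2 := Lam (fun z => ft z ^+ 2).
have F10 : 0 <= F1 by apply: Rintegral_ge0 => p pd; rewrite mulr_ge0 ?lambda_ge0.
have F20 : 0 <= F2 by apply: Rintegral_ge0 => p pd; rewrite mulr_ge0 ?lambda_ge0 ?sqr_ge0.
(* The order of the choices matters: [eps] fixes the polynomial and with it [P], then [k1] makes
   [P k1 F2 / 2] small, and only then [delta] beats the large factor [1 / (2 k1)]. The [+ 1] guard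
   against [F1], [P] or [F2] equal to 0. *)
pose eps := eta / (6 * (F1 + 1)).
have eps0 : 0 < eps by rewrite divr_gt0// mulr_gt0// ltr_wpDl.
have [p hp] := ap eps0.
set P := poly_lipschitz M p; have P0 : 0 <= P by exact: poly_lipschitz_ge0.
pose k1 := eta / (3 * (P + 1) * (F2 + 1)).
have k10 : 0 < k1 by rewrite divr_gt0// !mulr_gt0// ltr_wpDl.
pose delta := k1 * eta / (3 * (P + 1)).
have d0 : 0 < delta by rewrite divr_gt0// mulr_gt0// ltr_wpDl.
apply: filterS (tau_ge d0) => k hk.
have := @trace_error R (al k) (al0 k) (u k) ft M (u1 k) mft ft0 ftM ftL (@L (al k))
  (localization_frame (al0 k) (uV k) (u1 k)) h ap p eps k1 (ltW eps0) k10 hp.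
rewrite -disc_integral_truncate -/F1 -/F2 -/P -/(tau k) => /le_lt_trans; apply.
move: hk; rewrite -/F2; set d := F2 - _ => hk.
have h1 : 2 * eps * F1 <= eta / 3.
  have -> : 2 * eps * F1 = eta / 3 * (F1 / (F1 + 1)) by rewrite /eps; field; rewrite gt_eqF// ltr_wpDl.
  by rewrite ler_piMr ?divr_ge0 ?(ltW eta0)// ler_pdivrMr ?ltr_wpDl// mul1r lerDl.
have h2 : P * (k1 / 2 * F2) <= eta / 3.
  have -> : P * (k1 / 2 * F2) = eta / 3 * (P / (P + 1) * (F2 / (F2 + 1)) / 2).
    by rewrite /k1; field; rewrite !gt_eqF// ltr_wpDl.
  rewrite ler_piMr ?divr_ge0 ?(ltW eta0)// ler_pdivrMr// mul1r.
  apply: (@le_trans _ _ 1); last by rewrite ler1n.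
  by rewrite mulr_ile1 ?divr_ge0 ?addr_ge0// ler_pdivrMr ?ltr_wpDl// mul1r lerDl.
have h3 : P * ((2 * k1)^-1 * d) <= eta / 6.
  apply: (@le_trans _ _ (P * ((2 * k1)^-1 * delta))).
    by rewrite ler_wpM2l// ler_wpM2l// invr_ge0 mulr_ge0// ltW.
  have -> : P * ((2 * k1)^-1 * delta) = eta / 6 * (P / (P + 1)).
    by rewrite /delta; field; rewrite !gt_eqF// ltr_wpDl.
  by rewrite ler_piMr ?divr_ge0 ?(ltW eta0)// ler_pdivrMr ?ltr_wpDl// mul1r lerDl.
rewrite mulrDr; lra.
Qed.

End localization_trace.

Unset Implicit Arguments.
Unset Printing Implicit Defensive.
Theorem theorem1p6 (R : realType) (psi : bergman_space (0 : R))
    (f : R[i] -> R) (h : R -> R[i])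
    (psi_unit : hnorm (bergman_ip 0) psi = 1)
    (f_meas : disc_measurable f)
    (f_ge0 : disc_ae_nonneg f)
    (f_L1 : lambda_integrable f)
    (f_Loo : (disc_esssup f < +oo)%E)
    (h_cont : {within `[0, fine (disc_esssup f)], continuous h}) :
  let L (alpha : R) := localization alpha (V alpha psi) f in
  trace (bergman_ip alpha)
      (L alpha \o cfc (bergman_ip alpha) (L alpha) h) / (alpha + 1)%:C
    @[alpha --> +oo] -->
  disc_integral lambda_weight (fun z => (f z)%:C * h (f z)).
Proof.
(* Sequences suffice: a failure of convergence yields, for each [k], a parameter [a >= k] whose
   ratio is at distance at least [e] from the limit, and [trace_ratio_near] applies to this
   sequence. *)
move=> L; apply/nearC => e e0; apply: contrapT => nh.
have bad (k : nat) : exists a : R, k%:R <= a /\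
    ~ (modulus (trace (bergman_ip a) (L a \o cfc (bergman_ip a) (L a) h) / (a + 1)%:C
         - disc_integral lambda_weight (fun z => (f z)%:C * h (f z))) < e).
  apply: contrapT => nk; apply: nh; exists k%:R; split; first exact: num_real.
  by move=> a ka; apply: contrapT => na; apply: nk; exists a; split=> //; exact: ltW.
have [al hal] := choice bad.
have [K _ hK] := trace_ratio_near psi_unit f_meas f_ge0 f_L1 f_Loo h_cont (fun k => (hal k).1) e0.
exact: (hal K).2 (hK K (leqnn K)).
Qed.
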